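(* Let $k\ge2$, $\ell=2k-1$, $d=k-1$. For $0\le j\le d-1$ the vector $\boldsymbol\Psi_{\ell,j}:=\mathscr W_\ell^{-\mathsf T}\mathbf e_{j+1}$ is weakly holomorphic of weight $-\frac12-2j$ and type $\sigma_\ell^\vee$, and $\bigl(\mathbf H_\ell^{\langle r\rangle}\bigr)^{\mathsf T}\boldsymbol\Psi_{\ell,j}=\delta_{rj}$ for $0\le r,j\le d-1$. Every $\mathbf U\in M^!_{3/2}(\sigma_\ell^\vee)$ has the unique expansion $$\mathbf U=\sum_{j=0}^{d-1}f_j\boldsymbol\Psi_{\ell,j},\qquad f_j=\bigl(\mathbf H_\ell^{\langle j\rangle}\bigr)^{\mathsf T}\mathbf U\in M^!_{2j+2}(\mathrm{SL}_2(\mathbb Z)).$$ Moreover, the map $$M^!_{3/2}(\sigma_\ell^\vee)\longrightarrow\bigoplus_{n=0}^{d-1}M^!_{2n+2}(\mathrm{SL}_2(\mathbb Z)),\qquad\mathbf U\longmapsto\bigl(\mathcal J_{\ell,0}(\mathbf U),\dots,\mathcal J_{\ell,d-1}(\mathbf U)\bigr),$$ where $$\mathcal J_{\ell,n}(\mathbf U)=\frac{(-\ell/2)^n}{n!\,(3/2)_n}\,\mathbf H_\ell^{\mathsf T}\,\mathscr D^{[n]}_{3/2}\mathbf U,$$ is an isomorphism (of complex vector spaces).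
   Context: $\mathbb H$ is the upper half-plane, $q=e^{2\pi i\tau}$, $D=\frac1{2\pi i}\partial_\tau$, $e(x):=e^{2\pi ix}$, $\eta=q^{1/24}\prod_{m\ge1}(1-q^m)$, $E_{2m}$ the weight-$2m$ Eisenstein series with constant term $1$, $(a)_n=a(a+1)\cdots(a+n-1)$. $\mathrm{Mp}_2(\mathbb Z)$ is the group of pairs $(\gamma,\varphi)$, $\gamma\in\mathrm{SL}_2(\mathbb Z)$ with lower row $(c_\gamma,d_\gamma)$, $\varphi$ holomorphic on $\mathbb H$, $\varphi(\tau)^2=c_\gamma\tau+d_\gamma$, product $(\gamma_1,\varphi_1)(\gamma_2,\varphi_2)=(\gamma_1\gamma_2,(\varphi_1\circ\gamma_2)\varphi_2)$; generators $\widetilde T=(\begin{pmatrix}1&1\\0&1\end{pmatrix},1)$, $\widetilde S=(\begin{pmatrix}0&-1\\1&0\end{pmatrix},\sqrt\tau)$ (principal root). Slash action: $(F|_{\kappa,\rho}(\gamma,\varphi))(\tau)=\varphi(\tau)^{-2\kappa}\rho(\gamma,\varphi)^{-1}F(\gamma\tau)$; weight $\kappa$, type $\rho$ means slash invariance. $\rho^\vee$ is the contragredient. $M^!_\kappa(\rho)$: holomorphic functions on $\mathbb H$ of weight $\kappa$, type $\rho$ whose $q$-expansion at $i\infty$ has only finitely many negative exponents (''weakly holomorphic''); $M^!_w(\mathrm{SL}_2(\mathbb Z))$ is the scalar version. Serre derivatives: $\mathscr D_\kappa=D-\frac\kappa{12}E_2$; $\mathscr D_\kappa^{[0]}=\mathrm{Id}$,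 $\mathscr D_\kappa^{[1]}=\mathscr D_\kappa$, $\mathscr D_\kappa^{[n+1]}=\mathscr D_{\kappa+2n}\mathscr D_\kappa^{[n]}-\frac{n(n+\kappa-1)}{144}E_4\mathscr D_\kappa^{[n-1]}$ for $n\ge1$. Theta vector: $\vartheta_{\mathrm J}(z;\tau)=\sum_{n\in\frac12+\mathbb Z}e^{\pi in^2\tau+2\pi in(z+1/2)}$; $\Theta_{\ell,j}(\tau)=q^{j^2/(2\ell)}\vartheta_{\mathrm J}(j\tau;\ell\tau)$ for $1\le j\le d$, $\boldsymbol\Theta_\ell=(\Theta_{\ell,1},\dots,\Theta_{\ell,d})^{\mathsf T}$, $\mathbf H_\ell=-i\sqrt{\ell/2}\,\boldsymbol\Theta_\ell$. $\sigma_\ell$ is the $d$-dimensional unitary representation of $\mathrm{Mp}_2(\mathbb Z)$ with $\sigma_\ell(\widetilde T)=\mathrm{diag}(e((\ell-2j)^2/(8\ell)))_{1\le j\le d}$, $\sigma_\ell(\widetilde S)=e(-1/8)\bigl(\frac{2(-1)^{k+j+m}}{\sqrt\ell}\sin\frac{2\pi jm}{\ell}\bigr)_{1\le j,m\le d}$; $\mathbf H_\ell$ is a cusp form of weight $1/2$ and type $\sigma_\ell$. Wronskian: $\mathbf H_\ell^{\langle0\rangle}=\mathbf H_\ell$, $\mathbf H_\ell^{\langle r+1\rangle}=\mathscr D_{1/2+2r}\mathbf H_\ell^{\langle r\rangle}$, and $\mathscr W_\ell=(\mathbf H_\ell^{\langle0\rangle},\dots,\mathbf H_\ell^{\langle d-1\rangle})$,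 a $d\times d$ matrix of functions that is invertible at every point of $\mathbb H$. $\mathbf e_1,\dots,\mathbf e_d$ are the standard basis vectors of $\mathbb C^d$, and $\mathscr W_\ell^{-\mathsf T}$ is the inverse transpose. *)

(* Defs.v *)
From HB Require Import structures.
From mathcomp Require Import all_boot all_order all_algebra spectral.
From mathcomp Require Import all_classical all_reals all_analysis.
From mathcomp Require Import complex.

Set Implicit Arguments.
Unset Strict Implicit.
Unset Printing Implicit Defensive.

Import Order.TTheory GRing.Theory Num.Theory.
Import numFieldNormedType.Exports.
Local Open Scope classical_set_scope.
Local Open Scope complex_scope.
Local Open Scope ring_scope.

(* Functions on the upper half-plane are functions [R[i] -> _] of which only
   the values on [upper] matter; they are compared by [{in upper, _ =1 _}].
   The topology of R[i] is carried by the alias [R[i]^o], so limits and complex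
   derivatives are taken there. *)

Section ComplexAnalysis.
Variable R : realType.
Local Notation C := R[i].

Definition upper : {pred C} := [pred tau | 0 < complex.Im tau].

Definition cexp (z : C) : C :=
  (expR (complex.Re z))%:C * (cos (complex.Im z) +i* sin (complex.Im z)).

Definition twopii : C := (pi *+ 2)%:C * 'i%C.

Definition e (x : C) : C := cexp (twopii * x).

Definition csum (u : nat -> C) : C := limn (series (u : nat -> C^o)).

(* [Negz n] is [- (n + 1)]. *)
Definition csumZ (u : int -> C) : C :=
  csum (fun n => u (Posz n)) + csum (fun n => u (Negz n)).

Definition holomorphic (f : C -> C) : Prop :=
  {in upper, forall tau, derivable (f : C^o -> C^o) tau 1}.

Definition D (f : C -> C) (tau : C) : C :=
  twopii^-1 * derive1 (f : C^o -> C^o) tau.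

(* An expansion in powers of q^(1/h) with finitely many negative exponents. *)
Definition has_qexp (h : nat) (f : C -> C) : Prop :=
  exists (N : nat) (a : nat -> C), {in upper, forall tau,
    series (fun n => a n * e ((n%:R - N%:R) / h%:R * tau) : C^o) @ \oo
      --> (f tau : C^o)}.

End ComplexAnalysis.

Section Serre.
Variable R : realType.
Local Notation C := R[i].

Definition divsum (s n : nat) : nat := \sum_(d <- divisors n) d ^ s.

(* - 24 = - 4 / B_2 and 240 = - 8 / B_4 *)
Definition E2 (tau : C) : C :=
  1 - 24 * csum (fun n => (divsum 1 n.+1)%:R * e (n.+1%:R * tau)).

Definition E4 (tau : C) : C :=
  1 + 240 * csum (fun n => (divsum 3 n.+1)%:R * e (n.+1%:R * tau)).

Definition serre (kappa : C) (f : C -> C) (tau : C) : C :=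
  D f tau - kappa / 12 * E2 tau * f tau.

Fixpoint serre_iter (kappa : C) (n : nat) (f : C -> C) : C -> C :=
  match n with
  | 0 => f
  | m.+1 =>
    match m with
    | 0 => serre kappa f
    | p.+1 => fun tau =>
        serre (kappa + 2 * m%:R) (serre_iter kappa m f) tau
        - m%:R * (m%:R + kappa - 1) / 144 * E4 tau * serre_iter kappa p f tau
    end
  end.

Definition componentwise (d : nat) (op : (C -> C) -> C -> C)
    (F : C -> 'cV[C]_d) (tau : C) : 'cV[C]_d :=
  \col_i op (fun t => F t i 0) tau.

Definition pairing (d : nat) (F G : C -> 'cV[C]_d) (tau : C) : C :=
  ((F tau)^T *m G tau) 0 0.

End Serre.

Section Modular.
Variable R : realType.
Local Notation C := R[i].

Definition mx22 (a b c d : int) : 'M[int]_2 :=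
  \matrix_(i, j) if i == 0 then (if j == 0 then a else b)
                 else (if j == 0 then c else d).

Definition jfactor (g : 'M[int]_2) (tau : C) : C :=
  (g 1 0)%:~R * tau + (g 1 1)%:~R.

Definition moebius (g : 'M[int]_2) (tau : C) : C :=
  ((g 0 0)%:~R * tau + (g 0 1)%:~R) / jfactor g tau.

(* Mp_2(Z) is the subset [in_Mp2] of this type, modulo [mp_eq]. *)
Definition mp : Type := ('M[int]_2 * (C -> C))%type.

Definition in_Mp2 (g : mp) : Prop :=
  [/\ \det g.1 = 1, holomorphic g.2
    & {in @upper R, forall tau, g.2 tau ^+ 2 = jfactor g.1 tau}].

Definition mp_eq (g h : mp) : Prop := g.1 = h.1 /\ {in @upper R, g.2 =1 h.2}.

Definition mp_mul (g h : mp) : mp :=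
  (g.1 *m h.1, fun tau => g.2 (moebius h.1 tau) * h.2 tau).

Definition mpT : mp := (mx22 1 1 0 1, fun=> 1).
Definition mpS : mp := (mx22 0 (-1) 1 0, @sqrtc R).

Definition unitary_rep (d : nat) (rho : mp -> 'M[C]_d) : Prop :=
  [/\ forall g h, in_Mp2 g -> in_Mp2 h -> mp_eq g h -> rho g = rho h,
      forall g h, in_Mp2 g -> in_Mp2 h -> rho (mp_mul g h) = rho g *m rho h
    & forall g, in_Mp2 g -> rho g \is unitarymx].

Definition contragredient (d : nat) (rho : mp -> 'M[C]_d) (g : mp) : 'M[C]_d :=
  (invmx (rho g))^T.

(* Here [w] is twice the weight. *)
Definition slash (d : nat) (w : int) (rho : mp -> 'M[C]_d)
    (F : C -> 'cV[C]_d) (g : mp) (tau : C) : 'cV[C]_d :=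
  (g.2 tau) ^ (- w) *: (invmx (rho g) *m F (moebius g.1 tau)).

(* M^!_{w/2}(rho), for rho with rho(T) of finite order: the exponents of the
   q-expansion are then rational with bounded denominator. *)
Definition weakly_holomorphic (d : nat) (w : int) (rho : mp -> 'M[C]_d)
    (F : C -> 'cV[C]_d) : Prop :=
  [/\ forall i, holomorphic (fun tau => F tau i 0),
      forall g, in_Mp2 g -> {in @upper R, slash w rho F g =1 F}
    & exists2 h : nat, (0 < h)%N &
        forall i, has_qexp h (fun tau => F tau i 0)].

(* M^!_w(SL_2(Z)); here [w] is the weight itself. *)
Definition weakly_holomorphic_SL2 (w : int) (f : C -> C) : Prop :=
  [/\ holomorphic f,
      forall g : 'M[int]_2, \det g = 1 ->
        {in @upper R, forall tau,
          jfactor g tau ^ (- w) * f (moebius g tau) = f tau}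
    & has_qexp 1 f].

End Modular.

Section Theta.
Variable R : realType.
Local Notation C := R[i].

Definition thetaJ (z tau : C) : C :=
  csumZ (fun m => let n : C := m%:~R + 2^-1 in
    e (n ^+ 2 / 2 * tau + n * (z + 2^-1))).

Variable k : nat.

Definition ell : nat := (2 * k - 1)%N.

(* Coordinates are indexed by ['I_k.-1], so the index j in 1..d of the theta
   functions is [j.+1]. *)
Definition Theta (j : nat) (tau : C) : C :=
  e (j%:R ^+ 2 / (2 * ell%:R) * tau) * thetaJ (j%:R * tau) (ell%:R * tau).

Definition Hvec (tau : C) : 'cV[C]_k.-1 :=
  \col_j (- 'i%C * (Num.sqrt (ell%:R / 2 : R))%:C * Theta j.+1 tau).

Definition is_sigma (sigma : mp R -> 'M[C]_k.-1) : Prop :=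
  [/\ unitary_rep sigma,
      sigma (mpT R) = diag_mx (\row_(j < k.-1)
        e ((ell%:R - 2 * j.+1%:R) ^+ 2 / (8 * ell%:R)))
    & sigma (mpS R) = e (- 8^-1) *: \matrix_(j < k.-1, m < k.-1)
        (2 * (-1) ^+ (k + j.+1 + m.+1) / Num.sqrt (ell%:R : R)
         * sin (2 * pi * j.+1%:R * m.+1%:R / ell%:R))%:C].

Fixpoint Hder (r : nat) : C -> 'cV[C]_k.-1 :=
  match r with
  | 0 => Hvec
  | s.+1 => componentwise (serre (2^-1 + 2 * s%:R)) (Hder s)
  end.

Definition Wronskian (tau : C) : 'M[C]_k.-1 :=
  \matrix_(i, r) Hder r tau i 0.

Definition Psi (j : 'I_k.-1) (tau : C) : 'cV[C]_k.-1 :=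
  (invmx (Wronskian tau))^T *m delta_mx j 0.

Definition pochhammer (a : C) (n : nat) : C := \prod_(i < n) (a + i%:R).

Definition calJ (n : nat) (U : C -> 'cV[C]_k.-1) (tau : C) : C :=
  (- (ell%:R / 2)) ^+ n / (n`!%:R * pochhammer (3 / 2) n)
  * pairing Hvec (componentwise (serre_iter (3 / 2) n) U) tau.

End Theta.

(* Main.v *)
Require Import Defs.
From HB Require Import structures.
From mathcomp Require Import all_boot all_order all_algebra perm spectral.
From mathcomp Require Import all_classical all_reals all_analysis.
From mathcomp Require Import complex.
From mathcomp Require Import ring lra zify.

Set Implicit Arguments.
Unset Strict Implicit.
Unset Printing Implicit Defensive.

Import Order.TTheory GRing.Theory Num.Theory.
Import numFieldNormedType.Exports.
Local Open Scope ring_scope.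

(* The theta functions transform under S by Poisson summation, which rests on a
   comparison of Riemann sums of the Gaussian along different lines. For l = 3
   the theta function is the Dedekind eta function by the pentagonal number
   theorem; its logarithmic derivative is E_2 / 24, which gives the law of E_2,
   and Ramanujan's identity 12 D E_2 = E_2^2 - E_4 the law of E_4. Hence the
   Serre derivatives of H and of U are modular.

   The quotient of the Wronskian determinant by eta^(d (2 d - 1)) has a q-series
   with nonzero constant term (a Vandermonde determinant in the exponents of H),
   and its absolute value is invariant under SL_2(Z); by a maximum principle it
   is constant, so the Wronskian is invertible and its inverse is meromorphic at
   the cusp.

   Let P_{r,m} be the pairing of the r-th derivative of H with the m-th iterated
   derivative of U. The Leibniz rule reads
     P_{r,m+1} = serre P_{r,m} - P_{r+1,m} - c_m E_4 P_{r,m-1},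
   so that the row P_{0,m} = const J_m(U) and the column P_{r,0} = f_r of
   modular forms determine each other. *)


(** No contour integral occurs: every analytic object is an absolutely convergent sum. Two classical
    uses of residues need substitutes. The Gaussian integral behind Poisson summation gets its value
    1 from the self-duality of the theta series at s = 1. The valence formula for the Wronskian is
    replaced by a contraction: averaging bounds each coefficient a_n by the gap between a bound of
    |f| and |a_0|, and since every orbit meets Im >= 1/2, this gap shrinks by the factor 32/33.
    Absolute values are used because unitarity gives only the absolute value of det sigma(S). The
    exponent d (2 d - 1) is at once 24 times the sum of the leading exponents (l - 2 j)^2 / (8 l)
    and the sum of the doubled weights 1 + 4 r of the columns of the Wronskian, so the quotient has
    weight 0 and starts with q^0. The infinite product for eta never appears: a finite pentagonal
    identity yields Euler's recursion for its coefficients, and the recursion with the opposite sign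
    defines 1 / eta as a q-series. Hence 1 / det W, and with it the inverse of the Wronskian, has a
    q-expansion. Laws under S and T reach all of Mp_2(Z) because the lift (1, -1) of the identity is
    the fourth power of S. *)

(** * Limits of sequences and unconditional sums of complex families *)

Section Summation.
Variable R : realType.
Local Notation C := R[i].
Local Notation nc := (@ComplexField.Normc.normc R).

(** The norm of a complex number is itself an element of [C]; estimates are made with the
    real-valued [nc], so that the total order of [R] and [lra] are available. *)
Lemma ncE (z : C) : `|z| = (nc z)%:C%C. Proof. by case: z. Qed.

Lemma nc_ge0 (z : C) : 0 <= nc z.
Proof. by case: z => a b; exact: sqrtr_ge0. Qed.

Lemma ncM (x y : C) : nc (x * y) = nc x * nc y.
Proof. exact: ComplexField.Normc.normcM. Qed.

Lemma ncN (x : C) : nc (- x) = nc x. Proof. exact: normcN. Qed.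

Lemma ncD (x y : C) : nc (x + y) <= nc x + nc y.
Proof. exact: le_normcD. Qed.

Lemma nc0 : nc 0 = 0. Proof. exact: ComplexField.Normc.normc0. Qed.

Lemma nc1 : nc 1 = 1. Proof. exact: ComplexField.Normc.normc1. Qed.

Lemma nc_eq0 (x : C) : (nc x == 0) = (x == 0).
Proof.
apply/eqP/eqP => [|->]; last exact: nc0.
exact: ComplexField.Normc.eq0_normc.
Qed.

Lemma nc_gt0 (x : C) : (0 < nc x) = (x != 0).
Proof. by rewrite lt_def nc_eq0 nc_ge0 andbT. Qed.

Lemma ncV (x : C) : nc x^-1 = (nc x)^-1.
Proof. exact: ComplexField.Normc.normcV. Qed.

Lemma ncX (x : C) n : nc (x ^+ n) = nc x ^+ n.
Proof. by elim: n => [|n IH]; rewrite ?expr0 ?nc1// !exprS ncM IH. Qed.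

Lemma ncB (x y : C) : nc (x - y) = nc (y - x).
Proof. by rewrite -ncN opprB. Qed.

Lemma nc_sub (x y : C) : nc (x - y) <= nc x + nc y.
Proof. by rewrite -(ncN y) ncD. Qed.

Lemma nc_tri (z x y : C) : nc (x - y) <= nc (x - z) + nc (z - y).
Proof. by rewrite (_ : x - y = (x - z) + (z - y)) ?ncD// addrA subrK. Qed.

Lemma nc_real (x : R) : nc x%:C%C = `|x|.
Proof. by rewrite /= expr0n addr0 sqrtr_sqr. Qed.

Lemma nc_nat n : nc n%:R = n%:R.
Proof. by rewrite -[n%:R](rmorph_nat (@real_complex R)) nc_real normr_nat. Qed.

Lemma nc_Re (z : C) : `|complex.Re z| <= nc z.
Proof.
case: z => a b /=; rewrite -sqrtr_sqr ler_wsqrtr// lerDl; exact: sqr_ge0.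
Qed.

Lemma nc_Im (z : C) : `|complex.Im z| <= nc z.
Proof.
case: z => a b /=; rewrite -sqrtr_sqr ler_wsqrtr// lerDr; exact: sqr_ge0.
Qed.

Lemma nc_le (z : C) : nc z <= `|complex.Re z| + `|complex.Im z|.
Proof.
case: z => a b /=; have h : 0 <= `|a| + `|b| by rewrite addr_ge0.
rewrite -[leRHS](ger0_norm h) -sqrtr_sqr ler_wsqrtr// sqrrD -!normrX.
rewrite (ger0_norm (sqr_ge0 a)) (ger0_norm (sqr_ge0 b)) -addrA lerD2l lerDr.
by rewrite mulrn_wge0// mulr_ge0.
Qed.

Lemma nc_sum (I : Type) (s : seq I) (P : pred I) (f : I -> C) :
  nc (\sum_(i <- s | P i) f i) <= \sum_(i <- s | P i) nc (f i).
Proof.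
elim/big_rec2: _ => [|i x y _ h]; first by rewrite nc0.
by apply: le_trans (ncD _ _) _; rewrite lerD2l.
Qed.

Lemma eps_eq (x y : C) : (forall eps : R, 0 < eps -> nc (x - y) < eps) -> x = y.
Proof.
move=> h; apply/eqP; rewrite -subr_eq0 -nc_eq0 eq_le nc_ge0 andbT leNgt.
by apply/negP => /h; rewrite ltxx.
Qed.

Definition tends (u : nat -> C) (l : C) := forall eps : R, 0 < eps ->
  exists N, forall n, (N <= n)%N -> nc (u n - l) < eps.

Lemma tends_uniq u l l' : tends u l -> tends u l' -> l = l'.
Proof.
move=> h h'; apply: eps_eq => e e0.
have e2 : 0 < e / 2 by rewrite divr_gt0.
have [N hN] := h _ e2; have [N' hN'] := h' _ e2.
have := hN (maxn N N') (leq_maxl _ _); have := hN' (maxn N N') (leq_maxr _ _).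
set v := u _ => h1 h2; apply: le_lt_trans (nc_tri v _ _) _.
by rewrite (ncB l) [e]splitr ltrD.
Qed.

Lemma tends_cst l : tends (fun=> l) l.
Proof. by move=> e e0; exists 0%N => n _; rewrite subrr nc0. Qed.

Lemma tends_ext u v l : (exists N, forall n, (N <= n)%N -> u n = v n) ->
  tends u l -> tends v l.
Proof.
move=> [N1 h] hu e /hu [N2 h2]; exists (maxn N1 N2) => n; rewrite geq_max.
by move=> /andP[/h <- /h2].
Qed.

Lemma tendsD u v l m : tends u l -> tends v m ->
  tends (fun n => u n + v n) (l + m).
Proof.
move=> hu hv e e0; have e2 : 0 < e / 2 by rewrite divr_gt0.
have [N1 h1] := hu _ e2; have [N2 h2] := hv _ e2.
exists (maxn N1 N2) => n; rewrite geq_max => /andP[/h1 g1 /h2 g2].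
rewrite opprD addrACA; apply: le_lt_trans (ncD _ _) _.
by rewrite [e]splitr ltrD.
Qed.

Lemma tendsZ c u l : tends u l -> tends (fun n => c * u n) (c * l).
Proof.
move=> hu e e0; have c0 : 0 < nc c + 1 by rewrite ltr_wpDl// nc_ge0.
have [N h] := hu _ (divr_gt0 e0 c0); exists N => n /h.
rewrite -mulrBr ncM ltr_pdivlMr// mulrC; apply: le_lt_trans.
by rewrite ler_wpM2r ?nc_ge0// lerDl.
Qed.

Lemma tends_bound u l : tends u l -> exists M, forall n, nc (u n) <= M.
Proof.
move=> /(_ 1 ltr01)[N h].
have [M hM] : exists M, forall n, (n < N)%N -> nc (u n) <= M.
  elim: N {h} => [|N [M hM]]; first by exists 0.
  exists (Num.max M (nc (u N))) => n; rewrite ltnS leq_eqVlt => /predU1P[->|/hM h].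
    by rewrite le_max lexx orbT.
  by rewrite le_max h.
exists (Num.max M (1 + nc l)) => n; have [/hM h'|/h h'] := ltnP n N.
  by rewrite le_max h'.
rewrite le_max; apply/orP; right; rewrite -[u n](subrK l).
by apply: le_trans (ncD _ _) _; rewrite lerD2r ltW.
Qed.

Lemma tendsM u v l m : tends u l -> tends v m ->
  tends (fun n => u n * v n) (l * m).
Proof.
move=> hu hv; have [M hM] := tends_bound hv.
have h1 : tends (fun n => (u n - l) * v n) 0.
  move=> e e0; have M0 : 0 < M + 1.
    by rewrite ltr_wpDl// (le_trans (nc_ge0 _) (hM 0%N)).
  have [N h] := hu _ (divr_gt0 e0 M0); exists N => n /h.
  rewrite subr0 ncM ltr_pdivlMr//; apply: le_lt_trans.
  by rewrite ler_wpM2l ?nc_ge0// (le_trans (hM n))// lerDl.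
have := tendsD h1 (tendsZ l hv); rewrite add0r; apply: tends_ext.
by exists 0%N => n _; rewrite -mulrDl subrK.
Qed.

Lemma tends_sum (I : Type) (s : seq I) (u : I -> nat -> C) l :
  (forall i, tends (u i) (l i)) ->
  tends (fun n => \sum_(i <- s) u i n) (\sum_(i <- s) l i).
Proof.
move=> h; elim: s => [|i s IH].
  by rewrite big_nil; apply: tends_ext (tends_cst 0); exists 0%N => n _; rewrite big_nil.
rewrite big_cons; apply: tends_ext (tendsD (h i) IH).
by exists 0%N => n _; rewrite big_cons.
Qed.

Lemma tends_le u l M : tends u l -> (exists N, forall n, (N <= n)%N -> nc (u n) <= M) ->
  nc l <= M.
Proof.
move=> hu [N1 h]; rewrite leNgt; apply/negP => lM.
have /hu[N2 h2] : 0 < nc l - M by rewrite subr_gt0.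
have := h2 (maxn N1 N2) (leq_maxr _ _); have := h (maxn N1 N2) (leq_maxl _ _).
set v := u _ => h3; rewrite ltNge; apply/negP; rewrite negbK.
rewrite lerBlDr; apply: le_trans (_ : nc (l - v) + nc v <= _).
  by rewrite -{1}[l](subrK v) ncD.
by rewrite ncB lerD2l.
Qed.

Lemma tends_squeeze (u : nat -> C) (v : nat -> R) :
  (exists N, forall n, (N <= n)%N -> nc (u n) <= v n) ->
  tends (fun n => (v n)%:C%C) 0 -> tends u 0.
Proof.
move=> [N1 h] hv e /hv[N2 h2]; exists (maxn N1 N2) => n; rewrite geq_max.
move=> /andP[/h g1 /h2]; rewrite !subr0 nc_real; apply: le_lt_trans.
by apply: le_trans g1 (ler_norm _).
Qed.

Lemma tends_inv : tends (fun n => (n.+1%:R)^-1) 0.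
Proof.
move=> e e0; exists (Num.truncn e^-1) => n hn.
rewrite subr0 ncV nc_nat invf_plt ?posrE//.
apply: lt_le_trans (truncnS_gt _) _; by rewrite ler_nat ltnS.
Qed.

Section Families.
Variable T : eqType.
Implicit Types (f g : T -> C) (B : T -> R).

(** Convergence along the net of finite duplicate-free lists: the index type carries no order, so
    reindexing and regrouping are free. Theta series over [int] and multiple divisor sums rely on
    this. *)
Definition hassum f (l : C) := forall eps : R, 0 < eps ->
  exists A : seq T, forall s : seq T, uniq s -> {subset A <= s} ->
    nc (\sum_(x <- s) f x - l) < eps.

Definition rsum B := exists M, forall s : seq T, uniq s -> \sum_(x <- s) B x <= M.

Definition asum f := rsum (fun x => nc (f x)).

Lemma hassum_ext f g l : f =1 g -> hassum f l -> hassum g l.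
Proof.
move=> fg h e /h[A hA]; exists A => s us /(hA s us).
by under eq_bigr do rewrite fg.
Qed.

Lemma hassum_uniq f l l' : hassum f l -> hassum f l' -> l = l'.
Proof.
move=> h h'; apply: eps_eq => e e0.
have e2 : 0 < e / 2 by rewrite divr_gt0.
have [A hA] := h _ e2; have [A' hA'] := h' _ e2.
have h1 := hA (undup (A ++ A')) (undup_uniq _); have h2 := hA' (undup (A ++ A')) (undup_uniq _).
apply: le_lt_trans (nc_tri (\sum_(x <- undup (A ++ A')) f x) _ _) _.
rewrite (ncB l) [e]splitr ltrD//; [apply: h1|apply: h2] => x hx.
  by rewrite mem_undup mem_cat hx.
by rewrite mem_undup mem_cat hx orbT.
Qed.

Lemma hassum0 : hassum (fun=> 0) 0.
Proof. by move=> e e0; exists [::] => s _ _; rewrite big1// subrr nc0. Qed.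

Lemma hassumD f g l m : hassum f l -> hassum g m ->
  hassum (fun x => f x + g x) (l + m).
Proof.
move=> hf hg e e0; have e2 : 0 < e / 2 by rewrite divr_gt0.
have [A1 h1] := hf _ e2; have [A2 h2] := hg _ e2.
exists (A1 ++ A2) => s us hs; rewrite big_split/= opprD addrACA.
apply: le_lt_trans (ncD _ _) _; rewrite [e]splitr ltrD//.
  by apply: h1 => // x hx; apply: hs; rewrite mem_cat hx.
by apply: h2 => // x hx; apply: hs; rewrite mem_cat hx orbT.
Qed.

Lemma hassumZ c f l : hassum f l -> hassum (fun x => c * f x) (c * l).
Proof.
move=> hf e e0; have c0 : 0 < nc c + 1 by rewrite ltr_wpDl// nc_ge0.
have [A h] := hf _ (divr_gt0 e0 c0); exists A => s us /(h s us).
rewrite -mulr_sumr -mulrBr ncM ltr_pdivlMr// mulrC; apply: le_lt_trans.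
by rewrite ler_wpM2r ?nc_ge0// lerDl.
Qed.

Lemma hassum_sum (I : Type) (s : seq I) (f : I -> T -> C) l :
  (forall i, hassum (f i) (l i)) ->
  hassum (fun x => \sum_(i <- s) f i x) (\sum_(i <- s) l i).
Proof.
move=> h; elim: s => [|i s IH].
  by rewrite big_nil; apply: hassum_ext hassum0 => x; rewrite big_nil.
rewrite big_cons; apply: hassum_ext (hassumD (h i) IH) => x.
by rewrite big_cons.
Qed.

Lemma hassum_le f l M : hassum f l ->
  (forall s, uniq s -> nc (\sum_(x <- s) f x) <= M) -> nc l <= M.
Proof.
move=> h hM; rewrite leNgt; apply/negP => lM.
have /h[A hA] : 0 < nc l - M by rewrite subr_gt0.
have := hA _ (undup_uniq A) (fun x h => ltac:(by rewrite mem_undup)).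
have := hM _ (undup_uniq A).
set v := \sum_(x <- _) _ => h3; rewrite ltNge; apply/negP; rewrite negbK.
rewrite lerBlDr; apply: le_trans (_ : nc (l - v) + nc v <= _).
  by rewrite -{1}[l](subrK v) ncD.
by rewrite ncB lerD2l.
Qed.

Lemma ler_sum_sub B (s t : seq T) : (forall x, 0 <= B x) -> uniq s ->
  {subset s <= t} -> \sum_(x <- s) B x <= \sum_(x <- t) B x.
Proof.
move=> B0; elim: s t => [|x s IH] t /=; first by rewrite big_nil sumr_ge0.
move=> /andP[xs us] st; rewrite big_cons.
have xt : x \in t by apply: st; rewrite mem_head.
rewrite (perm_big _ (perm_to_rem xt)) big_cons lerD2l IH// => y ys.
have : y \in t by apply: st; rewrite inE ys orbT.
rewrite (perm_mem (perm_to_rem xt)) inE => /orP[/eqP yx|//].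
by rewrite -yx ys in xs.
Qed.

(** [A] is a list whose sum comes within [eps] of the supremum of all finite sums; a disjoint list
    of larger mass, appended to [A], would exceed this supremum. *)
Lemma rsum_tail B : (forall x, 0 <= B x) -> rsum B -> forall eps, 0 < eps ->
  exists2 A, uniq A & forall s, uniq s -> (forall x, x \in s -> x \notin A) ->
    \sum_(x <- s) B x < eps.
Proof.
move=> B0 [M hM] e e0.
pose E : set R := [set r | exists2 s, uniq s & r = \sum_(x <- s) B x]%classic.
have supE : has_sup E.
  split; first by exists 0, [::] => //; rewrite big_nil.
  by exists M => _ [s us ->]; exact: hM.
have [_ [A uA ->] hA] := sup_adherent e0 supE.
exists A => // s us hs; have : E (\sum_(x <- A ++ s) B x).
  exists (A ++ s) => //; rewrite cat_uniq uA us andbT; apply/hasPn => x /hs//.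
move=> /(ub_le_sup supE.2); rewrite big_cat/= => h.
by move: hA h; set a := \sum_(x <- A) _; set b := \sum_(x <- s) _; lra.
Qed.

Lemma rsum_le B B' : (forall x, B x <= B' x) -> rsum B' -> rsum B.
Proof.
move=> h [M hM]; exists M => s us; apply: le_trans (hM s us).
exact: ler_sum.
Qed.

Lemma rsumD B B' : rsum B -> rsum B' -> rsum (fun x => B x + B' x).
Proof.
move=> [M h] [M' h']; exists (M + M') => s us; rewrite big_split/=.
by rewrite lerD ?h ?h'.
Qed.

Lemma rsumZ (c : R) B : 0 <= c -> rsum B -> rsum (fun x => c * B x).
Proof.
move=> c0 [M h]; exists (c * M) => s us; rewrite -mulr_sumr ler_wpM2l//.
exact: h.
Qed.

Lemma asum_le f B : (forall x, nc (f x) <= B x) -> rsum B -> asum f.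
Proof. exact: rsum_le. Qed.

Lemma asumD f g : asum f -> asum g -> asum (fun x => f x + g x).
Proof. by move=> h h'; apply: rsum_le (rsumD h h') => x; exact: ncD. Qed.

Lemma asumZ c f : asum f -> asum (fun x => c * f x).
Proof.
by move=> h; apply: rsum_le (rsumZ (nc_ge0 c) h) => x; rewrite ncM.
Qed.

Lemma asum_ext f g : f =1 g -> asum f -> asum g.
Proof. by move=> fg; apply: rsum_le => x; rewrite fg. Qed.

Lemma rsum_hassum B : (forall x, 0 <= B x) -> rsum B ->
  exists l : R, hassum (fun x => (B x)%:C%C) l%:C%C.
Proof.
move=> B0 [M hM].
pose E : set R := [set r | exists2 s, uniq s & r = \sum_(x <- s) B x]%classic.
have supE : has_sup E.
  split; first by exists 0, [::] => //; rewrite big_nil.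
  by exists M => _ [s us ->]; exact: hM.
exists (sup E) => e e0.
have [_ [A uA ->] hA] := sup_adherent e0 supE.
exists A => s us hs; rewrite -rmorph_sum -rmorphB nc_real.
have h1 : \sum_(x <- s) B x <= sup E by apply: (ub_le_sup supE.2); exists s.
rewrite ler0_norm ?subr_le0// opprB ltrBlDr -ltrBlDl; apply: lt_le_trans hA _.
exact: ler_sum_sub.
Qed.

Lemma asum_hassum f : asum f -> exists l, hassum f l.
Proof.
move=> af.
(* The family p (f x) + |f x| is nonnegative and at most 2 |f x|, hence summable by a supremum;
   subtracting |f x| leaves the sum of p (f x). *)
have part (p : C -> R) : (forall z, `|p z| <= nc z) ->
    exists l, hassum (fun x => (p (f x))%:C%C) l.
  move=> hp.
  have [l1 h1] : exists l : R, hassum (fun x => (p (f x) + nc (f x))%:C%C) l%:C%C.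
    apply: rsum_hassum => [x|]; first by have := hp (f x); rewrite ler_norml; lra.
    apply: rsum_le (rsumD af af) => x; rewrite lerD2r.
    exact: le_trans (ler_norm _) (hp _).
  have [l2 h2] : exists l : R, hassum (fun x => (nc (f x))%:C%C) l%:C%C.
    by apply: rsum_hassum => // x; exact: nc_ge0.
  exists (l1%:C%C + -1 * l2%:C%C); apply: hassum_ext (hassumD h1 (hassumZ (-1) h2)) => x.
  by rewrite mulN1r rmorphD addrK.
have [l1 h1] := part _ nc_Re; have [l2 h2] := part _ nc_Im.
exists (l1 + 'i%C * l2); apply: hassum_ext (hassumD h1 (hassumZ 'i%C h2)) => x.
by rewrite [RHS]complexE.
Qed.

(** The value defaults to 0 for a family without a sum, so linearity and reindexing carry [asum]
    premises. *)
Definition tot f : C := xget 0 (hassum f).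

Lemma tot_eq f l : hassum f l -> tot f = l.
Proof.
move=> h; apply: hassum_uniq (h); rewrite /tot; by case: xgetP => [x _|/(_ l)/(_ h)].
Qed.

Lemma asum_tot f : asum f -> hassum f (tot f).
Proof. by move=> /asum_hassum[l h]; rewrite (tot_eq h). Qed.

Lemma totD f g : asum f -> asum g -> tot (fun x => f x + g x) = tot f + tot g.
Proof. by move=> hf hg; apply: tot_eq; apply: hassumD; exact: asum_tot. Qed.

Lemma totZ c f : asum f -> tot (fun x => c * f x) = c * tot f.
Proof. by move=> hf; apply: tot_eq; apply: hassumZ; exact: asum_tot. Qed.

Lemma tot_ext f g : f =1 g -> tot f = tot g.
Proof. by move=> /funext->. Qed.

Lemma tot_le f B M : (forall x, nc (f x) <= B x) ->
  (forall s, uniq s -> \sum_(x <- s) B x <= M) -> nc (tot f) <= M.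
Proof.
move=> h hM; have af : asum f by apply: asum_le h _; exists M.
apply: hassum_le (asum_tot af) _ => s us; apply: le_trans (nc_sum _ _ _) _.
by apply: le_trans (hM s us); apply: ler_sum.
Qed.

Lemma tot_tail f B (A : seq T) eps : uniq A -> asum f -> (forall x, nc (f x) <= B x) ->
  (forall s, uniq s -> (forall x, x \in s -> x \notin A) -> \sum_(x <- s) B x <= eps) ->
  nc (tot f - \sum_(x <- A) f x) <= eps.
Proof.
move=> uA af fB hB.
have fin : hassum (fun x => if x \in A then f x else 0) (\sum_(x <- A) f x).
  move=> e e0; exists A => s us As; rewrite -big_mkcond -big_filter.
  rewrite (perm_big A) ?subrr ?nc0//; apply: uniq_perm => //; first exact: filter_uniq.
  by move=> x; rewrite mem_filter; case: (boolP (x \in A)) => //= /As.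
have h := hassumD (asum_tot af) (hassumZ (-1) fin); rewrite mulN1r in h.
apply: hassum_le h _ => s us.
rewrite (eq_bigr (fun x => if x \notin A then f x else 0)); last first.
  by move=> x _; case: (x \in A) => /=; rewrite mulN1r ?subrr// oppr0 addr0.
rewrite -big_mkcond -big_filter; apply: le_trans (nc_sum _ _ _) _.
apply: le_trans (hB [seq x <- s | x \notin A] (filter_uniq _ us) _).
  exact: ler_sum.
by move=> x; rewrite mem_filter => /andP[].
Qed.

(** Dominated convergence: one finite list [A] leaves a tail below [e / 3] for all [n] at once, and
    on [A] the convergence is termwise. *)
Lemma tannery (F : nat -> T -> C) f B : (forall n x, nc (F n x) <= B x) ->
  rsum B -> (forall x, tends (F^~ x) (f x)) -> tends (fun n => tot (F n)) (tot f).
Proof.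
move=> FB hB Ff e e0.
have B0 x : 0 <= B x by apply: le_trans (nc_ge0 _) (FB 0%N x).
have fB x : nc (f x) <= B x by apply: tends_le (Ff x) _; exists 0%N.
have e3 : 0 < e / 3 by rewrite divr_gt0.
have [A uA hA] := rsum_tail B0 hB e3.
have [N hN] := tends_sum A Ff e3.
exists N => n /hN hn.
have hA' s : uniq s -> (forall x, x \in s -> x \notin A) -> \sum_(x <- s) B x <= e / 3.
  by move=> us /(hA s us)/ltW.
have h1 := tot_tail uA (asum_le (FB n) hB) (FB n) hA'.
have h2 := tot_tail uA (asum_le fB hB) fB hA'.
apply: le_lt_trans (nc_tri (\sum_(x <- A) f x) _ _) _.
apply: le_lt_trans (lerD (nc_tri (\sum_(x <- A) F n x) _ _) (lexx _)) _.
rewrite (ncB _ (tot f)); move: h1 h2 hn.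
set a := nc _; set b := nc _; set c := nc _; lra.
Qed.

End Families.
End Summation.

Section SumTheory.
Variable R : realType.
Local Notation C := R[i].
Local Notation nc := (@ComplexField.Normc.normc R).
Local Notation tot := (@tot R _).

Lemma hassum_fin (T : eqType) (f : T -> C) (A : seq T) : uniq A ->
  hassum (fun x => if x \in A then f x else 0) (\sum_(x <- A) f x).
Proof.
move=> uA e e0; exists A => s us As; rewrite -big_mkcond -big_filter.
rewrite (perm_big A) ?subrr ?nc0//; apply: uniq_perm => //; first exact: filter_uniq.
by move=> x; rewrite mem_filter; case: (boolP (x \in A)) => //= /As.
Qed.

Section Injection.
Variables (S T : eqType) (i : S -> T) (injI : injective i).

Definition part_inv (x : T) : option S :=
  if pselect (exists y, x = i y) is left h then Some (projT1 (cid h)) else None.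

Lemma part_invK : pcancel i part_inv.
Proof.
move=> y; rewrite /part_inv; case: pselect => [h|[]]; last by exists y.
by congr Some; apply: injI; rewrite -(projT2 (cid h)).
Qed.

Lemma part_invV : ocancel part_inv i.
Proof.
move=> x; rewrite /part_inv; case: pselect => //= h.
by rewrite -(projT2 (cid h)).
Qed.

Lemma sum_part_inv (V : nmodType) (f : T -> V) (s : seq T) :
  (forall x, x \in s -> f x != 0 -> exists y, x = i y) ->
  \sum_(x <- s) f x = \sum_(y <- pmap part_inv s) f (i y).
Proof.
move=> h; rewrite big_pmap; apply: eq_big_seq => x xs.
case E : (part_inv x) => [y|] /=; first by move: (part_invV x); rewrite E /= => ->.
apply/eqP; apply: contraT => /h-/(_ xs)[y xy].
by rewrite xy part_invK in E.
Qed.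

Lemma hassum_inj (f : T -> C) l : (forall x, f x != 0 -> exists y, x = i y) ->
  hassum (fun y => f (i y)) l -> hassum f l.
Proof.
move=> fi h e /h[A hA]; exists (map i A) => s us As.
rewrite (@sum_part_inv _ f) => [|x _]; last exact: fi.
apply: hA => [|y yA]; first exact: pmap_uniq part_invV _ us.
by rewrite mem_pmap; apply/mapP; exists (i y); rewrite ?part_invK// As// map_f.
Qed.

Lemma rsum_inj (B : T -> R) : rsum B -> rsum (fun y => B (i y)).
Proof.
move=> [M h]; exists M => s us; rewrite -(big_map i xpredT B).
by apply: h; rewrite map_inj_uniq.
Qed.

Lemma asum_inj (f : T -> C) : asum f -> asum (fun y => f (i y)).
Proof. exact: rsum_inj. Qed.

Lemma tot_inj (f : T -> C) : asum f ->
  (forall x, f x != 0 -> exists y, x = i y) -> tot (fun y => f (i y)) = tot f.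
Proof.
move=> af h; apply/esym/tot_eq/hassum_inj => //.
by apply: asum_tot; exact: asum_inj.
Qed.

End Injection.

Lemma tot_bij (S T : eqType) (i : S -> T) j (f : T -> C) : cancel i j -> cancel j i ->
  asum f -> tot (fun y => f (i y)) = tot f.
Proof.
move=> ij ji af; apply: tot_inj => //; first exact: can_inj ij.
by move=> x _; exists (j x).
Qed.

Lemma asum_if (T : eqType) (P : pred T) (f : T -> C) : asum f ->
  asum (fun x => if P x then f x else 0).
Proof. by apply: rsum_le => x; case: ifP; rewrite ?nc0// nc_ge0. Qed.

(** Let [A] carry all but [e / 2] of the mass. A list of fibres that contains the images of [A]
    misses only terms outside [A]. *)
Lemma tot_fib (U S : eqType) (p : U -> S) (f : U -> C) : asum f ->
  hassum (fun s => tot (fun u => if p u == s then f u else 0)) (tot f).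
Proof.
move=> af e e0; have e2 : 0 < e / 2 by rewrite divr_gt0.
have [A uA hA] := rsum_tail (fun x => nc_ge0 (f x)) af e2.
exists (map p A) => s us As.
have h1 : hassum (fun u => if p u \in s then f u else 0)
   (\sum_(x <- s) tot (fun u => if p u == x then f u else 0)).
  have := @hassum_sum R U S s (fun x u => if p u == x then f u else 0)
    (fun x => tot (fun u => if p u == x then f u else 0)) _.
  move=> /(_ (fun x => asum_tot (asum_if _ af))); apply: hassum_ext => u.
  rewrite -big_mkcond/=; case: ifP => us'.
    rewrite big_mkcond (bigD1_seq (p u))//= eqxx big1 ?addr0// => x.
    by rewrite eq_sym => /negPf->.
  by rewrite big_seq_cond big1// => x /andP[xs /eqP px]; rewrite px xs in us'.
have := hassumD (asum_tot af) (hassumZ (-1) h1); rewrite mulN1r => /hassum_le h2.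
rewrite ncB; apply: le_lt_trans (_ : e / 2 < e); last by rewrite ltr_pdivrMr// ltr_pMr//; lra.
apply: h2 => t ut.
rewrite (eq_bigr (fun x => if p x \notin s then f x else 0)); last first.
  by move=> x _; case: (p x \in s) => /=; rewrite mulN1r ?subrr// oppr0 addr0.
rewrite -big_mkcond -big_filter; apply: le_trans (nc_sum _ _ _) _.
apply/ltW/hA; first exact: filter_uniq.
move=> x; rewrite mem_filter => /andP[xs _]; apply: contra xs => xA.
by apply: As; rewrite map_f.
Qed.

Lemma phase (z : C) : exists2 c : C, nc c <= 1 & c * z = (nc z)%:C%C.
Proof.
have [->|z0] := eqVneq z 0; first by exists 0; rewrite ?nc0 ?mulr0.
exists ((nc z)%:C%C / z); last by rewrite mulfVK.
rewrite ncM ncV nc_real (ger0_norm (nc_ge0 z)).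
by rewrite divff ?nc_eq0.
Qed.

(** Factors from [phase] turn the sum of the absolute values of the fibre sums into the absolute
    value of a single sum over [U], in which each [u] occurs at most once and with a coefficient of
    modulus at most 1. *)
Lemma asum_fib (U S : eqType) (p : U -> S) (f : U -> C) : asum f ->
  asum (fun s => tot (fun u => if p u == s then f u else 0)).
Proof.
move=> af; have [M hM] := af; exists M => s us.
pose t x := tot (fun u => if p u == x then f u else 0).
have [c hc] : {c : S -> C & forall x, nc (c x) <= 1 /\ c x * t x = (nc (t x))%:C%C}.
  apply: (@choice _ _ (fun x c => nc c <= 1 /\ c * t x = (nc (t x))%:C%C)) => x.
  by have [c h1 h2] := phase (t x); exists c.
have h1 : hassum (fun u => \sum_(x <- s) c x * (if p u == x then f u else 0))
   (\sum_(x <- s) c x * t x).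
  apply: hassum_sum => x; apply: hassumZ; exact: asum_tot (asum_if _ af).
rewrite -/(t _) (_ : \sum_(x <- s) _ = nc (\sum_(x <- s) c x * t x)); last first.
  rewrite (eq_bigr (fun x => (nc (t x))%:C%C)) => [|x _]; last by case: (hc x).
  rewrite -rmorph_sum nc_real ger0_norm// sumr_ge0// => x _; exact: nc_ge0.
apply: hassum_le h1 _ => r ur; apply: le_trans (nc_sum _ _ _) (le_trans _ (hM r ur)).
apply: ler_sum => u _; have [us'|us'] := boolP (p u \in s).
  rewrite (bigD1_seq (p u))//= eqxx big1 => [|x /negPf xu]; last by rewrite eq_sym xu mulr0.
  by rewrite addr0 ncM ler_piMl ?nc_ge0//; case: (hc (p u)).
rewrite big_seq_cond big1 ?nc0 ?nc_ge0// => x /andP[xs _].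
by case: eqP us' => [->|_ _]; rewrite ?xs ?mulr0.
Qed.

Lemma tot_pair (S T : eqType) (f : S * T -> C) : asum f ->
  tot f = tot (fun s => tot (fun t => f (s, t))).
Proof.
move=> af; rewrite -(tot_eq (tot_fib fst af)); apply: tot_ext => s.
rewrite -(@tot_inj _ _ (fun t : T => (s, t)) _ (fun u => if u.1 == s then f u else 0)).
- by apply: tot_ext => t; rewrite /= eqxx.
- by move=> x y [].
- exact: asum_if.
- by move=> [x y] /=; case: (x =P s) => [->|_]; [exists y|rewrite eqxx].
Qed.

(** A finite list of pairs lies in the rectangle spanned by its two projections, over which the sum
    factors. *)
Lemma asum_prod (S T : eqType) (f : S -> C) (g : T -> C) : asum f -> asum g ->
  asum (fun u : S * T => f u.1 * g u.2).
Proof.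
move=> [M hf] [N hg]; exists (M * N) => s us.
pose s1 := undup (map fst s); pose s2 := undup (map snd s).
apply: le_trans (_ : \sum_(u <- [seq (x, y) | x <- s1, y <- s2]) nc (f u.1 * g u.2) <= _).
  apply: ler_sum_sub => //; first by move=> x; rewrite nc_ge0.
  move=> [x y] xy; apply/allpairsP; exists (x, y); split=> //=.
    by rewrite mem_undup; apply/mapP; exists (x, y).
  by rewrite mem_undup; apply/mapP; exists (x, y).
rewrite big_allpairs/=.
under eq_bigr do under eq_bigr do rewrite ncM.
under eq_bigr do rewrite -mulr_sumr.
rewrite -mulr_suml ler_pM ?sumr_ge0//; try by move=> *; rewrite nc_ge0.
- by apply: hf; exact: undup_uniq.
- by apply: hg; exact: undup_uniq.
Qed.

Lemma tot_prod (S T : eqType) (f : S -> C) (g : T -> C) : asum f -> asum g ->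
  tot (fun u : S * T => f u.1 * g u.2) = tot f * tot g.
Proof.
move=> af ag; rewrite tot_pair; last exact: asum_prod.
rewrite mulrC -totZ//; apply: tot_ext => s /=.
by rewrite totZ// mulrC.
Qed.

Lemma tot_antidiag (F : nat * nat -> C) n :
  tot (fun u => if (u.1 + u.2)%N == n then F u else 0) = \sum_(i < n.+1) F (i : nat, n - i)%N.
Proof.
apply: tot_eq.
pose A := [seq (i, n - i)%N | i <- index_iota 0 n.+1].
have uA : uniq A by rewrite map_inj_uniq ?iota_uniq// => x y [].
have := hassum_fin F uA.
rewrite big_map big_mkord; apply: hassum_ext => -[x y] /=.
congr (if _ then _ else _); apply/mapP/eqP => [[z]|<-].
  by rewrite mem_index_iota => /= zn [-> ->]; rewrite subnKC.
by exists x; rewrite ?mem_index_iota ?addKn//= ltnS leq_addr.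
Qed.

Lemma cauchy_prod (f g : nat -> C) : asum f -> asum g ->
  hassum (fun n => \sum_(i < n.+1) f i * g (n - i)%N) (tot f * tot g).
Proof.
move=> af ag; rewrite -tot_prod//.
have := tot_fib (fun u : nat * nat => (u.1 + u.2)%N) (asum_prod af ag).
by apply: hassum_ext => n; rewrite tot_antidiag.
Qed.

Lemma hassum_tends (f : nat -> C) l : hassum f l -> tends (fun n => \sum_(i < n) f i) l.
Proof.
move=> h e /h[A hA]; exists (foldr maxn 0%N A).+1 => n hn.
rewrite -(big_mkord xpredT f); apply: hA; first exact: iota_uniq.
clear -hn.
move=> x xA; rewrite mem_index_iota /=; apply: leq_trans hn; rewrite ltnS.
elim: A xA => //= y A IH; rewrite inE => /predU1P[->|/IH h'].
  exact: leq_maxl.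
exact: leq_trans h' (leq_maxr _ _).
Qed.

Lemma rsum_geo (r : R) : 0 <= r -> r < 1 -> rsum (fun n => r ^+ n).
Proof.
move=> r0 r1; exists (1 - r)^-1 => s us.
apply: le_trans (_ : \sum_(0 <= i < (foldr maxn 0%N s).+1) r ^+ i <= _).
  apply: ler_sum_sub => //; first by move=> x; exact: exprn_ge0.
  move=> x; rewrite mem_index_iota/= ltnS; elim: s {us} => //= y s IH.
  rewrite inE => /predU1P[->|/IH h']; first exact: leq_maxl.
  exact: leq_trans h' (leq_maxr _ _).
rewrite big_mkord; set N := (foldr _ _ _).+1.
have r1' : 0 < 1 - r by rewrite subr_gt0.
rewrite -[leRHS]mul1r ler_pdivlMr// mulrC -opprB mulNr.
by rewrite -subrX1 opprB gerBl exprn_ge0.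
Qed.

Lemma asum_geo (a : nat -> C) (M r : R) : 0 <= r -> r < 1 ->
  (forall n, nc (a n) <= M * r ^+ n) -> asum a.
Proof.
move=> r0 r1 h; apply: (asum_le h).
have M0 : 0 <= M by have := h 0%N; rewrite expr0 mulr1; apply: le_trans; exact: nc_ge0.
exact: rsumZ M0 (rsum_geo r0 r1).
Qed.

(** The left side is at most the sum of [x ^+ i] over [i <= n], a partial geometric series. *)
Lemma natX_le (x : R) n : 0 <= x -> x < 1 -> n.+1%:R * x ^+ n <= (1 - x)^-1.
Proof.
move=> x0 x1; have x1' : 0 < 1 - x by rewrite subr_gt0.
apply: le_trans (_ : \sum_(i < n.+1) x ^+ i <= _).
  rewrite mulr_natl -{1}[n.+1]card_ord -sumr_const; apply: ler_sum => i _.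
  by rewrite ler_wiXn2l// ?(ltW x1)// -ltnS ltn_ord.
rewrite -[leRHS]mul1r ler_pdivlMr// mulrC -opprB mulNr.
by rewrite -subrX1 opprB gerBl exprn_ge0.
Qed.

Lemma hassum_int (f : int -> C) l m : hassum (fun n => f (Posz n)) l ->
  hassum (fun n => f (Negz n)) m -> hassum f (l + m).
Proof.
move=> h1 h2.
apply: hassum_ext (hassumD (_ : hassum (fun x => if x is Posz n then f (Posz n) else 0) l)
                       (_ : hassum (fun x => if x is Negz n then f (Negz n) else 0) m)).
- by case=> n /=; rewrite ?addr0 ?add0r.
- by apply: (@hassum_inj _ _ Posz) => // [x y []//|[n _|n /eqP//]]; exists n.
- by apply: (@hassum_inj _ _ Negz) => // [x y []//|[n /eqP//|n _]]; exists n.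
Qed.

Lemma tot_int (f : int -> C) : asum f ->
  tot f = tot (fun n => f (Posz n)) + tot (fun n => f (Negz n)).
Proof.
move=> af; apply: tot_eq; apply: hassum_int; apply: asum_tot; apply: asum_inj af.
  by move=> x y [].
by move=> x y [].
Qed.

(** A positive element of [C] is real, so the radii in the topology of [C^o] and the real radii in
    [tends] amount to the same. *)
Lemma cvg_tends (u : nat -> C^o) (l : C^o) : (u @ \oo --> l)%classic <-> tends u l.
Proof.
split=> [/cvgrPdist_lt h e e0|h].
  have e0' : 0 < e%:C%C :> C by rewrite ltcR.
  have [N _ hN] := h _ e0'; exists N => n /hN /=.
  by rewrite ncE ltcR ncB.
apply/cvgrPdist_lt => e e0; have [eR e0'] : e = (complex.Re e)%:C%C /\ 0 < complex.Re e.
  move: e0; case: e => a b; rewrite ltcE/= => /andP[/eqP -> a0].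
  by rewrite a0.
have [N hN] := h _ e0'; exists N => // n /= /hN.
by rewrite ncE eR ltcR ncB.
Qed.

Lemma csum_tends (u : nat -> C) l : tends (fun n => \sum_(i < n) u i) l -> csum u = l.
Proof.
move=> h; rewrite /csum; apply: (@cvg_lim C^o); first exact: norm_hausdorff.
apply/cvg_tends; apply: tends_ext h; exists 0%N => n _.
by rewrite /series/= big_mkord.
Qed.

Lemma csum_tot (u : nat -> C) : asum u -> csum u = tot u.
Proof. by move=> h; apply/csum_tends/hassum_tends/asum_tot. Qed.

Lemma csumZ_tot (u : int -> C) : asum u -> csumZ u = tot u.
Proof.
move=> h; rewrite /csumZ tot_int// !csum_tot//; apply: asum_inj h.
  by move=> x y [].
by move=> x y [].
Qed.

End SumTheory.

(** * The complex exponential: functional equation and elementary bounds *)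

Section ExpBounds.
Variable R : realType.
Local Notation C := R[i].
Local Notation nc := (@ComplexField.Normc.normc R).

Lemma nc_sqr (z : C) : nc z ^+ 2 = complex.Re z ^+ 2 + complex.Im z ^+ 2.
Proof. by case: z => a b /=; rewrite sqr_sqrtr// addr_ge0 ?sqr_ge0. Qed.

Lemma cexp0 : cexp (0 : C) = 1.
Proof. by rewrite /cexp/= expR0 cos0 sin0 mul1r. Qed.

Lemma cexpD (x y : C) : cexp (x + y) = cexp x * cexp y.
Proof.
case: x y => a b [c d]; rewrite /cexp/= expRD cosD sinD.
by apply/eqP; rewrite eq_complex/=; apply/andP; split; apply/eqP; ring.
Qed.

Lemma cexp_neq0 (x : C) : cexp x != 0.
Proof.
apply/eqP => h; have := cexpD x (- x); rewrite subrr cexp0 h mul0r => /eqP.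
by rewrite oner_eq0.
Qed.

Lemma cexpN (x : C) : cexp (- x) = (cexp x)^-1.
Proof.
apply: (mulfI (cexp_neq0 x)); rewrite -cexpD subrr cexp0 divff//.
exact: cexp_neq0.
Qed.

Lemma nc_cexp (z : C) : nc (cexp z) = expR (complex.Re z).
Proof.
case: z => a b; rewrite /cexp ncM nc_real/= cos2Dsin2 sqrtr1 mulr1 ger0_norm// expR_ge0.
Qed.

Lemma cexpMn (x : C) n : cexp (n%:R * x) = cexp x ^+ n.
Proof.
elim: n => [|n IH]; first by rewrite mul0r cexp0.
by rewrite mulrS mulrDl mul1r cexpD IH exprS.
Qed.

Lemma cexp_real (x : R) : cexp x%:C%C = (expR x)%:C%C.
Proof. by rewrite /cexp/= cos0 sin0 -[(_ +i* _)%C]/(1%:C%C) mulr1. Qed.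

Lemma expR_sub1 (x : R) : `|expR x - 1| <= `|x| * expR `|x|.
Proof.
have h1 := expR_ge1Dx x; have h2 := expR_ge1Dx (- x).
have e0 := expR_gt0 x.
have h3 : expR x - 1 <= x * expR x.
  have : (1 - x) * expR x <= 1 by rewrite -[leRHS](expRxMexpNx_1 x) mulrC ler_wpM2l// ltW.
  lra.
have [x0|x0] := leP 0 x.
  by rewrite !ger0_norm//; lra.
have ex : expR x <= 1 by rewrite -expR0 ler_expR ltW.
rewrite ler0_norm ?subr_le0// (ltr0_norm x0) opprB.
apply: le_trans (_ : - x <= _); first lra.
by rewrite ler_peMr ?oppr_ge0 ?(ltW x0)// -expR0 ler_expR oppr_ge0 ltW.
Qed.

Lemma expR_sub1x (x : R) : `|expR x - 1 - x| <= x ^+ 2 * expR `|x|.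
Proof.
have h1 := expR_ge1Dx x; have h2 := expR_ge1Dx (- x).
have e0 := expR_gt0 x.
have h3 : expR x - 1 <= x * expR x.
  have : (1 - x) * expR x <= 1 by rewrite -[leRHS](expRxMexpNx_1 x) mulrC ler_wpM2l// ltW.
  lra.
rewrite ger0_norm; last lra.
apply: le_trans (_ : x * (expR x - 1) <= _); first lra.
apply: le_trans (ler_norm _) _; rewrite normrM -[x ^+ 2]real_normK ?num_real//.
by rewrite expr2 -mulrA ler_wpM2l// expR_sub1.
Qed.

Lemma sin_le (x : R) : `|sin x| <= `|x|.
Proof.
wlog x0 : x / 0 <= x.
  move=> h; have [/h//|/ltW x0] := leP 0 x.
  by rewrite -normrN -sinN -(normrN x); apply: h; rewrite oppr_ge0.
have [c _] := @MVT_segment R sin cos 0 x x0 (fun y _ => is_derive_sin y)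
  (continuous_subspaceT (@continuous_sin R)).
by rewrite sin0 !subr0 => ->; rewrite normrM ler_piMl// cos_max.
Qed.

Lemma cos_eq (x : R) : 1 - cos x = 2 * sin (x / 2) ^+ 2.
Proof.
rewrite {1}(splitr x) cosD; have := cos2Dsin2 (x / 2); rewrite -!expr2; lra.
Qed.

Lemma cos_sub1 (x : R) : `|cos x - 1| <= x ^+ 2 / 2.
Proof.
have -> : `|cos x - 1| = 2 * `|sin (x / 2)| ^+ 2.
  by rewrite distrC cos_eq normrM normrX ger0_norm.
have := sin_le (x / 2); rewrite -ler_sqr ?nnegrE// [X in _ <= X]real_normK ?num_real// exprMn expr2 => h.
nra.
Qed.

Lemma cos_sub1' (x : R) : `|cos x - 1| <= `|x|.
Proof.
have -> : `|cos x - 1| = 2 * `|sin (x / 2)| ^+ 2.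
  by rewrite distrC cos_eq normrM normrX ger0_norm.
have := sin_le (x / 2); have := sin_max (x / 2); rewrite normrM (@ger0_norm _ 2^-1) ?invr_ge0//.
have := normr_ge0 (sin (x / 2)); set s := `|_|; nra.
Qed.

Lemma sin_subx (x : R) : `|sin x - x| <= x ^+ 2.
Proof.
wlog x0 : x / 0 <= x.
  move=> h; have [/h//|/ltW x0] := leP 0 x.
  by have := h (- x); rewrite sinN sqrrN -opprD normrN oppr_ge0 => /(_ x0).
have dd (y : R) : is_derive y 1 (fun z => sin z - z) (cos y - 1).
  by apply: is_deriveB.
have cc : continuous (fun z : R => sin z - z).
  move=> y; apply: differentiable_continuous; apply/derivable1_diffP.
  by have [] := dd y.
have [c] := @MVT_segment R _ _ 0 x x0 (fun y _ => dd y) (continuous_subspaceT cc).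
rewrite in_itv/= sin0 !subr0 => /andP[c0 cx] ->; rewrite normrM expr2.
rewrite (ger0_norm x0) ler_wpM2r//; apply: le_trans (cos_sub1' c) _.
by rewrite ger0_norm.
Qed.

(** Real and imaginary parts are estimated separately from bounds on [expR], [cos] and [sin]. The
    quadratic order in [z] is what term-by-term differentiation needs. *)
Lemma cexp_bound (z : C) : nc (cexp z - 1 - z) <= 2 * nc z ^+ 2 * expR (nc z).
Proof.
apply: le_trans (nc_le _) _; have hx := nc_Re z; have hz := nc_sqr z.
have hE : expR `|complex.Re z| <= expR (nc z) by rewrite ler_expR.
rewrite hz; move: hE; move: (expR (nc z)) => E hE {hx hz}.
move: hE; case: z => x y /= hE.
have hex : expR x <= E by apply: le_trans hE; rewrite ler_expR ler_norm.
have eR0 := expR_gt0 `|x|; have ex0 := expR_gt0 x.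
have -> : expR x * cos y - 0 * sin y - 1 - x = expR x * (cos y - 1) + (expR x - 1 - x) by ring.
have -> : expR x * sin y + 0 * cos y - 0 - y = expR x * (sin y - y) + y * (expR x - 1) by ring.
apply: le_trans (lerD (ler_normD _ _) (ler_normD _ _)) _.
rewrite !normrM (ger0_norm (ltW ex0)).
have a1 : expR x * `|cos y - 1| <= E * (y ^+ 2 / 2) by rewrite ler_pM ?cos_sub1 ?(ltW ex0).
have a2 : expR x * `|sin y - y| <= E * (y ^+ 2) by rewrite ler_pM ?sin_subx ?(ltW ex0).
have a3 : `|expR x - 1 - x| <= x ^+ 2 * E.
  by apply: le_trans (expR_sub1x x) _; rewrite ler_wpM2l ?sqr_ge0.
have a4 : `|y| * `|expR x - 1| <= `|y| * (`|x| * E).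
  by rewrite ler_wpM2l//; apply: le_trans (expR_sub1 x) _; rewrite ler_wpM2l.
have a5 : `|y| * `|x| <= (x ^+ 2 + y ^+ 2) / 2.
  rewrite -[x ^+ 2]real_normK ?num_real// -[y ^+ 2]real_normK ?num_real//.
  have := sqr_ge0 (`|x| - `|y|); lra.
have E0 : 0 <= E by apply: le_trans hE; exact: ltW.
have a6 := ler_wpM2r E0 a5; have a7 := mulr_ge0 E0 (sqr_ge0 x).
move: a1 a2 a3 a4 a6 a7; lra.
Qed.

Lemma twopiiE : twopii R = 'i%C * (pi *+ 2)%:C%C. Proof. exact: mulrC. Qed.

Lemma pi2_gt0 : 0 < pi *+ 2 :> R. Proof. by rewrite pmulrn_lgt0// pi_gt0. Qed.

Lemma twopii_neq0 : twopii R != 0.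
Proof.
rewrite -nc_eq0 ncM nc_real /= expr0n expr1n add0r sqrtr1 mulr1 normr_eq0.
by rewrite gt_eqF// pi2_gt0.
Qed.

Lemma nc_twopii : nc (twopii R) = pi *+ 2.
Proof.
rewrite ncM nc_real /= expr0n expr1n add0r sqrtr1 mulr1 ger0_norm//.
by rewrite ltW// pi2_gt0.
Qed.

Lemma eE (x : C) : e x = cexp (twopii R * x). Proof. by []. Qed.

Lemma eD (x y : C) : e (x + y) = e x * e y.
Proof. by rewrite /e mulrDr cexpD. Qed.

Lemma e0 : e (0 : C) = 1. Proof. by rewrite /e mulr0 cexp0. Qed.

Lemma e_neq0 (x : C) : e x != 0. Proof. exact: cexp_neq0. Qed.

Lemma eN (x : C) : e (- x) = (e x)^-1. Proof. by rewrite /e mulrN cexpN. Qed.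

Lemma eMn (x : C) n : e (n%:R * x) = e x ^+ n.
Proof. by rewrite /e mulrCA cexpMn. Qed.

Lemma nc_e (x : C) : nc (e x) = expR (- (pi *+ 2 * complex.Im x)).
Proof.
by rewrite /e nc_cexp; congr expR; case: x => a b /=; ring.
Qed.

Lemma e_real (x : R) : e x%:C%C = (cos (pi *+ 2 * x) +i* sin (pi *+ 2 * x))%C.
Proof.
rewrite /e /cexp /twopii /=.
have -> : (pi *+ 2 * 0 - 0 * 1) * x - (pi *+ 2 * 1 + 0 * 0) * 0 = 0 :> R by ring.
have -> : (pi *+ 2 * 0 - 0 * 1) * 0 + (pi *+ 2 * 1 + 0 * 0) * x = pi *+ 2 * x :> R by ring.
by rewrite expR0 mul1r.
Qed.

Lemma e1 : e (1 : C) = 1.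
Proof. by rewrite -[1]/(1%:C%C) e_real mulr1 cos2pi sin2pi. Qed.

Lemma e_half : e (2^-1 : C) = -1.
Proof.
have -> : 2^-1 = (2^-1 : R)%:C%C :> C by rewrite fmorphV rmorph_nat.
have -> : e (2^-1 : R)%:C%C = (cos pi +i* sin pi)%C.
  by rewrite e_real -[pi *+ 2]mulr_natr mulfK.
by rewrite cospi sinpi; apply/eqP; rewrite eq_complex/= oppr0 !eqxx.
Qed.

Lemma e_nat n : e (n%:R : C) = 1.
Proof. by rewrite -[n%:R]mulr1 eMn e1 expr1n. Qed.

Lemma e_int (m : int) : e (m%:~R : C) = 1.
Proof.
case: m => n; first by rewrite e_nat.
by rewrite NegzE mulrNz eN -pmulrn e_nat invr1.
Qed.

End ExpBounds.

(** * Complex derivatives *)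

Section Derivative.
Variable R : realType.
Local Notation C := R[i].
Local Notation nc := (@ComplexField.Normc.normc R).

Definition cont0 (p : C -> C) (l : C) := forall eps : R, 0 < eps ->
  exists2 d : R, 0 < d & forall h, nc h < d -> nc (p h - l) < eps.

(* Caratheodory's form of the derivative. *)
Definition cderiv (f : C -> C) (t l : C) :=
  exists2 p : C -> C, forall h, f (t + h) = f t + p h * h & cont0 p l.

Lemma cont0_cst l : cont0 (fun=> l) l.
Proof. by move=> eps e0; exists 1 => // h _; rewrite subrr nc0. Qed.

Lemma cont0_id : cont0 id 0.
Proof. by move=> eps e0; exists eps => // h; rewrite subr0. Qed.

Lemma cont0D p q l m : cont0 p l -> cont0 q m -> cont0 (fun h => p h + q h) (l + m).
Proof.
move=> hp hq eps e0; have e2 : 0 < eps / 2 by rewrite divr_gt0.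
have [d1 d10 h1] := hp _ e2; have [d2 d20 h2] := hq _ e2.
exists (Num.min d1 d2); first by rewrite lt_min d10.
move=> h; rewrite lt_min => /andP[/h1 g1 /h2 g2].
by rewrite opprD addrACA; apply: le_lt_trans (ncD _ _) _; rewrite [eps]splitr ltrD.
Qed.

Lemma cont0M0 p q l : cont0 p 0 -> cont0 q l -> cont0 (fun h => p h * q h) 0.
Proof.
move=> hp hq eps e0; have m0 : 0 < nc l + 1 by rewrite ltr_wpDl// nc_ge0.
have [d1 d10 h1] := hp _ (divr_gt0 e0 m0); have [d2 d20 h2] := hq _ ltr01.
exists (Num.min d1 d2); first by rewrite lt_min d10.
move=> h; rewrite lt_min => /andP[/h1 g1 /h2 g2]; rewrite subr0 in g1; rewrite subr0.
rewrite ncM -[eps](divfK (lt0r_neq0 m0)); apply: ltr_pM; rewrite ?nc_ge0//.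
rewrite -[q h](subrK l) addrC; apply: le_lt_trans (ncD _ _) _; by rewrite ltrD2l.
Qed.

Lemma cont0Z c p l : cont0 p l -> cont0 (fun h => c * p h) (c * l).
Proof.
move=> hp eps e0; have m0 : 0 < nc c + 1 by rewrite ltr_wpDl// nc_ge0.
have [d d0 hd] := hp _ (divr_gt0 e0 m0); exists d => // h /hd.
rewrite -mulrBr ncM ltr_pdivlMr// mulrC; apply: le_lt_trans.
by rewrite ler_wpM2r ?nc_ge0// lerDl.
Qed.

Lemma cont0_ext p q l : p =1 q -> cont0 p l -> cont0 q l.
Proof. by move=> pq hp eps /hp[d d0 h]; exists d => // x /h; rewrite pq. Qed.

Lemma cont0M p q l m : cont0 p l -> cont0 q m -> cont0 (fun h => p h * q h) (l * m).
Proof.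
move=> hp hq.
have h1 : cont0 (fun h => p h + - l) 0.
  by rewrite -(subrr l); apply: cont0D hp (cont0_cst _).
have := cont0D (cont0M0 h1 hq) (cont0Z l hq); rewrite add0r.
by apply: cont0_ext => h; rewrite -mulrDl subrK.
Qed.

Lemma cont0_comp p u l : cont0 p l -> cont0 u 0 -> cont0 (fun h => p (u h)) l.
Proof.
move=> hp hu eps /hp[d d0 hd]; have [d' d'0 hd'] := hu _ d0.
by exists d' => // h /hd'; rewrite subr0 => /hd.
Qed.

Lemma cderiv_cst c t : cderiv (fun=> c) t 0.
Proof. by exists (fun=> 0); [move=> h; rewrite mul0r addr0|exact: cont0_cst]. Qed.

Lemma cderiv_id t : cderiv id t 1.
Proof. by exists (fun=> 1); [move=> h; rewrite mul1r|exact: cont0_cst]. Qed.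

Lemma cderivD f g t l m : cderiv f t l -> cderiv g t m ->
  cderiv (fun x => f x + g x) t (l + m).
Proof.
move=> [p hp cp] [q hq cq]; exists (fun h => p h + q h); last exact: cont0D.
by move=> h; rewrite hp hq mulrDl addrACA.
Qed.

Lemma cderivZ c f t l : cderiv f t l -> cderiv (fun x => c * f x) t (c * l).
Proof.
move=> [p hp cp]; exists (fun h => c * p h); last exact: cont0Z.
by move=> h; rewrite hp mulrDr mulrA.
Qed.

Lemma cderivM f g t l m : cderiv f t l -> cderiv g t m ->
  cderiv (fun x => f x * g x) t (l * g t + f t * m).
Proof.
move=> [p hp cp] [q hq cq].
exists (fun h => p h * g t + f t * q h + p h * (q h * h)).
  by move=> h; rewrite hp hq; ring.
rewrite -[X in cont0 _ X]addr0; apply: cont0D.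
  by apply: cont0D (cont0Z _ cq); apply: cont0M cp (cont0_cst _).
apply: cont0_ext (cont0M0 _ cp) => [h|]; first exact: mulrC.
apply: cont0_ext (cont0M0 cont0_id cq) => h; exact: mulrC.
Qed.

Lemma cderiv_comp f g t l m : cderiv f t l -> cderiv g (f t) m ->
  cderiv (fun x => g (f x)) t (m * l).
Proof.
move=> [p hp cp] [q hq cq]; exists (fun h => q (p h * h) * p h).
  by move=> h; rewrite hp hq mulrA.
apply: cont0M (cp); apply: cont0_comp cq _.
apply: cont0_ext (cont0M0 cont0_id cp) => h; exact: mulrC.
Qed.

(** The difference quotient, completed by [l] at [h = 0], serves as the slope function; a quadratic
    remainder makes it continuous there. Derivatives of q-series, inverses and square roots all come
    from this criterion. *)
Lemma cderiv_bound f t l (K d : R) : 0 < d ->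
  (forall h, nc h < d -> nc (f (t + h) - f t - l * h) <= K * nc h ^+ 2) -> cderiv f t l.
Proof.
move=> d0 hK.
exists (fun h => if h == 0 then l else (f (t + h) - f t) / h).
  move=> h; case: eqP => [->|/eqP h0]; first by rewrite mulr0 !addr0.
  by rewrite divfK// [RHS]addrC subrK.
move=> eps e0; have m0 : 0 < `|K| + 1 by rewrite ltr_wpDl.
exists (Num.min d (eps / (`|K| + 1))); first by rewrite lt_min d0 divr_gt0.
move=> h; rewrite lt_min => /andP[hd he].
case: eqP => [_|/eqP h0]; first by rewrite subrr nc0.
have n0 : 0 < nc h by rewrite nc_gt0.
rewrite -(ltr_pM2r n0) -ncM mulrBl divfK//.
apply: le_lt_trans (hK h hd) _; rewrite expr2 mulrA ltr_pM2r//.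
move: he; rewrite ltr_pdivlMr// mulrC; apply: le_lt_trans.
by rewrite ler_wpM2r ?nc_ge0//; apply: le_trans (ler_norm K) _; rewrite lerDl.
Qed.

Lemma cderiv_local f g t l (d : R) : 0 < d -> (forall h, nc h < d -> f (t + h) = g (t + h)) ->
  cderiv f t l -> cderiv g t l.
Proof.
move=> d0 fg [p hp cp].
exists (fun h => if h == 0 then l else (g (t + h) - g t) / h).
  move=> h; case: eqP => [->|/eqP h0]; first by rewrite mulr0 !addr0.
  by rewrite divfK// [RHS]addrC subrK.
move=> eps e0; have [d' d'0 hd'] := cp _ e0.
exists (Num.min d d'); first by rewrite lt_min d0.
move=> h; rewrite lt_min => /andP[hd hd2].
case: eqP => [_|/eqP h0]; first by rewrite subrr nc0.
have := fg 0; rewrite nc0 addr0 => /(_ d0) <-; rewrite -fg// hp [f t + _]addrC addrK.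
by rewrite mulfK// hd'.
Qed.

Lemma upperE (t : C) : (t \in @upper R) = (0 < complex.Im t).
Proof. by []. Qed.

Lemma upper_near (t h : C) : t \in @upper R -> nc h < complex.Im t -> t + h \in @upper R.
Proof.
rewrite !upperE raddfD/= => t0 hh; have := nc_Im h; rewrite ler_norml => /andP[h1 _].
lra.
Qed.

Lemma cderiv_ext f g t l : t \in @upper R -> {in @upper R, f =1 g} ->
  cderiv f t l -> cderiv g t l.
Proof.
move=> ut fg; apply: (cderiv_local (d := complex.Im t)) => // h hh.
by apply: fg; exact: upper_near.
Qed.

Lemma cderiv_cvg f t l : cderiv f t l <->
  ((fun h : C^o => h^-1 *: ((f : C^o -> C^o) (h + t) - f t)) @ 0^' --> (l : C^o))%classic.
Proof.
split=> [[p hp cp]|h].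
  apply/cvgrPdist_lt => e e0; have [eR e0'] : e = (complex.Re e)%:C%C /\ 0 < complex.Re e.
    move: e0; case: e => a b; rewrite ltcE/= => /andP[/eqP -> a0].
    by rewrite a0.
  have [d d0 hd] := cp _ e0'.
  apply/nbhs_ballP; exists (d%:C%C) => /=; first by rewrite ltcR.
  move=> h; rewrite /ball/= sub0r normrN ncE ltcR => hhd h0.
  rewrite addrC (addrC h) hp [f t + _]addrC addrK /GRing.scale/= mulrC mulfK//.
  by rewrite addrC ncE eR ltcR ncB hd.
exists (fun h => if h == 0 then l else (f (t + h) - f t) / h).
  move=> x; case: eqP => [->|/eqP h0]; first by rewrite mulr0 !addr0.
  by rewrite divfK// [RHS]addrC subrK.
move=> e e0; have e0' : 0 < e%:C%C :> C by rewrite ltcR.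
move/cvgrPdist_lt/(_ _ e0') : h => /nbhs_ballP[d /= d0 hd].
have [dR d0'] : d = (complex.Re d)%:C%C /\ 0 < complex.Re d.
  move: d0; case: (d) => a b; rewrite ltcE/= => /andP[/eqP -> a0].
  by rewrite a0.
exists (complex.Re d) => // h hh; case: eqP => [_|/eqP h0]; first by rewrite subrr nc0.
have := hd h; rewrite /ball/= sub0r normrN ncE dR ltcR => /(_ hh h0).
by rewrite ncE ltcR ncB /GRing.scale/= [t + h]addrC mulrC.
Qed.

Lemma cderiv_derivable f t l : cderiv f t l ->
  derivable (f : C^o -> C^o) t 1 /\ derive1 (f : C^o -> C^o) t = l.
Proof.
move=> /cderiv_cvg h; split.
  apply/cvg_ex; exists l; move: h; apply: cvg_trans; apply: near_eq_cvg.
  by near=> x; rewrite /= /shift/= /GRing.scale/= mulr1.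
by rewrite /derive1; apply: (@cvg_lim C^o) => //; exact: norm_hausdorff.
Unshelve. all: by end_near. Qed.

Lemma derivable_cderiv f t : derivable (f : C^o -> C^o) t 1 ->
  cderiv f t (derive1 (f : C^o -> C^o) t).
Proof.
move=> h; apply/cderiv_cvg; rewrite derive1E.
move: h; rewrite /derivable => /= h.
have -> : (fun h : C^o => h^-1 *: ((f : C^o -> C^o) (h + t) - f t)) =
          (fun h : C^o => h^-1 *: (((f : C^o -> C^o) \o shift t) (h *: (1 : C^o)) - f t)).
  by apply/funext => x; rewrite /= /shift/= /GRing.scale/= mulr1.
exact: h.
Qed.

Lemma cderiv_uniq f t l m : cderiv f t l -> cderiv f t m -> l = m.
Proof. by move=> /cderiv_derivable[_ <-] /cderiv_derivable[_ <-]. Qed.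

Lemma cderiv_D f t l : cderiv f t l -> D f t = (twopii R)^-1 * l.
Proof. by move=> /cderiv_derivable[_ h]; rewrite /D h. Qed.

Lemma holo_cderiv f t : holomorphic f -> t \in @upper R -> cderiv f t (twopii R * D f t).
Proof.
move=> hf ut; rewrite /D mulrA divff ?twopii_neq0// mul1r.
by apply: derivable_cderiv; exact: hf.
Qed.

Lemma cderiv_holo f : (forall t, t \in @upper R -> exists l, cderiv f t l) -> holomorphic f.
Proof. by move=> h t /h[l /cderiv_derivable[]]. Qed.

Lemma cderiv_inv t : t != 0 -> cderiv (fun x => x^-1) t (- t ^- 2).
Proof.
move=> t0; have n0 : 0 < nc t by rewrite nc_gt0.
apply: (@cderiv_bound _ _ _ (2 / nc t ^+ 3) (nc t / 2)); first by rewrite divr_gt0.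
move=> h hh; have h1 : nc t / 2 <= nc (t + h).
  have : nc t <= nc (t + h) + nc h by rewrite -{1}[t](addrK h) nc_sub.
  lra.
have th0 : t + h != 0 by rewrite -nc_gt0; apply: lt_le_trans h1; rewrite divr_gt0.
have -> : (t + h)^-1 - t^-1 - - t ^- 2 * h = h ^+ 2 / (t ^+ 2 * (t + h)).
  by field; rewrite t0 th0.
rewrite ncM ncV ncM !ncX mulrC; apply: ler_wpM2r; first by rewrite exprn_ge0// nc_ge0.
rewrite -[2 / _]invrK lef_pV2 ?posrE; last first.
- by rewrite invr_gt0 divr_gt0// exprn_gt0.
- by rewrite mulr_gt0 ?exprn_gt0// nc_gt0.
rewrite invf_div exprSr -mulrA ler_wpM2l ?exprn_ge0 ?nc_ge0//.
Qed.

End Derivative.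

(** * Series in fractional powers of q and their calculus *)

Section QSeries.
Variable R : realType.
Local Notation C := R[i].
Local Notation nc := (@ComplexField.Normc.normc R).
Local Notation tot := (@tot R _).

(* The radius of convergence of the power series with coefficients [a] is at
   least 1, that is, [\sum_n a n q^n] converges on the whole half-plane. *)
Definition urad (a : nat -> C) := forall y : R, 0 < y ->
  exists M, forall n, nc (a n) * expR (- (y * n%:R)) <= M.

Definition convol (a b : nat -> C) n := \sum_(i < n.+1) a i * b (n - i)%N.

Definition expo (h : nat) (s : R) (n : nat) : R := n%:R / h%:R + s.

Definition qterm h s n (t : C) : C := e ((expo h s n)%:C%C * t).

(* [f = \sum_n a n q^(n / h + s)] *)
Definition qser h s a (f : C -> C) :=
  urad a /\ {in @upper R, forall t, f t = tot (fun n => a n * qterm h s n t)}.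

Lemma expR_natl (y : R) n : expR (- (y * n%:R)) = expR (- y) ^+ n.
Proof. by rewrite -mulNr mulrC expRM_natl. Qed.

(** One half of the exponent [y] pays for the growth of [a], the other half remains as a geometric
    factor. *)
Lemma urad_geo a y : urad a -> 0 < y -> exists2 M, 0 <= M &
  forall n, nc (a n) * expR (- (y * n%:R)) <= M * expR (- (y / 2)) ^+ n.
Proof.
move=> ha y0; have [|M hM] := ha (y / 2); first by rewrite divr_gt0.
exists M => [|n]; first by apply: le_trans (hM 0%N); rewrite mulr_ge0 ?nc_ge0 ?expR_ge0.
have -> : - (y * n%:R) = - (y / 2 * n%:R) + - (y / 2 * n%:R) by field.
by rewrite expRD mulrA -(expR_natl (y / 2)) ler_wpM2r ?expR_ge0.
Qed.

Lemma expRN_lt1 (y : R) : 0 < y -> expR (- y) < 1.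
Proof. by move=> y0; rewrite -expR0 ltr_expR oppr_lt0. Qed.

Lemma urad_asum a y : urad a -> 0 < y -> asum (fun n => a n * (expR (- (y * n%:R)))%:C%C).
Proof.
move=> ha y0; have [M M0 hM] := urad_geo ha y0.
apply: (asum_geo (r := expR (- (y / 2))) (M := M)); rewrite ?expR_ge0 ?expRN_lt1 ?divr_gt0//.
by move=> n; rewrite ncM nc_real ger0_norm ?expR_ge0.
Qed.

Lemma urad_le (a b : nat -> C) : (forall n, nc (a n) <= nc (b n)) -> urad b -> urad a.
Proof.
move=> ab hb y /hb[M hM]; exists M => n; apply: le_trans (hM n).
by rewrite ler_wpM2r ?expR_ge0.
Qed.

Lemma uradD a b : urad a -> urad b -> urad (fun n => a n + b n).
Proof.
move=> ha hb y y0; have [M hM] := ha y y0; have [N hN] := hb y y0; exists (M + N) => n.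
apply: le_trans (lerD (hM n) (hN n)); rewrite -mulrDl ler_wpM2r ?expR_ge0//.
exact: ncD.
Qed.

Lemma uradZ c a : urad a -> urad (fun n => c * a n).
Proof.
move=> ha y /ha[M hM]; exists (nc c * M) => n; rewrite ncM -mulrA.
by rewrite ler_wpM2l ?nc_ge0.
Qed.

Lemma uradn a : urad a -> urad (fun n => n%:R * a n).
Proof.
move=> ha y y0; have [M M0 hM] := urad_geo ha y0.
exists (M * (1 - expR (- (y / 2)))^-1) => n; rewrite ncM nc_nat -mulrA.
apply: le_trans (ler_wpM2l _ (hM n)) _; first exact: ler0n.
rewrite mulrCA ler_wpM2l//; apply: le_trans (natX_le n _ _); rewrite ?expR_ge0 ?expRN_lt1 ?divr_gt0//.
by rewrite ler_wpM2r ?exprn_ge0 ?expR_ge0// ler_nat.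
Qed.

Lemma urad_convol a b : urad a -> urad b -> urad (convol a b).
Proof.
move=> ha hb y y0; have y2 : 0 < y / 2 by rewrite divr_gt0.
have [M hM] := ha _ y2; have [N hN] := hb _ y2.
have E0 : 0 <= expR (- (y / 2)) by exact: expR_ge0.
have M0 : 0 <= M by apply: le_trans (hM 0%N); rewrite mulr_ge0 ?nc_ge0 ?expR_ge0.
have N0 : 0 <= N by apply: le_trans (hN 0%N); rewrite mulr_ge0 ?nc_ge0 ?expR_ge0.
exists (M * N * (1 - expR (- (y / 2)))^-1) => n.
apply: le_trans (_ : n.+1%:R * (M * N) * expR (- (y / 2)) ^+ n <= _); last first.
  have h := natX_le n E0 (expRN_lt1 y2).
  apply: le_trans (ler_wpM2l (mulr_ge0 M0 N0) h).
  by rewrite le_eqVlt; apply/orP; left; apply/eqP; ring.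
have -> : - (y * n%:R) = - (y / 2 * n%:R) + - (y / 2 * n%:R) by field.
rewrite expRD -(expR_natl (y / 2)) [leLHS]mulrA; apply: ler_wpM2r; first exact: expR_ge0.
apply: le_trans (_ : \sum_(i < n.+1) M * N <= _); last first.
  by rewrite sumr_const card_ord mulr_natl.
apply: le_trans (ler_wpM2r (expR_ge0 _) (nc_sum _ _ _)) _; rewrite mulr_suml.
apply: ler_sum => i _; rewrite ncM.
have -> : - (y / 2 * n%:R) = - (y / 2 * (i : nat)%:R) + - (y / 2 * (n - i)%N%:R).
  by rewrite natrB -1?ltnS//; ring.
rewrite expRD mulrACA ler_pM ?mulr_ge0 ?nc_ge0 ?expR_ge0//.
Qed.

Lemma urad_dirac k c : urad (fun n => if n == k then c else 0).
Proof.
move=> y y0; exists (nc c) => n; case: eqP => _; last by rewrite nc0 mul0r nc_ge0.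
by rewrite ler_piMr ?nc_ge0// -expR0 ler_expR oppr_le0 mulr_ge0// ltW.
Qed.

Lemma urad_shift k a : urad a -> urad (fun n => if (k <= n)%N then a (n - k)%N else 0).
Proof.
move=> ha y y0; have [M hM] := ha y y0; exists M => n; case: ifP => kn; last first.
  by rewrite nc0 mul0r; apply: le_trans (hM 0%N); rewrite mulr_ge0 ?nc_ge0 ?expR_ge0.
apply: le_trans (hM (n - k)%N); rewrite ler_wpM2l ?nc_ge0// ler_expR lerN2.
by rewrite ler_wpM2l ?(ltW y0)// ler_nat leq_subr.
Qed.

Lemma urad_dil m a : (0 < m)%N -> urad a ->
  urad (fun n => if (m %| n)%N then a (n %/ m)%N else 0).
Proof.
move=> m0 ha y y0; have [M hM] := ha y y0; exists M => n; case: ifP => kn; last first.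
  by rewrite nc0 mul0r; apply: le_trans (hM 0%N); rewrite mulr_ge0 ?nc_ge0 ?expR_ge0.
apply: le_trans (hM (n %/ m)%N); rewrite ler_wpM2l ?nc_ge0// ler_expR lerN2.
by rewrite ler_wpM2l ?(ltW y0)// ler_nat leq_div.
Qed.

Lemma urad_sub m a : (0 < m)%N -> urad a -> urad (fun n => a (m * n)%N).
Proof.
move=> m0 ha y y0; have [|M hM] := ha (y / m%:R); first by rewrite divr_gt0// ltr0n.
exists M => n; apply: le_trans (hM (m * n)%N); rewrite natrM mulrA divfK//.
by rewrite pnatr_eq0 -lt0n.
Qed.

Lemma nc_qterm h s n t :
  nc (qterm h s n t) = expR (- (pi *+ 2 * complex.Im t * expo h s n)).
Proof.
rewrite /qterm nc_e; congr expR; case: t => a b /=; rewrite mul0r addr0.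
by rewrite -mulrA [b * _]mulrC.
Qed.

Lemma qterm_asum h s a t : (0 < h)%N -> urad a -> t \in @upper R ->
  asum (fun n => a n * qterm h s n t).
Proof.
move=> h0 ha ut; pose y := pi *+ 2 * complex.Im t / h%:R.
have y0 : 0 < y by rewrite !mulr_gt0 ?invr_gt0 ?ltr0n ?pi2_gt0.
apply: asum_le (asumZ (expR (- (pi *+ 2 * complex.Im t * s)))%:C%C (urad_asum ha y0)) => n.
rewrite [leLHS]ncM nc_qterm ![leRHS]ncM [X in _ <= _ * X]ncM !nc_real !(ger0_norm (expR_ge0 _)) [leRHS]mulrCA ler_wpM2l ?nc_ge0//.
rewrite -expRD ler_expR /y /expo le_eqVlt; apply/orP; left; apply/eqP; ring.
Qed.

Lemma qterm_eq h s n h' s' n' t : expo h s n = expo h' s' n' ->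
  qterm h s n t = qterm h' s' n' t.
Proof. by rewrite /qterm => ->. Qed.

Lemma qtermM h s s' m n t : (0 < h)%N ->
  qterm h s m t * qterm h s' n t = qterm h (s + s') (m + n) t.
Proof.
move=> h0; have -> : qterm h (s + s') (m + n) t = e ((expo h s m + expo h s' n)%:C%C * t).
  have -> : expo h s m + expo h s' n = expo h (s + s') (m + n).
    by rewrite /expo natrD mulrDl addrACA.
  by [].
by rewrite rmorphD mulrDl eD.
Qed.

Lemma qser_ext h s a f g : {in @upper R, f =1 g} -> qser h s a f -> qser h s a g.
Proof. by move=> fg [ha hf]; split=> // t ut; rewrite -fg// hf. Qed.

Lemma qserD h s a b f g : (0 < h)%N -> qser h s a f -> qser h s b g ->
  qser h s (fun n => a n + b n) (fun t => f t + g t).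
Proof.
move=> h0 [ha hf] [hb hg]; split; first exact: uradD.
move=> t ut; rewrite hf// hg// -totD; try exact: qterm_asum.
by apply: tot_ext => n; rewrite mulrDl.
Qed.

Lemma qserZ h s a f c : (0 < h)%N -> qser h s a f -> qser h s (fun n => c * a n) (fun t => c * f t).
Proof.
move=> h0 [ha hf]; split; first exact: uradZ.
move=> t ut; rewrite hf// -totZ; last exact: qterm_asum.
by apply: tot_ext => n; rewrite mulrA.
Qed.

Lemma qserM h s s' a b f g : (0 < h)%N -> qser h s a f -> qser h s' b g ->
  qser h (s + s') (convol a b) (fun t => f t * g t).
Proof.
move=> h0 [ha hf] [hb hg]; split; first exact: urad_convol.
move=> t ut; rewrite hf// hg//; apply/esym/tot_eq.
have := cauchy_prod (qterm_asum s h0 ha ut) (qterm_asum s' h0 hb ut).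
apply: hassum_ext => n; rewrite /convol mulr_suml; apply: eq_bigr => i _.
by rewrite mulrACA qtermM// subnKC// -ltnS.
Qed.

Lemma qser_shift h s k a f : (0 < h)%N -> qser h s a f ->
  qser h (s - k%:R / h%:R) (fun n => if (k <= n)%N then a (n - k)%N else 0) f.
Proof.
move=> h0 [ha hf]; split; first exact: urad_shift.
move=> t ut; rewrite hf//.
rewrite -(@tot_inj _ _ _ (fun n => k + n)%N _ (fun n => (if (k <= n)%N then a (n - k)%N else 0) * _)).
- apply: tot_ext => n; rewrite leq_addr addKn; congr (_ * _); apply: qterm_eq.
  by rewrite /expo natrD mulrDl; ring.
- by move=> x y /addnI.
- by apply: qterm_asum => //; exact: urad_shift.
- move=> n; case: ifP => [kn _|]; last by rewrite mul0r eqxx.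
  by exists (n - k)%N; rewrite subnKC.
Qed.

Lemma qser_dil h s m a f : (0 < h)%N -> (0 < m)%N -> qser h s a f ->
  qser (h * m) s (fun n => if (m %| n)%N then a (n %/ m)%N else 0) f.
Proof.
move=> h0 m0 [ha hf]; split; first exact: urad_dil.
have hm0 : (0 < h * m)%N by rewrite muln_gt0 h0.
move=> t ut; rewrite hf//.
rewrite -(@tot_inj _ _ _ (fun n => m * n)%N _ (fun n => (if (m %| n)%N then a (n %/ m)%N else 0) * _)).
- apply: tot_ext => n; rewrite dvdn_mulr// mulKn//; congr (_ * _); apply: qterm_eq.
  by rewrite /expo !natrM [h%:R * _]mulrC -mulf_div divff ?mul1r// pnatr_eq0 -lt0n.
- by move=> x y /eqP; rewrite eqn_pmul2l// => /eqP.
- by apply: qterm_asum => //; exact: urad_dil.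
- move=> n; case: ifP => [kn _|]; last by rewrite mul0r eqxx.
  by exists (n %/ m)%N; rewrite mulnC divnK.
Qed.

Lemma hassum_dirac (F : nat -> C) k : (forall n, n != k -> F n = 0) -> hassum F (F k).
Proof.
move=> h; have := @hassum_fin _ _ F [:: k] isT; rewrite big_seq1.
by apply: hassum_ext => n; rewrite inE; case: eqP => // /eqP/h.
Qed.

Lemma qser_cst h c : qser h 0 (fun n => if n == 0%N then c else 0) (fun=> c).
Proof.
split; first exact: urad_dirac.
move=> t ut; apply/esym/tot_eq.
have q1 : qterm h 0 0 t = 1 by rewrite /qterm /expo mul0r addr0 rmorph0 mul0r e0.
have := @hassum_dirac (fun n => (if n == 0%N then c else 0) * qterm h 0 n t) 0%N.
rewrite /= q1 mulr1; apply.
by move=> n /negPf->; rewrite mul0r.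
Qed.

Lemma urad_expo h s a : urad a -> urad (fun n => (expo h s n)%:C%C * a n).
Proof.
move=> ha.
have := uradD (uradZ (h%:R^-1) (uradn ha)) (uradZ s%:C%C ha); apply: urad_le => n.
by rewrite /expo rmorphD rmorphM fmorphV !rmorph_nat mulrDl mulrA [_^-1 * _]mulrC.
Qed.

(** By [cexp_bound] each term has a quadratic remainder, and since |k| < y / 2 the remainders are
    dominated by the twice differentiated series at [t'], a point of half the height. Only absolute
    values matter there, so [t'] may be taken on the imaginary axis. *)
Lemma qser_cderiv h s a f t : (0 < h)%N -> qser h s a f -> t \in @upper R ->
  cderiv f t (twopii R * tot (fun n => (expo h s n)%:C%C * a n * qterm h s n t)).
Proof.
move=> h0 [ha hf] ut; set y := complex.Im t; have y0 : 0 < y by [].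
pose t' : C := (0 +i* (y / 2))%C; have ut' : t' \in @upper R by rewrite upperE/= divr_gt0.
have ha1 := urad_expo h s ha; have ha2 := urad_expo h s ha1.
have [M hM] := qterm_asum s h0 ha2 ut'.
(* The last factor accounts for negative exponents: |x| <= x + (|s| - s) for x = n / h + s. *)
pose c := 2 * (pi *+ 2) ^+ 2 * expR (pi * y * (`|s| - s)).
have c0 : 0 <= c by rewrite !mulr_ge0 ?expR_ge0 ?exprn_ge0 ?(ltW (pi2_gt0 R)).
have y2 : 0 < y / 2 by rewrite divr_gt0.
apply: (cderiv_bound (K := c * M) y2) => k hk.
have utk : t + k \in @upper R by apply: upper_near => //; apply: lt_trans hk _; rewrite ltr_pdivrMr// ltr_pMr// ltrDl.
rewrite !hf// -totZ; last exact: qterm_asum.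
have A0 := qterm_asum s h0 ha ut; have A1 := qterm_asum s h0 ha1 ut.
have A2 := qterm_asum s h0 ha utk.
have E : tot (fun n => a n * qterm h s n (t + k)) - tot (fun n => a n * qterm h s n t)
   - tot (fun n => twopii R * ((expo h s n)%:C%C * a n * qterm h s n t)) * k
   = tot (fun n => a n * qterm h s n (t + k) + (-1) * (a n * qterm h s n t)
       + (- k) * (twopii R * ((expo h s n)%:C%C * a n * qterm h s n t))).
  have B1 := asumZ (twopii R) A1.
  rewrite (totD (asumD A2 (asumZ (-1) A0)) (asumZ (- k) B1)) (totD A2 (asumZ (-1) A0)).
  rewrite (totZ _ A0) (totZ (- k) B1); ring.
rewrite E {E}.
have key n : nc (a n * qterm h s n (t + k) + (-1) * (a n * qterm h s n t)
       + (- k) * (twopii R * ((expo h s n)%:C%C * a n * qterm h s n t))) <=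
   c * nc k ^+ 2 * nc ((expo h s n)%:C%C * ((expo h s n)%:C%C * a n) * qterm h s n t').
  set x := expo h s n.
  have -> : a n * qterm h s n (t + k) + (-1) * (a n * qterm h s n t)
       + (- k) * (twopii R * (x%:C%C * a n * qterm h s n t)) =
     a n * qterm h s n t * (cexp (twopii R * (x%:C%C * k)) - 1 - twopii R * (x%:C%C * k)).
    by rewrite /qterm -/x mulrDr eD -[e (_ * k)]/(cexp _); ring.
  rewrite ncM; apply: le_trans (ler_wpM2l (nc_ge0 _) (cexp_bound _)) _.
  rewrite (ncM (a n)) (ncM _ (qterm h s n t')) !nc_qterm (ncM (twopii R)) (ncM x%:C%C k).
  rewrite (ncM x%:C%C (_ * _)) (ncM x%:C%C (a n)) nc_twopii !nc_real -/y /= -/x.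
  have -> : nc (a n) * expR (- (pi *+ 2 * y * x)) *
     (2 * (pi *+ 2 * (`|x| * nc k)) ^+ 2 * expR (pi *+ 2 * (`|x| * nc k))) =
     2 * (pi *+ 2) ^+ 2 * nc k ^+ 2 * (`|x| * (`|x| * nc (a n))) *
      (expR (- (pi *+ 2 * y * x)) * expR (pi *+ 2 * (`|x| * nc k))) by ring.
  have -> : c * nc k ^+ 2 * (`|x| * (`|x| * nc (a n)) * expR (- (pi *+ 2 * (y / 2) * x)))
    = 2 * (pi *+ 2) ^+ 2 * nc k ^+ 2 * (`|x| * (`|x| * nc (a n))) *
      (expR (pi * y * (`|s| - s)) * expR (- (pi *+ 2 * (y / 2) * x))) by rewrite /c; ring.
  apply: ler_wpM2l.
    by rewrite !mulr_ge0 ?exprn_ge0 ?nc_ge0 ?(ltW (pi2_gt0 R)).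
  rewrite -!expRD ler_expR.
  have hx : `|x| <= x + (`|s| - s).
    rewrite /x /expo; have n0 : 0 <= n%:R / h%:R :> R by rewrite mulr_ge0 ?invr_ge0.
    by apply: le_trans (ler_normD _ _) _; rewrite (ger0_norm n0); lra.
  have p0 : 0 < pi :> R by exact: pi_gt0.
  have h1 : `|x| * nc k <= `|x| * (y / 2) by rewrite ler_wpM2l// ltW.
  have h2 : pi * (`|x| * nc k) <= pi * (`|x| * (y / 2)) by rewrite ler_wpM2l// ltW.
  have h3 : pi * y * `|x| <= pi * y * (x + (`|s| - s)) by rewrite ler_wpM2l// mulr_ge0// ltW.
  by rewrite -mulr_natl; move: h2 h3; lra.
apply: le_trans (tot_le key _ ) (_ : c * nc k ^+ 2 * M <= _).
  by move=> r ur; rewrite -mulr_sumr ler_wpM2l ?hM// mulr_ge0// exprn_ge0// nc_ge0.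
by rewrite mulrAC.
Qed.

Lemma qser_D h s a f : (0 < h)%N -> qser h s a f ->
  qser h s (fun n => (expo h s n)%:C%C * a n) (D f).
Proof.
move=> h0 hf; split; first by apply: urad_expo; case: hf.
move=> t ut; rewrite (cderiv_D (qser_cderiv h0 hf ut)) mulKf//.
exact: twopii_neq0.
Qed.

Lemma qser_holo h s a f : (0 < h)%N -> qser h s a f -> holomorphic f.
Proof. by move=> h0 hf; apply: cderiv_holo => t ut; eexists; exact: qser_cderiv hf ut. Qed.

Definition qexp h f := exists (N : nat) a, qser h (- (N%:R / h%:R)) a f.

(** Pointwise convergence forces the growth condition [urad]: the terms of a convergent series are
    bounded, and at height y h / (2 pi) the n-th term has absolute value |a n| exp (- y n) up to a
    constant factor. *)
Lemma qexp_has h f : (0 < h)%N -> has_qexp h f <-> qexp h f.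
Proof.
move=> h0; have hR : h%:R != 0 :> R by rewrite pnatr_eq0 -lt0n.
have hC : h%:R != 0 :> C by rewrite pnatr_eq0 -lt0n.
have E N n t : e ((n%:R - N%:R) / h%:R * t) = qterm h (- (N%:R / h%:R)) n t.
  by rewrite /qterm /expo -mulrBl rmorphM rmorphB fmorphV !rmorph_nat.
split=> -[N [a ha]]; exists N, a; last first.
  case: ha => ua hf t ut; apply/cvg_tends; rewrite hf//.
  apply: tends_ext (hassum_tends (asum_tot (qterm_asum _ h0 ua ut))).
  by exists 0%N => n _; rewrite /series/= big_mkord; apply: eq_bigr => i _; rewrite E.
have ht t : t \in @upper R ->
    tends (fun n => \sum_(i < n) a i * qterm h (- (N%:R / h%:R)) i t) (f t).
  move=> /ha/cvg_tends; apply: tends_ext; exists 0%N => n _.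
  by rewrite /series/= big_mkord; apply: eq_bigr => i _; rewrite E.
have ua : urad a.
  move=> y y0; pose t : C := (0 +i* (y * h%:R / (pi *+ 2)))%C.
  have ut : t \in @upper R by rewrite upperE/= !mulr_gt0 ?ltr0n// invr_gt0 pi2_gt0.
  have [M hM] := tends_bound (ht t ut); exists ((M + M) * expR (- (y * N%:R))) => n.
  have := le_trans (nc_sub _ _) (lerD (hM n.+1) (hM n)).
  rewrite big_ord_recr/= [X in X - _]addrC addrK ncM nc_qterm => h1.
  have -> : - (y * n%:R) = - (pi *+ 2 * complex.Im t * expo h (- (N%:R / h%:R)) n) + - (y * N%:R).
    rewrite /expo /t/=; move: (pi *+ 2) (lt0r_neq0 (pi2_gt0 R)) => p p0.
    by field; rewrite ?hR ?p0.
  by rewrite expRD mulrA ler_wpM2r ?expR_ge0.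
split=> // t ut; apply: tends_uniq (ht t ut) _.
exact: hassum_tends (asum_tot (qterm_asum _ h0 ua ut)).
Qed.

Lemma qexp_ext h f g : {in @upper R, f =1 g} -> qexp h f -> qexp h g.
Proof. by move=> fg [N [a hf]]; exists N, a; exact: qser_ext hf. Qed.

Lemma qexp_lift h N N' a f : (0 < h)%N -> (N <= N')%N -> qser h (- (N%:R / h%:R)) a f ->
  exists b, qser h (- (N'%:R / h%:R)) b f.
Proof.
move=> h0 NN /(qser_shift (N' - N) h0); rewrite natrB//.
have -> : - (N%:R / h%:R) - (N'%:R - N%:R) / h%:R = - (N'%:R / h%:R) :> R by ring.
by move=> hq; exists (fun n => if (N' - N <= n)%N then a (n - (N' - N))%N else 0).
Qed.

Lemma qexpD h f g : (0 < h)%N -> qexp h f -> qexp h g -> qexp h (fun t => f t + g t).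
Proof.
move=> h0 [N [a hf]] [M [b hg]].
have [a' hf'] := qexp_lift h0 (leq_maxl N M) hf.
have [b' hg'] := qexp_lift h0 (leq_maxr N M) hg.
by exists (maxn N M), (fun n => a' n + b' n); exact: qserD.
Qed.

Lemma qexpM h f g : (0 < h)%N -> qexp h f -> qexp h g -> qexp h (fun t => f t * g t).
Proof.
move=> h0 [N [a hf]] [M [b hg]]; exists (N + M)%N, (convol a b).
by rewrite natrD mulrDl opprD; exact: qserM.
Qed.

Lemma qexp_cst h c : qexp h (fun=> c).
Proof.
exists 0%N, (fun n => if n == 0%N then c else 0).
by rewrite mul0r oppr0; exact: qser_cst.
Qed.

Lemma qexpZ h c f : (0 < h)%N -> qexp h f -> qexp h (fun t => c * f t).
Proof. by move=> h0; apply: qexpM => //; exact: qexp_cst. Qed.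

Lemma qexp_D h f : (0 < h)%N -> qexp h f -> qexp h (D f).
Proof.
move=> h0 [N [a hf]]; exists N, (fun n => (expo h (- (N%:R / h%:R)) n)%:C%C * a n).
exact: qser_D.
Qed.

Lemma qexp_sum h (I : Type) (s : seq I) (f : I -> C -> C) : (0 < h)%N ->
  (forall i, qexp h (f i)) -> qexp h (fun t => \sum_(i <- s) f i t).
Proof.
move=> h0 hf; elim: s => [|i s IH].
  by apply: qexp_ext (qexp_cst h 0) => t _; rewrite big_nil.
by apply: qexp_ext (qexpD h0 (hf i) IH) => t _; rewrite big_cons.
Qed.

Lemma qexp_prod h (I : Type) (s : seq I) (f : I -> C -> C) : (0 < h)%N ->
  (forall i, qexp h (f i)) -> qexp h (fun t => \prod_(i <- s) f i t).
Proof.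
move=> h0 hf; elim: s => [|i s IH].
  by apply: qexp_ext (qexp_cst h 1) => t _; rewrite big_nil.
by apply: qexp_ext (qexpM h0 (hf i) IH) => t _; rewrite big_cons.
Qed.

Lemma qexp_holo h f : (0 < h)%N -> qexp h f -> holomorphic f.
Proof. by move=> h0 [N [a /qser_holo]]; exact. Qed.

Lemma qexp_dil h m f : (0 < h)%N -> (0 < m)%N -> qexp h f -> qexp (h * m) f.
Proof.
move=> h0 m0 [N [a hf]]; exists (N * m)%N, (fun n => if (m %| n)%N then a (n %/ m)%N else 0).
rewrite !natrM -mulf_div divff ?mulr1; first exact: qser_dil.
by rewrite pnatr_eq0 -lt0n.
Qed.

Lemma qser_qexp h (s : nat) a f : (0 < h)%N -> qser h (s%:R / h%:R) a f -> qexp h f.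
Proof.
move=> h0 /(qser_shift s h0); rewrite subrr => hf; exists 0%N.
by rewrite mul0r oppr0; exists (fun n => if (s <= n)%N then a (n - s)%N else 0).
Qed.

Lemma sum_root_unity h n : (0 < h)%N ->
  \sum_(r < h) e (n%:R / h%:R * (r : nat)%:R : C) = if (h %| n)%N then h%:R else 0.
Proof.
move=> h0; have hC : h%:R != 0 :> C by rewrite pnatr_eq0 -lt0n.
pose w : C := e (n%:R / h%:R).
rewrite (eq_bigr (fun r : 'I_h => w ^+ r)); last by move=> r _; rewrite mulrC eMn.
have wh : w ^+ h = 1 by rewrite -eMn mulrC divfK// e_nat.
case: ifP => [/dvdnP[m ->]|hn] in w wh *.
  rewrite /w natrM mulfK//.
  under eq_bigr do rewrite e_nat expr1n.
  by rewrite sumr_const card_ord.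
have w1 : w != 1.
  (* If w = 1, the fractional part x of n / h satisfies cos (2 pi x) = 1, hence sin (pi x) = 0,
     which is impossible for 0 < x < 1. *)
  apply/eqP => w1; move: hn; suff -> : (h %| n)%N by [].
  move: w1; rewrite /w.
  have -> : n%:R / h%:R = (n %/ h)%N%:R + ((n %% h)%N%:R / h%:R : R)%:C%C :> C.
    rewrite rmorphM fmorphV !rmorph_nat {1}(divn_eq n h) natrD natrM; by field.
  rewrite eD e_nat mul1r e_real => /eqP; rewrite eq_complex/= => /andP[/eqP hc _].
  rewrite /dvdn; apply/eqP; move: hc; have := ltn_pmod n h0; move: (n %% h)%N => r rh.
  set x := (r%:R / h%:R : R); have x0 : 0 <= x by rewrite mulr_ge0 ?invr_ge0.
  have x1 : x < 1 by rewrite ltr_pdivrMr ?ltr0n// mul1r ltr_nat.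
  have := cos_eq (pi *+ 2 * x) => + hc; rewrite hc subrr => /esym/eqP.
  rewrite mulf_eq0 pnatr_eq0/= sqrf_eq0.
  have -> : pi *+ 2 * x / 2 = pi * x by rewrite -[pi *+ 2]mulr_natr; field.
  move=> s0; case: r @x x0 x1 hc s0 rh => // r x x0 x1 hc s0 rh; exfalso; move: s0.
  rewrite gt_eqF// sin_gt0_pi// mulr_gt0 ?pi_gt0//=; last by rewrite divr_gt0 ?ltr0n.
  by rewrite gtr_pMr ?pi_gt0.
apply/eqP; have := subrX1 w h; rewrite wh subrr => /esym/eqP.
by rewrite mulf_eq0 subr_eq0 (negPf w1).
Qed.

(** The mean over [t], [t + 1], ..., [t + h - 1] multiplies each term by a sum of roots of unity,
    which vanishes unless [h] divides the index. The offset is first raised to a multiple of [h], so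
    that it does not disturb these roots. *)
Lemma qexp_periodic h f : (0 < h)%N -> qexp h f ->
  {in @upper R, forall t, f (t + 1) = f t} -> qexp 1 f.
Proof.
move=> h0 [N [a hf]] f1; have hC : h%:R != 0 :> C by rewrite pnatr_eq0 -lt0n.
have hR : h%:R != 0 :> R by rewrite pnatr_eq0 -lt0n.
have [b [ub {}hf]] := qexp_lift h0 (leq_pmulr N h0) hf.
exists N, (fun n => b (h * n)%N); split; first exact: urad_sub.
move=> t ut; have un r : t + r%:R \in @upper R.
  rewrite upperE raddfD/= -[r%:R](rmorph_nat (@real_complex R)) /= addr0; exact: ut.
have fr r : f (t + r%:R) = f t.
  elim: r => [|r IH]; first by rewrite addr0.
  by rewrite -natr1 addrA f1.
have avg : h%:R * f t = tot (fun n => (if (h %| n)%N then h%:R else 0) *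
     (b n * qterm h (- ((N * h)%N%:R / h%:R)) n t)).
  rewrite mulr_natl -{1}[h]card_ord -sumr_const.
  apply/esym/tot_eq.
  rewrite (eq_bigr (fun r : 'I_h => f (t + (r : nat)%:R))) => [|r _]; last by rewrite fr.
  have := @hassum_sum R _ _ (index_enum 'I_h)
    (fun (r : 'I_h) n => b n * qterm h (- ((N * h)%N%:R / h%:R)) n (t + (r : nat)%:R))
    (fun r => f (t + (r : nat)%:R)).
  move=> /(_ _)/hassum_ext; apply=> [n|r].
    rewrite -mulr_sumr mulrCA -(@sum_root_unity h n h0) mulr_suml; congr (_ * _).
    apply: eq_bigr => r _; rewrite /qterm mulrDr eD mulrC; congr (_ * _).
    rewrite /expo natrM mulfK// rmorphB rmorphM fmorphV !rmorph_nat mulrBl eD.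
    by rewrite -natrM eN e_nat invr1 mulr1.
  by rewrite hf//; apply: asum_tot; exact: qterm_asum.
apply: (mulfI hC); rewrite avg.
have ab := qterm_asum (- ((N * h)%N%:R / h%:R)) h0 ub ut.
rewrite -(@tot_inj _ _ _ (fun n => h * n)%N).
- rewrite -totZ; last by apply: qterm_asum => //; exact: urad_sub.
  apply: tot_ext => n; rewrite dvdn_mulr//; congr (_ * (_ * _)); apply: qterm_eq.
  by rewrite /expo !natrM mulfK// !divr1 mulrAC divff// mul1r.
- by move=> x y /eqP; rewrite eqn_pmul2l// => /eqP.
- apply: asum_le (asumZ h%:R ab) => n; case: ifP => // _.
  by rewrite mul0r nc0 nc_ge0.
- move=> n; case: ifP => [/dvdnP[m ->] _|]; last by rewrite mul0r eqxx.
  by exists m; rewrite mulnC.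
Qed.

(** The coefficient [c] at the exponent [s] may vanish, so that leading terms add and multiply
    without case distinctions. *)
Definition qlead s c f := exists2 a, qser 1 s a f & a 0%N = c.

Lemma qlead_ext s c f g : {in @upper R, f =1 g} -> qlead s c f -> qlead s c g.
Proof. by move=> fg [a hf a0]; exists a => //; exact: qser_ext hf. Qed.

Lemma qleadD s c d f g : qlead s c f -> qlead s d g ->
  qlead s (c + d) (fun t => f t + g t).
Proof.
by move=> [a ha <-] [b hb <-]; exists (fun n => a n + b n) => //; exact: qserD.
Qed.

Lemma qleadM s s' c d f g : qlead s c f -> qlead s' d g ->
  qlead (s + s') (c * d) (fun t => f t * g t).
Proof.
move=> [a ha <-] [b hb <-]; exists (convol a b); first exact: qserM.
by rewrite /convol big_ord1.
Qed.

Lemma qleadZ s c k f : qlead s c f -> qlead s (k * c) (fun t => k * f t).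
Proof. by move=> [a ha <-]; exists (fun n => k * a n) => //; exact: qserZ. Qed.

Lemma qlead_cst c : qlead 0 c (fun=> c).
Proof. by exists (fun n => if n == 0%N then c else 0) => //; exact: qser_cst. Qed.

Lemma qlead_D s c f : qlead s c f -> qlead s (s%:C%C * c) (D f).
Proof.
move=> [a ha <-]; exists (fun n => (expo 1 s n)%:C%C * a n); first exact: qser_D.
by rewrite /expo mul0r add0r.
Qed.

Lemma qlead_prod (I : Type) (r : seq I) (s : I -> R) (c : I -> C) (f : I -> C -> C) :
  (forall i, qlead (s i) (c i) (f i)) ->
  qlead (\sum_(i <- r) s i) (\prod_(i <- r) c i) (fun t => \prod_(i <- r) f i t).
Proof.
move=> hf; elim: r => [|i r IH].
  by rewrite !big_nil; apply: qlead_ext (qlead_cst 1) => t _; rewrite big_nil.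
by rewrite !big_cons; apply: qlead_ext (qleadM (hf i) IH) => t _; rewrite big_cons.
Qed.

Lemma qlead0 s : qlead s 0 (fun=> 0).
Proof.
exists (fun=> 0) => //; split.
  by apply: urad_le (urad_dirac 0 0) => n; case: ifP.
move=> t ut; apply/esym/tot_eq; apply: hassum_ext (@hassum0 R _) => n.
by rewrite mul0r.
Qed.

Lemma qlead_sum (I : Type) (r : seq I) s (c : I -> C) (f : I -> C -> C) :
  (forall i, qlead s (c i) (f i)) ->
  qlead s (\sum_(i <- r) c i) (fun t => \sum_(i <- r) f i t).
Proof.
move=> hf; elim: r => [|i r IH].
  by rewrite !big_nil; apply: qlead_ext (qlead0 s) => t _; rewrite big_nil.
by rewrite !big_cons; apply: qlead_ext (qleadD (hf i) IH) => t _; rewrite big_cons.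
Qed.

End QSeries.

(** * Growth classes of functions, uniform in a parameter *)

Section Growth.
Variables (R : realType) (T : Type).
Implicit Types F G : T -> R -> R.

(** The parameter [q] will be a step length, possibly with a position on a path; the constants must
    not depend on it, because the steps are later refined indefinitely. *)
Definition poly_bounded F := exists p A, 0 <= A /\
  forall q y, `|F q y| <= A * (1 + `|y|) ^+ p.

Definition rapid F := forall c : R, exists A, forall q y, `|F q y| <= A * expR (- (c * `|y|)).

Lemma one_le1D (y : R) : 1 <= 1 + `|y|. Proof. by rewrite lerDl. Qed.

Lemma pb_cst F (A : R) : (forall q y, `|F q y| <= A) -> poly_bounded F.
Proof.
move=> h; exists 0%N, `|A|; split=> // q y; rewrite expr0 mulr1.
by apply: le_trans (h q y) (ler_norm _).
Qed.

Lemma pb_lin F (A B : R) : 0 <= A -> 0 <= B -> (forall q y, `|F q y| <= A * `|y| + B) -> poly_bounded F.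
Proof.
move=> A0 B0 h; exists 1%N, (A + B); split; first exact: addr_ge0.
move=> q y; apply: le_trans (h q y) _; rewrite expr1; have := normr_ge0 y.
move: (`|y|) => z z0; nra.
Qed.

Lemma pbM F G : poly_bounded F -> poly_bounded G -> poly_bounded (fun q y => F q y * G q y).
Proof.
move=> [p [A [A0 hA]]] [p' [B [B0 hB]]]; exists (p + p')%N, (A * B).
split; first exact: mulr_ge0.
by move=> q y; rewrite normrM exprD mulrACA ler_pM.
Qed.

Lemma pbD F G : poly_bounded F -> poly_bounded G -> poly_bounded (fun q y => F q y + G q y).
Proof.
move=> [p [A [A0 hA]]] [p' [B [B0 hB]]]; exists (p + p')%N, (A + B).
split; first exact: addr_ge0.
move=> q y; apply: le_trans (ler_normD _ _) _; rewrite mulrDl lerD//.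
  by apply: le_trans (hA q y) _; rewrite ler_wpM2l// ler_weXn2l ?one_le1D// leq_addr.
by apply: le_trans (hB q y) _; rewrite ler_wpM2l// ler_weXn2l ?one_le1D// leq_addl.
Qed.

Lemma rapidD F G : rapid F -> rapid G -> rapid (fun q y => F q y + G q y).
Proof.
move=> hF hG c; have [A hA] := hF c; have [B hB] := hG c; exists (A + B) => q y.
by apply: le_trans (ler_normD _ _) _; rewrite mulrDl lerD.
Qed.

Lemma rapidM F G : poly_bounded F -> rapid G -> rapid (fun q y => F q y * G q y).
Proof.
move=> [p [A [A0 hA]]] hG c; have [B hB] := hG (c + p%:R).
exists (A * B) => q y; rewrite normrM -mulrA.
apply: le_trans (ler_pM _ _ (hA q y) (hB q y)) _; rewrite ?normr_ge0//.
rewrite -mulrA ler_wpM2l//; have h : (1 + `|y|) ^+ p <= expR (p%:R * `|y|).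
  by rewrite expRM_natl lerXn2r ?nnegrE ?expR_ge0 ?addr_ge0// expR_ge1Dx.
have B0 : 0 <= B * expR (- ((c + p%:R) * `|y|)) by apply: le_trans (hB q y).
apply: le_trans (ler_wpM2r B0 h) _.
rewrite mulrCA -expRD le_eqVlt; apply/orP; left; apply/eqP.
by congr (_ * expR _); ring.
Qed.

Lemma rapid_le F G : (forall q y, `|F q y| <= `|G q y|) -> rapid G -> rapid F.
Proof. by move=> FG hG c; have [A hA] := hG c; exists A => q y; exact: le_trans (FG q y) _. Qed.

End Growth.

(** * Gaussians: decay, Taylor bounds and Riemann sums along lines *)

Section Gauss.
Variable R : realType.
Local Notation C := R[i].
Local Notation nc := (@ComplexField.Normc.normc R).
Local Notation tot := (@tot R _).

(** In contrast to [cexp_bound], the exponential factor depends on the real part of [z]: exponents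
    of Gaussians have large modulus but very negative real part, where exp |z| would be far too
    big. *)
Lemma cexp_bound2 (z : C) :
  nc (cexp z - 1 - z) <= 2 * nc z ^+ 2 * (1 + expR (complex.Re z)).
Proof.
apply: le_trans (nc_le _) _; rewrite nc_sqr; case: z => x y /=.
set E := 1 + expR x; have ex0 := expR_gt0 x.
have hex : expR x <= E by rewrite /E; lra.
have h1 := expR_ge1Dx x; have h2 := expR_ge1Dx (- x).
have h3 : expR x - 1 <= x * expR x.
  have : (1 - x) * expR x <= 1 by rewrite -[leRHS](expRxMexpNx_1 x) mulrC ler_wpM2l// ltW.
  lra.
have b1 : `|expR x - 1| <= `|x| * E.
  rewrite /E; have [x0|x0] := leP 0 x.
    rewrite !ger0_norm; [nra|lra|lra].
  have ex : expR x <= 1 by rewrite -expR0 ler_expR ltW.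
  rewrite ler0_norm ?subr_le0// (ltr0_norm x0) opprB; nra.
have a3 : `|expR x - 1 - x| <= x ^+ 2 * E.
  rewrite ger0_norm; last lra.
  apply: le_trans (_ : x * (expR x - 1) <= _); first lra.
  apply: le_trans (ler_norm _) _; rewrite normrM -[x ^+ 2]real_normK ?num_real//.
  by rewrite expr2 -mulrA ler_wpM2l.
have -> : expR x * cos y - 0 * sin y - 1 - x = expR x * (cos y - 1) + (expR x - 1 - x) by ring.
have -> : expR x * sin y + 0 * cos y - 0 - y = expR x * (sin y - y) + y * (expR x - 1) by ring.
apply: le_trans (lerD (ler_normD _ _) (ler_normD _ _)) _.
rewrite !normrM (ger0_norm (ltW ex0)).
have a1 : expR x * `|cos y - 1| <= E * (y ^+ 2 / 2) by rewrite ler_pM ?cos_sub1 ?(ltW ex0).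
have a2 : expR x * `|sin y - y| <= E * (y ^+ 2) by rewrite ler_pM ?sin_subx ?(ltW ex0).
have a4 : `|y| * `|expR x - 1| <= `|y| * (`|x| * E) by rewrite ler_wpM2l.
have a5 : `|y| * `|x| <= (x ^+ 2 + y ^+ 2) / 2.
  rewrite -[x ^+ 2]real_normK ?num_real// -[y ^+ 2]real_normK ?num_real//.
  have := sqr_ge0 (`|x| - `|y|); lra.
have E0 : 0 <= E by rewrite /E; lra.
have a6 := ler_wpM2r E0 a5; have a7 := mulr_ge0 E0 (sqr_ge0 x).
move: a1 a2 a3 a4 a6 a7; lra.
Qed.

Definition gauss (u : C) : C := cexp (- (pi%:C%C * u ^+ 2)).

Lemma gaussE u : gauss u = cexp (- (pi%:C%C * u ^+ 2)). Proof. by []. Qed.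

(** With d = - pi (2 u v + v^2), gauss (u + v) = gauss u * cexp d, so the factor [1 + expR (Re d)]
    of [cexp_bound2] becomes the sum of the Gaussian's absolute values at both end points. *)
Lemma gauss_taylor u v :
  nc (gauss (u + v) - gauss u + (pi *+ 2)%:C%C * u * v * gauss u) <=
  nc v ^+ 2 * (2 * pi ^+ 2 * (2 * nc u + nc v) ^+ 2 + pi) * (nc (gauss u) + nc (gauss (u + v))).
Proof.
have p0 : 0 < pi :> R by exact: pi_gt0.
pose d : C := - (pi%:C%C * (2 * u * v + v ^+ 2)).
have guv : gauss (u + v) = gauss u * cexp d.
  by rewrite /gauss -cexpD /d; congr cexp; ring.
have -> : gauss (u + v) - gauss u + (pi *+ 2)%:C%C * u * v * gauss u =
   gauss u * (cexp d - 1 - d) - pi%:C%C * v ^+ 2 * gauss u.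
  rewrite guv /d rmorphMn; move: (gauss u) (cexp _) => g c; ring.
apply: le_trans (nc_sub _ _) _.
have nd : nc d <= pi * (nc v * (2 * nc u + nc v)).
  rewrite /d ncN (ncM pi%:C%C) nc_real (ger0_norm (ltW p0)) ler_wpM2l ?(ltW p0)//.
  have -> : 2 * u * v + v ^+ 2 = v * (2 * u + v) by ring.
  rewrite (ncM v) ler_wpM2l ?nc_ge0//; apply: le_trans (ncD _ _) _.
  by rewrite ncM nc_nat.
have nguv : nc (gauss (u + v)) = nc (gauss u) * expR (complex.Re d).
  by rewrite guv ncM nc_cexp.
rewrite (ncM (gauss u)) (ncM _ (gauss u)) (ncM pi%:C%C) ncX nc_real (ger0_norm (ltW p0)).
have h1 := ler_wpM2l (nc_ge0 (gauss u)) (cexp_bound2 d).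
have nd2 : nc d ^+ 2 <= (pi * (nc v * (2 * nc u + nc v))) ^+ 2.
  by rewrite lerXn2r ?nnegrE ?nc_ge0// (le_trans (nc_ge0 d) nd).
apply: le_trans (lerD h1 (lexx _)) _; rewrite nguv.
have g0 := nc_ge0 (gauss u); have e0 := expR_ge0 (complex.Re d).
move: nd2 g0 e0 (nc_ge0 v) (nc_ge0 u) p0.
move: (nc (gauss u)) (expR _) (nc d) (nc v) (nc u) pi => g E D V U p hD g0 E0 V0 U0 p0.
have h2 : g * (2 * D ^+ 2 * (1 + E)) <= g * (2 * (p * (V * (2 * U + V))) ^+ 2 * (1 + E)).
  by rewrite ler_wpM2l// ler_wpM2r ?addr_ge0// ler_wpM2l.
apply: le_trans (lerD h2 (lexx _)) _.
have : 0 <= p * V ^+ 2 * (g * E) by rewrite !mulr_ge0 ?sqr_ge0 ?(ltW p0).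
move=> h3; rewrite -subr_ge0 (_ : _ - _ = p * V ^+ 2 * (g * E))//; ring.
Qed.

Lemma gauss_decay (k S W c : R) : 0 < k -> 0 <= S -> 0 <= W -> exists A, forall (s w : C) (y : R),
  k <= complex.Re (s ^+ 2) -> nc s <= S -> nc w <= W ->
  nc (gauss (s * y%:C%C + w)) <= A * expR (- (c * `|y|)).
Proof.
move=> k0 S0 W0; have p0 : 0 < pi :> R by exact: pi_gt0.
pose b := 2 * pi * S * W + c.
exists (expR (pi * W ^+ 2 + b ^+ 2 / (4 * pi * k))) => s w y ks sS wW.
rewrite /gauss nc_cexp -expRD ler_expR.
have -> : complex.Re (- (pi%:C%C * (s * y%:C%C + w) ^+ 2)) =
  - pi * (y ^+ 2 * complex.Re (s ^+ 2) + 2 * y * complex.Re (s * w) + complex.Re (w ^+ 2)).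
  case: (s) (w) => a a' [d d'] /=; ring.
have h1 : - (`|y| * (S * W)) <= y * complex.Re (s * w).
  rewrite lerNl; apply: le_trans (ler_norm _) _; rewrite normrN normrM ler_wpM2l//.
  apply: le_trans (nc_Re _) _; rewrite ncM ler_pM ?nc_ge0//.
have h2 : - W ^+ 2 <= complex.Re (w ^+ 2).
  rewrite lerNl; apply: le_trans (ler_norm _) _; rewrite normrN.
  by apply: le_trans (nc_Re _) _; rewrite ncX lerXn2r ?nnegrE ?nc_ge0.
have h3 : k * y ^+ 2 <= y ^+ 2 * complex.Re (s ^+ 2) by rewrite mulrC ler_wpM2l ?sqr_ge0.
have h4 : - (pi * k) * `|y| ^+ 2 + b * `|y| <= b ^+ 2 / (4 * pi * k).
  rewrite -subr_ge0; have pk : 0 < pi * k by rewrite mulr_gt0.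
  rewrite (_ : _ - _ = (b - 2 * (pi * k) * `|y|) ^+ 2 / (4 * (pi * k))).
    by rewrite divr_ge0 ?sqr_ge0// mulr_ge0// ltW.
  have gen (p k' b' z : R) : p != 0 -> k' != 0 ->
      b' ^+ 2 / (4 * p * k') - (- (p * k') * z ^+ 2 + b' * z) =
      (b' - 2 * (p * k') * z) ^+ 2 / (4 * (p * k')).
    by move=> hp hk; field; rewrite hp hk.
  by apply: gen; exact: lt0r_neq0.
rewrite real_normK ?num_real// in h4.
have h5 : - pi * (y ^+ 2 * complex.Re (s ^+ 2) + 2 * y * complex.Re (s * w) + complex.Re (w ^+ 2))
   <= - pi * (k * y ^+ 2 - 2 * (`|y| * (S * W)) - W ^+ 2).
  rewrite ler_nM2l ?oppr_lt0//; lra.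
apply: le_trans h5 _; rewrite /b in h4 *; lra.
Qed.

Lemma gauss_rapid (T : Type) (s w : T -> C) (k S W : R) : 0 < k -> 0 <= S -> 0 <= W ->
  (forall q, k <= complex.Re (s q ^+ 2)) -> (forall q, nc (s q) <= S) -> (forall q, nc (w q) <= W) ->
  rapid (fun q y => nc (gauss (s q * y%:C%C + w q))).
Proof.
move=> k0 S0 W0 hs hS hW c; have [A hA] := gauss_decay c k0 S0 W0; exists A => q y.
by rewrite ger0_norm ?nc_ge0// hA.
Qed.

Lemma sum_geo_le (r : R) (s : seq nat) : 0 <= r -> r < 1 -> uniq s ->
  \sum_(i <- s) r ^+ i <= (1 - r)^-1.
Proof.
move=> r0 r1 us.
apply: le_trans (_ : \sum_(0 <= i < (foldr maxn 0%N s).+1) r ^+ i <= _).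
  apply: ler_sum_sub => //; first by move=> x; exact: exprn_ge0.
  move=> x; rewrite mem_index_iota/= ltnS; elim: s {us} => //= y s IH.
  rewrite inE => /predU1P[->|/IH h']; first exact: leq_maxl.
  exact: leq_trans h' (leq_maxr _ _).
rewrite big_mkord; set N := (foldr _ _ _).+1.
have r1' : 0 < 1 - r by rewrite subr_gt0.
rewrite -[leRHS]mul1r ler_pdivlMr// mulrC -opprB mulNr.
by rewrite -subrX1 opprB gerBl exprn_ge0.
Qed.

Lemma sum_int_le (B : int -> R) (M1 M2 : R) :
  (forall s, uniq s -> \sum_(n <- s) B (Posz n) <= M1) ->
  (forall s, uniq s -> \sum_(n <- s) B (Negz n) <= M2) ->
  forall s, uniq s -> \sum_(k <- s) B k <= M1 + M2.
Proof.
move=> h1 h2 s us.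
rewrite (eq_bigr (fun k => (if k is Posz _ then B k else 0) + (if k is Negz _ then B k else 0))); last first.
  by case=> n _; rewrite ?addr0 ?add0r.
have i1 : injective Posz by move=> x y [].
have i2 : injective Negz by move=> x y [].
rewrite big_split/= (@sum_part_inv _ _ _ i1 _ (fun k => if k is Posz _ then B k else 0)); last first.
  by case=> // n _; rewrite ?eqxx//; exists n.
rewrite (@sum_part_inv _ _ _ i2 _ (fun k => if k is Negz _ then B k else 0)); last first.
  by case=> // n _; rewrite ?eqxx//; exists n.
apply: lerD; [apply: h1|apply: h2].
  by apply: pmap_uniq us; exact: part_invV.
by apply: pmap_uniq us; exact: part_invV.
Qed.

Definition node (N : nat) (k : int) : R := k%:~R / N%:R.

(** Each half-line is bounded by a geometric series of ratio r = exp (- 1 / N), and 1 / (1 - r) <= N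
    + 1 <= 2 N. *)
Lemma node_sum N (s : seq int) : (0 < N)%N -> uniq s ->
  \sum_(k <- s) expR (- `|node N k|) <= 4 * N%:R.
Proof.
move=> N0 us; have NR : 0 < N%:R :> R by rewrite ltr0n.
pose r := expR (- N%:R^-1 : R).
have r1 : r < 1 by rewrite expRN_lt1// invr_gt0.
have rb : (1 - r)^-1 <= 2 * N%:R.
  have h := expR_ge1Dx (N%:R^-1 : R).
  have h2 : r * (1 + N%:R^-1) <= 1.
    by rewrite -[leRHS](expRxMexpNx_1 N%:R^-1) mulrC ler_wpM2r// expR_ge0.
  have h3 : r * (N%:R + 1) <= N%:R.
    have := ler_wpM2r (ltW NR) h2; rewrite -mulrA mulrDl mul1r mulVf ?lt0r_neq0//.
  have N1 : 1 <= N%:R :> R by rewrite ler1n.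
  rewrite invf_ple ?posrE ?subr_gt0//; last by rewrite mulr_gt0.
  rewrite lerBrDr -lerBrDl; apply: le_trans (_ : N%:R / (N%:R + 1) <= _).
    by rewrite ler_pdivlMr//; lra.
  rewrite ler_pdivrMr; last lra.
  rewrite invfM mulrBl mul1r.
  have : 2^-1 / N%:R * (N%:R + 1) <= 1 :> R.
    rewrite mulrAC ler_pdivrMr// mul1r; lra.
  lra.
have E n : `|node N (Posz n)| = n%:R / N%:R by rewrite /node ger0_norm ?divr_ge0.
have E' n : `|node N (Negz n)| = n.+1%:R / N%:R.
  by rewrite /node NegzE mulrNz mulNr normrN ger0_norm ?divr_ge0.
have rn n : expR (- (n%:R / N%:R)) = r ^+ n by rewrite mulrC expR_natl.
apply: le_trans (sum_int_le (B := fun k => expR (- `|node N k|)) (M1 := 2 * N%:R) (M2 := 2 * N%:R) _ _ us) _.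
- move=> t ut; rewrite (eq_bigr (fun n => r ^+ n)) => [|n _]; last by rewrite E rn.
  exact: le_trans (sum_geo_le (expR_ge0 _) r1 ut) rb.
- move=> t ut; apply: le_trans (ler_sum (G := fun n => r ^+ n) _ _) _.
    by move=> n _; rewrite E' rn exprS ler_piMl ?exprn_ge0 ?expR_ge0// ltW.
  exact: le_trans (sum_geo_le (expR_ge0 _) r1 ut) rb.
- lra.
Qed.

Lemma node_asum N (f : R -> C) (A : R) : (0 < N)%N ->
  (forall y, nc (f y) <= A * expR (- `|y|)) -> asum (fun k => f (node N k)).
Proof.
move=> N0 h; have A0 : 0 <= A.
  have := le_trans (nc_ge0 _) (h 0); rewrite pmulr_lge0// expR_gt0//.
exists (A * (4 * N%:R)) => s us.
apply: le_trans (ler_sum _ (fun k _ => h (node N k))) _.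
by rewrite -mulr_sumr ler_wpM2l// node_sum.
Qed.

Lemma node_tot N (f : R -> C) (A : R) : (0 < N)%N ->
  (forall y, nc (f y) <= A * expR (- `|y|)) -> nc (tot (fun k => f (node N k))) <= A * (4 * N%:R).
Proof.
move=> N0 h; have A0 : 0 <= A.
  have := le_trans (nc_ge0 _) (h 0); rewrite pmulr_lge0// expR_gt0//.
apply: tot_le (fun k => h (node N k)) _ => s us.
by rewrite -mulr_sumr ler_wpM2l// node_sum.
Qed.

Lemma node_shift N (f : R -> C) : (0 < N)%N -> asum (fun k => f (node N k)) ->
  tot (fun k => f (node N k + N%:R^-1)) = tot (fun k => f (node N k)).
Proof.
move=> N0 af; rewrite -(@tot_bij _ _ _ (fun k : int => k + 1) (fun k => k - 1) (fun k => f (node N k))) //.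
- by apply: tot_ext => k; rewrite /node intrD mulrDl mul1r.
- by move=> k; rewrite addrK.
- by move=> k; rewrite subrK.
Qed.

(** The open sector |arg s| < pi / 4, where Re (s^2) > 0 and the Gaussian decays along the line s
    R. *)
Definition sector (s : C) := `|complex.Im s| < complex.Re s.

Lemma nodeE N k : node N k = k%:~R / N%:R. Proof. by []. Qed.

(** Riemann sum of mesh 1 / N for the integral of exp (- pi z^2) along the line s R + w. *)
Definition riemann N (s w : C) : C := N%:R^-1 * tot (fun k => s * gauss (s * (node N k)%:C%C + w)).

(** Along the segment from 1 to s the quantity x - |y| is affine, from 1 to a - |b|, hence at least
    [m]; then x^2 - y^2 = (x - |y|) (x + |y|) >= m^2. *)
Lemma sector_path s : sector s -> exists2 k, 0 < k &
  forall l : R, 0 <= l <= 1 -> k <= complex.Re ((1 + l%:C%C * (s - 1)) ^+ 2).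
Proof.
case: s => a b; rewrite /sector/= => ab; pose m := Num.min 1 (a - `|b|).
have m0 : 0 < m by rewrite lt_min ltr01 subr_gt0.
have m1 : m <= 1 by rewrite ge_min lexx.
have m2 : m <= a - `|b| by rewrite ge_min lexx orbT.
exists (m ^+ 2); first exact: exprn_gt0.
move=> l /andP[l0 l1] /=.
set x := 1 + _; set y := 0 + _.
have xE : x = 1 + l * (a - 1) by rewrite /x; ring.
have yE : y = l * b by rewrite /y; ring.
have h1 : m <= x - `|y|.
  rewrite xE yE normrM (ger0_norm l0).
  have := mulr_ge0 l0 (_ : 0 <= a - `|b| - m); rewrite subr_ge0 => /(_ m2).
  have := mulr_ge0 (_ : 0 <= 1 - l) (_ : 0 <= 1 - m); rewrite !subr_ge0 => /(_ l1 m1).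
  lra.
have -> : x * x - y * y = (x - `|y|) * (x + `|y|).
  by have : `|y| * `|y| = y * y; [rewrite -!expr2 real_normK ?num_real|]; nra.
rewrite expr2 ler_pM ?(ltW m0)//; apply: le_trans h1 _; rewrite lerD2l.
by have := normr_ge0 y; lra.
Qed.

(* A substitute for Cauchy's theorem: moving [(s, w)] along a segment to [(1, 0)]
   changes each term of the Riemann sum by a difference which telescopes in the
   node up to second order, so that in the limit the Gaussian integral along
   [s R + w] does not depend on [s] and [w]. *)
Lemma riemann_path s w : sector s -> exists B, forall N, (0 < N)%N ->
  nc (riemann N s w - riemann N 1 0) <= B / N%:R.
Proof.
move=> ss; have [k k0 hk] := sector_path ss.
pose sl (l : R) : C := 1 + l%:C%C * (s - 1); pose wl (l : R) : C := l%:C%C * w.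
pose sg : C := s - 1.
(* A position on the segment together with a step that does not leave it. *)
pose T := {q : R * R | [&& 0 <= q.1, 0 <= q.2 & q.1 + q.2 <= 1]}.
pose la (q : T) := (sval q).1; pose hh (q : T) := (sval q).2.
have qP (q : T) : [/\ 0 <= la q, 0 <= hh q & la q + hh q <= 1] by have /and3P[] := svalP q.
pose Sb := 1 + nc sg; pose Wb := nc w + Sb.
have S0 : 0 <= Sb by rewrite addr_ge0// nc_ge0.
have W0 : 0 <= Wb by rewrite addr_ge0// nc_ge0.
have nsl l : 0 <= l <= 1 -> nc (sl l) <= Sb.
  move=> /andP[l0 l1]; apply: le_trans (ncD _ _) _; rewrite nc1 lerD2l ncM nc_real.
  by rewrite ger0_norm// ler_piMl// nc_ge0.
have nwl l : 0 <= l <= 1 -> nc (wl l) <= nc w.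
  move=> /andP[l0 l1]; rewrite ncM nc_real.
  by rewrite ger0_norm// ler_piMl// nc_ge0.
have l1 q : 0 <= la q <= 1 by have [a b c] := qP q; rewrite a /=; lra.
have l2 q : 0 <= la q + hh q <= 1 by have [a b c] := qP q; rewrite addr_ge0.
have h1 q : 0 <= hh q <= 1 by have [a b c] := qP q; rewrite b /=; lra.
pose u q (y : R) : C := sl (la q) * y%:C%C + wl (la q).
pose v0 (y : R) : C := sg * y%:C%C + w.
pose g0 (q : T) y := nc (gauss (u q y)).
pose g1 (q : T) y := nc (gauss (sl (la q + hh q) * y%:C%C + wl (la q + hh q))).
pose g2 (q : T) y := nc (gauss (sl (la q) * y%:C%C + (wl (la q) + sl (la q) * (hh q)%:C%C))).
have G0 : rapid g0.
  apply: (@gauss_rapid T (fun q => sl (la q)) (fun q => wl (la q)) k Sb Wb) => // q; rewrite ?hk ?nsl//.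
  by apply: le_trans (nwl _ (l1 q)) _; rewrite /Wb lerDl.
have G1 : rapid g1.
  apply: (@gauss_rapid T (fun q => sl (la q + hh q)) (fun q => wl (la q + hh q)) k Sb Wb) => // q; rewrite ?hk ?nsl//.
  by apply: le_trans (nwl _ (l2 q)) _; rewrite /Wb lerDl.
have G2 : rapid g2.
  apply: (@gauss_rapid T (fun q => sl (la q)) (fun q => wl (la q) + sl (la q) * (hh q)%:C%C) k Sb Wb) => // q; rewrite ?hk ?nsl//.
  apply: le_trans (ncD _ _) _; rewrite lerD ?nwl// ncM nc_real.
  have /andP[a b] := h1 q; rewrite ger0_norm//; apply: le_trans (ler_wpM2l (nc_ge0 _) b) _.
  by rewrite mulr1 nsl.
have Pu : poly_bounded (fun q y => nc (u q y)).
  apply: (@pb_lin _ _ _ Sb (nc w)) => //; first exact: nc_ge0.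
  move=> q y; rewrite ger0_norm ?nc_ge0//; apply: le_trans (ncD _ _) _.
  by rewrite lerD ?nwl// ncM nc_real ler_wpM2r ?nsl.
have Pv : poly_bounded (fun (q : T) y => nc (v0 y)).
  apply: (@pb_lin _ _ _ (nc sg) (nc w)) => //; rewrite ?nc_ge0//.
  move=> q y; rewrite ger0_norm ?nc_ge0//; apply: le_trans (ncD _ _) _.
  by rewrite lerD// ncM nc_real.
have Pc (F : T -> R) A : (forall q, `|F q| <= A) -> poly_bounded (fun q (y : R) => F q).
  by move=> h; apply: (@pb_cst _ _ _ A) => q y.
have Ps : poly_bounded (fun q (y : R) => nc (sl (la q))).
  by apply: (Pc _ Sb) => q; rewrite ger0_norm ?nc_ge0// nsl.
have Ps2 : poly_bounded (fun q (y : R) => nc (sl (la q + hh q))).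
  by apply: (Pc _ Sb) => q; rewrite ger0_norm ?nc_ge0// nsl.
have Ph : poly_bounded (fun q (y : R) => hh q).
  by apply: (Pc _ 1) => q; have /andP[a b] := h1 q; rewrite ger0_norm.
have Pcst c : poly_bounded (fun (q : T) (y : R) => c : R) by apply: (Pc _ `|c|).
(* The y-derivative of [L] equals the derivative of [sl l * gauss (sl l * y + wl l)] along the path;
   [L'] is this common derivative, and [E1], [E2] bound the two second-order remainders. *)
pose L q y := v0 y * gauss (u q y).
pose L' q y := (sg - (pi *+ 2)%:C%C * sl (la q) * v0 y * u q y) * gauss (u q y).
pose E1 q y := nc (sl (la q + hh q)) * (nc (v0 y) * nc (v0 y) *
     (2 * pi ^+ 2 * ((2 * nc (u q y) + hh q * nc (v0 y)) * (2 * nc (u q y) + hh q * nc (v0 y))) + pi)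
      * (g0 q y + g1 q y)) + pi *+ 2 * nc sg * nc (u q y) * nc (v0 y) * g0 q y.
pose E2 q y := (nc (v0 y) + nc sg * hh q) * (nc (sl (la q)) * nc (sl (la q)) *
     (2 * pi ^+ 2 * ((2 * nc (u q y) + nc (sl (la q)) * hh q) * (2 * nc (u q y) + nc (sl (la q)) * hh q)) + pi)
      * (g0 q y + g2 q y)) + pi *+ 2 * nc sg * nc (sl (la q)) * nc (u q y) * g0 q y.
have R1 : rapid E1.
  apply: rapidD; last by apply: rapidM G0; do ?[apply: pbM|apply: pbD] => //; exact: Pcst.
  apply: rapidM => //; apply: rapidM (rapidD G0 G1).
  by do ?[apply: pbM|apply: pbD] => //; exact: Pcst.
have R2 : rapid E2.
  apply: rapidD; last by apply: rapidM G0; do ?[apply: pbM|apply: pbD] => //; exact: Pcst.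
  apply: rapidM; first by do ?[apply: pbM|apply: pbD] => //; exact: Pcst.
  apply: rapidM (rapidD G0 G2).
  by do ?[apply: pbM|apply: pbD] => //; exact: Pcst.
have nh q : nc (hh q)%:C%C = hh q.
  by have /andP[a b] := h1 q; rewrite nc_real ger0_norm.
have B1 q y : nc (sl (la q + hh q) * gauss (sl (la q + hh q) * y%:C%C + wl (la q + hh q))
    - sl (la q) * gauss (u q y) - (hh q)%:C%C * L' q y) <= hh q ^+ 2 * E1 q y.
  have uv : sl (la q + hh q) * y%:C%C + wl (la q + hh q) = u q y + (hh q)%:C%C * v0 y.
    by rewrite /u /v0 /sl /wl /sg !rmorphD; ring.
  have se : sl (la q + hh q) = sl (la q) + (hh q)%:C%C * sg.
    by rewrite /sl /sg !rmorphD; ring.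
  have := gauss_taylor (u q y) ((hh q)%:C%C * v0 y); rewrite -uv (ncM _ (v0 y)) nh => ht.
  set rem := gauss _ - _ + _ in ht.
  have -> : sl (la q + hh q) * gauss (sl (la q + hh q) * y%:C%C + wl (la q + hh q))
    - sl (la q) * gauss (u q y) - (hh q)%:C%C * L' q y = sl (la q + hh q) * rem -
    (hh q)%:C%C ^+ 2 * ((pi *+ 2)%:C%C * sg * u q y * v0 y * gauss (u q y)).
    rewrite /rem /L' [X in _ - _ * X]mulrC; move: (gauss (_ + _)) (gauss (u q y)) => a b.
    by rewrite se; ring.
  apply: le_trans (nc_sub _ _) _; rewrite /E1 [leRHS]mulrDr lerD//.
    rewrite (ncM _ rem) mulrCA ler_wpM2l ?nc_ge0//; apply: le_trans ht _.
    by rewrite le_eqVlt; apply/orP; left; apply/eqP; rewrite /g0 /g1; ring.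
  rewrite (ncM (_ ^+ 2)) ncX nh ler_wpM2l ?sqr_ge0// !(ncM _ (gauss _)) !(ncM _ (v0 y)) !(ncM _ (u q y)).
  by rewrite (ncM _ sg) nc_real ger0_norm ?(ltW (pi2_gt0 R)).
have B2 q y : nc (L q (y + hh q) - L q y - (hh q)%:C%C * L' q y) <= hh q ^+ 2 * E2 q y.
  have uv : u q (y + hh q) = u q y + sl (la q) * (hh q)%:C%C.
    by rewrite /u !rmorphD; ring.
  have ug : nc (gauss (u q (y + hh q))) = g2 q y.
    by rewrite uv /g2 /u addrA.
  have ve : v0 (y + hh q) = v0 y + sg * (hh q)%:C%C by rewrite /v0 rmorphD; ring.
  have := gauss_taylor (u q y) (sl (la q) * (hh q)%:C%C).
  rewrite -uv ug (ncM (sl (la q))) nh => ht.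
  set rem := gauss _ - _ + _ in ht.
  have -> : L q (y + hh q) - L q y - (hh q)%:C%C * L' q y = v0 (y + hh q) * rem -
    (hh q)%:C%C ^+ 2 * ((pi *+ 2)%:C%C * sg * sl (la q) * u q y * gauss (u q y)).
    rewrite /rem /L' /L; move: (gauss (u q (y + hh q))) (gauss (u q y)) => a b.
    by rewrite ve; ring.
  apply: le_trans (nc_sub _ _) _; rewrite /E2 [leRHS]mulrDr lerD//.
    rewrite (ncM _ rem) mulrCA ler_pM ?nc_ge0//.
      by rewrite ve; apply: le_trans (ncD _ _) _; rewrite (ncM sg) nh.
    apply: le_trans ht _.
    by rewrite le_eqVlt; apply/orP; left; apply/eqP; rewrite /g0; ring.
  rewrite (ncM (_ ^+ 2)) ncX nh ler_wpM2l ?sqr_ge0// !(ncM _ (gauss _)) !(ncM _ (u q y)) !(ncM _ (sl _)).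
  by rewrite (ncM _ sg) nc_real ger0_norm ?(ltW (pi2_gt0 R)).
have [A1 hA1] := R1 1; have [A2 hA2] := R2 1.
have RL : rapid (fun q y => nc (L q y)).
  by apply: rapid_le (rapidM Pv G0) => q y; rewrite /L ncM.
have RP1 : rapid (fun q y => nc (sl (la q) * gauss (u q y))).
  by apply: rapid_le (rapidM Ps G0) => q y; rewrite ncM.
have RP2 : rapid (fun q y => nc (sl (la q + hh q) * gauss (sl (la q + hh q) * y%:C%C + wl (la q + hh q)))).
  by apply: rapid_le (rapidM Ps2 G1) => q y; rewrite ncM.
have [A3 hA3] := RL 1; have [A4 hA4] := RP1 1; have [A5 hA5] := RP2 1.
exists ((A1 + A2) * 4) => N N0.
have NR : 0 < N%:R :> R by rewrite ltr0n.
have step (j : nat) : (j < N)%N ->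
    nc (riemann N (sl (j.+1%:R / N%:R)) (wl (j.+1%:R / N%:R)) -
        riemann N (sl (j%:R / N%:R)) (wl (j%:R / N%:R))) <= (A1 + A2) * 4 / N%:R ^+ 2.
  move=> jN.
  have qok : [&& 0 <= (j%:R / N%:R : R, N%:R^-1 : R).1, 0 <= (j%:R / N%:R : R, N%:R^-1 : R).2 &
      (j%:R / N%:R : R, N%:R^-1 : R).1 + (j%:R / N%:R : R, N%:R^-1 : R).2 <= 1].
    rewrite /= divr_ge0// invr_ge0 ler0n/= -{2}[N%:R^-1]mul1r -mulrDl ler_pdivrMr// mul1r.
    by rewrite natr1 ler_nat.
  pose q : T := @exist (R * R) (fun q => is_true [&& 0 <= q.1, 0 <= q.2 & q.1 + q.2 <= 1])
    (j%:R / N%:R, N%:R^-1) qok.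
  have lq : la q = j%:R / N%:R by []. have hq : hh q = N%:R^-1 by [].
  have lhq : j.+1%:R / N%:R = la q + hh q by rewrite lq hq -natr1 mulrDl mul1r.
  rewrite lhq -lq /riemann -mulrBr (ncM N%:R^-1) ncV nc_nat.
  have e1 c : - (1 * c) = - c :> R by rewrite mul1r.
  have as2 : asum (fun k => sl (la q + hh q) * gauss (sl (la q + hh q) * (node N k)%:C%C + wl (la q + hh q))).
    apply: (@node_asum N (fun y => sl (la q + hh q) * gauss (sl (la q + hh q) * y%:C%C + wl (la q + hh q))) A5) => // y.
    by have := hA5 q y; rewrite ger0_norm ?nc_ge0// mul1r.
  have as1 : asum (fun k => sl (la q) * gauss (u q (node N k))).
    apply: (@node_asum N (fun y => sl (la q) * gauss (u q y)) A4) => // y.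
    by have := hA4 q y; rewrite ger0_norm ?nc_ge0// mul1r.
  have asL : asum (fun k => L q (node N k)).
    apply: (@node_asum N (L q) A3) => // y.
    by have := hA3 q y; rewrite ger0_norm ?nc_ge0// mul1r.
  have asL1 : asum (fun k => L q (node N k + N%:R^-1)).
    apply: asum_ext (asum_inj (i := fun k : int => k + 1) _ asL); last exact: addIr.
    by move=> n; rewrite /node intrD mulrDl mul1r.
  (* The increments of [L] from node to node add up to 0 by [node_shift]. Subtracting them leaves
     the total unchanged and cancels the first-order part of the step, so that [Z] is of size
     N^-2. *)
  pose Z y := sl (la q + hh q) * gauss (sl (la q + hh q) * y%:C%C + wl (la q + hh q))
     + (-1) * (sl (la q) * gauss (u q y)) + (-1) * (L q (y + N%:R^-1) + (-1) * L q y).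
  have -> : tot (fun k => sl (la q + hh q) * gauss (sl (la q + hh q) * (node N k)%:C%C + wl (la q + hh q)))
      - tot (fun k => sl (la q) * gauss (sl (la q) * (node N k)%:C%C + wl (la q)))
      = tot (fun k => Z (node N k)).
    rewrite (totD (asumD as2 (asumZ (-1) as1)) (asumZ (-1) (asumD asL1 (asumZ (-1) asL)))).
    rewrite (totD as2 (asumZ (-1) as1)) (totZ _ as1) (totZ (-1) (asumD asL1 (asumZ (-1) asL))).
    by rewrite (totD asL1 (asumZ (-1) asL)) (totZ _ asL) (node_shift N0 asL); ring.
  have bZ y : nc (Z y) <= (N%:R^-1 ^+ 2 * (A1 + A2)) * expR (- `|y|).
    have -> : Z y = (sl (la q + hh q) * gauss (sl (la q + hh q) * y%:C%C + wl (la q + hh q))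
      - sl (la q) * gauss (u q y) - (hh q)%:C%C * L' q y) -
      (L q (y + hh q) - L q y - (hh q)%:C%C * L' q y) by rewrite /Z -hq; ring.
    apply: le_trans (nc_sub _ _) _; apply: le_trans (lerD (B1 q y) (B2 q y)) _.
    rewrite hq -mulrDr -mulrA ler_wpM2l ?sqr_ge0// mulrDl.
    have := hA1 q y; have := hA2 q y; rewrite !mul1r => b1 b2.
    by rewrite lerD// (le_trans (ler_norm _)).
  apply: le_trans (ler_wpM2l _ (node_tot N0 bZ)) _; first by rewrite invr_ge0.
  by rewrite le_eqVlt; apply/orP; left; apply/eqP; field; rewrite lt0r_neq0.
have tele n : (n <= N)%N -> nc (riemann N (sl (n%:R / N%:R)) (wl (n%:R / N%:R)) - riemann N 1 0)
    <= n%:R * ((A1 + A2) * 4 / N%:R ^+ 2).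
  elim: n => [_|n IH nN].
    by rewrite !mul0r /sl /wl !rmorph0 !mul0r addr0 subrr nc0.
  apply: le_trans (nc_tri (riemann N (sl (n%:R / N%:R)) (wl (n%:R / N%:R))) _ _) _.
  have -> : n.+1%:R * ((A1 + A2) * 4 / N%:R ^+ 2) = (A1 + A2) * 4 / N%:R ^+ 2 + n%:R * ((A1 + A2) * 4 / N%:R ^+ 2).
    by rewrite -natr1 mulrDl mul1r addrC.
  by apply: lerD; [exact: step|exact: IH (ltnW nN)].
have := tele N (leqnn N); rewrite divff ?lt0r_neq0//.
rewrite /sl /wl rmorph1 !mul1r [1 + (s - 1)]addrC subrK.
move=> /le_trans; apply; rewrite le_eqVlt; apply/orP; left; apply/eqP.
by field; rewrite lt0r_neq0.
Qed.

End Gauss.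

(** * Poisson summation for Gaussians *)

Section Poisson.
#[local] Opaque e cexp gauss.
Variable R : realType.
Local Notation C := R[i].
Local Notation nc := (@ComplexField.Normc.normc R).
Local Notation tot := (@tot R _).
Local Notation gauss := (@gauss R).
Local Notation node := (@node R).

Lemma sum_root_unity_int h (k : int) : (0 < h)%N ->
  \sum_(r < h) e (k%:~R / h%:R * (r : nat)%:R : C) = if (h%:Z %| k)%Z then h%:R else 0.
Proof.
move=> h0; have hZ : h%:Z != 0 by rewrite eqz_nat -lt0n.
have hC : h%:R != 0 :> C by rewrite pnatr_eq0 -lt0n.
have [n hn] : exists n : nat, (k %% h%:Z)%Z = n%:Z.
  by exists `|(k %% h%:Z)%Z|%N; rewrite gez0_abs// modz_ge0.
have kE : k = (k %/ h%:Z)%Z * h%:Z + n%:Z by rewrite {1}(divz_eq k h%:Z) hn.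
have -> : (h%:Z %| k)%Z = (h %| n)%N.
  by rewrite kE rpredDl ?dvdz_mull// /dvdz.
rewrite -(@sum_root_unity R h n h0); apply: eq_bigr => r _.
have -> : k%:~R / h%:R * (r : nat)%:R = ((k %/ h%:Z)%Z * r%:Z)%:~R + n%:R / h%:R * (r : nat)%:R :> C.
  by rewrite {1}kE intrD !intrM; field.
by rewrite eD e_int mul1r.
Qed.

(** A crude Jordan inequality, sin y >= y / 8 on [0, pi / 2]: up to 1/2 from |sin y - y| <= y^2,
    beyond by monotonicity and pi / 2 < 2. *)
Lemma sin_lower (y : R) : `|y| <= pi / 2 -> y ^+ 2 / 64 <= sin y ^+ 2.
Proof.
move=> hy; have p4 := pihalf_lt2 R.
wlog y0 : y hy / 0 <= y.
  move=> h; have [/h->//|/ltW y0] := leP 0 y.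
  by have := h (- y); rewrite sinN !sqrrN normrN oppr_ge0; apply.
rewrite (ger0_norm y0) in hy.
have sb : y / 8 <= sin y.
  have b1 (z : R) : 0 <= z -> z <= 2^-1 -> z / 2 <= sin z.
    move=> z0 z1; have := sin_subx z; rewrite ler_norml => /andP[h _]; nra.
  have [y1|y1] := leP y 2^-1; first by apply: le_trans (b1 y y0 y1); lra.
  apply: le_trans (_ : 2^-1 / 2 <= _); first lra.
  apply: le_trans (b1 2^-1 _ _) _; rewrite ?invr_ge0//.
  by rewrite ltW// ltr_sin// in_itv/=; apply/andP; split; lra.
rewrite (_ : y ^+ 2 / 64 = (y / 8) ^+ 2); last by field.
by rewrite lerXn2r ?nnegrE ?divr_ge0// (le_trans _ sb)// divr_ge0.
Qed.

(** The first-order Taylor terms for the steps [s * h] and [- (s * h)] cancel. The factor [h ^+ 2]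
    becomes the quadratic decay of the Fourier coefficients in [dft_bound]. *)
Lemma gauss_diff2 s x : sector s -> exists2 A, 0 <= A & forall h y : R, 0 <= h <= 1 ->
  nc (gauss (s * (y + h)%:C%C + s * x%:C%C) + gauss (s * (y - h)%:C%C + s * x%:C%C)
      - 2 * gauss (s * y%:C%C + s * x%:C%C)) <= h ^+ 2 * A * expR (- `|y|).
Proof.
move=> ss; have [k k0 hk] := sector_path ss.
have ks : k <= complex.Re (s ^+ 2) by have := hk 1; rewrite ler01 lexx rmorph1 mul1r addrC subrK; apply.
pose T := {h : R | 0 <= h <= 1}.
have hP (q : T) : 0 <= sval q <= 1 by case: q.
have nh (q : T) : nc (sval q)%:C%C = sval q by rewrite nc_real ger0_norm//; case/andP: (hP q).
pose u (y : R) : C := s * y%:C%C + s * x%:C%C.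
pose W := nc s * `|x| + nc s.
have W0 : 0 <= W by rewrite addr_ge0 ?mulr_ge0 ?nc_ge0.
pose g0 (q : T) y := nc (gauss (s * y%:C%C + s * x%:C%C)).
pose g1 (q : T) y := nc (gauss (s * y%:C%C + (s * x%:C%C + s * (sval q)%:C%C))).
pose g2 (q : T) y := nc (gauss (s * y%:C%C + (s * x%:C%C - s * (sval q)%:C%C))).
have nsx : nc (s * x%:C%C) = nc s * `|x| by rewrite ncM nc_real.
have nsh (q : T) : nc (s * (sval q)%:C%C) <= nc s.
  by rewrite ncM nh ler_piMr ?nc_ge0//; case/andP: (hP q).
have G0 : rapid g0.
  apply: (@gauss_rapid R T (fun=> s) (fun=> s * x%:C%C) k (nc s) W) => // [|q]; first exact: nc_ge0.
  by rewrite nsx lerDl nc_ge0.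
have G1 : rapid g1.
  apply: (@gauss_rapid R T (fun=> s) (fun q => s * x%:C%C + s * (sval q)%:C%C) k (nc s) W) => // [|q]; first exact: nc_ge0.
  by apply: le_trans (ncD _ _) _; rewrite nsx lerD.
have G2 : rapid g2.
  apply: (@gauss_rapid R T (fun=> s) (fun q => s * x%:C%C - s * (sval q)%:C%C) k (nc s) W) => // [|q]; first exact: nc_ge0.
  by apply: le_trans (nc_sub _ _) _; rewrite nsx lerD.
have Pu : poly_bounded (fun (q : T) y => nc (u y)).
  apply: (@pb_lin _ _ _ (nc s) (nc s * `|x|)); rewrite ?mulr_ge0 ?nc_ge0//.
  by move=> q y; rewrite ger0_norm ?nc_ge0//; apply: le_trans (ncD _ _) _; rewrite !ncM !nc_real.
have Pcst c : poly_bounded (fun (q : T) (y : R) => c : R) by apply: (@pb_cst _ _ _ `|c|).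
have Ph : poly_bounded (fun (q : T) (y : R) => sval q).
  by apply: (@pb_cst _ _ _ 1) => q y; have /andP[a b] := hP q; rewrite ger0_norm.
pose E q y := (nc s * nc s * (2 * pi ^+ 2 * ((2 * nc (u y) + nc s * sval q) * (2 * nc (u y) + nc s * sval q)) + pi)) *
   (g0 q y + g1 q y + (g0 q y + g2 q y)).
have RE : rapid E.
  apply: rapidM; last by apply: rapidD; apply: rapidD.
  by do ?[apply: pbM|apply: pbD] => //; exact: Pcst.
have [A hA] := RE 1; have A0 : 0 <= A.
  have h01 : 0 <= (0 : R) <= 1 by rewrite lexx ler01.
  have := hA (exist (fun h : R => is_true (0 <= h <= 1)) 0 h01) 0.
  by move=> /(le_trans (normr_ge0 _)); rewrite pmulr_lge0 ?expR_gt0.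
exists A => // h y hh; pose q : T := exist (fun h : R => is_true (0 <= h <= 1)) h hh.
have := gauss_taylor (u y) (s * h%:C%C); have := gauss_taylor (u y) (- (s * h%:C%C)).
have -> : u y - s * h%:C%C = s * (y - h)%:C%C + s * x%:C%C by rewrite /u rmorphB; ring.
have -> : u y + s * h%:C%C = s * (y + h)%:C%C + s * x%:C%C by rewrite /u rmorphD; ring.
have g1E : nc (gauss (s * (y + h)%:C%C + s * x%:C%C)) = g1 q y.
  by rewrite /g1 /=; congr (nc (gauss _)); rewrite rmorphD; ring.
have g2E : nc (gauss (s * (y - h)%:C%C + s * x%:C%C)) = g2 q y.
  by rewrite /g2 /=; congr (nc (gauss _)); rewrite rmorphB; ring.
rewrite g1E g2E ncN (ncM s) (nh q).
set r2 := gauss _ - _ + _ => h2; set r1 := gauss _ - _ + _ => h1.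
have -> : gauss (s * (y + h)%:C%C + s * x%:C%C) + gauss (s * (y - h)%:C%C + s * x%:C%C)
      - 2 * gauss (s * y%:C%C + s * x%:C%C) = r1 + r2.
  by rewrite /r1 /r2 -/(u y); move: (gauss (u y)) (gauss _) (gauss _) => a b c; ring.
apply: le_trans (ncD _ _) _; apply: le_trans (lerD h1 h2) _.
have := hA q y; rewrite mul1r => /(le_trans (ler_norm _)) hE.
apply: (@le_trans _ _ (h ^+ 2 * E q y)); last by rewrite -mulrA ler_wpM2l ?sqr_ge0.
by rewrite le_eqVlt; apply/orP; left; apply/eqP; rewrite /E /g0 /= -/(u y); ring.
Qed.

(** Riemann sum of mesh 1 / N for the integral of e (c y) gauss (s (y + x)) over y. *)
Definition dft (s : C) (x : R) N (c : R) : C :=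
  N%:R^-1 * tot (fun k => e (c * node N k)%:C%C * gauss (s * (node N k)%:C%C + s * x%:C%C)).

Lemma nc_ereal (c : R) : nc (e c%:C%C) = 1.
Proof. by rewrite nc_e /= mulr0 oppr0 expR0. Qed.

Lemma gauss_shift_decay s x (c : R) : sector s -> exists A, forall y,
  nc (gauss (s * y%:C%C + s * x%:C%C)) <= A * expR (- (c * `|y|)).
Proof.
move=> ss; have [k k0 hk] := sector_path ss.
have ks : k <= complex.Re (s ^+ 2) by have := hk 1; rewrite ler01 lexx rmorph1 mul1r addrC subrK; apply.
have [A hA] := gauss_decay c k0 (nc_ge0 s) (nc_ge0 (s * x%:C%C)).
by exists A => y; apply: hA.
Qed.

(** Two summations by parts: moving the nodes by one step multiplies the sum [S] by e (c h) or its
    inverse, h = 1 / N, so the sum against the second difference of the Gaussian is [S] times e (- c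
    h) + e (c h) - 2. This factor is - 4 sin^2 (pi c h), of modulus at least (c h)^2 / 4 for |c| <=
    N / 2. The bound is therefore uniform in N. *)
Lemma dft_bound s x : sector s -> exists B, forall N (c : R), (0 < N)%N ->
  `|c| <= N%:R / 2 -> c ^+ 2 * nc (dft s x N c) <= B /\ nc (dft s x N c) <= B.
Proof.
move=> ss; have [A A0 hA] := gauss_diff2 x ss.
have [A1 hA1] := gauss_shift_decay x 1 ss.
have A10 : 0 <= A1.
  by have := le_trans (nc_ge0 _) (hA1 0); rewrite pmulr_lge0 ?expR_gt0.
exists (16 * A + 4 * A1) => N c N0 hc; have NR : 0 < N%:R :> R by rewrite ltr0n.
have NR0 := lt0r_neq0 NR.
pose f (y : R) := gauss (s * y%:C%C + s * x%:C%C).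
pose h : R := N%:R^-1; have h0 : 0 < h by rewrite invr_gt0.
have h1 : 0 <= h <= 1 by rewrite ltW//= invf_le1// ler1n.
have fA y : nc (f y) <= A1 * expR (- `|y|) by have := hA1 y; rewrite mul1r.
have fcA (p : R -> R) y : nc (e (p y)%:C%C * f y) <= A1 * expR (- `|y|) by rewrite ncM nc_ereal mul1r.
have as1 : asum (fun k => e (c * node N k)%:C%C * f (node N k)).
  by apply: (@node_asum R N (fun y => e (c * y)%:C%C * f y) A1) => // y; exact: (fcA (fun y => c * y)).
set S := tot (fun k => e (c * node N k)%:C%C * f (node N k)).
have dS : dft s x N c = N%:R^-1 * S by [].
have nS : nc S <= A1 * (4 * N%:R).
  by apply: (@node_tot R N (fun y => e (c * y)%:C%C * f y) A1) => // y; exact: (fcA (fun y => c * y)).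
split; last first.
  rewrite dS ncM ncV nc_nat; apply: le_trans (ler_wpM2l (ltW h0) nS) _.
  have -> : N%:R^-1 * (A1 * (4 * N%:R)) = 4 * A1 by field.
  lra.
have as2 : asum (fun k => e (c * node N k)%:C%C * f (node N k + h)).
  have := asum_inj (i := fun k : int => k + 1) (@addIr _ 1) as1.
  move=> /(asumZ (e (- (c * h))%:C%C)); apply: asum_ext => k.
  rewrite mulrA -eD -rmorphD; have -> : node N (k + 1) = node N k + h.
    by rewrite !nodeE intrD mulrDl mul1r.
  by congr (e _%:C%C * _); ring.
have as3 : asum (fun k => e (c * node N k)%:C%C * f (node N k - h)).
  have := asum_inj (i := fun k : int => k - 1) (@addIr _ (-1)) as1.
  move=> /(asumZ (e (c * h)%:C%C)); apply: asum_ext => k.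
  rewrite mulrA -eD -rmorphD; have -> : node N (k - 1) = node N k - h.
    by rewrite !nodeE intrB mulrBl mul1r.
  by congr (e _%:C%C * _); ring.
have t2 : tot (fun k => e (c * node N k)%:C%C * f (node N k + h)) = e (- (c * h))%:C%C * S.
  rewrite -totZ// -(@tot_bij _ _ _ (fun k : int => k + 1) (fun k => k - 1) (fun k => e (- (c * h))%:C%C * _)).
  - apply: tot_ext => k; have -> : node N (k + 1) = node N k + h.
      by rewrite !nodeE intrD mulrDl mul1r.
    by rewrite mulrA -eD -rmorphD; congr (e _%:C%C * _); ring.
  - by move=> k; rewrite addrK.
  - by move=> k; rewrite subrK.
  - exact: asumZ.
have t3 : tot (fun k => e (c * node N k)%:C%C * f (node N k - h)) = e (c * h)%:C%C * S.
  rewrite -totZ// -(@tot_bij _ _ _ (fun k : int => k - 1) (fun k => k + 1) (fun k => e (c * h)%:C%C * _)).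
  - apply: tot_ext => k; have -> : node N (k - 1) = node N k - h.
      by rewrite !nodeE intrB mulrBl mul1r.
    by rewrite mulrA -eD -rmorphD; congr (e _%:C%C * _); ring.
  - by move=> k; rewrite subrK.
  - by move=> k; rewrite addrK.
  - exact: asumZ.
have t4 : (e (- (c * h))%:C%C + e (c * h)%:C%C - 2) * S =
    tot (fun k => e (c * node N k)%:C%C * (f (node N k + h) + f (node N k - h) - 2 * f (node N k))).
  have -> : (e (- (c * h))%:C%C + e (c * h)%:C%C - 2) * S = e (- (c * h))%:C%C * S + e (c * h)%:C%C * S + (-2) * S by ring.
  rewrite -t2 -t3 -(totD as2 as3) -(totZ (-2) as1) -(totD (asumD as2 as3) (asumZ (-2) as1)).
  by apply: tot_ext => k; ring.
have n4 : nc ((e (- (c * h))%:C%C + e (c * h)%:C%C - 2) * S) <= (h ^+ 2 * A) * (4 * N%:R).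
  rewrite t4; apply: (@node_tot R N (fun y => e (c * y)%:C%C * (f (y + h) + f (y - h) - 2 * f y))) => // y.
  by rewrite ncM nc_ereal mul1r hA.
have lb : (c * h) ^+ 2 / 4 <= nc (e (- (c * h))%:C%C + e (c * h)%:C%C - 2).
  rewrite !e_real mulrN cosN sinN.
  have -> : (cos (pi *+ 2 * (c * h)) -i* sin (pi *+ 2 * (c * h)))%C + (cos (pi *+ 2 * (c * h)) +i* sin (pi *+ 2 * (c * h)))%C - 2
     = (- (2 * (1 - cos (pi *+ 2 * (c * h)))))%:C%C :> C.
    by apply/eqP; rewrite eq_complex/=; apply/andP; split; apply/eqP; ring.
  rewrite nc_real normrN; apply: le_trans (ler_norm _); rewrite cos_eq.
  have -> : pi *+ 2 * (c * h) / 2 = pi * (c * h) by rewrite -[pi *+ 2]mulr_natr; field.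
  have p2 := pi_ge2 R; have p0 := pi_gt0 R.
  have := @sin_lower (pi * (c * h)); rewrite normrM (ger0_norm (ltW p0)) ler_wpM2l ?(ltW p0)//; last first.
    by rewrite normrM (gtr0_norm h0) ler_pdivrMr// mulrC.
  move=> /(_ isT); rewrite exprMn => hs.
  have : 4 <= pi ^+ 2 :> R by rewrite expr2; nra.
  move=> /(ler_wpM2r (sqr_ge0 (c * h))) h3; lra.
have := le_trans (ler_wpM2r (nc_ge0 S) lb); rewrite -ncM => /(_ _ n4) h5.
rewrite dS ncM ncV nc_nat -/h.
have h6 : c ^+ 2 * (h * nc S) = ((c * h) ^+ 2 / 4 * nc S) * (4 * N%:R).
  by rewrite /h; field.
rewrite h6; apply: le_trans (ler_wpM2r _ h5) _; first by rewrite mulr_ge0// ltW.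
have -> : h ^+ 2 * A * (4 * N%:R) * (4 * N%:R) = 16 * A by rewrite /h; field.
lra.
Qed.

Lemma twopii_real (c y : R) : twopii R * (c * y)%:C%C = 2 * 'i%C * pi%:C%C * c%:C%C * y%:C%C.
Proof. by rewrite twopiiE !rmorphM rmorphMn; ring. Qed.

(** The Fourier integral approximated by [dft], once the Gaussian integral is known to be 1. *)
Definition dual (s : C) (x c : R) : C := s^-1 * (e (- (c * x))%:C%C * gauss (c%:C%C / s)).

Lemma sector_neq0 (s : C) : sector s -> s != 0.
Proof. by rewrite /sector; apply: contraTneq => ->; rewrite /= normr0 ltxx. Qed.

(** Completing the square trades the oscillating factor for a shift of the line of integration,
    which [riemann_path] shows to be immaterial in the limit. *)
Lemma dft_eval s x N c : (0 < N)%N -> sector s -> dft s x N c = dual s x c * riemann N s (s * x%:C%C - 'i%C * c%:C%C / s).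
Proof.
move=> N0 ss; have s0 := sector_neq0 ss; rewrite /dft /dual /riemann [RHS]mulrCA; congr (_ * _).
set w := s * _ - _.
have E k : e (c * node N k)%:C%C * gauss (s * (node N k)%:C%C + s * x%:C%C) =
   s^-1 * (e (- (c * x))%:C%C * gauss (c%:C%C / s)) * (s * gauss (s * (node N k)%:C%C + w)).
  have -> : s^-1 * (e (- (c * x))%:C%C * gauss (c%:C%C / s)) * (s * gauss (s * (node N k)%:C%C + w)) =
      e (- (c * x))%:C%C * gauss (c%:C%C / s) * gauss (s * (node N k)%:C%C + w).
    by move: (e _) (gauss _) (gauss _) => a b d; field.
  have xN : (- x)%:C%C = - x%:C%C :> C by rewrite rmorphN.
  rewrite !eE -mulrN !twopii_real xN !gaussE -!cexpD; congr cexp; rewrite /w.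
  have := sqr_i R; move: ('i%C : C) (pi%:C%C : C) (node N k)%:C%C c%:C%C x%:C%C => I p y cc xx I2.
  apply/eqP; rewrite -subr_eq0.
  have -> : 2 * I * p * cc * y + - (p * (s * y + s * xx) ^+ 2) -
    (2 * I * p * cc * - xx + - (p * (cc / s) ^+ 2) + - (p * (s * y + (s * xx - I * cc / s)) ^+ 2))
    = (p * cc ^+ 2 / s ^+ 2) * (I ^+ 2 + 1) by field.
  by rewrite I2 addNr mulr0.
rewrite -(@tot_ext _ _ _ _ (fun k => esym (E k))).
have [A hA] : exists A, forall y, nc (gauss (s * y%:C%C + w)) <= A * expR (- (1 * `|y|)).
  have [k k0 hk] := sector_path ss.
  have ks : k <= complex.Re (s ^+ 2) by have := hk 1; rewrite ler01 lexx rmorph1 mul1r addrC subrK; apply.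
  have [A hA] := gauss_decay 1 k0 (nc_ge0 s) (nc_ge0 w).
  by exists A => y; apply: hA.
have as1 : asum (fun k => s * gauss (s * (node N k)%:C%C + w)).
  apply: (@node_asum R N (fun y => s * gauss (s * y%:C%C + w)) (nc s * A)) => // y.
  by rewrite ncM -mulrA ler_wpM2l ?nc_ge0//; have := hA y; rewrite mul1r.
exact: (totZ _ as1).
Qed.

(** An exact identity before any limit: summed over N = 2 n + 1 consecutive frequencies, the roots
    of unity cancel unless N divides the index k, so only the integers survive among the nodes k /
    N. *)
Lemma poisson_finite s x (b : R) n : sector s ->
  tot (fun m : int => e (b * m%:~R)%:C%C * gauss (s * (m%:~R : R)%:C%C + s * x%:C%C)) =
  \sum_(j < n.*2.+1) dft s x n.*2.+1 (j%:R - n%:R + b).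
Proof.
move=> ss; set N := n.*2.+1; have N0 : (0 < N)%N by [].
have NR : N%:R != 0 :> R by rewrite pnatr_eq0.
have NC : N%:R != 0 :> C by rewrite pnatr_eq0.
pose f (y : R) := gauss (s * y%:C%C + s * x%:C%C).
have [A hA] := gauss_shift_decay x 1 ss.
have asc (p : R -> R) : asum (fun k => e (p (node N k))%:C%C * f (node N k)).
  apply: (@node_asum R N (fun y => e (p y)%:C%C * f y) A) => // y.
  by rewrite ncM nc_ereal mul1r; have := hA y; rewrite mul1r.
rewrite /dft -mulr_sumr.
have H : hassum (fun k => \sum_(j < N) e ((j%:R - n%:R + b) * node N k)%:C%C * f (node N k))
   (\sum_(j < N) tot (fun k => e ((j%:R - n%:R + b) * node N k)%:C%C * f (node N k))).
  by apply: hassum_sum => j; apply: asum_tot; exact: (asc (fun y => (j%:R - n%:R + b) * y)).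
rewrite -(tot_eq H).
have E k : \sum_(j < N) e ((j%:R - n%:R + b) * node N k)%:C%C * f (node N k) =
    N%:R * (if (N%:Z %| k)%Z then e (b * node N k)%:C%C * f (node N k) else 0).
  rewrite -mulr_suml.
  have -> : \sum_(j < N) e ((j%:R - n%:R + b) * node N k)%:C%C =
     e ((b - n%:R) * node N k)%:C%C * (if (N%:Z %| k)%Z then N%:R else 0).
    rewrite -(sum_root_unity_int k N0) mulr_sumr; apply: eq_bigr => j _.
    rewrite -eD; congr e; rewrite nodeE !rmorphM rmorphD !rmorphB fmorphV !rmorph_nat rmorph_int; ring.
  case: ifP => [/dvdzP[m ->]|_]; last by rewrite mulr0 mul0r mulr0.
  have -> : e ((b - n%:R) * node N (m * N%:Z))%:C%C = e (b * node N (m * N%:Z))%:C%C.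
    have -> : node N (m * N%:Z) = m%:~R by rewrite nodeE intrM mulfK.
    rewrite mulrBl rmorphB eD.
    have -> : - (n%:R * m%:~R)%:C%C = (- (n%:Z * m))%:~R :> C.
      by rewrite intrN intrM rmorphM rmorph_nat rmorph_int.
    by rewrite e_int mulr1.
  move: (e _) (f _) => a c; ring.
rewrite -(@tot_ext _ _ _ _ (fun k => esym (E k))) totZ; last by apply: asum_if; exact: (asc (fun y => b * y)).
rewrite mulKf//.
rewrite -(@tot_inj _ _ _ (fun m : int => m * N%:Z) _ (fun k => if (N%:Z %| k)%Z then _ else 0)).
- apply: tot_ext => m; rewrite dvdz_mull//; have -> : node N (m * N%:Z) = m%:~R by rewrite nodeE intrM mulfK.
  by [].
- by apply: mulIf.
- by apply: asum_if; exact: (asc (fun y => b * y)).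
- by move=> k; case: ifP => [/dvdzP[m ->] _|_ /eqP//]; exists m.
Qed.

Lemma gauss_real (y : R) : gauss y%:C%C = (expR (- (pi * y ^+ 2)))%:C%C.
Proof. by rewrite gaussE -rmorphXn -rmorphM -rmorphN cexp_real. Qed.

(** A majorant of quadratic decay whose sums over each half-line telescope. *)
Definition weight (r : int) : R := ((`|r|%N.+1)%:R * (`|r|%N.+2)%:R)^-1.

Lemma weight_rsum : rsum weight.
Proof.
have S1 s : uniq s -> \sum_(n <- s) ((n.+1)%:R * (n.+2)%:R)^-1 <= 1 :> R.
  move=> us; apply: le_trans (_ : \sum_(0 <= i < (foldr maxn 0%N s).+1) ((i.+1)%:R * (i.+2)%:R)^-1 <= _).
    apply: ler_sum_sub => [x| |x]; [by rewrite invr_ge0 mulr_ge0|exact: us|].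
    rewrite mem_index_iota/= ltnS; elim: s {us} => //= y s IH.
    rewrite inE => /predU1P[->|/IH h']; first exact: leq_maxl.
    exact: leq_trans h' (leq_maxr _ _).
  set N := (foldr _ _ _).+1.
  suff -> : \sum_(0 <= i < N) ((i.+1)%:R * (i.+2)%:R)^-1 = 1 - (N.+1)%:R^-1 :> R.
    by rewrite gerBl invr_ge0.
  elim: N => [|N IH]; first by rewrite big_geq// invr1 subrr.
  rewrite big_nat_recr//= IH; have h1 : N.+1%:R != 0 :> R by rewrite pnatr_eq0.
  have h2 : N.+2%:R != 0 :> R by rewrite pnatr_eq0.
  have e2 : N.+2%:R = N.+1%:R + 1 :> R by rewrite natr1.
  rewrite e2 in h2 *; move: (N.+1%:R) h1 h2 => u h1 h2; field; by rewrite h1 h2.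
exists (1 + 1); apply: sum_int_le => s us; first exact: S1.
apply: le_trans (S1 s us); apply: ler_sum => n _; rewrite /weight /=.
rewrite lef_pV2 ?posrE ?mulr_gt0 ?ltr0n//; rewrite -!natrM ler_nat; nia.
Qed.

Lemma dual_bound s x b : sector s^-1 -> exists A, forall r : int,
  nc (dual s x (r%:~R + b)) <= A * weight r.
Proof.
move=> ss; have [A hA] := gauss_shift_decay b 2 ss.
have A0 : 0 <= A.
  by have := le_trans (nc_ge0 _) (hA 0); rewrite pmulr_lge0 ?expR_gt0.
exists (nc s^-1 * (2 * A)) => r; rewrite /dual ncM ncM nc_ereal mul1r -mulrA ler_wpM2l ?nc_ge0//.
have -> : (r%:~R + b)%:C%C / s = s^-1 * (r%:~R : R)%:C%C + s^-1 * b%:C%C.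
  by rewrite rmorphD; ring.
apply: le_trans (hA _) _; rewrite [2 * A]mulrC -mulrA ler_wpM2l//.
have -> : `|r%:~R| = `|r|%N%:R :> R by rewrite -intr_norm -abszE.
rewrite /weight; set n := `|r|%N.
have h : n.+1%:R <= expR (n%:R : R) by rewrite -natr1 addrC expR_ge1Dx.
rewrite expRN ler_pdivlMr ?mulr_gt0 ?ltr0n// ler_pdivrMl ?expR_gt0//.
rewrite (expRM_natl 2) expr2; have h2 : n.+2%:R <= 2 * n.+1%:R :> R by rewrite -natrM ler_nat; nia.
have h3 : 0 <= n.+1%:R :> R by [].
have := ler_pM h3 h3 h h; have := ler_wpM2l h3 h2.
move: (expR _) => E; lra.
Qed.

(** The term at 0 is 1 and all others are positive. This number is divided out to find the Gaussian
    integral. *)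
Lemma theta_pos : tot (fun m : int => gauss (m%:~R : R)%:C%C) != 0.
Proof.
have s1 : sector (1 : C) by rewrite /sector/= normr0 ltr01.
have [A hA] := gauss_shift_decay 0 1 s1.
have ag : asum (fun m : int => gauss (m%:~R : R)%:C%C).
  have := @node_asum R 1 (fun y => gauss y%:C%C) A isT.
  move=> /(_ _)/asum_ext; apply=> [m|y]; first by rewrite nodeE divr1.
  by have := hA y; rewrite rmorph0 mulr0 addr0 !mul1r.
apply/eqP => t0; have := asum_tot ag; rewrite t0 => /(_ (1 / 2) _)[|B hB]; first by rewrite divr_gt0.
have sB : {subset B <= undup (0 :: B)} by move=> m mB; rewrite mem_undup inE mB orbT.
have := hB _ (undup_uniq (0 :: B)) sB; apply/negP; rewrite -leNgt subr0.
rewrite (eq_bigr (fun m : int => (expR (- (pi * (m%:~R : R) ^+ 2)))%:C%C)) => [|m _]; last by rewrite gauss_real.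
rewrite -rmorph_sum nc_real; apply: le_trans (ler_norm _).
rewrite (bigD1_seq 0) ?undup_uniq ?mem_undup ?mem_head//= expr0n/= mulr0 oppr0 expR0.
apply: (@le_trans _ _ (1 + 0)); first lra.
by rewrite lerD2l sumr_ge0// => m _; exact: expR_ge0.
Qed.

(** [poisson_finite] is compared frequency by frequency with its limit and summed by [tannery]. The
    factor [riemann n.*2.+1 1 0] is kept, since its limit, the Gaussian integral, has not been
    determined yet. *)
Lemma poisson_pre s x b : sector s -> sector s^-1 -> `|b| <= 1 / 2 ->
  tends (fun n => tot (fun m : int => e (b * m%:~R)%:C%C * gauss (s * (m%:~R : R)%:C%C + s * x%:C%C))
    - riemann n.*2.+1 1 0 * tot (fun r : int => dual s x (r%:~R + b))) 0.
Proof.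
move=> ss ss' hb.
have [B hB] := dft_bound x ss; have [A hA] := dual_bound x b ss'.
have A0 : 0 <= A.
  by have := le_trans (nc_ge0 _) (hA 0); rewrite pmulr_lge0// /weight invr_gt0 mulr_gt0.
have s1 : sector (1 : C) by rewrite /sector/= normr0 ltr01.
have [K hK] := gauss_shift_decay 0 1 s1.
have K0 : 0 <= K by have := le_trans (nc_ge0 _) (hK 0); rewrite pmulr_lge0 ?expR_gt0.
have riem N : (0 < N)%N -> nc (riemann N 1 0) <= 4 * K.
  move=> N0; have NR : N%:R != 0 :> R by rewrite pnatr_eq0 -lt0n.
  rewrite /riemann ncM ncV nc_nat.
  have := @node_tot R N (fun y => 1 * gauss (1 * y%:C%C + 0)) K N0.
  move=> /(_ _)/(ler_wpM2l (_ : 0 <= N%:R^-1)) => H.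
  apply: le_trans (H _ _) _; first by rewrite invr_ge0.
    by move=> y; have := hK y; rewrite rmorph0 mulr0 !mul1r.
  have -> : N%:R^-1 * (K * (4 * N%:R)) = 4 * K by field.
  by [].
have B0 : 0 <= B.
  have [|_] := hB 1%N 0 isT _; first by rewrite normr0 divr_ge0.
  exact: le_trans (nc_ge0 _).
pose N n := n.*2.+1.
pose F n (r : int) := (if (`|r|%N <= n)%N then dft s x (N n) (r%:~R + b) else 0)
   + (- riemann (N n) 1 0) * dual s x (r%:~R + b).
have ad : asum (fun r : int => dual s x (r%:~R + b)).
  by apply: asum_le hA (rsumZ A0 weight_rsum).
have small n (r : int) : (`|r|%N <= n)%N -> `|r%:~R + b| <= (N n)%:R / 2.
  move=> rn; apply: le_trans (ler_normD _ _) _.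
  have -> : `|r%:~R| = `|r|%N%:R :> R by rewrite -intr_norm -abszE.
  have : `|r|%N%:R <= n%:R :> R by rewrite ler_nat.
  have : (N n)%:R = 2 * n%:R + 1 :> R by rewrite /N -natr1 -mul2n natrM.
  lra.
(* For r nonzero, |r + b| >= |r| / 2 and (|r| + 1) (|r| + 2) <= 6 r^2 = 24 (|r| / 2)^2, which is the
   origin of 24. *)
have FB n r : nc (F n r) <= (24 * B + 4 * K * A) * weight r.
  rewrite mulrDl; apply: le_trans (ncD _ _) _; apply: lerD; last first.
    by rewrite ncM ncN -[leRHS]mulrA; apply: ler_pM; rewrite ?nc_ge0 ?riem ?hA.
  have w0 : 0 <= weight r by rewrite /weight invr_ge0 mulr_ge0.
  case: ifP => rn; last by rewrite nc0 !mulr_ge0.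
  have [h1 h2] := hB (N n) (r%:~R + b) isT (small n r rn).
  have [rz|r0] := eqVneq r 0.
    apply: le_trans h2 _; rewrite rz /weight absz0 mul1r; lra.
  have n1 : 1 <= `|r|%N%:R :> R by rewrite ler1n absz_gt0.
  have cb : (`|r|%N%:R / 2) ^+ 2 <= (r%:~R + b) ^+ 2 :> R.
    rewrite -[leRHS]real_normK ?num_real// lerXn2r ?nnegrE ?divr_ge0//.
    have -> : `|r|%N%:R = `|r%:~R| :> R by rewrite -intr_norm -abszE.
    have : `|r%:~R| = `|r|%N%:R :> R by rewrite -intr_norm -abszE.
    have : `|r%:~R| <= `|r%:~R + b| + `|b| :> R by rewrite -{1}[r%:~R](addrK b) ler_normB.
    lra.
  rewrite /weight ler_pdivlMr ?mulr_gt0 ?ltr0n//.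
  have w6 : `|r|%N.+1%:R * `|r|%N.+2%:R <= 24 * (`|r|%N%:R / 2) ^+ 2 :> R.
    clear -n1; move: (`|r|%N) n1 => m n1.
    have -> : m.+2%:R = m%:R + 2 :> R by rewrite -!natr1; ring.
    rewrite -natr1; move: (m%:R) n1 => z z1; nra.
  have d0 := nc_ge0 (dft s x (N n) (r%:~R + b)).
  apply: le_trans (ler_wpM2l d0 w6) _; rewrite mulrCA ler_wpM2l//.
  by apply: le_trans (ler_wpM2l d0 cb) _; rewrite mulrC.
have Fr r : tends (F^~ r) 0.
  have [Q hQ] := riemann_path (s * x%:C%C - 'i%C * (r%:~R + b)%:C%C / s) ss.
  apply: (@tends_squeeze _ _ (fun n => nc (dual s x (r%:~R + b)) * `|Q| * n.+1%:R^-1)).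
    exists `|r|%N => n rn; rewrite /F rn dft_eval// mulNr [riemann _ 1 0 * _]mulrC -mulrBr ncM.
    rewrite -[leRHS]mulrA; apply: ler_wpM2l; first exact: nc_ge0.
    apply: le_trans (hQ (N n) isT) _.
    have N0 : 0 < (N n)%:R :> R by rewrite ltr0n.
    apply: (@le_trans _ _ (`|Q| / (N n)%:R)); first by rewrite ler_wpM2r ?invr_ge0 ?ler_norm// ltW.
    rewrite ler_wpM2l// lef_pV2 ?posrE ?ltr0n// ler_nat /N; lia.
  have := tendsZ (nc (dual s x (r%:~R + b)) * `|Q|)%:C%C (@tends_inv R); rewrite mulr0.
  by apply: tends_ext; exists 0%N => n _; rewrite [RHS]rmorphM fmorphV rmorph_nat.
have Fs n : tot (F n) = tot (fun m : int => e (b * m%:~R)%:C%C * gauss (s * (m%:~R : R)%:C%C + s * x%:C%C))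
    - riemann n.*2.+1 1 0 * tot (fun r : int => dual s x (r%:~R + b)).
  have fin : hassum (fun r : int => if (`|r|%N <= n)%N then dft s x (N n) (r%:~R + b) else 0)
      (\sum_(j < N n) dft s x (N n) (j%:R - n%:R + b)).
    pose S := [seq j%:Z - n%:Z | j <- index_iota 0 (N n)].
    have uS : uniq S by rewrite map_inj_uniq ?iota_uniq// => i j /addIr [].
    have := hassum_fin (fun r : int => dft s x (N n) (r%:~R + b)) uS.
    rewrite big_map big_mkord.
    rewrite (eq_bigr (fun j : 'I_(N n) => dft s x (N n) (j%:R - n%:R + b))) => [|j _]; last by rewrite intrB.
    apply: hassum_ext => r; congr (if _ then _ else _).
    apply/mapP/idP => [[j]|rn].
      by rewrite mem_index_iota /N => /= jN ->; lia.
    exists (absz ((r : int) + n%:Z)); rewrite ?mem_index_iota /N; lia.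
  rewrite (poisson_finite x b n ss) -mulNr; apply: tot_eq; apply: hassumD fin _.
  by apply: hassumZ; exact: asum_tot.
have := @tannery R _ F (fun=> 0) _ FB (rsumZ _ weight_rsum) Fr.
rewrite (tot_eq (@hassum0 R _)) => H; apply: tends_ext (H _); first by exists 0%N => n _; exact: Fs.
by rewrite addr_ge0 ?mulr_ge0.
Qed.

(** For s = 1 and x = b = 0 both sides of [poisson_pre] involve the same nonzero theta value, so the
    Riemann sums of the Gaussian tend to 1; inserting this limit gives the general case. *)
Lemma poisson s x b : sector s -> sector s^-1 -> `|b| <= 1 / 2 ->
  tot (fun m : int => e (b * m%:~R)%:C%C * gauss (s * (m%:~R : R)%:C%C + s * x%:C%C))
  = tot (fun r : int => dual s x (r%:~R + b)).
Proof.
move=> ss ss' hb; have s1 : sector (1 : C) by rewrite /sector/= normr0 ltr01.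
have s1' : sector (1^-1 : C) by rewrite invr1.
have lim1 : tends (fun n => riemann n.*2.+1 1 0 : C) 1.
  have := @poisson_pre 1 0 0 s1 s1'; rewrite normr0 => /(_ (divr_ge0 ler01 (ler0n _ 2))).
  set T1 := tot _; set T2 := tot _.
  have e1 : T1 = tot (fun m : int => gauss (m%:~R : R)%:C%C).
    by apply: tot_ext => m; rewrite mul0r rmorph0 e0 !mul1r addr0.
  have e2 : T2 = tot (fun m : int => gauss (m%:~R : R)%:C%C).
    by apply: tot_ext => m; rewrite /dual invr1 mulr0 oppr0 rmorph0 e0 !mul1r addr0 mulr1.
  rewrite e1 e2 => /(tendsZ (- (tot (fun m : int => gauss (m%:~R : R)%:C%C))^-1)).
  move=> /(tendsD (tends_cst 1)); rewrite mulr0 addr0; apply: tends_ext.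
  exists 0%N => n _; have := theta_pos; move: (tot _) (riemann _ _ _) => t r t0; by field.
have := tendsD (tends_cst (tot (fun m : int => e (b * m%:~R)%:C%C * gauss (s * (m%:~R : R)%:C%C + s * x%:C%C))))
   (tendsZ (-1) (tendsM lim1 (tends_cst (tot (fun r : int => dual s x (r%:~R + b)))))).
have := poisson_pre x ss ss' hb.
set L := tot _; set G := tot _ => h1; rewrite mul1r mulN1r => h2.
have h3 : tends (fun n => L - riemann n.*2.+1 1 0 * G) (L - G).
  by apply: tends_ext h2; exists 0%N => n _; rewrite mulN1r.
by apply/eqP; rewrite -subr_eq0; apply/eqP; apply: tends_uniq h3 h1.
Qed.

End Poisson.

Lemma twopiiE2 (R : realType) : twopii R = 2 * 'i%C * pi%:C%C.
Proof. by rewrite /twopii (rmorphMn (@real_complex R) 2 pi) -mulr_natl; ring. Qed.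

(** * Rewriting rules for the embedding of the reals *)

Section RealCasts.
Variable R : realType.
Implicit Types x y : R.

Lemma rcD x y : (x + y)%:C%C = x%:C%C + y%:C%C. Proof. exact: rmorphD. Qed.
Lemma rcB x y : (x - y)%:C%C = x%:C%C - y%:C%C. Proof. exact: rmorphB. Qed.
Lemma rcN x : (- x)%:C%C = - x%:C%C. Proof. exact: rmorphN. Qed.
Lemma rcM x y : (x * y)%:C%C = x%:C%C * y%:C%C. Proof. exact: rmorphM. Qed.
Lemma rcV x : (x^-1)%:C%C = (x%:C%C)^-1. Proof. exact: fmorphV. Qed.
Lemma rcX x n : (x ^+ n)%:C%C = x%:C%C ^+ n. Proof. exact: rmorphXn. Qed.
Lemma rcn n : (n%:R : R)%:C%C = n%:R. Proof. exact: rmorph_nat. Qed.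
Lemma rcz (n : int) : (n%:~R : R)%:C%C = n%:~R. Proof. exact: rmorph_int. Qed.
Lemma rc1 : (1 : R)%:C%C = 1. Proof. by []. Qed.

Definition rcE := (rcn, rcz, rcD, rcB, rcN, rcM, rcV, rcX).
End RealCasts.

(** * The inversion law of theta series with characteristics *)

Section ThetaLaw.
#[local] Opaque e cexp gauss.
Variable R : realType.
Local Notation C := R[i].
Local Notation nc := (@ComplexField.Normc.normc R).
Local Notation tot := (@tot R _).
Local Notation gauss := (@gauss R).
Local Notation sqrtc := (@sqrtc R).

Lemma upper_neq0 (t : C) : t \in @upper R -> t != 0.
Proof. by rewrite upperE; apply: contraTneq => ->; rewrite /= ltxx. Qed.

Lemma nc_gt_Re (z : C) : complex.Im z != 0 -> `|complex.Re z| < nc z.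
Proof.
case: z => a b /= b0; rewrite -sqrtr_sqr ltr_sqrt ?ltrDl ?exprn_even_gt0//.
by rewrite ltr_wpDl ?sqr_ge0// exprn_even_gt0.
Qed.

Lemma sqrtc_upper (t : C) : t \in @upper R ->
  0 < complex.Re (sqrtc t) /\ 0 < complex.Im (sqrtc t).
Proof.
rewrite upperE => t0; have := nc_gt_Re (lt0r_neq0 t0).
case: t t0 => a b /= b0; rewrite ltr_norml => /andP[h1 h2].
split; first by rewrite sqrtr_gt0 divr_gt0//; lra.
rewrite (gt_eqF b0) gtr0_sg// mul1r sqrtr_gt0 divr_gt0//; lra.
Qed.

Lemma sqrtc_uniq (t z : C) : t \in @upper R -> z ^+ 2 = t -> 0 < complex.Re z -> z = sqrtc t.
Proof.
move=> ut zt z0; have [s0 _] := sqrtc_upper ut.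
have : (z - sqrtc t) * (z + sqrtc t) = 0 by rewrite -subr_sqr zt sqr_sqrtc subrr.
move=> /eqP; rewrite mulf_eq0 => /orP[]; first by rewrite subr_eq0 => /eqP.
rewrite addr_eq0 => /eqP zE; move: z0; rewrite zE raddfN oppr_gt0/= => h.
by have := lt_trans h s0; rewrite ltxx.
Qed.

Lemma upper_S (t : C) : t \in @upper R -> - t^-1 \in @upper R.
Proof.
rewrite !upperE raddfN/=; case: t => a b /= b0.
rewrite opprK divr_gt0// ltr_wpDl ?sqr_ge0// exprn_gt0//.
Qed.

Lemma upper_scale (t : C) (r : R) : 0 < r -> t \in @upper R -> r%:C%C * t \in @upper R.
Proof. by move=> r0; rewrite !upperE; case: t => a b /= b0; rewrite mul0r addr0 mulr_gt0. Qed.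

Lemma sqrtc_neq0 (t : C) : t \in @upper R -> sqrtc t != 0.
Proof. by move=> ut; rewrite sqrtc_eq0 upper_neq0. Qed.

Lemma sqrtc_S (t : C) : t \in @upper R -> sqrtc (- t^-1) = 'i%C / sqrtc t.
Proof.
move=> ut; apply/esym/sqrtc_uniq; first exact: upper_S.
  by rewrite expr_div_n sqr_i sqr_sqrtc mulN1r.
have [] := sqrtc_upper ut; case: (sqrtc t) => a b /= a0 b0.
rewrite mul0r mul1r sub0r opprK divr_gt0// ltr_wpDl ?sqr_ge0// exprn_gt0//.
Qed.

Lemma sqrtc_scale (t : C) (r : R) : 0 < r -> t \in @upper R ->
  sqrtc (r%:C%C * t) = (Num.sqrt r)%:C%C * sqrtc t.
Proof.
move=> r0 ut; apply/esym/sqrtc_uniq; first exact: upper_scale.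
  by rewrite exprMn sqr_sqrtc -rmorphXn sqr_sqrtr// ltW.
have [] := sqrtc_upper ut; case: (sqrtc t) => a b /= a0 b0.
by rewrite mul0r subr0 mulr_gt0// sqrtr_gt0.
Qed.

Lemma e_quarter : e (- 4^-1 : C) = - 'i%C.
Proof.
have -> : - 4^-1 = (- 4^-1 : R)%:C%C :> C by rewrite rmorphN fmorphV rmorph_nat.
rewrite e_real; have -> : pi *+ 2 * - 4^-1 = - (pi / 2) :> R by rewrite -[pi *+ 2]mulr_natr; field.
by rewrite cosN sinN cos_pihalf sin_pihalf; apply/eqP; rewrite eq_complex/= oppr0 !eqxx.
Qed.

Lemma sectorE (z : C) : 0 < complex.Re z -> 0 < complex.Re (z ^+ 2) -> sector z.
Proof.
rewrite /sector; case: z => a b /= a0 h; rewrite -(ltr_pXn2r (n := 2)) ?nnegrE ?(ltW a0)//.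
by rewrite real_normK ?num_real//; move: h; rewrite !expr2; lra.
Qed.

Lemma sectorV (z : C) : sector z -> sector z^-1.
Proof.
move=> sz; have z0 := sector_neq0 sz; move: sz; rewrite /sector.
case: z z0 => a b /= z0 h; have n0 : 0 < a ^+ 2 + b ^+ 2.
  have a0 := le_lt_trans (normr_ge0 b) h.
  by rewrite ltr_pwDl ?sqr_ge0// exprn_gt0.
by rewrite normrN normrM (@gtr0_norm _ _^-1) ?invr_gt0// ltr_pM2r ?invr_gt0.
Qed.

(** For [t] in the upper half-plane, the square root of - i t with positive real part: e (- 1/8) is
    a root of - i. As Re (- i t) = Im t > 0, it lies in [sector], and Gaussians along it are theta
    terms. *)
Definition rot (t : C) : C := sqrtc t * e (- 8^-1).

Lemma rot_sqr t : rot t ^+ 2 = - 'i%C * t.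
Proof.
rewrite exprMn sqr_sqrtc -eMn mulrC; congr (_ * _); rewrite -e_quarter; congr e.
by field.
Qed.

Lemma rot_sector t : t \in @upper R -> sector (rot t).
Proof.
move=> ut; apply: sectorE; last first.
  rewrite rot_sqr; move: ut; rewrite upperE; case: t => a b /= b0.
  by rewrite oppr0 mul0r sub0r mulN1r opprK.
rewrite /rot; have -> : - 8^-1 = (- 8^-1 : R)%:C%C :> C by rewrite rmorphN fmorphV rmorph_nat.
rewrite e_real; have -> : pi *+ 2 * - 8^-1 = - (pi / 4) :> R by rewrite -[pi *+ 2]mulr_natr; field.
rewrite cosN sinN; have [] := sqrtc_upper ut; case: (sqrtc t) => a b /= a0 b0.
have p0 := pi_gt0 R.
have c0 : 0 < cos (pi / 4 : R) by apply: cos_gt0_pihalf; apply/andP; split; lra.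
have s0 : 0 < sin (pi / 4 : R) by apply: sin_gt0_pihalf; apply/andP; split; lra.
by rewrite mulrN opprK addr_gt0// mulr_gt0.
Qed.

Lemma gauss_rot t (u : C) : gauss (rot t * u) = e (u ^+ 2 / 2 * t).
Proof.
rewrite gaussE eE exprMn rot_sqr twopiiE2; congr cexp.
by move: ('i%C : C) (pi%:C%C : C) => I p; field.
Qed.

Lemma gauss_rotV t (c : C) : t \in @upper R -> gauss (c / rot t) = e (c ^+ 2 / 2 * - t^-1).
Proof.
move=> ut; have t0 := upper_neq0 ut.
rewrite gaussE eE expr_div_n rot_sqr twopiiE2; congr cexp.
have := sqr_i R; move: ('i%C : C) (pi%:C%C : C) => I p I2.
have I0 : I != 0 by apply: contra_eq_neq I2 => ->; rewrite expr0n/= eq_sym oppr_eq0 oner_eq0.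
rewrite [RHS](_ : _ = - (p * (c ^+ 2 / (- I * t))) * (- I ^+ 2)); last by field; rewrite ?t0 ?I0.
by rewrite I2 opprK mulr1.
Qed.

Lemma theta_law t (x b : R) : t \in @upper R -> `|b| <= 1 / 2 ->
  tot (fun r : int => e (- ((r%:~R + b) * x))%:C%C * e ((r%:~R + b)%:C%C ^+ 2 / 2 * - t^-1)) =
  sqrtc t * e (- 8^-1) * tot (fun m : int => e (b * m%:~R)%:C%C * e ((m%:~R + x)%:C%C ^+ 2 / 2 * t)).
Proof.
move=> ut hb; have ss := rot_sector ut; have ss' := sectorV ss.
have r0 := sector_neq0 ss.
have := poisson x ss ss' hb.
rewrite (@tot_ext _ _ _ (fun m : int => e (b * m%:~R)%:C%C * e ((m%:~R + x)%:C%C ^+ 2 / 2 * t))); last first.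
  by move=> m; rewrite -mulrDr -rmorphD gauss_rot.
move=> ->; have [A hA] := dual_bound x b ss'.
have A0 : 0 <= A.
  by have := le_trans (nc_ge0 _) (hA 0); rewrite pmulr_lge0// /weight invr_gt0 mulr_gt0.
rewrite -/(rot t) -totZ; last by apply: asum_le hA (rsumZ A0 (@weight_rsum R)).
by apply: tot_ext => r; rewrite /dual mulVKf// gauss_rotV.
Qed.

Lemma theta_asum t (x b : R) : t \in @upper R ->
  asum (fun m : int => e (b * m%:~R)%:C%C * e ((m%:~R + x)%:C%C ^+ 2 / 2 * t)).
Proof.
move=> ut; have ss := rot_sector ut; have [A hA] := gauss_shift_decay x 1 ss.
have := @node_asum R 1 (fun y => e (b * y)%:C%C * gauss (rot t * y%:C%C + rot t * x%:C%C)) A isT.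
move=> /(_ _)/asum_ext; apply=> [m|y].
  by rewrite nodeE divr1 -mulrDr -rmorphD gauss_rot.
by rewrite ncM nc_ereal mul1r; have := hA y; rewrite mul1r.
Qed.

Lemma tot_fin n (f : 'I_n -> C) : tot f = \sum_i f i.
Proof.
apply: tot_eq; have := @hassum_fin R _ f (index_enum 'I_n) (index_enum_uniq _).
by apply: hassum_ext => i; rewrite mem_index_enum.
Qed.

Lemma tot_mod l (c : int) (g : int -> C) : (0 < l)%N -> asum g ->
  tot g = \sum_(m < l) tot (fun n : int => g (l%:Z * n + m%:Z + c)).
Proof.
case: l => // l _ ag.
pose i (u : 'I_l.+1 * int) : int := (l.+1)%:Z * u.2 + (u.1 : nat)%:Z + c.
pose j (p : int) : 'I_l.+1 * int := (inord (absz ((p - c) %% (l.+1)%:Z)%Z), ((p - c) %/ (l.+1)%:Z)%Z).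
have ij : cancel i j.
  move=> [m n]; rewrite /i /j /= addrK [(l.+1)%:Z * n]mulrC divzMDl// modzMDl.
  have hm : 0 <= (m : nat)%:Z < (l.+1)%:Z by rewrite ltz_nat ltn_ord.
  by rewrite divz_small ?addr0 ?modz_small//= inord_val.
have ji : cancel j i.
  move=> p; rewrite /i /j /= inordK; last first.
    by rewrite -ltz_nat gez0_abs ?modz_ge0// ltz_pmod.
  by rewrite gez0_abs ?modz_ge0// mulrC -divz_eq subrK.
rewrite -(tot_bij ij ji ag) tot_pair ?tot_fin//.
by apply: asum_inj ag; exact: can_inj ij.
Qed.

End ThetaLaw.

(** * The theta functions [tht l j]: q-series and transformation laws *)

Section ThetaSeries.
#[local] Opaque e cexp.
Variable R : realType.
Local Notation sqrtc := (@sqrtc R).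
Local Notation C := R[i].
Local Notation nc := (@ComplexField.Normc.normc R).
Local Notation tot := (@tot R _).

(* The square in the exponent of [Theta] is completed, and a constant dropped:
   [Theta_{l, j} = i tht l j]. *)
Definition tht (l j : nat) (t : C) : C :=
  tot (fun m : int => e (m%:~R / 2) * e ((2 * l%:R * m%:~R + l%:R + 2 * j%:R) ^+ 2 / (8 * l%:R) * t)).

Section Coefficients.
Variables l j : nat.
Hypotheses (ol : odd l) (j0 : (0 < j)%N) (jl : (2 * j < l)%N).

(** The exponent of the m-th term minus the smallest one, attained at m = - 1: ((2 l m + l + 2 j)^2
    - (l - 2 j)^2) / (8 l) = (m + 1) (l m + 2 j) / 2. It is an integer because [l] is odd. *)
Definition thexp (m : int) : nat := (absz ((m + 1) * (l%:Z * m + (2 * j)%:Z))%R %/ 2)%N.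

Lemma thexpE m : (thexp m)%:Z * 2 = (m + 1) * (l%:Z * m + (2 * j)%:Z).
Proof.
have ge : 0 <= (m + 1) * (l%:Z * m + (2 * j)%:Z).
  have [m0|m0] := leP 0 m; first by rewrite mulr_ge0//; nia.
  have [->|m1] := eqVneq m (-1); first by rewrite addNr mul0r.
  rewrite -mulrNN mulr_ge0//; first lia.
  have : m <= -2 by lia.
  move=> h; nia.
have ev : (2 %| absz ((m + 1) * (l%:Z * m + (2 * j)%:Z))%R)%N.
  have [q hq] : exists q : int, l%:Z = q * 2 + 1.
    exists (l./2)%:Z; rewrite -{1}(odd_double_half l) ol; lia.
  have [p [hp|hp]] : exists p : int, m = p * 2 \/ m = p * 2 + 1.
    exists (m %/ 2)%Z; lia.
    have -> : (m + 1) * (l%:Z * m + (2 * j)%:Z) = ((m + 1) * (l%:Z * p + j%:Z)) * 2 by rewrite hp PoszM; ring.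
    by rewrite abszM dvdn_mull.
  have -> : (m + 1) * (l%:Z * m + (2 * j)%:Z) = ((p + 1) * (l%:Z * m + (2 * j)%:Z)) * 2 by rewrite hp; ring.
  by rewrite abszM dvdn_mull.
rewrite /thexp -[2]/(Posz 2) -PoszM divnK// gez0_abs//.
Qed.

(** Equal values give (m - n) (l (m + n + 1) + 2 j) = 0, and the second factor is nonzero since 0 <
    2 j < l. Hence distinct terms never share a power of q. *)
Lemma thexp_inj : injective thexp.
Proof.
move=> m n mn; have := thexpE m; have := thexpE n; rewrite mn => -> h.
have : (m - n) * (l%:Z * (m + n + 1) + (2 * j)%:Z) = 0.
  apply/eqP; have : (m + 1) * (l%:Z * m + (2 * j)%:Z) - (n + 1) * (l%:Z * n + (2 * j)%:Z) == 0.
    by rewrite subr_eq0 h.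
  by congr (_ == 0); ring.
move=> /eqP; rewrite mulf_eq0 subr_eq0 => /orP[/eqP//|/eqP h2]; exfalso.
move: h2; move: (m + n + 1) => x; have [x0|x0] := leP 0 x; first nia.
have : x <= -1 by lia.
nia.
Qed.

Definition thcoef (n : nat) : C := oapp (fun m : int => e (m%:~R / 2)) 0 (part_inv thexp n).

Lemma nc_half (m : int) : nc (e (m%:~R / 2 : C)) = 1.
Proof.
have -> : m%:~R / 2 = (m%:~R / 2 : R)%:C%C :> C by rewrite rmorphM fmorphV rmorph_nat rmorph_int.
exact: nc_ereal.
Qed.

Lemma thcoef_urad : urad thcoef.
Proof.
move=> y y0; exists 1 => n; rewrite -[leRHS]mul1r ler_pM ?nc_ge0 ?expR_ge0//.
  by rewrite /thcoef; case: (part_inv _ n) => [m|]; [rewrite /= nc_half|rewrite [oapp _ _ _]/(0 : C) nc0 ler01].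
by rewrite -expR0 ler_expR oppr_le0 mulr_ge0// ltW.
Qed.

Lemma tht_expo (m : int) : (2 * l%:R * m%:~R + l%:R + 2 * j%:R) ^+ 2 / (8 * l%:R) =
  (expo 1 ((l%:R - 2 * j%:R) ^+ 2 / (8 * l%:R)) (thexp m))%:C%C :> C.
Proof.
have l0 : l%:R != 0 :> C by rewrite pnatr_eq0; case: (l) jl.
have h : (thexp m)%:R * 2 = (m%:~R + 1) * (l%:R * m%:~R + 2 * j%:R) :> C.
  have := congr1 (fun z : int => z%:~R : C) (thexpE m).
  by rewrite (intrM _ _ 2) (intrM _ (m + 1)) (intrD _ m 1) (intrD _ (l%:Z * m)) (intrM _ l%:Z m) -!pmulrn natrM.
have -> : (expo 1 ((l%:R - 2 * j%:R) ^+ 2 / (8 * l%:R)) (thexp m))%:C%C =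
   (thexp m)%:R + (l%:R - 2 * j%:R) ^+ 2 / (8 * l%:R) :> C.
  by rewrite /expo divr1 (rmorphD (@real_complex R)) (rmorphM (@real_complex R)) fmorphV rmorphXn rmorphB !rmorphM !rmorph_nat.
have -> : (thexp m)%:R = (m%:~R + 1) * (l%:R * m%:~R + 2 * j%:R) / 2 :> C by rewrite -h mulfK.
by move: (m%:~R) (l%:R) l0 (j%:R) => x y y0 z; field.
Qed.

Lemma tht_asum t : t \in @upper R ->
  asum (fun m : int => e (m%:~R / 2) * e ((2 * l%:R * m%:~R + l%:R + 2 * j%:R) ^+ 2 / (8 * l%:R) * t)).
Proof.
move=> ut; have := asum_inj thexp_inj (qterm_asum ((l%:R - 2 * j%:R) ^+ 2 / (8 * l%:R)) (isT : (0 < 1)%N) thcoef_urad ut).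
by apply: asum_ext => m; rewrite /thcoef part_invK ?tht_expo//; exact: thexp_inj.
Qed.

Lemma tht_qser : qser 1 ((l%:R - 2 * j%:R) ^+ 2 / (8 * l%:R)) thcoef (tht l j).
Proof.
split=> [|t ut]; first exact: thcoef_urad.
rewrite -(@tot_inj _ _ _ _ thexp_inj); last 2 first.
- by apply: qterm_asum => //; exact: thcoef_urad.
- move=> n; rewrite /thcoef; case E : part_inv => [m|] /=; last by rewrite mul0r eqxx.
  by move=> _; exists m; have := part_invV thexp n; rewrite E.
by apply: tot_ext => m; rewrite /thcoef part_invK ?tht_expo//; exact: thexp_inj.
Qed.

Lemma thcoef0 : thcoef 0 = -1.
Proof.
have -> : 0%N = thexp (-1) by rewrite /thexp addNr mul0r.
rewrite /thcoef part_invK /=; last exact: thexp_inj.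
by rewrite mulN1r eN e_half invrN1.
Qed.

Lemma tht_qlead : qlead ((l%:R - 2 * j%:R) ^+ 2 / (8 * l%:R)) (-1) (tht l j).
Proof. by exists thcoef; [exact: tht_qser|exact: thcoef0]. Qed.

End Coefficients.

Lemma tht_term l (m n : int) t : (0 < l)%N ->
  (2 * l%:R * n%:~R + l%:R + 2 * m%:~R) ^+ 2 / (8 * l%:R) * t =
  ((l%:Z * n + m)%:~R + l%:R / 2 : R)%:C%C ^+ 2 / 2 * ((l%:R^-1 : R)%:C%C * t) :> C.
Proof.
move=> l0; have lC : l%:R != 0 :> C by rewrite pnatr_eq0 -lt0n.
rewrite intrD intrM !rmorphD !rmorphM !fmorphV !rmorph_nat !rmorph_int.
by move: (l%:R) lC => x y; field.
Qed.

Lemma tht_asum_all l j t : (0 < l)%N -> t \in @upper R ->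
  asum (fun m : int => e (m%:~R / 2) * e ((2 * l%:R * m%:~R + l%:R + 2 * j%:R) ^+ 2 / (8 * l%:R) * t)).
Proof.
move=> l0 ut; have lR : 0 < l%:R :> R by rewrite ltr0n.
have lR0 := lt0r_neq0 lR.
have ul : (l%:R : R)%:C%C * t \in @upper R by exact: upper_scale.
have := theta_asum (2^-1 + j%:R / l%:R) 2^-1 ul; apply: asum_ext => m; congr (e _ * e _).
  by rewrite rmorphM fmorphV rmorph_nat rmorph_int mulrC.
have -> : (m%:~R + (2^-1 + j%:R / l%:R))%:C%C = m%:~R + (2^-1 + j%:R / l%:R) :> C.
  by rewrite !rmorphD rmorphM !fmorphV !rmorph_nat rmorph_int.
have lC : l%:R != 0 :> C by rewrite pnatr_eq0 -lt0n.
by rewrite (rmorph_nat (@real_complex R)); move: (l%:R) lC => x y; field.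
Qed.

(** The involution m |-> - m - 1 preserves the square in the exponent and reverses the sign e (m /
    2). *)
Lemma tht0 l t : (0 < l)%N -> t \in @upper R -> tht l 0 t = 0.
Proof.
move=> l0 ut; have a := tht_asum_all 0 l0 ut.
suff h : tht l 0 t = - tht l 0 t.
  by apply/eqP; move/eqP: h; rewrite -subr_eq0 opprK -mulr2n mulrn_eq0.
rewrite -mulN1r -totZ// /tht.
rewrite -(@tot_bij _ _ _ (fun n : int => - n - 1) (fun n => - n - 1) (fun n => _ * e _))//; try by move=> n; ring.
apply: tot_ext => n; rewrite mulrA.
have -> : (- n - 1)%:~R = - n%:~R - 1 :> C by rewrite intrB intrN.
congr (_ * e _); last by congr (_ * _); ring.
have -> : (- n%:~R - 1) / 2 = n%:~R / 2 + (- n - 1)%:~R + 2^-1 :> C.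
  by rewrite (intrB _ (- n)) (intrN _ n); field.
by rewrite !eD e_int mulr1 e_half mulrC.
Qed.

(** The substitution m |-> - m - 2, which keeps the sign e (m / 2). *)
Lemma tht_sym l j t : (0 < l)%N -> (j <= l)%N -> t \in @upper R -> tht l (l - j) t = tht l j t.
Proof.
move=> l0 jl ut; have a := tht_asum_all j l0 ut.
rewrite /tht -(@tot_bij _ _ _ (fun n : int => - n - 2) (fun n => - n - 2) (fun n => _ * e (_ ^+ 2 / _ * t)))//; try by move=> n; ring.
apply: tot_ext => n; have -> : (- n - 2)%:~R = - n%:~R - 2 :> C by rewrite intrB intrN.
congr (_ * e _).
  have -> : (- n%:~R - 2) / 2 = n%:~R / 2 + (- n - 1)%:~R :> C.
    by rewrite (intrB _ (- n)) (intrN _ n); field.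
  by rewrite eD e_int mulr1.
  by rewrite natrB//; congr (_ / _ * _); ring.
exact: tht_asum_all.
Qed.

(** [theta_law] at t / l with the characteristics 1/2 and j / l - 1/2: the dual side is
    [tht l j (- t^-1)] up to the phase e (- K), and the other side is split into residue classes
    modulo l, each of them a multiple of some [tht l m t]. *)
Lemma tht_S_sum d j t : (0 < j <= d)%N -> t \in @upper R -> let l := d.*2.+1 in
  tht l j (- t^-1) = sqrtc t * ((Num.sqrt (l%:R : R))^-1)%:C%C * e (- 8^-1) *
   \sum_(m < l) 'i%C * e ((j%:R - (m : nat)%:R - d%:R) / 2) * e (j%:R * (m : nat)%:R / l%:R) * tht l m t.
Proof.
move=> /andP[j0 jd] ut l; have l0 : (0 < l)%N by [].
have lR : 0 < l%:R :> R by rewrite ltr0n.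
have lC : l%:R != 0 :> C by rewrite pnatr_eq0.
have lE : l%:R = 2 * d%:R + 1 :> R by rewrite /l -natr1 -mul2n natrM.
have lEC : l%:R = 2 * d%:R + 1 :> C by rewrite /l -natr1 -mul2n natrM.
pose u := (l%:R^-1 : R)%:C%C * t.
have uu : u \in @upper R by apply: upper_scale; rewrite ?invr_gt0.
pose b : R := j%:R / l%:R - 2^-1.
have bb : `|b| <= 1 / 2.
  have : j%:R / l%:R <= 1 :> R.
    by rewrite ler_pdivrMr// mul1r ler_nat /l; lia.
  have : 0 <= j%:R / l%:R :> R by rewrite divr_ge0.
  rewrite /b ler_norml => h1 h2; apply/andP; split; lra.
have bC : b%:C%C = j%:R / l%:R - 2^-1 :> C by rewrite /b rmorphB rmorphM !fmorphV !rmorph_nat.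
clearbody b.
have xC : (2^-1 : R)%:C%C = 2^-1 :> C by rewrite fmorphV rmorph_nat.
have := theta_law 2^-1 uu bb.
rewrite /u sqrtc_scale ?invr_gt0// sqrtrV// -/u.
set K := 4^-1 + j%:R / (2 * l%:R) : C.
have aS : asum (fun r : int => e (- ((r%:~R + b) * 2^-1))%:C%C * e ((r%:~R + b)%:C%C ^+ 2 / 2 * - u^-1)).
  have := asumZ (e (- (b / 2))%:C%C) (theta_asum b (- 2^-1) (upper_S uu)); apply: asum_ext => r.
  by rewrite mulrA -eD -rmorphD; congr (e _%:C%C * _); field.
have -> : tot (fun r : int => e (- ((r%:~R + b) * 2^-1))%:C%C * e ((r%:~R + b)%:C%C ^+ 2 / 2 * - u^-1))
   = e (- K) * tht l j (- t^-1).
  rewrite /tht -totZ; last by apply: tht_asum_all => //; exact: upper_S.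
  rewrite -(@tot_bij _ _ _ (fun n : int => n + 1) (fun n => n - 1) _ _ _ aS) => [|n|n]; last 2 first.
  - by rewrite addrK.
  - by rewrite subrK.
  apply: tot_ext => m; rewrite [RHS]mulrA -(eD (- K)); congr (_ * e _).
    have -> : (- (((m + 1)%:~R + b) * 2^-1))%:C%C = - K + m%:~R / 2 + (- m)%:~R :> C.
      by rewrite rcN rcM rcD bC xC rcz intrN (intrD _ m 1) /K; field.
    by rewrite [LHS]eD e_int mulr1.
  rewrite rcD bC rcz (intrD _ m 1) /u rcV rcn.
  by have := upper_neq0 ut; move: (l%:R) lC (j%:R) => x x0 y t0; field; rewrite x0 t0.
(* Residues are counted from d because l / 2 = d + 1/2: offset and characteristic together form the
   summand l of [tht]. *)
rewrite (tot_mod d l0 (theta_asum 2^-1 b uu)).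
have i4 : e (4^-1 : C) = 'i%C.
  by rewrite -[4^-1]opprK eN e_quarter; apply/eqP; rewrite eq_complex/=; apply/andP; split; apply/eqP; field.
rewrite (eq_bigr (fun m : 'I_l => e (- K) * ('i%C * e ((j%:R - (m : nat)%:R - d%:R) / 2) * e (j%:R * (m : nat)%:R / l%:R) * tht l m t))); last first.
  move=> m _; rewrite /tht -totZ; last exact: tht_asum_all.
  rewrite -totZ; last by apply: asumZ; exact: tht_asum_all.
  apply: tot_ext => n.
  have -> : (2 * l%:R * n%:~R + l%:R + 2 * (m : nat)%:R) ^+ 2 / (8 * l%:R) * t =
      ((l%:Z * n + (m : nat)%:Z + d%:Z)%:~R + 2^-1)%:C%C ^+ 2 / 2 * u :> C.
    rewrite [(m : nat)%:R]pmulrn tht_term// -/u; congr (_%:C%C ^+ 2 / 2 * _).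
    by rewrite (intrD _ _ d%:Z) -pmulrn lE; field.
  move: (e (_ / 2 * u)) => E.
  have -> : e (- K) * ('i%C * e ((j%:R - (m : nat)%:R - d%:R) / 2) * e (j%:R * (m : nat)%:R / l%:R) * (e (n%:~R / 2) * E))
    = e (- K + 4^-1 + (j%:R - (m : nat)%:R - d%:R) / 2 + j%:R * (m : nat)%:R / l%:R + n%:~R / 2) * E.
    by rewrite !eD i4; ring.
  congr (_ * _).
    have -> : (b * (l%:Z * n + (m : nat)%:Z + d%:Z)%:~R)%:C%C = - K + 4^-1 + (j%:R - (m : nat)%:R - d%:R) / 2
        + j%:R * (m : nat)%:R / l%:R + n%:~R / 2 + ((j%:Z - d%:Z - 1) * n)%:~R :> C.
      rewrite rcM bC rcz (intrD _ _ d%:Z) (intrD _ _ (m : nat)%:Z) (intrM _ l%:Z) intrM (intrB _ _ 1) (intrB _ j%:Z) /K -!pmulrn.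
      move: lC; rewrite lEC; move: (d%:R) (j%:R) ((m : nat)%:R) (n%:~R) => x y z w lC; field; exact: lC.
    by rewrite [LHS]eD e_int mulr1.
rewrite -mulr_sumr => H; apply: (mulfI (e_neq0 (- K))); rewrite H [RHS]mulrCA.
by rewrite [_%:C%C * sqrtc t]mulrC mulrCA.
Qed.

Lemma e_halves (n : nat) : e (n%:R / 2 : C) = (-1) ^+ n.
Proof. by rewrite eMn e_half. Qed.

Lemma sum_odd (V : zmodType) d (F : nat -> V) :
  \sum_(m < d.*2.+1) F m = F 0%N + \sum_(m < d) (F m.+1 + F (d.*2.+1 - m.+1)%N).
Proof.
rewrite big_ord_recl big_split/=; congr (_ + _).
rewrite -(big_mkord xpredT (fun m => F m.+1)) -addnn (big_cat_nat (n := d)) ?leq_addr//=.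
rewrite big_mkord; congr (_ + _).
rewrite -{1}[d]add0n big_addn addnK big_mkord.
rewrite (reindex_inj rev_ord_inj) /=; apply: eq_bigr => i _; congr F.
have := ltn_ord i; lia.
Qed.

(** The term m = 0 vanishes by [tht0]. The terms m and l - m contain the same function by [tht_sym],
    with exponentials of opposite argument and opposite sign, which combine to a sine. *)
Lemma tht_S d j t : (0 < j <= d)%N -> t \in @upper R -> let l := d.*2.+1 in
  tht l j (- t^-1) = sqrtc t * ((Num.sqrt (l%:R : R))^-1)%:C%C * e (- 8^-1) *
   \sum_(m < d) (2 * (-1) ^+ (d.+1 + j + m.+1) * sin (2 * pi * j%:R * m.+1%:R / l%:R))%:C%C * tht l m.+1 t.
Proof.
move=> hj ut l; rewrite tht_S_sum// -/l; congr (_ * _).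
have l0 : (0 < l)%N by []. have lC : l%:R != 0 :> C by rewrite pnatr_eq0.
pose F (m : nat) := 'i%C * e ((j%:R - m%:R - d%:R) / 2) * e (j%:R * m%:R / l%:R) * tht l m t.
rewrite (sum_odd d F) {1}/F tht0// mulr0 add0r; apply: eq_bigr => m _.
have ml : (m.+1 <= l)%N by have := ltn_ord m; rewrite /l; lia.
rewrite /F tht_sym// -mulrDl; congr (_ * _); rewrite natrB// -/l.
move: (m.+1) ml => n nl.
have -> : (j%:R - (l%:R - n%:R) - d%:R) / 2 = (j + n + d)%N%:R / 2 + (- (2 * d)%N%:Z - 1)%:~R + 2^-1 :> C.
  have lE : l%:R = 2 * d%:R + 1 :> C by rewrite /l -natr1 -mul2n natrM.
  by rewrite lE intrB intrN -pmulrn (natrM _ 2 d) (natrD _ _ d) natrD; field.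
have -> : (j%:R - n%:R - d%:R) / 2 = (j + n + d)%N%:R / 2 + (- (n + d)%N%:Z)%:~R :> C.
  by rewrite intrN -pmulrn !natrD; field.
have -> : j%:R * (l%:R - n%:R) / l%:R = - (j%:R * n%:R / l%:R) + j%:R :> C.
  by move: lC; move: (l%:R) => x x0; field.
have E1 : e ((j + n + d)%N%:R / 2 + (- (n + d)%N%:Z)%:~R : C) = (-1) ^+ (j + n + d).
  by rewrite [LHS]eD e_int mulr1 e_halves.
have E2 : e ((j + n + d)%N%:R / 2 + (- (2 * d)%N%:Z - 1)%:~R + 2^-1 : C) = - (-1) ^+ (j + n + d).
  by rewrite [LHS]eD e_half [X in X * _]eD e_int mulr1 e_halves mulrN1.
have E3 : e (- (j%:R * n%:R / l%:R) + j%:R : C) = e (- (j%:R * n%:R / l%:R)).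
  by rewrite [LHS]eD e_nat mulr1.
rewrite E1 E2 E3.
have -> : j%:R * n%:R / l%:R = (j%:R * n%:R / l%:R : R)%:C%C :> C by rewrite !rcE.
rewrite -(rcN (j%:R * n%:R / l%:R)) (e_real (j%:R * n%:R / l%:R)) (e_real (- (j%:R * n%:R / l%:R))) (mulrN (pi *+ 2)) cosN sinN.
have -> : pi *+ 2 * (j%:R * n%:R / l%:R) = 2 * pi * j%:R * n%:R / l%:R :> R.
  by rewrite -[pi *+ 2]mulr_natl !mulrA.
have -> : (d.+1 + j + n = (j + n + d).+1)%N by lia.
move: (sin _) (cos _) => sn cs.
have -> : (-1) ^+ (j + n + d) = ((-1) ^+ (j + n + d) : R)%:C%C :> C by rewrite rcX rcN rc1.
rewrite exprS; move: ((-1) ^+ (j + n + d) : R) => sg.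
by apply/eqP; rewrite eq_complex/=; apply/andP; split; apply/eqP; ring.
Qed.

Lemma qser_T s a (f : C -> C) t : qser 1 s a f -> t \in @upper R -> f (t + 1) = e s%:C%C * f t.
Proof.
move=> [ua hf] ut; have ut1 : t + 1 \in @upper R by move: ut; rewrite !upperE raddfD/= addr0.
rewrite !hf// -totZ; last exact: qterm_asum.
apply: tot_ext => n; rewrite [RHS]mulrCA; congr (_ * _).
have -> : qterm 1 s n (t + 1) = e ((expo 1 s n)%:C%C * t + (expo 1 s n)%:C%C) by rewrite /qterm mulrDr mulr1.
rewrite eD [LHS]mulrC; congr (_ * _).
by rewrite /expo divr1 rmorphD eD rmorph_nat e_nat mul1r.
Qed.

End ThetaSeries.

(** * Euler's pentagonal number theorem and recursion *)

Section Pentagonal.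
Variable R : realType.
Local Notation C := R[i].

Fixpoint tri (s : nat) : nat := if s is s'.+1 then (tri s' + s)%N else 0.

Lemma triS s : tri s.+1 = (tri s + s.+1)%N. Proof. by []. Qed.

Lemma tri2 s : (tri s * 2 = s * s.+1)%N.
Proof. by elim: s => // s IH; rewrite triS mulnDl IH; lia. Qed.

Definition qpoch (n : nat) : {poly C} := \prod_(i < n) (1 - 'X^(i.+1)).

Definition qpochr (n s : nat) : {poly C} := \prod_(s <= i < n) (1 - 'X^(i.+1)).

(** Shanks's finite form of the pentagonal number theorem: the term s = 0 is the n-th partial
    product, while the whole sum equals a truncated pentagonal series. *)
Definition shanks (n : nat) : {poly C} :=
  \sum_(s < n.+1) (-1) ^+ s * 'X^(s * n + tri s) * qpochr n s.

(** Expanding the last factor 1 - X^(n + 1) of [qpochr n.+1 s] produces, for each s, a multiple of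
    the term s + 1 of [shanks n]; after this shift everything cancels except the boundary terms. *)
Lemma shanksS n : shanks n.+1 = shanks n +
  (-1) ^+ n.+1 * ('X^(n.+1 * n.+1 + tri n.+1) + 'X^(n.+1 * n.+1 + tri n)).
Proof.
rewrite {1}/shanks big_ord_recr/= /qpochr big_geq// mulr1.
pose B s : {poly C} := 'X^(s * n + tri s) * qpochr n s.
rewrite (eq_bigr (fun s : 'I_n.+1 => (-1) ^+ s * 'X^s * B s - (-1) ^+ s * ('X^(s * n + tri s + (s + n.+1)) * qpochr n s))); last first.
  move=> s _; rewrite big_nat_recr -1?ltnS//= -/(qpochr n s) /B mulnS -addnA (exprD _ s) (exprD _ _ (s + n.+1)) (exprD _ s n.+1).
  move: ('X^s : {poly C}) ('X^(n.+1) : {poly C}) ('X^(s * n + tri s) : {poly C}) (qpochr n s) ((-1) ^+ s : {poly C}) => a b c d f; ring.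
rewrite sumrB big_ord_recl big_ord_recr /=.
have E (s : 'I_n) : (-1) ^+ s * ('X^(s * n + tri s + (s + n.+1)) * qpochr n s) =
   (-1) ^+ s * ((1 - 'X^(s.+1)) * B s.+1).
  have -> : (s * n + tri s + (s + n.+1) = s.+1 * n + tri s.+1)%N by rewrite triS mulSn; lia.
  by rewrite /B /qpochr [in LHS]big_ltn//; congr (_ * _); rewrite mulrCA.
rewrite (eq_bigr _ (fun s _ => E s)).
have Sh : shanks n = B 0%N + \sum_(i < n) - (-1) ^+ i * B i.+1.
  rewrite /shanks big_ord_recl expr0 mul1r; congr (_ + _).
  by apply: eq_bigr => i _; rewrite /= /bump add1n exprS mulN1r -mulrA.
rewrite Sh {Sh} expr0 !mul1r.
have -> : (n * n + tri n + (n + n.+1) = n.+1 * n.+1 + tri n)%N by rewrite mulSn mulnS; lia.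
rewrite {1}/qpochr big_geq// mulr1.
have -> : \sum_(i < n) (-1) ^+ bump 0 i * 'X^(bump 0 i) * B (bump 0 i) =
   \sum_(i < n) - (-1) ^+ i * B i.+1 + \sum_(i < n) (-1) ^+ i * ((1 - 'X^(i.+1)) * B i.+1).
  rewrite -big_split; apply: eq_bigr => i _; rewrite /bump add1n exprS /=.
  by move: ('X^(i.+1) : {poly C}) (B _) ((-1) ^+ i : {poly C}) => x b c; ring.
rewrite exprS; move: (\sum_(_ < n) _) (\sum_(_ < n) _) ('X^_ : {poly C}) ('X^_ : {poly C}) ((-1) ^+ n : {poly C}) => S1 S2 x y z.
ring.
Qed.

Lemma qpochr0 n : qpochr n 0 = qpoch n.
Proof. by rewrite /qpochr big_mkord. Qed.

(** Every term with s >= 1 is divisible by X^(n + 1). *)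
Lemma shanks_coef n i : (i <= n)%N -> (shanks n)`_i = (qpoch n)`_i.
Proof.
move=> ni; rewrite /shanks big_ord_recl /= expr0 mul1r mul1r qpochr0 coefD coef_sum big1 ?addr0//.
move=> s _; rewrite /bump leq0n add1n [tri _]/= mulrAC mulrC coefXnM ifT//.
by rewrite mulSn; lia.
Qed.

Local Notation pexp := (thexp 3 1).

(** At m = u - 1 the exponent is the generalised pentagonal number u (3 u - 1) / 2; u = s is treated
    here, u = - s in [pexpN]. *)
Lemma pexpP (s : nat) : pexp (s%:Z - 1) = (s * s + tri s.-1)%N.
Proof.
have := @thexpE 3 1 isT isT isT (s%:Z - 1); have := tri2 s.-1; case: s => [|s] h1 h2.
  by rewrite /=; lia.
have h3 := congr1 Posz h1; rewrite !PoszM [s.+1.-1]/= -[s.+1]addn1 PoszD in h3.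
have : (pexp (s.+1%:Z - 1))%:Z * 2 = ((s.+1 * s.+1 + tri s)%N%:Z * 2)%R.
  have h4 : (tri s)%:Z * 2 = s%:Z * (s%:Z + 1) := h3.
  rewrite h2 (PoszD (s.+1 * s.+1)) [RHS]mulrDl h4 PoszM -[s.+1]addn1 PoszD; ring.
by rewrite [s.+1.-1]/=; lia.
Qed.

Lemma pexpN (s : nat) : pexp (- s%:Z - 1) = (s * s + tri s)%N.
Proof.
have := @thexpE 3 1 isT isT isT (- s%:Z - 1); have := tri2 s => h1 h2.
have : (pexp (- s%:Z - 1))%:Z * 2 = ((s * s + tri s)%N%:Z * 2)%R by rewrite h2; nia.
lia.
Qed.

Definition pterm (u : int) : {poly C} := (-1) ^+ (absz u) * 'X^(pexp (u - 1)).

Lemma ptermP (s : nat) : pterm s%:Z = (-1) ^+ s * 'X^(s * s + tri s.-1).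
Proof. by rewrite /pterm pexpP. Qed.

Lemma ptermN (s : nat) : pterm (- s%:Z) = (-1) ^+ s * 'X^(s * s + tri s).
Proof. by rewrite /pterm pexpN abszN. Qed.

Definition penta (n : nat) : {poly C} := \sum_(j < n.*2.+1) pterm (j%:Z - n%:Z).

Lemma pentaS n : penta n.+1 = penta n +
  (-1) ^+ n.+1 * ('X^(n.+1 * n.+1 + tri n.+1) + 'X^(n.+1 * n.+1 + tri n)).
Proof.
rewrite /penta doubleS big_ord_recl big_ord_recr.
have -> : ((ord0 : 'I_n.*2.+3) : nat)%:Z - n.+1%:Z = - n.+1%:Z by rewrite /= sub0r.
have -> : ((lift ord0 (ord_max : 'I_n.*2.+2)) : nat)%:Z - n.+1%:Z = n.+1%:Z by rewrite /= /bump; lia.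
rewrite ptermP ptermN [n.+1.-1]/= mulrDr.
rewrite (eq_bigr (fun j : 'I_n.*2.+1 => pterm ((j : nat)%:Z - n%:Z))); last first.
  by move=> j _; congr pterm; rewrite /= /bump; lia.
by move: (\sum_(_ < _) _) => S; rewrite addrC -addrA [X in S + X]addrC.
Qed.

Lemma shanks_penta n : shanks n = penta n.
Proof.
elim: n => [|n IH]; last by rewrite shanksS pentaS IH.
rewrite /shanks /penta big_ord1 (big_ord1 _ (fun j => pterm (j%:Z - 0))) /qpochr big_geq// subrr.
by rewrite (ptermP 0) mulr1.
Qed.

(** The coefficients of the product of all 1 - q^n; the sign offsets [thcoef] being -1 at 0. *)
Definition pcoef (i : nat) : C := - thcoef R 3 1 i.

Lemma e_half_int (u : int) : e (u%:~R / 2 : C) = (-1) ^+ (absz u).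
Proof.
case: u => n; first by rewrite -pmulrn e_halves.
rewrite NegzE intrN mulNr eN -pmulrn e_halves abszN /= -signr_odd.
by case: (odd _); rewrite ?expr0 ?invr1 ?expr1 ?invrN1.
Qed.

Lemma pexp_ge (m : int) : (absz (m + 1)%R <= pexp m)%N.
Proof. have := @thexpE 3 1 isT isT isT m; nia. Qed.

Lemma penta_coef n i : (i <= n)%N -> (penta n)`_i = pcoef i.
Proof.
have inj := @thexp_inj 3 1 isT isT isT.
move=> ni; rewrite /penta coef_sum.
rewrite (eq_bigr (fun j : 'I_n.*2.+1 => (-1) ^+ (absz ((j : nat)%:Z - n%:Z)) * (i == pexp ((j : nat)%:Z - n%:Z - 1))%:R)); last first.
  by move=> j _; rewrite /pterm -(rmorph_sign (@polyC C)) coefCM coefXn.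
rewrite /pcoef /thcoef; case E : (part_inv pexp i) => [m|] /=.
  have im : i = pexp m by have := part_invV pexp i; rewrite E.
  have := pexp_ge m; rewrite -im => mi.
  have j0 : (absz (m + 1 + n%:Z)%R < n.*2.+1)%N by lia.
  have j0E : (absz (m + 1 + n%:Z)%R)%:Z - n%:Z = m + 1 by lia.
  rewrite (bigD1 (Ordinal j0))//= j0E addrK im eqxx mulr1 big1 ?addr0.
    rewrite -e_half_int intrD mulrDl mul1r eD e_half mulrN1//.
  move=> j /eqP jj; rewrite (inj_eq inj); case: eqP => [mj|_]; last by rewrite mulr0.
  case: jj; apply: val_inj => /=; lia.
rewrite oppr0 big1// => j _; case: eqP => [ij|_]; last by rewrite mulr0.
by move: E; rewrite ij part_invK.
Qed.

(* [divisors 0 = [:: 1]], so [divsum s 0] is not the empty sum. *)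
Definition sig (s n : nat) : C := if n is 0 then 0 else (divsum s n)%:R.

Lemma qpoch_log M N : exists Q : {poly C}, 'X * (qpoch N)^`() +
  qpoch N * \sum_(s < N) (\sum_(x < M) 'X^(s.+1 * x.+1)) *+ s.+1 = 'X^(M.+1) * Q.
Proof.
elim: N => [|N [Q IH]].
  by exists 0; rewrite /qpoch !big_ord0 derivC !mulr0 addr0.
pose s := N.+1; exists ((1 - 'X^s) * Q - qpoch N * 'X^(s * M.+1 - M.+1) *+ s).
have geo m : (1 - 'X^s) * (\sum_(x < m) 'X^(s * x.+1)) = 'X^s - 'X^(s * m.+1) :> {poly C}.
  elim: m => [|m IHm]; first by rewrite big_ord0 mulr0 muln1 subrr.
  by rewrite big_ord_recr/= mulrDr IHm mulrBl mul1r -exprD -mulnS addrA subrK.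
have -> : 'X^(M.+1) * ((1 - 'X^s) * Q - qpoch N * 'X^(s * M.+1 - M.+1) *+ s) =
   (1 - 'X^s) * ('X^(M.+1) * Q) - qpoch N * 'X^(s * M.+1) *+ s.
  rewrite -(@subnKC M.+1 (s * M.+1)) ?leq_pmull// addKn (exprD _ M.+1) -!mulrnAr.
  by move: ('X^_ : {poly C}) ('X^_ : {poly C}) ('X^_ : {poly C}) => a b c; ring.
rewrite -IH.
have -> : qpoch N.+1 = qpoch N * (1 - 'X^s) by rewrite /qpoch big_ord_recr.
rewrite big_ord_recr /= -/s derivM derivB derivXn -[1]/(1%:P) derivC sub0r.
have Xs : 'X * 'X^(s.-1) = 'X^s :> {poly C} by rewrite -exprS.
have := geo M; move: (\sum_(x < M) _) (\sum_(x < N) _) Xs => G T.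
move: (qpoch N) ((qpoch N)^`()) ('X : {poly C}) => P P' X.
move: (X ^+ s) (X ^+ s.-1) (X ^+ (s * M.+1)) => a b c h g.
rewrite -[b *+ s]mulr_natr -[G *+ s]mulr_natr -[_ *+ s in RHS]mulr_natr.
have -> : X * (P' * (1%:P - a) + P * - (b * s%:R)) + P * (1%:P - a) * (T + G * s%:R) =
   X * P' * (1%:P - a) - P * (X * b) * s%:R + (1%:P - a) * P * T + P * ((1%:P - a) * G) * s%:R by ring.
rewrite h g; ring.
Qed.

Lemma sum_divisors n k : (0 < k <= n)%N ->
  (\sum_(s < n) \sum_(x < n) (if s.+1 * x.+1 == k then s.+1 else 0) = divsum 1 k)%N.
Proof.
move=> /andP[k0 kn]; rewrite /divsum.
rewrite (eq_bigr (fun s : 'I_n => if (s.+1 %| k)%N then s.+1 else 0%N)); last first.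
  move=> s _; case: ifP => [/dvdnP[q kq]|sk].
    have q0 : (0 < q)%N by case: q kq => // kq; rewrite kq in k0.
    have qn : (q.-1 < n)%N by rewrite prednK//; apply: leq_trans kn; rewrite kq leq_pmulr.
    rewrite (bigD1 (Ordinal qn))//= prednK// mulnC -kq eqxx big1 ?addn0// => x xq.
    case: eqP => // h; case/eqP: xq; apply: val_inj => /=.
    by move: h; rewrite kq mulnC => /eqP; rewrite eqn_pmul2r// => /eqP <-.
  rewrite big1// => x _; case: eqP => // h; move: sk; rewrite -h dvdn_mulr//.
rewrite -(big_mkord xpredT (fun s => if (s.+1 %| k)%N then s.+1 else 0%N)).
rewrite -(big_add1 _ _ 0 n.+1 xpredT (fun s => if (s %| k)%N then s else 0%N)) -big_mkcond /=.
under [RHS]eq_bigr do rewrite expn1.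
rewrite -big_filter; apply: perm_big; apply: uniq_perm; rewrite ?filter_uniq ?iota_uniq ?divisors_uniq//.
move=> d; rewrite mem_filter mem_index_iota -dvdn_divisors//; case dk : (d %| k)%N => //=.
by rewrite (dvdn_gt0 k0 dk) ltnS (leq_trans (dvdn_leq k0 dk) kn).
Qed.

(** Euler's recursion between the coefficients and sigma_1. For M = N = n the error in [qpoch_log]
    starts beyond X^n, and up to degree n the coefficients of the finite product are already
    [pcoef]. *)
Lemma pcoef_rec n : n%:R * pcoef n = - convol (sig 1) pcoef n.
Proof.
have [Q] := qpoch_log n n; move=> /(congr1 (fun p : {poly C} => p`_n)).
rewrite coefXnM ltnSn coefD coefXM => h.
have E i : (i <= n)%N -> (qpoch n)`_i = pcoef i.
  by move=> ni; rewrite -shanks_coef// shanks_penta penta_coef.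
have -> : n%:R * pcoef n = (if n == 0%N then 0 else (qpoch n)^`()`_n.-1).
  case: eqP => [->|/eqP n0]; first by rewrite mul0r.
  by rewrite coef_deriv prednK ?lt0n// E// mulr_natl.
apply/eqP; rewrite -addr_eq0; apply/eqP; rewrite -[RHS]h; congr (_ + _).
rewrite mulrC coefM /convol; apply: eq_bigr => k _; rewrite E ?leq_subr//; congr (_ * _).
rewrite coef_sum.
have -> : sig 1 k = (\sum_(s < n) \sum_(x < n) (if (s.+1 * x.+1 == k)%N then s.+1 else 0))%N%:R.
  case k0 : (k == 0 :> nat)%N.
    by rewrite (eqP k0) big1// => s _; rewrite big1.
  rewrite sum_divisors; last by rewrite lt0n k0 -ltnS ltn_ord.
  by case: (k : nat) k0.
rewrite natr_sum; apply: eq_bigr => s _; rewrite coefMn coef_sum natr_sum -sumrMnl.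
by apply: eq_bigr => x _; rewrite coefXn eq_sym; case: eqP; rewrite ?mul0rn.
Qed.


Lemma pcoef0 : pcoef 0 = 1. Proof. by rewrite /pcoef (@thcoef0 R 3 1 isT isT isT) opprK. Qed.

End Pentagonal.

(** * Convolution of coefficient sequences and formal exponentials *)

Section Convolution.
Variable R : realType.
Local Notation C := R[i].
Local Notation nc := (@ComplexField.Normc.normc R).
Implicit Types a b c : nat -> C.

(** An identity between convolutions at index n is one between n-th coefficients of polynomials
    truncated at n, so the ring laws are inherited from polynomials. *)
Let trunc n a : {poly C} := \poly_(i < n.+1) a i.

Let truncE n a i : (i <= n)%N -> (trunc n a)`_i = a i.
Proof. by move=> h; rewrite coef_poly ltnS h. Qed.

Let convolE n a b i : (i <= n)%N -> convol a b i = (trunc n a * trunc n b)`_i.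
Proof.
move=> h; rewrite coefM; apply: eq_bigr => j _.
by rewrite !truncE// ?(leq_trans (leq_subr _ _))// (leq_trans _ h)// -ltnS.
Qed.

Lemma convolC a b n : convol a b n = convol b a n.
Proof. by rewrite !(@convolE n)// mulrC. Qed.

Lemma convolA a b c n : convol (convol a b) c n = convol a (convol b c) n.
Proof.
have E : (trunc n a * trunc n b * trunc n c)`_n = convol (convol a b) c n.
  rewrite coefM; apply: eq_bigr => j _.
  by rewrite -convolE ?truncE// ?leq_subr// -ltnS.
rewrite -E -mulrA coefM; apply: eq_bigr => j _.
by rewrite -convolE ?truncE// ?leq_subr// -ltnS.
Qed.

Lemma convolDl a b c n : convol (fun i => a i + b i) c n = convol a c n + convol b c n.
Proof. by rewrite -big_split; apply: eq_bigr => i _; rewrite mulrDl. Qed.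

Lemma convolZl x a b n : convol (fun i => x * a i) b n = x * convol a b n.
Proof. by rewrite mulr_sumr; apply: eq_bigr => i _; rewrite mulrA. Qed.

Lemma convol_dirac x a n : convol (fun i => if i == 0%N then x else 0) a n = x * a n.
Proof.
rewrite /convol big_ord_recl subn0 eqxx big1 ?addr0// => i _.
by rewrite /= mul0r.
Qed.

Lemma convol_deriv a b n : n%:R * convol a b n =
  convol (fun i => i%:R * a i) b n + convol a (fun i => i%:R * b i) n.
Proof.
rewrite /convol -big_split mulr_sumr; apply: eq_bigr => i _ /=.
have -> : n%:R = i%:R + (n - i)%:R :> C by rewrite -natrD subnKC// -ltnS.
move: (i%:R : C) ((n - i)%:R : C) => x y; ring.
Qed.

Section ExpRecursion.
Variable s : nat -> C.
Hypotheses (s0 : s 0%N = 0) (us : urad s).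

(* The coefficients of [exp (\sum_n s n / n q^n)], which solve
   [n * x n = convol s x n]. *)
Fixpoint expser_upto (n : nat) : nat -> C :=
  if n is m.+1 then fun i => if i == n then
    m.+1%:R^-1 * \sum_(k < m.+1) s k.+1 * expser_upto m (m - k)%N else expser_upto m i
  else fun i => (i == 0%N)%:R.

Definition expser n := expser_upto n n.

Let expserE m i : (i <= m)%N -> expser_upto m i = expser i.
Proof.
elim: m => [|m IH] im; first by move: im; rewrite leqn0 => /eqP->.
rewrite /=; case: eqP => [->|/eqP im']; first by rewrite /expser /= eqxx.
by apply: IH; rewrite -ltnS ltn_neqAle im' im.
Qed.

Lemma expser0 : expser 0 = 1. Proof. by []. Qed.

Lemma expser_rec n : n%:R * expser n = convol s expser n.
Proof.
case: n => [|n]; first by rewrite /convol big_ord1 s0 !mul0r.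
rewrite {1}/expser /= eqxx mulrA mulfV ?pnatr_eq0// mul1r /convol [RHS]big_ord_recl /= s0 mul0r add0r.
by apply: eq_bigr => k _; rewrite expserE ?leq_subr// /bump add1n subSS.
Qed.

(* With [b n = |x n| exp (- y n)] the recursion gives [n b n <= K max_(i < n) b i],
   so that b stops growing for [n >= K]. *)
Lemma urad_expser : urad expser.
Proof.
move=> y y0; have [K hK] := urad_asum us y0.
pose b n := nc (expser n) * expR (- (y * n%:R)).
have b0 n : 0 <= b n by rewrite mulr_ge0 ?nc_ge0 ?expR_ge0.
pose N := (Num.truncn `|K|).+1; have KN : K <= N%:R.
  by rewrite (le_trans (ler_norm _))// ltW// /N truncnS_gt.
exists (\sum_(i < N) b i); elim/ltn_ind => n IH; case: (ltnP n N) => nN.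
  by rewrite (bigD1 (Ordinal nN))//= lerDl sumr_ge0.
set B := \sum_(i < N) b i in IH *; have B0 : 0 <= B by apply: sumr_ge0.
have n0 : 0 < n%:R :> R by rewrite ltr0n (leq_trans _ nN).
rewrite -(ler_pM2l n0); apply: (@le_trans _ _ (K * B)); last first.
  by rewrite ler_wpM2r// (le_trans KN)// ler_nat.
rewrite mulrA -{1}(nc_nat R n) -(ncM n%:R) expser_rec /convol.
apply: (@le_trans _ _ (\sum_(i < n.+1) nc (s i * (expR (- (y * i%:R)))%:C%C) * B)); last first.
  rewrite -mulr_suml ler_wpM2r//; have := hK (index_iota 0 n.+1) (iota_uniq _ _).
  by rewrite big_mkord.
rewrite -ler_pdivlMr ?expR_gt0//; apply: le_trans (nc_sum _ _ _) _; rewrite mulr_suml.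
apply: ler_sum => i _; rewrite ler_pdivlMr ?expR_gt0// (ncM (s i)) (ncM (s i)) nc_real ger0_norm ?expR_ge0//.
case: (posnP i) => [->|i0]; first by rewrite s0 nc0 !mul0r.
have -> : expR (- (y * n%:R)) = expR (- (y * i%:R)) * expR (- (y * (n - i)%:R)).
  have -> : n%:R = i%:R + (n - i)%:R :> R by rewrite -natrD subnKC// -ltnS.
    by rewrite mulrDr opprD expRD.
have {}IH := IH (n - i)%N _; rewrite mulrACA ler_wpM2l ?mulr_ge0 ?nc_ge0 ?expR_ge0//.
by apply: IH; have := ltn_ord i; lia.
Qed.

(** Multiplication by n acts as a derivation on convolutions; the two recursions contribute s p x
    with opposite signs, so all coefficients of positive index vanish. *)
Lemma expser_inv p : p 0%N = 1 -> (forall n, n%:R * p n = - convol s p n) ->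
  forall n, convol p expser n = if n == 0%N then 1 else 0.
Proof.
move=> p0 hp n; case: eqP => [->|/eqP n0]; first by rewrite /convol big_ord1 p0 expser0 mulr1.
have nn : n%:R != 0 :> C by rewrite pnatr_eq0.
apply: (mulfI nn); rewrite mulr0 convol_deriv.
have -> : convol (fun i => i%:R * p i) expser n = - convol (convol s p) expser n.
  by rewrite -mulN1r -convolZl; apply: eq_bigr => i _; rewrite hp mulN1r.
have -> : convol p (fun i => i%:R * expser i) n = convol p (convol s expser) n.
  by apply: eq_bigr => i _; rewrite expser_rec.
have -> : convol (convol s p) expser n = convol p (convol s expser) n.
  rewrite -convolA; apply: eq_bigr => i _; by rewrite convolC.
by rewrite addNr.
Qed.

End ExpRecursion.
End Convolution.

(** * The eta function, its inverse and its logarithmic derivative *)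

Section DedekindEta.
#[local] Opaque e cexp.
Variable R : realType.
Local Notation C := R[i].
Local Notation nc := (@ComplexField.Normc.normc R).
Local Notation tot := (@tot R _).

Lemma urad1 (c : C) : urad (fun=> c).
Proof.
move=> y y0; exists (nc c) => n; rewrite ler_piMr ?nc_ge0//.
by rewrite -expR0 ler_expR oppr_le0 mulr_ge0// ltW.
Qed.

Lemma urad_sig s : urad (@sig R s).
Proof.
apply: (@urad_le _ _ (fun n => n%:R ^+ s.+1)).
  case=> [|n]; first by rewrite [sig _ _ _]/= nc0 nc_ge0.
  rewrite [sig _ _ _]/= -natrX !nc_nat ler_nat /divsum expnS.
  apply: (@leq_trans (\sum_(d <- divisors n.+1) n.+1 ^ s)).
    rewrite big_seq [leqRHS]big_seq; apply: leq_sum => d.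
    by rewrite -dvdn_divisors// => /dvdn_leq dn; case: (s) => // r; rewrite leq_exp2r// dn.
  rewrite big_const_seq count_predT iter_addn_0 mulnC leq_mul2r.
  apply/orP; right; rewrite -{2}(size_iota 1 n.+1); apply: uniq_leq_size; first exact: divisors_uniq.
  by move=> d; rewrite -dvdn_divisors// mem_iota => dn; rewrite (dvdn_gt0 _ dn)// add1n ltnS dvdn_leq.
elim: s.+1 => [|m IH]; first exact: urad_le (urad1 1).
by apply: urad_le (uradn IH) => n; rewrite exprS.
Qed.

Lemma qterm1 n (t : C) : qterm 1 0 n t = e (n%:R * t).
Proof. by rewrite /qterm /expo divr1 addr0 rcn. Qed.

Lemma sig_qser s : qser 1 0 (@sig R s) (fun t => csum (fun n => (divsum s n.+1)%:R * e (n.+1%:R * t))).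
Proof.
split=> [|t ut]; first exact: urad_sig.
have us := qterm_asum 0 (isT : (0 < 1)%N) (urad_sig s) ut.
have S_inj : injective S by move=> m n [].
have H n : (divsum s n.+1)%:R * e (n.+1%:R * t) = sig R s n.+1 * qterm 1 0 n.+1 t by rewrite qterm1.
rewrite csum_tot; last by apply: asum_ext (asum_inj S_inj us) => n; rewrite H.
rewrite (tot_ext H); apply: (tot_inj S_inj us) => -[|n] nz; last by exists n.
by rewrite mul0r eqxx in nz.
Qed.

Let onem (c : C) s f : qser 1 0 (@sig R s) f ->
  qser 1 0 (fun n => (if n == 0%N then 1 else 0) + c * sig R s n) (fun t => 1 + c * f t).
Proof. by move=> h; apply: qserD => //; [exact: qser_cst|exact: qserZ]. Qed.

Lemma E2_qser : qser 1 0 (fun n => (if n == 0%N then 1 else 0) + - 24 * sig R 1 n) (@E2 R).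
Proof. by apply: qser_ext (onem (- 24) (sig_qser 1)) => t _; rewrite mulNr. Qed.

Lemma E4_qser : qser 1 0 (fun n => (if n == 0%N then 1 else 0) + 240 * sig R 3 n) (@E4 R).
Proof. exact: (onem 240 (sig_qser 3)). Qed.

(* minus the Dedekind eta function *)
Definition eta : C -> C := tht 3 1.

Lemma eta_qser : qser 1 24^-1 (fun n => - pcoef R n) eta.
Proof.
have := @tht_qser R 3 1 isT isT isT.
have -> : (3 - 2 * 1) ^+ 2 / (8 * 3) = 24^-1 :> R by field.
case=> h1 h2; split=> [|t ut]; first by apply: urad_le h1 => n; rewrite opprK.
by rewrite /eta h2//; apply: tot_ext => n; rewrite opprK.
Qed.

Let recip := expser (@sig R 1).

(** The inverse of [eta], constructed as a q-series of leading exponent - 1/24; [eta_mulV] then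
    yields the nonvanishing of [eta] and a q-expansion of its inverse together. *)
Definition etaV (t : C) : C := - tot (fun n => recip n * qterm 1 (- 24^-1) n t).

Lemma etaV_qser : qser 1 (- 24^-1) (fun n => - 1 * recip n) etaV.
Proof.
have ur : urad recip by apply: urad_expser => //; exact: urad_sig.
split=> [|t ut]; first exact: uradZ.
rewrite /etaV -[LHS]mulN1r -totZ; last exact: qterm_asum.
by apply: tot_ext => n; rewrite [LHS]mulrA.
Qed.

Lemma eta_mulV t : t \in @upper R -> eta t * etaV t = 1.
Proof.
move=> ut; have [_ ->//] := qserM (isT : (0 < 1)%N) eta_qser etaV_qser.
have [_ h] := @qser_cst R 1 1; rewrite [RHS](h t ut); apply: tot_ext => n; rewrite subrr; congr (_ * _).
rewrite -(@expser_inv _ (@sig R 1) (erefl _) (@pcoef R) (pcoef0 R) (@pcoef_rec R)).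
by apply: eq_bigr => i _; rewrite -/recip; ring.
Qed.

Lemma eta_neq0 t : t \in @upper R -> eta t != 0.
Proof. by move=> ut; apply: contraTneq (oner_neq0 C) => h; rewrite -(eta_mulV ut) h mul0r eqxx. Qed.

(** Coefficientwise this is [pcoef_rec]; the leading exponent 1/24 of [eta] matches the constant
    term 1 of [E2]. *)
Lemma D_eta t : t \in @upper R -> D eta t = E2 t * eta t / 24.
Proof.
move=> ut; have [_ ->//] := qser_D (isT : (0 < 1)%N) eta_qser.
have [_ h] := qserM (isT : (0 < 1)%N) E2_qser eta_qser.
rewrite h// add0r mulrC -totZ; last by apply: qterm_asum => //; case: (qserM (isT : (0 < 1)%N) E2_qser eta_qser).
apply: tot_ext => n; rewrite [RHS]mulrA; congr (_ * _).
rewrite convolDl convol_dirac convolZl mul1r.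
have -> : convol (@sig R 1) (fun i => - pcoef R i) n = n%:R * pcoef R n.
  rewrite pcoef_rec -sumrN; by apply: eq_bigr => i _; rewrite mulrN.
rewrite /expo divr1 !rcE; move: (n%:R : C) (pcoef R n) => x y.
by field.
Qed.

End DedekindEta.

(** * Splitting sums over pairs according to their order *)

Section Triangle.
Variables (R : realType) (T : eqType).
Local Notation C := R[i].
Local Notation tot := (@tot R _).

(** [above], [diag] and [below] parametrise the pairs whose first entry is greater than, equal to or
    less than the second; in [above] and [below], [u.1.1] is the difference minus 1. *)
Definition above (u : nat * nat * T) := ((u.1.1 + u.1.2).+1, u.1.2, u.2).
Definition below (u : nat * nat * T) := (u.1.2, (u.1.1 + u.1.2).+1, u.2).
Definition diag (u : nat * T) := (u.1, u.1, u.2).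

Lemma above_inj : injective above.
Proof. by move=> [[a b] t] [[a' b'] t'] [] h E ->; congr (_, _, _); lia. Qed.

Lemma below_inj : injective below.
Proof. by move=> [[a b] t] [[a' b'] t'] [] E h ->; congr (_, _, _); lia. Qed.

Lemma diag_inj : injective diag.
Proof. by move=> [b t] [b' t'] [] -> _ ->. Qed.

Lemma tot_triangle (F : nat * nat * T -> C) : asum F ->
  tot F = tot (fun u => F (above u)) + tot (fun u => F (diag u)) + tot (fun u => F (below u)).
Proof.
move=> aF; pose G (P : rel nat) (u : nat * nat * T) := if P u.1.1 u.1.2 then F u else 0.
have aG P : asum (G P) by apply: asum_if.
have -> : tot F = tot (fun u => G (fun a b => b < a)%N u + G (fun a b => a == b) u + G (fun a b => a < b)%N u).
  by apply: tot_ext => -[[a b] t]; rewrite /G /=; case: ltngtP; rewrite ?addr0 ?add0r.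
rewrite totD ?totD//; last exact: asumD.
congr (_ + _ + _).
- rewrite -(tot_inj above_inj)//; first by apply: tot_ext => u; rewrite /G /= ltnS leq_addl.
  move=> [[a b] t]; rewrite /G /=; case: ltnP => ab; last by rewrite eqxx.
  by exists (a - b.+1, b, t)%N; rewrite /above /=; congr (_, _, _); lia.
- rewrite -(tot_inj diag_inj)//; first by apply: tot_ext => u; rewrite /G /= eqxx.
  move=> [[a b] t]; rewrite /G /=; case: (a =P b) => [->|_]; last by rewrite eqxx.
  by exists (b, t).
- rewrite -(tot_inj below_inj)//; first by apply: tot_ext => u; rewrite /G /= ltnS leq_addl.
  move=> [[a b] t]; rewrite /G /=; case: ltnP => ab; last by rewrite eqxx.
  by exists (b - a.+1, a, t)%N; rewrite /below /=; congr (_, _, _); lia.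
Qed.

(** The pairs (i, j) are grouped by c = i + j + 1: the fibre over 0 is empty, and the fibre over c
    has c elements. *)
Lemma tot_below (F : T * (nat * nat) -> C) : asum F ->
  let G (u : T * nat) := \sum_(i < u.2) F (u.1, ((i : nat), (u.2.-1 - i)%N)) in
  asum G /\ tot F = tot G.
Proof.
move=> aF G; pose p (u : T * (nat * nat)) := (u.1, (u.2.1 + u.2.2).+1).
suff h s : tot (fun u => if p u == s then F u else 0) = G s.
  split; first exact: asum_ext h (asum_fib p aF).
  by rewrite -(tot_eq (tot_fib p aF)); apply: tot_ext.
case: s => t [|c] /=.
  rewrite /G big_ord0; apply: tot_eq; apply: (@hassum_ext _ _ (fun=> 0)); last exact: hassum0.
  by move=> [t' [i j]]; rewrite /= xpair_eqE andbF.
rewrite /G -(big_mkord xpredT (fun i => F (t, (i, c - i)%N))).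
pose s := [seq (t, (i, c - i)%N) | i <- index_iota 0 c.+1].
have us : uniq s by rewrite map_inj_uniq ?iota_uniq// => i j [].
rewrite -(big_map (fun i => (t, (i, c - i)%N)) xpredT F) -/s; apply: tot_eq.
apply: hassum_ext (hassum_fin F us) => -[t' [i j]] /=.
rewrite xpair_eqE eqSS /=; congr (if _ then _ else _).
apply/mapP/andP => [[k]|[/eqP-> /eqP ij]].
  by rewrite mem_index_iota /= ltnS => kc [-> -> ->]; rewrite eqxx subnKC.
by exists i; [rewrite mem_index_iota /= ltnS; lia|congr (_, (_, _)); lia].
Qed.

End Triangle.

(** * Ramanujan's identity and the inversion laws of [E2] and [E4] *)

Section Ramanujan.
#[local] Opaque e cexp.
Variable R : realType.
Local Notation C := R[i].
Local Notation nc := (@ComplexField.Normc.normc R).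
Local Notation tot := (@tot R _).

Section Divisors.
Variable t : C.
Hypothesis ut : t \in @upper R.
Let q := e t.

Let y := pi *+ 2 * complex.Im t.

Let y0 : 0 < y. Proof. by rewrite mulr_gt0 ?pi2_gt0// -upperE. Qed.

Let ncq : nc q = expR (- y). Proof. by rewrite /q nc_e. Qed.

(** With a and x the two indices plus one, this is the term a^s q^(a x) of the Lambert series whose
    sum is that of sigma_s(n) q^n. *)
Let w s (u : nat * nat) : C := u.1.+1%:R ^+ s * q ^+ (u.1.+1 * u.2.+1).

Let w_asum s : asum (w s).
Proof.
have h1 : asum (fun a => a.+1%:R ^+ s * (expR (- (y * a%:R)))%:C%C).
  apply: (@urad_asum R (fun a => a.+1%:R ^+ s)) => //; elim: s => [|s IH]; first exact: urad_le (urad1 1).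
  apply: urad_le (uradD (uradn IH) IH) => n.
  by rewrite exprS -{1}[n.+1%:R]/(n.+1%:R) -natr1 mulrDl mul1r.
have h2 : asum (fun x : nat => 1 * (expR (- (y * x%:R)))%:C%C) by apply: urad_asum => //; exact: urad1.
have [M hM] := asum_prod h1 h2; exists M => l ul; apply: le_trans (hM l ul).
apply: ler_sum => -[a x] _; rewrite /w /= mul1r (ncM (_ ^+ s)) (ncM (_ * _)) (ncM (_ ^+ s)) -mulrA.
apply: ler_wpM2l; first exact: nc_ge0.
rewrite ncX ncq !nc_real !ger0_norm ?expR_ge0// !expR_natl -exprD.
by apply: ler_wiXn2l; [exact: expR_ge0|rewrite ltW// expRN_lt1|lia].
Qed.

Lemma tot_divisors (s p : nat) :
  asum (fun u => u.1.+1%:R ^+ s * (u.1.+1 * u.2.+1)%:R ^+ p * q ^+ (u.1.+1 * u.2.+1)) ->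
  tot (fun u => u.1.+1%:R ^+ s * (u.1.+1 * u.2.+1)%:R ^+ p * q ^+ (u.1.+1 * u.2.+1)) =
  tot (fun n => n%:R ^+ p * sig R s n * qterm 1 0 n t).
Proof.
move=> aF; rewrite -(tot_eq (tot_fib (fun u : nat * nat => (u.1.+1 * u.2.+1)%N) aF)).
apply: tot_ext => -[|n].
  by rewrite mulr0 mul0r; apply: tot_eq; apply: (@hassum_ext _ _ (fun=> 0)) => //; exact: hassum0.
pose F (u : nat * nat) : C := u.1.+1%:R ^+ s * (u.1.+1 * u.2.+1)%:R ^+ p * q ^+ (u.1.+1 * u.2.+1).
pose l := [seq (d.-1, (n.+1 %/ d).-1) | d <- divisors n.+1].
have pos d : d \in divisors n.+1 -> [/\ (0 < d)%N, (0 < n.+1 %/ d)%N & (d * (n.+1 %/ d))%N = n.+1].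
  rewrite -dvdn_divisors// => dn; have d0 := dvdn_gt0 (isT : (0 < n.+1)%N) dn.
  by rewrite d0 divn_gt0// dvdn_leq// mulnC divnK.
have ul : uniq l.
  rewrite map_inj_in_uniq ?divisors_uniq// => d d' /pos[d0 _ _] /pos[d'0 _ _] [h _].
  by rewrite -(prednK d0) h prednK.
transitivity (\sum_(u <- l) F u).
  apply: tot_eq; apply: hassum_ext (hassum_fin F ul) => -[a x] /=.
  congr (if _ then _ else _); apply/mapP/eqP => [[d /pos[d0 x0 dx]] [-> ->]|h].
    by rewrite !prednK.
  by exists a.+1; rewrite -?dvdn_divisors// -h ?dvdn_mulr// mulKn.
rewrite big_map [sig _ _ _]/= /divsum natr_sum mulr_sumr mulr_suml big_seq [RHS]big_seq.
apply: eq_bigr => d /pos[d0 x0 dx]; rewrite /F /= !prednK// dx natrX qterm1 eMn.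
by rewrite -/q [_ ^+ s * _]mulrC.
Qed.

Let T := (nat * nat * (nat * nat))%type.
(** For ((a, b), (x, y)), all indices raised by one, [E] is q^(a x + b y) and [Z] is q^(a x + b x +
    b y). *)
Let E (u : T) : C := q ^+ (u.1.1.+1 * u.2.1.+1 + u.1.2.+1 * u.2.2.+1).
Let Z (u : T) : C := q ^+ (u.1.1.+1 * u.2.1.+1 + u.1.2.+1 * u.2.1.+1 + u.1.2.+1 * u.2.2.+1).
Implicit Type v : nat -> nat -> C.

(** The first expansion compares a with b, the second x with y. Writing the larger entry as the
    smaller plus a difference turns each off-diagonal part into a sum over [Z]; in the first
    expansion this changes the weight, in the second it only permutes its arguments. *)
Let splits v : asum (fun u : T => v u.1.1 u.1.2 * E u) ->
  [/\ asum (fun u : T => v u.1.1 u.1.2 * Z u), asum (fun u : T => v u.1.2 u.1.1 * Z u),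
   tot (fun u : T => v u.1.1 u.1.2 * E u) = tot (fun u : T => v (u.1.1 + u.1.2).+1 u.1.2 * Z u) +
     tot (fun u : nat * (nat * nat) => v u.1 u.1 * q ^+ (u.1.+1 * (u.2.1 + u.2.2).+2)) +
     tot (fun u : T => v u.1.2 (u.1.1 + u.1.2).+1 * Z u) &
   tot (fun u : T => v u.1.1 u.1.2 * E u) = tot (fun u : T => v u.1.2 u.1.1 * Z u) +
     tot (fun u : nat * (nat * nat) => v u.2.1 u.2.2 * q ^+ (u.1.+1 * (u.2.1 + u.2.2).+2)) +
     tot (fun u : T => v u.1.1 u.1.2 * Z u)].
Proof.
move=> aE; pose F (u : T) := v u.1.1 u.1.2 * E u.
have aF : asum F by [].
have swK : involutive (fun u : T => (u.2, u.1)) by move=> [[a b] [c d]].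
pose F' (u : T) := F (u.2, u.1).
have aF' : asum F' by apply: (asum_inj (inv_inj swK)).
have aB := asum_inj (@below_inj _) aF.
have aA' := asum_inj (@above_inj _) aF'; have aB' := asum_inj (@below_inj _) aF'.
pose i (u : T) : T := ((u.2.2, u.2.1), (u.1.2, u.1.1)).
have iK : involutive i by move=> [[a b] [c d]].
pose j (u : T) : T := ((u.2.2, u.2.1), u.1); pose j' (u : T) : T := (u.2, (u.1.2, u.1.1)).
have jK : cancel j j' by move=> [[a b] [c d]].
have jK' : cancel j' j by move=> [[a b] [c d]].
have kK : involutive (fun u : T => (u.1, (u.2.2, u.2.1)) : T) by move=> [[a b] [c d]].
have ei u : F' (above (i u)) = v u.1.2 u.1.1 * Z u by rewrite /F' /F /E /Z /=; congr (_ * _ ^+ _); lia.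
have ej u : F' (below (j u)) = v u.1.1 u.1.2 * Z u by rewrite /F' /F /E /Z /=; congr (_ * _ ^+ _); lia.
split.
- by apply: asum_ext ej (asum_inj (can_inj jK) aB').
- by apply: asum_ext ei (asum_inj (inv_inj iK) aA').
- rewrite -/F (tot_triangle aF); congr (_ + _ + _).
  + by apply: tot_ext => u; rewrite /F /E /Z /=; congr (_ * _ ^+ _); lia.
  + by apply: tot_ext => u; rewrite /F /E /Z /=; congr (_ * _ ^+ _); lia.
  rewrite -(tot_bij kK kK aB); apply: tot_ext => u.
  by rewrite /F /E /Z /=; congr (_ * _ ^+ _); lia.
- rewrite -/F -(tot_bij swK swK aF) -/F' (tot_triangle aF'); congr (_ + _ + _).
  + by rewrite -(tot_bij iK iK aA'); apply: tot_ext => u; rewrite ei.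
  + by apply: tot_ext => u; rewrite /F' /F /E /Z /=; congr (_ * _ ^+ _); lia.
  by rewrite -(tot_bij jK jK' aB'); apply: tot_ext => u; rewrite ej.
Qed.

(** The weights a b and a^2: replacing a by a + b keeps them in the span of a b, a^2 and b^2, so
    that the four relations of [splits] contain only three different sums over [Z]. *)
Let v1 a b : C := a.+1%:R * b.+1%:R.
Let v2 a (b : nat) : C := a.+1%:R ^+ 2.

Let v_asum r s : asum (fun u : T => u.1.1.+1%:R ^+ r * u.1.2.+1%:R ^+ s * E u).
Proof.
have i_inj : injective (fun u : T => ((u.1.1, u.2.1), (u.1.2, u.2.2)) : T).
  by move=> [[a b] [x z]] [[a' b'] [x' z']] [] -> -> -> ->.
apply: asum_ext (asum_inj i_inj (asum_prod (w_asum r) (w_asum s))) => -[[a b] [x z]].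
by rewrite /w /E /= exprD mulrACA.
Qed.

Let S1 := tot (w 1).

Let S1_sqr : tot (fun u : T => v1 u.1.1 u.1.2 * E u) = S1 ^+ 2.
Proof.
have iK : involutive (fun u : T => ((u.1.1, u.2.1), (u.1.2, u.2.2)) : T) by move=> [[a b] [x z]].
rewrite expr2 -(tot_prod (w_asum 1) (w_asum 1)) -(tot_bij iK iK (asum_prod (w_asum 1) (w_asum 1))).
by apply: tot_ext => -[[a b] [x z]]; rewrite /w /E /v1 /= exprD mulrACA !expr1.
Qed.

Let sum_v1 c : \sum_(i < c) v1 i (c.-1 - i) = (c.+1%:R ^+ 3 - c.+1%:R) / 6.
Proof.
elim: c => [|c IH]; first by rewrite big_ord0 expr1n subrr mul0r.
have E0 : \sum_(i < c) (v1 i (c - i) - v1 i (c.-1 - i)) = c%:R * c.+1%:R / 2.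
  rewrite (eq_bigr (fun i : 'I_c => i.+1%:R)); last first.
    move=> i _; rewrite /v1 -mulrBr -natrB; last by rewrite ltnS leq_sub2r// leq_pred.
    have -> : ((c - i).+1 - (c.-1 - i).+1 = 1)%N by have := ltn_ord i; lia.
    by rewrite mulr1.
  elim: (c) => [|m IHm]; first by rewrite big_ord0 !mul0r.
  rewrite big_ord_recr /= IHm -[m.+2%:R]natr1 -[m.+1%:R]natr1; by field.
rewrite big_ord_recr /= subnn -[X in X + _](subrK (\sum_(i < c) v1 i (c.-1 - i))) -sumrB E0 IH.
rewrite /v1 -[c.+2%:R]natr1 -[c.+1%:R]natr1; by field.
Qed.

Let sum_v2 c : \sum_(i < c) v2 i (c.-1 - i) = (2 * c.+1%:R ^+ 3 - 3 * c.+1%:R ^+ 2 + c.+1%:R) / 6.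
Proof.
elim: c => [|c IH]; first by rewrite big_ord0; field.
rewrite big_ord_recr /= (eq_bigr (fun i : 'I_c => v2 i (c.-1 - i))) // IH.
rewrite /v2 -[c.+2%:R]natr1 -[c.+1%:R]natr1; by field.
Qed.

Let P s p := tot (fun n : nat => n%:R ^+ p * sig R s n * qterm 1 0 n t).

Let P_w s : tot (w s) = P s 0.
Proof.
have h u : w s u = u.1.+1%:R ^+ s * (u.1.+1 * u.2.+1)%:R ^+ 0 * q ^+ (u.1.+1 * u.2.+1) by rewrite mulr1.
by rewrite (tot_ext h) tot_divisors//; apply: asum_ext h (w_asum s).
Qed.

Let upper_sum v (g : C -> C) : asum (fun u : T => v u.1.1 u.1.2 * E u) ->
  (forall c, \sum_(i < c) v i (c.-1 - i)%N = g c.+1%:R) ->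
  tot (fun u : nat * (nat * nat) => v u.2.1 u.2.2 * q ^+ (u.1.+1 * (u.2.1 + u.2.2).+2)) =
  tot (fun u : nat * nat => g u.1.+1%:R * q ^+ (u.1.+1 * u.2.+1)).
Proof.
move=> aE hg; pose j (u : nat * (nat * nat)) : T := (u.2, (u.1, u.1)).
have j_inj : injective j by move=> [x [a b]] [x' [a' b']] [] -> -> ->.
have hj u : v (j u).1.1 (j u).1.2 * E (j u) = v u.2.1 u.2.2 * q ^+ (u.1.+1 * (u.2.1 + u.2.2).+2).
  by rewrite /E /=; congr (_ * _ ^+ _); lia.
have [aG ->] := tot_below (asum_ext hj (asum_inj j_inj aE)).
have sK : cancel (fun u : nat * nat => (u.2, u.1)) (fun u => (u.2, u.1)) by case.
rewrite -(tot_bij sK sK aG); apply: tot_ext => -[c x] /=; rewrite -hg mulr_suml.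
apply: eq_bigr => i _; congr (_ * _ ^+ _).
have -> : ((i + (c.-1 - i)).+2 = c.+1)%N by have := ltn_ord i; lia.
exact: mulnC.
Qed.

(* Liouville's argument: the sums over [a x + b y = n] are split according to the
   order of [a] and [b], and of [x] and [y]; both splittings produce sums over
   [a x + b x + b y = n], which are then eliminated. *)
Lemma sig1_square : P 1 0 ^+ 2 = (5 * P 3 0 + P 1 0 - 6 * P 1 1) / 12.
Proof.
have a1 : asum (fun u : T => v1 u.1.1 u.1.2 * E u).
  by apply: asum_ext (v_asum 1 1) => u; rewrite /v1 !expr1.
have a2 : asum (fun u : T => v2 u.1.1 u.1.2 * E u).
  by apply: asum_ext (v_asum 2 0) => u; rewrite /v2 mulr1.
have [z1 _ e1 e1'] := splits a1; have [z2 z2' e2 e2'] := splits a2.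
pose Bd := tot (fun u : nat * (nat * nat) => u.1.+1%:R ^+ 2 * q ^+ (u.1.+1 * (u.2.1 + u.2.2).+2)).
have E1 : tot (fun u : T => v1 (u.1.1 + u.1.2).+1 u.1.2 * Z u) =
    tot (fun u : T => v1 u.1.1 u.1.2 * Z u) + tot (fun u : T => v2 u.1.2 u.1.1 * Z u).
  rewrite -totD//; apply: tot_ext => u; rewrite -mulrDl; congr (_ * _).
  by rewrite /v1 /v2 -addSn -addnS natrD mulrDl.
have E2 : tot (fun u : T => v1 u.1.2 (u.1.1 + u.1.2).+1 * Z u) = tot (fun u : T => v1 (u.1.1 + u.1.2).+1 u.1.2 * Z u).
  by apply: tot_ext => u; rewrite /v1 mulrC [_ * _%:R]mulrC mulrC.
have E3 : tot (fun u : T => v1 u.1.2 u.1.1 * Z u) = tot (fun u : T => v1 u.1.1 u.1.2 * Z u).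
  by apply: tot_ext => u; rewrite /v1 [_%:R * _%:R]mulrC.
have E4 : tot (fun u : T => v2 (u.1.1 + u.1.2).+1 u.1.2 * Z u) = tot (fun u : T => v2 u.1.1 u.1.2 * Z u) +
    (tot (fun u : T => v2 u.1.2 u.1.1 * Z u) + 2 * tot (fun u : T => v1 u.1.1 u.1.2 * Z u)).
  have z3 := asumZ 2 z1; rewrite -totZ// -totD// -totD//; last exact: asumD.
  apply: tot_ext => u; rewrite [2 * (_ * Z u)]mulrA -!mulrDl; congr (_ * _).
  rewrite /v1 /v2 -addSn -addnS natrD; ring.
have D1 : tot (fun u : nat * (nat * nat) => v1 u.1 u.1 * q ^+ (u.1.+1 * (u.2.1 + u.2.2).+2)) = Bd by [].
have D2 : tot (fun u : nat * (nat * nat) => v2 u.1 u.1 * q ^+ (u.1.+1 * (u.2.1 + u.2.2).+2)) = Bd by [].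
have U1 := upper_sum a1 (g := fun x => (x ^+ 3 - x) / 6) sum_v1.
have U2 := upper_sum a2 (g := fun x => (2 * x ^+ 3 - 3 * x ^+ 2 + x) / 6) sum_v2.
have aZ s c := asumZ c (w_asum s).
have B1 : tot (fun u : nat * nat => (u.1.+1%:R ^+ 3 - u.1.+1%:R) / 6 * q ^+ (u.1.+1 * u.2.+1)) = 6^-1 * P 3 0 + - 6^-1 * P 1 0.
  rewrite -!P_w -!totZ// -totD//; apply: tot_ext => u; rewrite /w; ring.
have B2 : tot (fun u : nat * nat => (2 * u.1.+1%:R ^+ 3 - 3 * u.1.+1%:R ^+ 2 + u.1.+1%:R) / 6 * q ^+ (u.1.+1 * u.2.+1)) =
    3^-1 * P 3 0 + - 2^-1 * P 2 0 + 6^-1 * P 1 0.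
  rewrite -!P_w -!totZ// -!totD//; last exact: asumD.
  by apply: tot_ext => u; rewrite /w; field.
have B3 : Bd = P 1 1 - P 2 0.
  have hd (u : nat * (nat * nat)) : v1 (diag u).1.1 (diag u).1.2 * E (diag u) = u.1.+1%:R ^+ 2 * q ^+ (u.1.+1 * (u.2.1 + u.2.2).+2).
    by rewrite /v1 /E /= -expr2; congr (_ * _ ^+ _); lia.
  have [aG hG] := tot_below (asum_ext hd (asum_inj (@diag_inj _) a1)).
  have hw (u : nat * nat) : \sum_(i < u.2) u.1.+1%:R ^+ 2 * q ^+ (u.1.+1 * (i + (u.2.-1 - i)).+2) + w 2 u =
      u.1.+1%:R ^+ 1 * (u.1.+1 * u.2.+1)%:R ^+ 1 * q ^+ (u.1.+1 * u.2.+1).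
    rewrite (eq_bigr (fun=> u.1.+1%:R ^+ 2 * q ^+ (u.1.+1 * u.2.+1))); last first.
      move=> i _; congr (_ * _ ^+ (_ * _)%N); have := ltn_ord i; lia.
    rewrite sumr_const card_ord -mulr_natr /w natrM -[u.2.+1%:R]natr1; ring.
  rewrite [P 1 1]/P -tot_divisors; last by apply: asum_ext hw (asumD aG (w_asum 2)).
  by rewrite -(tot_ext hw) totD// -P_w addrK.
rewrite -P_w -/S1 -S1_sqr.
move: e1 e1' e2 e2'; rewrite E2 E3 E4 E1 D1 ?D2 U1 U2 B1 B2 B3 /S1 P_w.
move: (tot (fun u : T => v1 u.1.1 u.1.2 * Z u)) (tot (fun u : T => v2 u.1.2 u.1.1 * Z u)) (tot (fun u : T => v2 u.1.1 u.1.2 * Z u)).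
move: (tot (fun u : T => v1 u.1.1 u.1.2 * E u)) (tot (fun u : T => v2 u.1.1 u.1.2 * E u)) => A1 A2 z zb za e1 e1' e2 e2'.
move: (P 3 0) (P 2 0) (P 1 0) (P 1 1) e1 e1' e2 e2' => p3 p2 p1 p11 e1 e1' e2 e2'.
apply/eqP; rewrite -subr_eq0; apply/eqP.
(* The mean of the two relations for [v1] contains the unknown sums only as 2 z + zb, and this
   combination is what the difference of the two relations for [v2] determines. *)
transitivity (2^-1 * (A1 - (z + zb + (p11 - p2) + (z + zb))) + 2^-1 * (A1 - (z + (6^-1 * p3 + - 6^-1 * p1) + z)) +
   ((A2 - (zb + (3^-1 * p3 + - 2^-1 * p2 + 6^-1 * p1) + za)) - (A2 - (za + (zb + 2 * z) + (p11 - p2) + zb)))).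
  by field.
by rewrite -e1 -e1' -e2 -e2' !subrr !mulr0 !addr0.
Qed.

End Divisors.

Lemma E2_sig t : t \in @upper R -> E2 t = 1 - 24 * tot (fun n => sig R 1 n * qterm 1 0 n t).
Proof. by move=> ut; rewrite /E2; have [_ ->] := sig_qser R 1. Qed.

Lemma E4_sig t : t \in @upper R -> E4 t = 1 + 240 * tot (fun n => sig R 3 n * qterm 1 0 n t).
Proof. by move=> ut; rewrite /E4; have [_ ->] := sig_qser R 3. Qed.

Lemma ramanujan t : t \in @upper R -> 12 * D (@E2 R) t = E2 t ^+ 2 - E4 t.
Proof.
move=> ut; have [_ ->//] := qser_D (isT : (0 < 1)%N) (E2_qser R).
have h0 s : tot (fun n : nat => n%:R ^+ 0 * sig R s n * qterm 1 0 n t) = tot (fun n => sig R s n * qterm 1 0 n t).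
  by apply: tot_ext => n; rewrite mul1r.
have -> : tot (fun n => (expo 1 0 n : R)%:C%C * ((if n == 0%N then 1 else 0) + -24 * sig R 1 n) * qterm 1 0 n t) =
    - 24 * tot (fun n : nat => n%:R ^+ 1 * sig R 1 n * qterm 1 0 n t).
  rewrite -totZ; last by apply: (@qterm_asum R 1 0 (fun n => n%:R * sig R 1 n)) => //; apply: uradn; exact: urad_sig.
  apply: tot_ext => n; rewrite /expo divr1 addr0 rcn expr1 [RHS]mulrA; congr (_ * _).
  by case: eqP => [->|_]; [rewrite !mul0r mulr0|ring].
have := sig1_square ut; rewrite (h0 1%N) (h0 3%N) E2_sig// E4_sig//.
move: (tot _) (tot _) (tot _) => a b c h.
have -> : (1 - 24 * c) ^+ 2 = 1 - 48 * c + 576 * c ^+ 2 by ring.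
by rewrite h; field.
Qed.

(** Applied twice at the fixed point i of S, the law reads eta(i) = i c^2 eta(i); this gives c^2
    without evaluating the sine in [c0]. *)
Lemma eta_S : exists2 c : C, 'i%C * c ^+ 2 = 1 &
  {in @upper R, forall t, eta (- t^-1) = c * sqrtc t * eta t}.
Proof.
pose c0 : C := ((Num.sqrt (3 : R))^-1)%:C%C * e (- 8^-1) *
  (2 * (-1) ^+ (1.+1 + 1 + 1) * sin (2 * pi * 1 * 1 / 3))%:C%C.
have h t : t \in @upper R -> eta (- t^-1) = c0 * sqrtc t * eta t.
  by move=> ut; rewrite /eta (@tht_S R 1 1 t isT ut) big_ord1 /c0 /=; ring.
exists c0 => //; have ui : 'i%C \in @upper R by rewrite upperE /= ltr01.
have := h _ (upper_S ui); rewrite invrN invrK opprK (h _ ui) sqrtc_S//.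
have := eta_neq0 ui; have := sqrtc_neq0 ui; clear h; move: c0 (eta _) (sqrtc _) => c x s s0 x0.
have -> : c * ('i%C / s) * (c * s * x) = 'i%C * c ^+ 2 * x by field.
by move=> /esym; rewrite -{2}[x]mul1r => /(mulIf x0).
Qed.

Lemma cderiv_S (t : C) : t \in @upper R -> cderiv (fun x => - x^-1) t (t ^- 2).
Proof.
move=> ut; have := cderivZ (-1) (cderiv_inv (upper_neq0 ut)); rewrite mulN1r opprK.
by apply: cderiv_ext ut _ => x _; rewrite mulN1r.
Qed.

(** Logarithmic derivative of the law of eta^2; squaring removes the square root from the automorphy
    factor. *)
Lemma E2_S t : t \in @upper R -> E2 (- t^-1) = t ^+ 2 * E2 t + 12 * t / twopii R.
Proof.
move=> ut; have [c c1 h] := eta_S; have t0 := upper_neq0 ut.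
have sq : {in @upper R, forall x, eta (- x^-1) * eta (- x^-1) = c ^+ 2 * (x * (eta x * eta x))}.
  move=> x ux; rewrite !h//; transitivity (c ^+ 2 * (sqrtc x ^+ 2 * (eta x * eta x))); first by ring.
  by rewrite sqr_sqrtc.
have dE x : x \in @upper R -> cderiv (@eta R) x (twopii R * (E2 x * eta x / 24)).
  by move=> ux; rewrite -D_eta//; apply: holo_cderiv => //; exact: qser_holo (isT : (0 < 1)%N) (eta_qser R).
have dS := cderiv_comp (cderiv_S ut) (dE _ (upper_S ut)).
have := cderiv_uniq (cderiv_ext ut sq (cderivM dS dS))
  (cderivZ (c ^+ 2) (cderivM (cderiv_id t) (cderivM (dE _ ut) (dE _ ut)))).
have := sq t ut; move: (E2 t) (E2 _) (eta_neq0 (upper_S ut)) (eta_neq0 ut) (twopii_neq0 R).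
have c0 : c != 0.
  by apply: contra_eq_neq c1 => ->; rewrite expr0n mulr0 eq_sym oner_neq0.
move: (eta t) (eta _) (twopii R) => a b p E E' b0 a0 p0 h1 h2.
have {}h2 : b * b * p * E' / 12 / t ^+ 2 = c ^+ 2 * (a * a + t * (p * E * (a * a) / 12)).
  transitivity (p * (E' * b / 24) * t ^- 2 * b + b * (p * (E' * b / 24) * t ^- 2)); first by field.
  by rewrite h2; field.
have ca : c ^+ 2 * t * (a * a) != 0 by rewrite !mulf_neq0// ?expf_neq0.
apply: (mulfI ca); transitivity (12 * t ^+ 2 / p * (c ^+ 2 * (a * a + t * (p * E * (a * a) / 12)))); last by field.
by rewrite -h2 h1; field; rewrite p0 t0.
Qed.

Lemma E2_T t : t \in @upper R -> E2 (t + 1) = E2 t.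
Proof. by move=> ut; rewrite (qser_T (E2_qser R) ut) e0 mul1r. Qed.

Lemma E4_T t : t \in @upper R -> E4 (t + 1) = E4 t.
Proof. by move=> ut; rewrite (qser_T (E4_qser R) ut) e0 mul1r. Qed.

(** By [ramanujan], E4 = E2^2 - 12 D E2; differentiating [E2_S] makes the inhomogeneous terms
    cancel. *)
Lemma E4_S t : t \in @upper R -> E4 (- t^-1) = t ^+ 4 * E4 t.
Proof.
move=> ut; have t0 := upper_neq0 ut.
have eE4 x : x \in @upper R -> E4 x = E2 x ^+ 2 - 12 * D (@E2 R) x by move=> /ramanujan ->; ring.
have dE x : x \in @upper R -> cderiv (@E2 R) x (twopii R * D (@E2 R) x).
  exact: holo_cderiv (qser_holo (isT : (0 < 1)%N) (E2_qser R)).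
have dS := cderiv_comp (cderiv_S ut) (dE _ (upper_S ut)).
have d2 := cderivD (cderivM (cderivM (cderiv_id t) (cderiv_id t)) (dE _ ut)) (cderivZ (12 / twopii R) (cderiv_id t)).
have h : {in @upper R, forall x, E2 (- x^-1) = x * x * E2 x + 12 / twopii R * x}.
  by move=> x ux; rewrite E2_S//; ring.
have := cderiv_uniq (cderiv_ext ut h dS) d2.
rewrite !eE4 ?upper_S// h//; move: (E2 t) (D _ t) (D _ _) (twopii_neq0 R) => E D1 D2.
move: (twopii R) => p p0 h2.
have {}h2 : D2 = t ^+ 2 / p * (((1 * t + t * 1) * E + t * t * (p * D1)) + 12 / p * 1).
  by rewrite -h2; field; rewrite p0 t0.
by rewrite h2; field.
Qed.

End Ramanujan.

(** * A q-series with S-invariant absolute value is constant *)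

Section Constancy.
#[local] Opaque e cexp.
Variable R : realType.
Local Notation C := R[i].
Local Notation nc := (@ComplexField.Normc.normc R).
Local Notation tot := (@tot R _).

Lemma pi_ge2 : 2 <= pi :> R.
Proof.
have := @cos_sub1 R (pi / 2); rewrite cos_pihalf sub0r normrN1.
have := pi_gt0 R; move: (pi : R) => p p0 h; nra.
Qed.

Lemma qser_int a f t (m : int) : qser 1 0 a f -> t \in @upper R -> f (t + m%:~R) = f t.
Proof.
case=> _ h ut; have u' : t + m%:~R \in @upper R.
  by rewrite upperE -rcz raddfD /= addr0 -upperE.
rewrite !h//; apply: tot_ext => n; rewrite !qterm1 mulrDr [X in _ * X]eD.
have -> : n%:R * m%:~R = (n%:Z * m)%:~R :> C by rewrite intrM.
by rewrite e_int mulr1.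
Qed.

Variables (f : C -> C) (a : nat -> C).
Hypotheses (hf : qser 1 0 a f)
  (fS : {in @upper R, forall t, nc (f (- t^-1)) = nc (f t)}).

(** As long as Im t < 1/2, translating to |Re t| <= 1/2 gives |t|^2 <= 1/2, so that S at least
    doubles the imaginary part. *)
Let to_half_plane t : t \in @upper R ->
  exists t', 2^-1 <= complex.Im t' /\ nc (f t') = nc (f t).
Proof.
move=> ut; pose y := complex.Im t; have y0 : 0 < y by rewrite -upperE.
have [n hn] : exists n : nat, 2^-1 <= 2 ^+ n * complex.Im t.
  exists (Num.truncn y^-1).+1; rewrite -/y -ler_pdivrMr// [_ / y]mulrC.
  apply: (@le_trans _ _ y^-1); first by rewrite ler_piMr ?invr_ge0 ?(ltW y0)// invf_le1// ler1n.
  rewrite (le_trans (ltW (truncnS_gt _)))// -natrX ler_nat; exact: ltnW (ltn_expl _ _).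
elim: n t ut hn {y y0} => [|n IH] t ut; first by rewrite mul1r; exists t.
move=> hn; have [h|h] := leP 2^-1 (complex.Im t); first by exists t.
pose m : int := - Num.floor (complex.Re t + 2^-1); pose t1 := t + m%:~R.
have E1 : nc (f t1) = nc (f t) by rewrite (qser_int _ hf).
have Im1 : complex.Im t1 = complex.Im t by rewrite /t1 -rcz raddfD /= addr0.
have Re1 : `|complex.Re t1| <= 2^-1.
  have -> : complex.Re t1 = complex.Re t - (Num.floor (complex.Re t + 2^-1))%:~R.
    by rewrite /t1 -rcz raddfD /= /m intrN.
  have := floor_le (complex.Re t + 2^-1); have := floorD1_gt (complex.Re t + 2^-1).
  by rewrite intrD mulr1z; move: (complex.Re t) ((Num.floor (complex.Re t + 2^-1))%:~R : R) => z x; rewrite ler_norml; lra.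
have u1 : t1 \in @upper R by rewrite upperE Im1 -upperE.
rewrite -E1 -fS//; apply: IH; first exact: upper_S.
apply: le_trans hn _; rewrite exprSr -mulrA ler_wpM2l ?exprn_ge0// -Im1.
move: Re1 h; rewrite -Im1; move: u1; rewrite upperE; clear; move: t1 => [x y] /= y0 xr yl.
rewrite opprK ler_pdivlMr; last by rewrite ltr_wpDl ?sqr_ge0// exprn_gt0.
rewrite mulrAC ler_piMl// ?(ltW y0)//.
have : `|x| * `|x| <= 2^-1 * 2^-1 by rewrite ler_pM.
have : y * y <= 2^-1 * 2^-1 by rewrite ler_pM// ltW.
by rewrite -normrM ger0_norm -?expr2 ?sqr_ge0// !expr2; lra.
Qed.

(** The n-th Fourier coefficient on a horizontal segment, from N samples. Aliasing adds the
    coefficients with index congruent to n modulo N, which disappear as N grows. *)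
Let avg N (n : int) t : C := N%:R^-1 * \sum_(k < N) e (- n%:~R * (k : nat)%:R / N%:R) * f (t + (k : nat)%:R / N%:R).

Let upper_shift t (k N : nat) : t \in @upper R -> t + k%:R / N%:R \in @upper R.
Proof. by rewrite !upperE -!rcn -rcV -rcM raddfD /= addr0. Qed.

Let avgE N n t : (0 < N)%N -> t \in @upper R ->
  avg N n t = tot (fun m => if (N%:Z %| m%:Z - n)%Z then a m * qterm 1 0 m t else 0).
Proof.
move=> N0 ut; have NC : N%:R != 0 :> C by rewrite pnatr_eq0 -lt0n.
have [ua h] := hf; have aS k := qterm_asum 0 (isT : (0 < 1)%N) ua (upper_shift k N ut).
apply/esym/tot_eq.
have := hassumZ N%:R^-1 (hassum_sum (index_enum 'I_N) (fun k : 'I_N =>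
  hassumZ (e (- n%:~R * (k : nat)%:R / N%:R)) (asum_tot (aS k)))).
rewrite /avg (eq_bigr (fun k : 'I_N => e (- n%:~R * (k : nat)%:R / N%:R) * f (t + (k : nat)%:R / N%:R))); last first.
  by move=> k _; rewrite h// upper_shift.
apply: hassum_ext => m.
rewrite (eq_bigr (fun k : 'I_N => a m * qterm 1 0 m t * e ((m%:Z - n)%:~R / N%:R * (k : nat)%:R))).
  rewrite -mulr_sumr sum_root_unity_int//; case: ifP => _; last by rewrite !mulr0.
  by field.
move=> k _; rewrite !qterm1 mulrCA -[RHS]mulrA; congr (_ * _); rewrite -!eD; congr e.
by rewrite intrD intrN -pmulrn; field.
Qed.

Let avg_tends n t : t \in @upper R -> tends (fun N => avg N.+1 n t)
  (if n is Posz m then a m * qterm 1 0 m t else 0).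
Proof.
move=> ut; have [ua h] := hf; have aS := qterm_asum 0 (isT : (0 < 1)%N) ua ut.
pose g m : C := if m%:Z == n then a m * qterm 1 0 m t else 0.
have -> : (if n is Posz m then a m * qterm 1 0 m t else 0) = tot g.
  apply/esym/tot_eq; rewrite {}/g; case: n => [n|n]; last exact: hassum_ext (@hassum0 _ _).
  have := @hassum_dirac R (fun m => if m%:Z == n%:Z then a m * qterm 1 0 m t else 0) n.
  by rewrite eqxx; apply=> m; rewrite eqz_nat => /negPf->.
apply: (tends_ext (u := fun N => tot (fun m => if (N.+1%:Z %| m%:Z - n)%Z then a m * qterm 1 0 m t else 0))).
  by exists 0%N => N _; rewrite avgE.
apply: (@tannery _ _ _ _ (fun m => nc (a m * qterm 1 0 m t))) => //.
  by move=> N m; case: ifP => _ //; rewrite nc0 nc_ge0.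
move=> m; apply: tends_ext (tends_cst (g m)); exists (absz (m%:Z - n)) => N hN.
rewrite /g -subr_eq0; case: eqP => [->|/eqP nz]; first by rewrite dvdz0.
case: ifP => // /dvdzP[q hq]; have : (N.+1 <= absz (m%:Z - n)%R)%N; last by rewrite ltnNge hN.
by rewrite hq abszM leq_pmull// absz_gt0; apply: contraNneq nz => q0; rewrite hq q0 mul0r.
Qed.

Let kernel (z : C) : nc z = 1 -> 2 + z + z^-1 = (nc (1 + z) ^+ 2)%:C%C.
Proof.
case: z => x y z1; have xy := esym (@nc_sqr R (x +i* y)%C); rewrite z1 expr1n /= in xy.
rewrite nc_sqr /=; apply/eqP; rewrite eq_complex /=.
apply/andP; split; apply/eqP; rewrite xy ?divr1; lra.
Qed.

(* Averaging [f] against the nonnegative kernel [|1 + z k|^2 / 2], where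
   [z k = c e (- n k / N)], isolates [a 0] and [a n]. *)
Let two_terms n (c : C) B t : (0 < n)%N -> nc c = 1 -> {in @upper R, forall t, nc (f t) <= B} ->
  t \in @upper R -> nc (a 0 + c / 2 * (a n * qterm 1 0 n t)) <= B.
Proof.
move=> n0 c1 hB ut.
have lim : tends (fun N => avg N.+1 0 t + (c / 2 * avg N.+1 n%:Z t + c^-1 / 2 * avg N.+1 (- n%:Z) t))
    (a 0 * qterm 1 0 0 t + (c / 2 * (a n * qterm 1 0 n t) + c^-1 / 2 * 0)).
  apply: tendsD; first exact: (avg_tends 0 ut).
  apply: tendsD; apply: tendsZ; first exact: (avg_tends n ut).
  by have := avg_tends (- n%:Z) ut; case: (n) n0 => // m _; rewrite -NegzE.
move: lim; rewrite qterm1 mul0r e0 mulr1 mulr0 addr0 => lim; apply: tends_le lim _.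
exists n => N nN; pose M := N.+1; pose z (k : nat) : C := c * e (- n%:R * k%:R / M%:R).
have MC : M%:R != 0 :> C by rewrite pnatr_eq0.
have ncz k : nc (z k) = 1.
  rewrite /z ncM c1 mul1r.
  have -> : - n%:R * k%:R / M%:R = (- n%:R * k%:R / M%:R : R)%:C%C by rewrite !rcE.
  by rewrite nc_e /= mulr0 oppr0 expR0.
pose w k : C := 2 + z k + (z k)^-1.
have ncw k : (nc (w k))%:C%C = w k.
  by rewrite /w kernel// nc_real ger0_norm// sqr_ge0.
have sumz (u : int) : absz u = n -> \sum_(k < M) e (u%:~R * (k : nat)%:R / M%:R) = 0 :> C.
  move=> un; have := @sum_root_unity_int R M u isT; case: ifP => [|_ s0].
    by rewrite dvdzE un /= => /(dvdn_leq n0); rewrite leqNgt ltnS nN.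
  by rewrite -[RHS]s0; apply: eq_bigr => i _; congr e; field.
have zV k : (z k)^-1 = c^-1 * e (n%:Z%:~R * k%:R / M%:R).
  by rewrite /z invfM -eN; congr (_ * e _); rewrite -pmulrn; field.
have sumw : \sum_(k < M) nc (w k) = 2 * M%:R.
  apply: complexI; rewrite rmorph_sum (eq_bigr (fun k : 'I_M => w k)); last by move=> i _; exact: ncw.
  rewrite big_split big_split /= sumr_const card_ord (eq_bigr _ (fun (i : 'I_M) _ => zV i)) -!mulr_sumr.
  rewrite (sumz n%:Z)// -[X in _ + X + _](_ : c * \sum_(k < M) e ((- n%:Z)%:~R * (k : nat)%:R / M%:R) = _).
    by rewrite (sumz (- n%:Z)) ?abszN// !mulr0 !addr0 -[LHS]mulr_natr rcM !rcn.
  by congr (c * _); apply: eq_bigr => i _; rewrite intrN -pmulrn.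
have -> : avg M 0 t + (c / 2 * avg M n%:Z t + c^-1 / 2 * avg M (- n%:Z) t) =
    (2 * M%:R)^-1 * \sum_(k < M) w k * f (t + (k : nat)%:R / M%:R).
  rewrite /avg !mulr_sumr -!big_split /=; apply: eq_bigr => i _.
  rewrite intrN opprK oppr0 !mul0r e0 /w zV /z -pmulrn.
  move: (e _) (e _) (f _) => x y F; move: (M%:R : C) MC => m m0; field.
  by rewrite m0 -nc_eq0 c1 oner_neq0.
rewrite (ncM _^-1) ncV (ncM 2) !nc_nat ler_pdivrMl; last by rewrite mulr_gt0 ?ltr0n.
rewrite -sumw mulr_suml; apply: le_trans (nc_sum _ _ _) _; apply: ler_sum => k _.
by rewrite ncM ler_wpM2l ?nc_ge0// hB// upper_shift.
Qed.

Hypothesis a0 : a 0%N != 0.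

Let S := nc (a 0).

(** A phase that aligns the n-th term X with a 0 turns [two_terms] into |a 0| + |X| / 2 <= B. The
    height 1/8 makes |q| = exp (- pi / 4). *)
Let coef_bound n B : (0 < n)%N -> {in @upper R, forall t, nc (f t) <= B} ->
  nc (a n) * expR (- (pi / 4 * n%:R)) <= 2 * (B - S).
Proof.
move=> n0 hB; pose t : C := (8^-1 : R)%:C%C * 'i%C.
have ut : t \in @upper R by rewrite /t upper_scale// upperE /= ltr01.
pose X := a n * qterm 1 0 n t.
have -> : nc (a n) * expR (- (pi / 4 * n%:R)) = nc X.
  rewrite ncM nc_qterm; congr (_ * expR (- _)).
  rewrite /t /= /expo divr1 addr0 mulr1 mul0r addr0 -[_ *+ 2]mulr_natr; by field.
have S0 : S != 0 by rewrite nc_eq0.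
have [X0|X0] := eqVneq X 0.
  have := two_terms n0 (nc1 R) hB ut; rewrite -/X X0 mulr0 addr0 nc0 -/S; lra.
pose c : C := a 0%N / S%:C%C * ((nc X)%:C%C / X).
have c1 : nc c = 1.
  rewrite /c; move: (X) X0 => Y Y0; rewrite !ncM !ncV !nc_real !ger0_norm ?nc_ge0// -/S divff// mul1r.
  by rewrite divff// nc_eq0.
have := two_terms n0 c1 hB ut; rewrite -/X.
have SC : S%:C%C != 0 by rewrite (inj_eq (@complexI R)).
have -> : a 0%N + c / 2 * X = a 0%N / S%:C%C * (S + nc X / 2)%:C%C.
  by rewrite /c !rcE; field; rewrite X0 SC.
move: (X) => Y; rewrite (ncM (_ / _)) (ncM (a 0%N)) ncV !nc_real (ger0_norm (nc_ge0 _)) -/S divff// mul1r.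
rewrite ger0_norm; last by rewrite addr_ge0 ?divr_ge0 ?nc_ge0.
by move: (nc Y) => y; lra.
Qed.

(** At height at least 1/2 the n-th term is at most 2 (B - S) x^n: the exponent pi n exceeds the pi
    n / 4 of [coef_bound] by 3 pi n / 4 >= 3 n / 2. From exp (3/4) >= 7/4 one gets x <= 16/49, and 2
    x / (1 - x) <= 32/33. *)
Let contract B : {in @upper R, forall t, nc (f t) <= B} ->
  {in @upper R, forall t, nc (f t) <= S + 32 / 33 * (B - S)}.
Proof.
move=> hB t0 ut0; have [t [ht <-]] := to_half_plane ut0.
have ut : t \in @upper R by rewrite upperE (lt_le_trans _ ht)// invr_gt0 ltr0n.
pose x := expR (- (3 / 2)) : R.
have x1 : 0 <= x <= 16 / 49.
  rewrite expR_ge0 /= /x expRN -[leRHS]invrK lef_pV2 ?posrE ?invr_gt0 ?expR_gt0//.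
  have -> : 3 / 2 = 3 / 4 + 3 / 4 :> R by field.
  have := @expR_ge1Dx R (3 / 4); rewrite expRD; move: (expR _) => z; nra.
have BS : 0 <= B - S.
  have := coef_bound (isT : (0 < 1)%N) hB; have := nc_ge0 (a 1%N).
  have := expR_ge0 (- (pi / 4 * 1) : R); move: (expR _) (nc _) (B - S) => u v w; nra.
have [ua h] := hf; rewrite h//.
apply: tends_le (hassum_tends (asum_tot (qterm_asum 0 (isT : (0 < 1)%N) ua ut))) _.
exists 1%N => -[|n] // _; rewrite big_ord_recl; apply: le_trans (ncD _ _) _; apply: lerD.
  by rewrite qterm1 mul0r e0 mulr1.
apply: (@le_trans _ _ (\sum_(i < n) 2 * (B - S) * x ^+ i.+1)).
  apply: le_trans (nc_sum _ _ _) _; apply: ler_sum => i _; rewrite lift0.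
  rewrite ncM nc_qterm /expo divr1 addr0.
  have hc := coef_bound (isT : (0 < i.+1)%N) hB.
  apply: (@le_trans _ _ (nc (a i.+1) * expR (- (pi / 4 * i.+1%:R)) * x ^+ i.+1)); last first.
    by rewrite ler_wpM2r ?exprn_ge0 ?expR_ge0.
  rewrite -[leRHS]mulrA ler_wpM2l ?nc_ge0// /x -expRM_natl -expRD ler_expR.
  rewrite -[pi *+ 2]mulr_natr; have := ltr0Sn R i; have := pi_ge2; move: (pi : R) (i.+1%:R : R) ht => p m.
  move: (complex.Im t) => y yl p2 m0.
  have : p * (2^-1 * m) <= p * (y * m) by rewrite ler_wpM2l ?ler_wpM2r// ?ltW//; lra.
  have : 2 * m <= p * m by rewrite ler_wpM2r// ltW.
  lra.
rewrite -mulr_sumr; have : \sum_(i < n) x ^+ i.+1 <= 16 / 33.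
  case/andP: x1 => x0 x1; have hx : x / (1 - x) <= 16 / 33.
    rewrite ler_pdivrMr; lra.
  apply: le_trans hx; rewrite ler_pdivlMr; last lra.
  have -> : \sum_(i < n) x ^+ i.+1 = x * \sum_(i < n) x ^+ i.
    by rewrite mulr_sumr; apply: eq_bigr => i _; rewrite exprS.
  by rewrite -mulrA ler_piMr// mulrC -opprB mulNr -subrX1 opprB gerBl exprn_ge0.
move: (\sum_(i < n) _) (B - S) BS => u v v0; nra.
Qed.

(** Iterating [contract] drives the bound of |f| down to |a 0|, whereupon [coef_bound] forces every
    later coefficient to vanish. *)
Lemma qser_invariant_cst : {in @upper R, forall t, f t = a 0}.
Proof.
(* A first finite bound exists because every value of |f| is taken at height at least 1/2, where the
   coefficients are summable against exp (- pi n). *)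
have [ua h] := hf; have [B hB] : exists B, {in @upper R, forall t, nc (f t) <= B}.
  have [M hM] := urad_asum ua (pi_gt0 R); exists M => t0 ut0.
  have [t [ht <-]] := to_half_plane ut0.
  have ut : t \in @upper R by rewrite upperE (lt_le_trans _ ht)// invr_gt0 ltr0n.
  rewrite h//; apply: tot_le hM => n; rewrite (ncM _ (qterm _ _ _ _)) (ncM _ (_)%:C%C) nc_qterm nc_real ger0_norm ?expR_ge0//.
  rewrite ler_wpM2l ?nc_ge0// ler_expR /expo divr1 addr0 lerN2 -mulr_natr.
  have := pi_gt0 R; have := ler0n R n; move: (pi : R) (n%:R : R) (complex.Im t) ht => p m y yl m0 p0.
  have : p * (2^-1 * m) <= p * (y * m) by rewrite ler_wpM2l ?ler_wpM2r// ltW.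
  rewrite mul1r; lra.
have iter k : {in @upper R, forall t, nc (f t) <= S + (32 / 33) ^+ k * (B - S)}.
  elim: k => [|k IH] t ut; first by rewrite mul1r addrC subrK hB.
  have := contract IH ut; rewrite exprS -[_ * _ * (B - S)]mulrA; move: (_ ^+ k * _) (nc _) => u v; lra.
have a0' n : (0 < n)%N -> a n = 0.
  move=> n0; apply/eqP; rewrite -nc_eq0 -[_ == 0](mulIr_eq0 _ (mulIf (lt0r_neq0 (expR_gt0 (- (pi / 4 * n%:R)))))).
  set v := _ * _; have v0 : 0 <= v by rewrite mulr_ge0 ?nc_ge0 ?expR_ge0.
  have hv k : v <= 2 * (B - S) * (32 / 33) ^+ k.
    apply: le_trans (coef_bound n0 (iter k)) _; rewrite addrAC subrr add0r; lra.
  (* By [natX_le], (k + 1) (32/33)^k <= 33, so [v] is at most a constant divided by k + 1 for every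
     k. *)
  have hk k : k.+1%:R * v <= 66 * (B - S).
    have BS : 0 <= B - S by have := hv 0%N; rewrite mulr1; lra.
    apply: le_trans (ler_wpM2l _ (hv k)) _ => //; rewrite mulrCA.
    have := @natX_le R (32 / 33) k; have -> : (1 - 32 / 33)^-1 = 33 :> R by field.
    move=> /(_ _ _)/(ler_wpM2l (mulr_ge0 (ler0n _ 2) BS)) => hh.
    apply: le_trans (hh _ _) _; lra.
  rewrite eq_le v0 andbT leNgt; apply/negP => vp.
  have := hk (Num.truncn (66 * (B - S) / v)); rewrite -ler_pdivlMr// leNgt.
  by rewrite (le_lt_trans _ (truncnS_gt _)).
move=> t ut; rewrite h//; apply/tot_eq.
have := @hassum_dirac R (fun n => a n * qterm 1 0 n t) 0%N; rewrite qterm1 mul0r e0 mulr1; apply=> n n0.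
by rewrite a0' ?mul0r// lt0n.
Qed.

End Constancy.

(** * Transformation laws under S and T and the Serre derivative *)

Section Laws.
#[local] Opaque e cexp.
Variable R : realType.
Local Notation C := R[i].
Local Notation nc := (@ComplexField.Normc.normc R).

Lemma cderivX (f : C -> C) t l n : cderiv f t l -> cderiv (fun x => f x ^+ n) t (n%:R * f t ^+ n.-1 * l).
Proof.
move=> df; elim: n => [|n IH]; first by rewrite !mul0r; exact: cderiv_cst.
rewrite -natr1; have := cderivM df IH; rewrite (_ : l * f t ^+ n + _ = (n%:R + 1) * f t ^+ n * l).
  by apply: cderiv_local (ltr01 : 0 < 1 :> R) _ => h _; rewrite exprS.
by case: n IH => [|n] _ /=; rewrite ?exprS; ring.
Qed.

Lemma cderiv_sum (I : Type) (s : seq I) (f : I -> C -> C) t (l : I -> C) :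
  (forall i, cderiv (f i) t (l i)) ->
  cderiv (fun x => \sum_(i <- s) f i x) t (\sum_(i <- s) l i).
Proof.
move=> df; elim: s => [|i s IH].
  rewrite big_nil; apply: cderiv_local (ltr01 : 0 < 1 :> R) _ (cderiv_cst 0 t) => h _.
  by rewrite big_nil.
rewrite big_cons; apply: cderiv_local (ltr01 : 0 < 1 :> R) _ (cderivD (df i) IH) => h _.
by rewrite big_cons.
Qed.

(** Both roots lie in the right half-plane, which bounds |s' + s| from below by Re s and controls s'
    - s = h / (s' + s). *)
Lemma sqrtc_cderiv (t : C) : t \in @upper R -> cderiv (@sqrtc R) t ((2 * sqrtc t)^-1).
Proof.
move=> ut; set s := sqrtc t; have [r0 _] := sqrtc_upper ut; rewrite -/s in r0.
have s0 : s != 0 by apply: sqrtc_neq0.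
pose r := complex.Re s; have y0 : 0 < complex.Im t by rewrite -upperE.
apply: (@cderiv_bound R _ _ _ ((2 * r ^+ 3)^-1) (complex.Im t)) => // h hh.
have uh := upper_near ut hh; set s' := sqrtc (t + h); have [r0' _] := sqrtc_upper uh.
have le_r z : r <= complex.Re z -> r <= nc z by move=> zr; rewrite (le_trans zr)// (le_trans (ler_norm _))// nc_Re.
have ls : r <= nc s by apply: le_r.
have lss : r <= nc (s' + s) by apply: le_r; rewrite raddfD /= lerDr ltW.
have ss0 : s' + s != 0 by rewrite -nc_gt0 (lt_le_trans _ lss).
have hE : h = (s' - s) * (s' + s) by rewrite -subr_sqr !sqr_sqrtc addrC addKr.
have -> : s' - s - (2 * s)^-1 * h = - (h ^+ 2 * ((2 * s)^-1 * ((s' + s)^-1) ^+ 2)).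
  by rewrite hE; field; rewrite s0 ss0.
rewrite ncN (ncM (h ^+ 2)) ncX mulrC ler_wpM2r ?sqr_ge0//.
rewrite (ncM (_^-1)) ncX !ncV (ncM 2) nc_nat (_ : 2 * r ^+ 3 = 2 * r * r ^+ 2); last by ring.
rewrite (invfM (2 * r)) -[(r ^+ 2)^-1]exprVn ler_pM ?sqr_ge0 ?invr_ge0 ?mulr_ge0 ?nc_ge0//.
  rewrite lef_pV2 ?posrE ?mulr_gt0 ?(lt_le_trans r0 ls)//; lra.
by rewrite ler_pXn2r ?nnegrE ?invr_ge0 ?nc_ge0 ?(ltW r0)// lef_pV2 ?posrE ?(lt_le_trans r0 lss).
Qed.

(** What the Serre derivative needs to know about S and T. The factor [j] has weight 1/2, its square
    being c t + d; hence [phi] has derivative j^-4, and [E2] and [E4] acquire j^4 and j^8. *)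
Definition equivariant (phi j : C -> C) := exists2 j' : C -> C,
  {in @upper R, forall t, phi t \in @upper R /\ j t != 0} &
  {in @upper R, forall t, [/\ cderiv phi t (j t ^- 4), cderiv j t (j' t),
    E2 (phi t) = j t ^+ 4 * E2 t + 24 * j t ^+ 3 * j' t / twopii R &
    E4 (phi t) = j t ^+ 8 * E4 t]}.

Lemma equivariant_S : equivariant (fun t => - t^-1) (@sqrtc R).
Proof.
exists (fun t => (2 * sqrtc t)^-1) => t ut; first by split; [exact: upper_S|exact: sqrtc_neq0].
have s0 := sqrtc_neq0 ut; have sq := sqr_sqrtc t.
have s4 : sqrtc t ^+ 4 = t ^+ 2 by rewrite -{2}sq -exprM.
have s8 : sqrtc t ^+ 8 = t ^+ 4 by rewrite -{2}sq -exprM.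
rewrite s4 s8 E2_S// E4_S//; split=> //; last 1 first.
- congr (_ + _); rewrite -{1}sq; move: (sqrtc t) s0 (twopii R) (twopii_neq0 R) => s s0 p p0.
  by field; rewrite s0 p0.
- exact: cderiv_S.
- exact: sqrtc_cderiv.
Qed.

Lemma upper_T (t : C) : t \in @upper R -> t + 1 \in @upper R.
Proof. by rewrite !upperE raddfD /= addr0. Qed.

Lemma equivariant_T : equivariant (fun t => t + 1) (fun=> 1).
Proof.
exists (fun=> 0) => t ut; first by split; [exact: upper_T|exact: oner_neq0].
rewrite !expr1n invr1 E2_T// E4_T// mulr0 mul0r addr0 !mul1r; split=> //; last exact: cderiv_cst.
by have := cderivD (cderiv_id t) (cderiv_cst 1 t); rewrite addr0.
Qed.

Section Vector.
Variable d : nat.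
Implicit Types (F G : C -> 'cV[C]_d) (M N : 'M[C]_d).

(** Since [j] is the factor of weight 1/2, [w] is twice the weight. *)
Definition vlaw (phi j : C -> C) (w : nat) M F :=
  {in @upper R, forall t, F (phi t) = j t ^+ w *: (M *m F t)}.

Definition vholo F := forall i, holomorphic (fun t => F t i 0).

Definition vqexp h F := forall i, qexp h (fun t => F t i 0).

(** The derivative of j^w and the inhomogeneous term of [E2], multiplied by w / 24, cancel. *)
Lemma vlaw_serre phi j w M F : equivariant phi j -> vholo F -> vlaw phi j w M F ->
  vlaw phi j (w + 4) M (componentwise (serre (w%:R / 2)) F).
Proof.
move=> [j' h1 h2] hF lF t ut; have [up j0] := h1 t ut; have [dphi dj e2 e4] := h2 t ut.
apply/matrixP => i o; rewrite !ord1 {o} !mxE /serre.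
pose f m t := F t m 0.
have dF x m : x \in @upper R -> cderiv (f m) x (twopii R * D (f m) x).
  by move=> ux; exact: holo_cderiv (hF m) ux.
have E m : {in @upper R, (fun x => j x ^+ w * \sum_n M m n * f n x) =1 (fun x => f m (phi x))}.
  by move=> x ux; rewrite /f lF// !mxE.
have := cderiv_uniq (cderiv_ext ut (E i) (cderivM (cderivX w dj)
   (cderiv_sum (index_enum _) (fun n => cderivZ (M i n) (dF t n ut)))))
  (cderiv_comp dphi (dF _ i up)).
rewrite -/(f i) -/(f i (phi t)) -(E i t ut) e2.
have -> : \sum_n M i n * (componentwise (serre (w%:R / 2)) F t) n 0 =
   \sum_n M i n * D (f n) t - w%:R / 24 * E2 t * \sum_n M i n * f n t.
  rewrite mulr_sumr -sumrB; apply: eq_bigr => n _; rewrite mxE /serre -/(f n) /f.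
  by move: (D _ t) (F t n 0) (M i n) (w%:R : C) => x y z u; field.
have -> : \sum_n M i n * (twopii R * D (f n) t) = twopii R * \sum_n M i n * D (f n) t.
  by rewrite mulr_sumr; apply: eq_bigr => n _; rewrite mulrCA.
move: (\sum_n _) (\sum_n _) (D (f i) (phi t)) => A B L.
have -> : w%:R * j t ^+ w.-1 * j' t = w%:R * j t ^+ w / j t * j' t.
  by case: (w) => [|n]; rewrite ?mul0r// exprS /=; field.
rewrite exprD; move: (j t ^+ w) (w%:R : C) (j t) (j' t) (E2 t) (twopii R) j0 (twopii_neq0 R).
move=> W u x x' E2 p x0 p0 h.
have -> : L = x ^+ 4 / p * (p * L * x ^- 4) by field; rewrite x0 p0.
by rewrite -h; field; rewrite x0 p0.
Qed.

Lemma vlawD phi j w M F G : vlaw phi j w M F -> vlaw phi j w M G ->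
  vlaw phi j w M (fun t => F t + G t).
Proof. by move=> hF hG t ut; rewrite hF// hG// mulmxDr scalerDr. Qed.

Lemma vlawZ phi j w w' M F (f : C -> C) : vlaw phi j w M F ->
  {in @upper R, forall t, f (phi t) = j t ^+ w' * f t} ->
  vlaw phi j (w + w') M (fun t => f t *: F t).
Proof.
by move=> hF hf t ut; rewrite hF// hf// -scalemxAr !scalerA exprD; congr (_ *: _); ring.
Qed.

Lemma pairing_law phi j w w' M N F G : vlaw phi j w M F -> vlaw phi j w' N G ->
  M^T *m N = 1%:M ->
  {in @upper R, forall t, pairing F G (phi t) = j t ^+ (w + w') * pairing F G t}.
Proof.
move=> hF hG MN t ut; rewrite /pairing hF// hG//.
have -> : (j t ^+ w *: (M *m F t))^T = j t ^+ w *: (M *m F t)^T by apply/matrixP => a b; rewrite !mxE.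
rewrite -scalemxAl -scalemxAr scalerA -exprD.
by rewrite mxE trmx_mul -mulmxA [_^T *m (N *m _)]mulmxA MN mul1mx.
Qed.

Lemma qexp_E2 h : (0 < h)%N -> qexp h (@E2 R).
Proof.
move=> h0; rewrite -[h]mul1n; apply: qexp_dil => //; apply: (@qser_qexp R 1 0) => //.
by rewrite mul0r; exact: E2_qser.
Qed.

Lemma qexp_E4 h : (0 < h)%N -> qexp h (@E4 R).
Proof.
move=> h0; rewrite -[h]mul1n; apply: qexp_dil => //; apply: (@qser_qexp R 1 0) => //.
by rewrite mul0r; exact: E4_qser.
Qed.

Lemma qexp_serre h kappa (f : C -> C) : (0 < h)%N -> qexp h f -> qexp h (serre kappa f).
Proof.
move=> h0 hf; apply: qexp_ext (qexpD h0 (qexp_D h0 hf)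
  (qexpM h0 (qexpZ (- (kappa / 12)) h0 (qexp_E2 h0)) hf)) => t _.
by rewrite /serre !mulNr.
Qed.

Lemma vqexp_holo h F : (0 < h)%N -> vqexp h F -> vholo F.
Proof. by move=> h0 hF i; apply: qexp_holo (hF i). Qed.

Lemma vqexp_serre h kappa F : (0 < h)%N -> vqexp h F -> vqexp h (componentwise (serre kappa) F).
Proof.
move=> h0 hF i; apply: qexp_ext (qexp_serre kappa h0 (hF i)) => t _.
by rewrite mxE.
Qed.

Lemma pairing_qexp h F G : (0 < h)%N -> vqexp h F -> vqexp h G -> qexp h (pairing F G).
Proof.
move=> h0 hF hG; apply: qexp_ext (qexp_sum (index_enum 'I_d) h0 (fun i => qexpM h0 (hF i) (hG i))) => t _.
by rewrite /pairing mxE; apply: eq_bigr => i _; rewrite mxE.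
Qed.

Lemma det_law phi j M (W : C -> 'M[C]_d) (w : 'I_d -> nat) :
  (forall r, vlaw phi j (w r) M (fun t => col r (W t))) ->
  {in @upper R, forall t, \det (W (phi t)) = \prod_r j t ^+ w r * (\det M * \det (W t))}.
Proof.
move=> lW t ut; have -> : W (phi t) = M *m W t *m diag_mx (\row_r j t ^+ w r).
  apply/matrixP => i r; rewrite mul_mx_diag [RHS]mxE.
  have := lW r t ut => /matrixP/(_ i 0); rewrite !mxE => ->; rewrite mulrC; congr (_ * _).
  by apply: eq_bigr => n _; rewrite !mxE.
rewrite !det_mulmx det_diag mulrC; congr (_ * _).
by apply: eq_bigr => r _; rewrite mxE.
Qed.

End Vector.
End Laws.

(** The matrix factors into a Vandermonde matrix and a triangular coefficient matrix with ones on
    the diagonal. It will be applied to the leading coefficients of the Wronskian. *)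
Lemma det_monic_eval (F : fieldType) n (x : 'I_n -> F) (p : nat -> {poly F}) : injective x ->
  (forall r, p r \is monic /\ size (p r) = r.+1) ->
  \det (\matrix_(i < n, r < n) (p r).[x i]) != 0.
Proof.
move=> xI hp; pose V := Vandermonde n (\row_i x i); pose L := \matrix_(m < n, r < n) (p r)`_m.
have -> : \matrix_(i, r) (p r).[x i] = V^T *m L.
  apply/matrixP => i r; rewrite !mxE (@horner_coef_wide _ n); last by rewrite (hp r).2.
  by apply: eq_bigr => m _; rewrite !mxE mulrC.
rewrite det_mulmx det_tr det_Vandermonde mulf_neq0//.
  apply/prodf_neq0 => i _; apply/prodf_neq0 => m im; rewrite !mxE subr_eq0.
  by apply: contraTneq im => /xI->; rewrite ltnn.
rewrite -det_tr det_trig.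
  apply/prodf_neq0 => i _; rewrite !mxE; have [/monicP + sz] := hp i.
  by rewrite lead_coefE sz /= => ->; rewrite oner_neq0.
by apply/is_trig_mxP => i m im; rewrite !mxE nth_default// (hp i).2.
Qed.

(** * Laws of the theta vector and nonvanishing of its Wronskian *)

Section WronskianNonvanishing.
#[local] Opaque e cexp.
Variable R : realType.
Local Notation C := R[i].
Local Notation nc := (@ComplexField.Normc.normc R).
Local Notation tot := (@tot R _).
Variable k : nat.
Hypothesis k2 : (2 <= k)%N.
Let d := k.-1.
Local Notation l := (ell k).

Let kE : k = d.+1. Proof. by rewrite /d prednK// ltnW. Qed.
Let lE : l = d.*2.+1. Proof. by rewrite /ell kE; lia. Qed.
Let d0 : (0 < d)%N. Proof. by rewrite /d; case: (k) k2 => [|[]]. Qed.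
Let l_odd : odd l. Proof. by rewrite lE /= odd_double. Qed.
Let l0 : (0 < l)%N. Proof. by rewrite lE. Qed.
Let lC : l%:R != 0 :> C. Proof. by rewrite pnatr_eq0 -lt0n. Qed.
Let lR : l%:R != 0 :> R. Proof. by rewrite pnatr_eq0 -lt0n. Qed.
Let jl (j : 'I_d) : (2 * j.+1 < l)%N. Proof. by rewrite lE; have := ltn_ord j; lia. Qed.

Let amp : C := (Num.sqrt (l%:R / 2 : R))%:C%C.

(** Completing the square gives [Theta] = i [tht], where i = e (1/4) comes from the halves in n (z +
    1/2) with n = m + 1/2; it cancels the - i of [Hvec]. *)
Lemma Hvec_tht t (j : 'I_k.-1) : t \in @upper R -> @Hvec R k t j 0 = amp * tht l j.+1 t.
Proof.
move=> ut; rewrite mxE /Theta /thetaJ -/amp.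
pose g (m : int) : C := e (m%:~R / 2) * e ((2 * l%:R * m%:~R + l%:R + 2 * j.+1%:R) ^+ 2 / (8 * l%:R) * t).
have ag : asum g by exact: tht_asum.
have lt : (fun m : int => let n : C := m%:~R + 2^-1 in e (n ^+ 2 / 2 * (l%:R * t) + n * (j.+1%:R * t + 2^-1))) =1
    (fun m => 'i%C * e (- (j.+1%:R ^+ 2 / (2 * l%:R) * t)) * g m).
  move=> m; have -> : 'i%C = e (4^-1 : C).
    by have := e_quarter R; rewrite eN => /(congr1 (fun z => z^-1)); rewrite invrK invrN invCi opprK.
  rewrite /g -!eD; congr e; rewrite /=; move: (m%:~R : C) (j.+1%:R : C) (l%:R : C) lC => x y z z0.
  by field.
rewrite csumZ_tot; last by apply: asum_ext (asumZ _ ag) => m; exact: esym (lt m).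
rewrite (tot_ext lt) totZ// -/(tht l j.+1 t) eN.
have ii : - 'i%C * 'i%C = 1 :> C by rewrite mulNr -expr2 sqr_i opprK.
move: (e_neq0 (j.+1%:R ^+ 2 / (2 * l%:R) * t)); move: (e _) (tht _ _ _) => x y x0.
transitivity (- 'i%C * 'i%C * amp * y); last by rewrite ii mul1r.
by field.
Qed.

Let expH (j : 'I_d) : R := (l%:R - 2 * j.+1%:R) ^+ 2 / (8 * l%:R).

Lemma Hvec_qlead (j : 'I_k.-1) : qlead (expH j) (amp * - 1) (fun t => @Hvec R k t j 0).
Proof.
have := qleadZ amp (@tht_qlead R l j.+1 l_odd (ltn0Sn j) (jl j)).
apply: qlead_ext => t ut.
by rewrite Hvec_tht.
Qed.

Let h := (8 * l)%N.
Let h0 : (0 < h)%N. Proof. by rewrite /h muln_gt0 l0. Qed.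

Lemma Hvec_vqexp : vqexp h (@Hvec R k).
Proof.
move=> j; have [a ha _] := Hvec_qlead j.
have := qser_dil (isT : (0 < 1)%N) h0 ha; rewrite mul1n.
have -> : expH j = ((l - 2 * j.+1) ^ 2)%:R / h%:R.
  rewrite /expH /h natrX (natrB _ (ltnW (jl j))) (natrM _ 2) (natrM _ 8) //.
exact: qser_qexp.
Qed.

Definition SmatC : 'M[C]_k.-1 := e (- 8^-1) *: \matrix_(j < k.-1, m < k.-1)
  (2 * (-1) ^+ (k + j.+1 + m.+1) / Num.sqrt (l%:R : R)
    * sin (2 * pi * j.+1%:R * m.+1%:R / l%:R))%:C%C.

Definition TmatC : 'M[C]_k.-1 := diag_mx (\row_(j < k.-1)
  e ((l%:R - 2 * j.+1%:R) ^+ 2 / (8 * l%:R))).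

Lemma Hvec_S : vlaw (fun t => - t^-1) (@sqrtc R) 1 SmatC (@Hvec R k).
Proof.
move=> t ut; apply/matrixP => j o; rewrite !ord1 {o} Hvec_tht ?upper_S// lE tht_S//; last first.
  by have := ltn_ord j; rewrite /d.
rewrite mxE mxE -/d expr1.
rewrite (eq_bigr (fun m : 'I_d => (2 * (-1) ^+ (k + j.+1 + m.+1) * sin (2 * pi * j.+1%:R * m.+1%:R / l%:R))%:C%C * tht l m.+1 t)); last first.
  by move=> m _; rewrite -lE -kE.
rewrite !mulr_sumr; apply: eq_bigr => m _; rewrite Hvec_tht// !mxE -lE.
have -> : 2 * (-1) ^+ (k + j.+1 + m.+1) / Num.sqrt l%:R * sin (2 * pi * j.+1%:R * m.+1%:R / l%:R) =
   (Num.sqrt l%:R)^-1 * (2 * (-1) ^+ (k + j.+1 + m.+1) * sin (2 * pi * j.+1%:R * m.+1%:R / l%:R)) :> R.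
  by ring.
rewrite [in RHS]rcM; move: (_%:C%C) (_%:C%C) (e _) (sqrtc t) (tht _ _ _) => x y z s w; ring.
Qed.

Lemma Hvec_T : vlaw (fun t => t + 1) (fun=> 1) 1 TmatC (@Hvec R k).
Proof.
move=> t ut; apply/matrixP => j o; rewrite !ord1 {o} expr1n scale1r mul_diag_mx.
have [a ha _] := Hvec_qlead j; rewrite (qser_T ha ut) [RHS]mxE; congr (_ * _).
rewrite mxE; congr e; by rewrite /expH rcM rcX rcB rcV !rcM !rcn.
Qed.

Let kappa (r : nat) : C := 2^-1 + 2 * r%:R.

Lemma HderS r t (i : 'I_k.-1) : @Hder R k r.+1 t i 0 = serre (kappa r) (fun t => @Hder R k r t i 0) t.
Proof. by rewrite mxE. Qed.

Lemma Hder_vqexp r : vqexp h (@Hder R k r).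
Proof. by elim: r => [|r IH]; [exact: Hvec_vqexp|exact: vqexp_serre]. Qed.

Lemma Hder_law phi j M r : equivariant phi j -> vlaw phi j 1 M (@Hvec R k) ->
  vlaw phi j (1 + 4 * r) M (@Hder R k r).
Proof.
move=> ej h1; elim: r => [|r IH]; first by rewrite muln0.
have -> : (1 + 4 * r.+1 = 1 + 4 * r + 4)%N by lia.
have := vlaw_serre ej (vqexp_holo h0 (@Hder_vqexp r)) IH.
by have -> : (1 + 4 * r)%:R / 2 = 2^-1 + 2 * r%:R :> C by rewrite natrD natrM; field.
Qed.

(** On a leading power q^x the Serre derivative of weight kappa acts as x - kappa / 12, so r of them
    multiply the leading coefficient by [pol r] at x. *)
Let pol (r : nat) : {poly C} := \prod_(q < r) ('X - (kappa q / 12)%:P).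

Let pol_monic r : pol r \is monic. Proof. by apply: monic_prod => q _; exact: monicXsubC. Qed.

Let pol_size r : size (pol r) = r.+1.
Proof. by rewrite /pol size_prod_XsubC /index_enum -enumT size_enum_ord. Qed.

Lemma qlead_serre s c (f : C -> C) x : qlead s c f -> qlead s ((s%:C%C - x / 12) * c) (serre x f).
Proof.
move=> hf; have hE : qlead 0 (1 : C) (@E2 R).
  exists (fun n => (if n == 0%N then 1 else 0) + - 24 * sig R 1 n); first exact: E2_qser.
  by rewrite /= mulr0 addr0.
have h2 := qleadM hE hf; rewrite add0r mul1r in h2.
have := qleadD (qlead_D hf) (qleadZ (- (x / 12)) h2); rewrite -mulrDl; apply: qlead_ext => t _.
by rewrite /serre mulNr mulrA.
Qed.

Lemma Hder_qlead r (i : 'I_k.-1) :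
  qlead (expH i) (amp * -1 * (pol r).[(expH i)%:C%C]) (fun t => @Hder R k r t i 0).
Proof.
elim: r => [|r IH]; first by rewrite /pol big_ord0 hornerC mulr1; exact: Hvec_qlead.
have := qlead_serre (kappa r) IH.
have -> : ((expH i)%:C%C - kappa r / 12) * (amp * -1 * (pol r).[(expH i)%:C%C]) =
    amp * -1 * (pol r.+1).[(expH i)%:C%C].
  rewrite /pol big_ord_recr /= hornerM hornerXsubC; ring.
by apply: qlead_ext => t _; rewrite HderS.
Qed.

(** The numbers l - 2 j are positive and distinct, hence so are their squares. *)
Let expH_inj : injective (fun i : 'I_d => (expH i)%:C%C : C).
Proof.
move=> i j /complexI; have [hi hj] := (jl i, jl j); rewrite /expH => /(mulIf _) E.
have {E} : (l%:R - 2 * i.+1%:R : R) ^+ 2 = (l%:R - 2 * j.+1%:R) ^+ 2.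
  by apply: E; rewrite invr_eq0 mulf_neq0.
move/eqP; rewrite eqrXn2// ?subr_ge0 -?natrM ?ler_nat ?(ltnW hi) ?(ltnW hj)//.
move=> /eqP/addrI/oppr_inj/eqP; rewrite eqr_nat => /eqP ij; apply: val_inj => /=; lia.
Qed.

(** 24 times the sum of the leading exponents, and also the sum of the doubled weights 1 + 4 r: the
    power of [eta] that matches the determinant both at the cusp and in weight. *)
Let m := (d * (d.*2.-1))%N.

(** In reverse order the numbers l - 2 j run through 1, 3, ..., 2 d - 1, and the sum of these
    squares is d (4 d^2 - 1) / 3 with 4 d^2 - 1 = (2 d - 1) l. *)
Let sum_expH : \sum_(i < d) expH i = m%:R / 24.
Proof.
have sq n : \sum_(i < n) (2 * i%:R + 1) ^+ 2 = n%:R * (4 * n%:R ^+ 2 - 1) / 3 :> R.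
  elim: n => [|n IH]; first by rewrite big_ord0 !mul0r.
  by rewrite big_ord_recr /= IH -natr1; field.
rewrite (eq_bigr (fun i : 'I_d => (2 * (rev_ord i : nat)%:R + 1) ^+ 2 / (8 * l%:R))); last first.
  move=> i _; rewrite /expH; congr (_ ^+ 2 / _); rewrite lE /= natrB ?ltn_ord//.
  by rewrite -[d.*2.+1%:R]natr1 -muln2 natrM -[i.+1%:R]natr1; ring.
rewrite -mulr_suml (_ : \sum_(i < d) (2 * (rev_ord i : nat)%:R + 1) ^+ 2 = \sum_(i < d) (2 * i%:R + 1) ^+ 2).
  2: by rewrite [RHS](reindex_inj rev_ord_inj).
rewrite sq.
have -> : m%:R = d%:R * (2 * d%:R - 1) :> R.
  by rewrite /m natrM -subn1 natrB ?double_gt0// -muln2 natrM [_ * 2]mulrC.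
have -> : l%:R = 2 * d%:R + 1 :> R by rewrite lE -natr1 -muln2 natrM mulrC.
have : 2 * d%:R + 1 != 0 :> R by rewrite lt0r_neq0// ltr_wpDl// mulr_ge0.
by move: (d%:R : R) => x x0; field.
Qed.

Lemma det_qlead (n : nat) (s : 'I_n -> R) (c : 'I_n -> 'I_n -> C) (W : C -> 'M[C]_n) :
  (forall i r, qlead (s i) (c i r) (fun t => W t i r)) ->
  qlead (\sum_i s i) (\det (\matrix_(i, r) c i r)) (fun t => \det (W t)).
Proof.
move=> hW; rewrite /determinant.
have := qlead_sum (index_enum _) (fun p : 'S_n => qleadZ ((-1) ^+ p : C) (qlead_prod (index_enum _) (fun i => hW i (p i)))).
rewrite (eq_bigr (fun p : 'S_n => (-1) ^+ p * \prod_i (\matrix_(i, r) c i r) i (p i))); last first.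
  by move=> p _; congr (_ * _); apply: eq_bigr => i _; rewrite mxE.
by apply: qlead_ext.
Qed.

(** Stated with [etaV] so that it also displays the inverse determinant as a multiple of
    [etaV t ^+ m], from which the dual vectors get their q-expansion. *)
Lemma det_Wronskian_eta : nc (\det SmatC) = 1 -> exists2 a : C, a != 0 &
  {in @upper R, forall t, \det (@Wronskian R k t) * etaV t ^+ m = a}.
Proof.
move=> nS; pose W := @Wronskian R k.
have hW (i r : 'I_k.-1) : qlead (expH i) (amp * -1 * (pol r).[(expH i)%:C%C]) (fun t => W t i r).
  by apply: qlead_ext (Hder_qlead r i) => x _; rewrite mxE.
have hV : qlead (- 24^-1) (- 1 * 1 : C) (@etaV R) by exists (fun n => - 1 * expser (@sig R 1) n); first exact: etaV_qser.
have := qleadM (det_qlead hW) (qlead_prod (index_enum 'I_m) (fun=> hV)).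
have -> : \sum_(i < k.-1) expH i + \sum_(i <- index_enum 'I_m) - 24^-1 = 0 :> R.
  by rewrite sum_expH sumr_const card_ord -[X in _ + X]mulr_natr; ring.
case=> a ha ea.
have a0 : a 0%N != 0.
  rewrite ea mulf_neq0//; last by rewrite prodf_seq_neq0; apply/allP => i _; rewrite /= mulr1 oppr_eq0 oner_neq0.
  have -> : \matrix_(i, r) (amp * -1 * (pol r).[(expH i)%:C%C]) =
      (amp * -1) *: \matrix_(i < k.-1, r < k.-1) (pol r).[(expH i)%:C%C] by apply/matrixP => i r; rewrite !mxE.
  rewrite detZ mulf_neq0//; last exact: det_monic_eval.
  rewrite expf_neq0// mulf_neq0 ?oppr_eq0 ?oner_neq0// /amp -[0]/((0 : R)%:C%C) (inj_eq (@complexI R)).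
  by rewrite sqrtr_eq0 -ltNge divr_gt0// ltr0n.
exists (a 0%N) => // t ut; have -> : etaV t ^+ m = \prod_(i <- index_enum 'I_m) etaV t.
  by rewrite prodr_const card_ord.
move: t ut; apply: (@qser_invariant_cst R _ a ha _ a0) => x ux.
have lW (r : 'I_k.-1) : vlaw (fun t => - t^-1) (@sqrtc R) (1 + 4 * r) SmatC (fun t => col r (W t)).
  move=> z uz; have := Hder_law r (equivariant_S R) Hvec_S uz.
  have cE y : col r (W y) = @Hder R k r y by apply/matrixP => i o; rewrite !mxE ord1.
  by rewrite !cE.
rewrite (det_law lW ux) -expr_sum.
have -> : (\sum_(r < k.-1) (1 + 4 * r) = m)%N.
  rewrite big_split sum1_card card_ord -big_distrr /= -(big_mkord xpredT id) /m.
  have : (2 * \sum_(0 <= i < k.-1) i = k.-1 * k.-2)%N.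
    elim: (k.-1) => [|n IH]; first by rewrite big_nil.
    rewrite big_nat_recr//= mulnDr IH; case: (n) => // p; rewrite /=; lia.
  rewrite -/d; move: (\sum_(0 <= i < d) i)%N d0 => s; rewrite -/d; case: (d) => // n _ /=; nia.
have [c c1 hc] := eta_S R; have ncc : nc c = 1.
  have : nc ('i%C * c ^+ 2) = 1 by rewrite c1 nc1.
  rewrite ncM ncX /= expr0n expr1n add0r sqrtr1 mul1r => /eqP.
  by rewrite sqrp_eq1 ?nc_ge0// => /eqP.
have eV y : y \in @upper R -> etaV y = (eta y)^-1.
  by move=> uy; rewrite -[LHS](mulKf (eta_neq0 uy)) eta_mulV// mulr1.
rewrite !prodr_const card_ord !eV ?upper_S// hc//.
rewrite !invfM !exprMn !ncM !ncX !ncV nS ncc invr1 expr1n !mul1r.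
have : nc (sqrtc x) != 0 by rewrite nc_eq0 sqrtc_neq0.
move: (nc (sqrtc x)) (nc (\det _)) ((nc (eta x))^-1 ^+ m) => y z u y0.
by rewrite exprVn mulrACA mulfV ?mul1r// expf_neq0.
Qed.

End WronskianNonvanishing.

(** * Generation of SL_2(Z) by S and T *)

Section Generators.

Let S2 := mx22 0 (-1) 1 0.
Let T2 := mx22 1 1 0 1.

Lemma mx2_eq (A B : 'M[int]_2) : A 0 0 = B 0 0 -> A 0 1 = B 0 1 ->
  A 1 0 = B 1 0 -> A 1 1 = B 1 1 -> A = B.
Proof.
move=> h00 h01 h10 h11; apply/matrixP.
have two (i : 'I_2) : i = 0 \/ i = 1.
  by case: i => [[|[|]]] // h; [left|right]; apply: val_inj.
by move=> i j; case: (two i) => ->; case: (two j) => ->.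
Qed.

Lemma mul_mx2 (A B : 'M[int]_2) i j : (A *m B) i j = A i 0 * B 0 j + A i 1 * B 1 j.
Proof.
rewrite mxE big_ord_recl big_ord_recl big_ord0 addr0; congr (_ + A i _ * B _ j); exact: val_inj.
Qed.

Lemma det_mx2 (A : 'M[int]_2) : \det A = A 0 0 * A 1 1 - A 0 1 * A 1 0.
Proof.
rewrite (expand_det_row _ 0) big_ord_recl big_ord_recl big_ord0 addr0 /cofactor !det_mx11 !mxE /=.
rewrite expr0 expr1 mul1r mulN1r mulrN; congr (A _ _ * A _ _ - A _ _ * A _ _); exact: val_inj.
Qed.

(** The Euclidean algorithm on the first column. Only left products by S and T are allowed, so their
    inverses must be written as positive words. *)
Lemma SL2_ind (P : 'M[int]_2 -> Prop) : P 1%:M -> (forall g, \det g = 1 -> P g -> P (S2 *m g)) ->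
  (forall g, \det g = 1 -> P g -> P (T2 *m g)) -> forall g, \det g = 1 -> P g.
Proof.
move=> P1 PS PT.
have dS g : \det g = 1 -> \det (S2 *m g) = 1 by move=> dg; rewrite det_mulmx dg mulr1 det_mx2 !mxE.
have dT g : \det g = 1 -> \det (T2 *m g) = 1 by move=> dg; rewrite det_mulmx dg mulr1 det_mx2 !mxE.
pose V (n : int) := mx22 1 n 0 1.
have dV n g : \det g = 1 -> \det (V n *m g) = 1.
  by move=> dg; rewrite det_mulmx dg mulr1 det_mx2 !mxE /= mulr0 subr0.
have VD m n : V m *m V n = V (m + n).
  by apply: mx2_eq; rewrite mul_mx2 !mxE /=; ring.
have PTN g : \det g = 1 -> P g -> P (V (-1) *m g).
  move=> dg Pg.
  have TS : T2 *m S2 = mx22 1 (-1) 1 0 by apply: mx2_eq; rewrite !mul_mx2 !mxE.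
  have TSTS : T2 *m (S2 *m (T2 *m S2)) = mx22 0 (-1) 1 (-1).
    by rewrite mulmxA TS; apply: mx2_eq; rewrite !mul_mx2 !mxE.
  have SSS : S2 *m (S2 *m S2) = mx22 0 1 (-1) 0.
    have -> : S2 *m S2 = mx22 (-1) 0 0 (-1) by apply: mx2_eq; rewrite !mul_mx2 !mxE.
    by apply: mx2_eq; rewrite !mul_mx2 !mxE.
  (* The inverse of T is the positive word S^3 T S T S. *)
  have -> : V (-1) = S2 *m (S2 *m S2) *m (T2 *m (S2 *m (T2 *m S2))).
    by rewrite SSS TSTS; apply: mx2_eq; rewrite !mul_mx2 !mxE.
  by rewrite -!mulmxA; do ![apply: (PS)|apply: (PT)|apply: (dS)|apply: (dT)].
have V0 : V 0 = 1%:M by apply: mx2_eq; rewrite !mxE.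
have PV n g : \det g = 1 -> P g -> P (V n *m g).
  case: n => n; elim: n g => [|n IH] g dg Pg.
  - by rewrite V0 mul1mx.
  - have -> : V n.+1 = T2 *m V n by rewrite [T2]/(V 1) VD; congr V; lia.
    by rewrite -mulmxA; apply: PT; [exact: dV|exact: IH].
  - exact: PTN.
  have -> : V (Negz n.+1) = V (-1) *m V (Negz n) by rewrite VD; congr V; lia.
  by rewrite -mulmxA; apply: PTN; [exact: dV|exact: IH].
have SE (g : 'M[int]_2) : (S2 *m g) 0 0 = - g 1 0 /\ (S2 *m g) 1 0 = g 0 0.
  by rewrite !mul_mx2 !mxE /=; split; ring.
have VE n (g : 'M[int]_2) : (V n *m g) 0 0 = g 0 0 + n * g 1 0 /\ (V n *m g) 1 0 = g 1 0.
  by rewrite !mul_mx2 !mxE /=; split; ring.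
have S4 : S2 *m S2 *m (S2 *m S2) = 1%:M.
  have -> : S2 *m S2 = mx22 (-1) 0 0 (-1) by apply: mx2_eq; rewrite !mul_mx2 !mxE.
  by apply: mx2_eq; rewrite !mul_mx2 !mxE.
move=> g; have [n hn] : exists n, (absz (g 1%R 0%R) <= n)%N by exists (absz (g 1 0)).
elim: n g hn => [|n IH] g gn dg.
  have c0 : g 1 0 = 0 by lia.
  have : g 0 0 * g 1 1 = 1 by rewrite -dg det_mx2 c0; ring.
  move=> ad; have /eqP := congr1 absz ad; rewrite abszM muln_eq1 => /andP[/eqP a1 _].
  have [{}a1|{}a1] : g 0 0 = 1 \/ g 0 0 = -1 by lia.
    have d1 : g 1 1 = 1 by rewrite -ad a1 mul1r.
    have -> : g = V (g 0 1) *m 1%:M by rewrite mulmx1; apply: mx2_eq; rewrite !mxE.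
    by apply: PV => //; rewrite det1.
  have d1 : g 1 1 = -1 by rewrite -ad a1 mulN1r opprK.
  have -> : g = V (- g 0 1) *m (S2 *m (S2 *m 1%:M)).
    have -> : S2 *m (S2 *m 1%:M) = mx22 (-1) 0 0 (-1) by apply: mx2_eq; rewrite !mul_mx2 !mxE.
    by apply: mx2_eq; rewrite !mul_mx2 !mxE /= ?a1 ?d1 ?c0; ring.
  by do ![apply: (PV)|apply: (PS)|apply: (dS)]; rewrite ?det1.
have [|gn'] := leqP (absz (g 1 0)) n; first by move=> h; apply: IH.
have c0 : g 1 0 != 0 by apply/eqP => h; rewrite h in gn'.
(* The lower left entry of [g'] is the remainder of the upper left entry of [g] modulo the lower
   left one, and S^4 = 1 recovers [g] as V q S^3 g'. *)
pose q := (g 0%R 0%R %/ g 1%R 0%R)%Z; pose g' := S2 *m (V (- q) *m g).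
have dg' : \det g' = 1 by apply/dS/dV.
have Pg' : P g'.
  apply: IH => //; rewrite /g' (SE _).2 (VE _ _).1 mulNr.
  have -> : g 0 0 - q * g 1 0 = (g 0%R 0%R %% g 1%R 0%R)%Z by rewrite /q {1}(divz_eq (g 0 0) (g 1 0)) addrC addKr.
  have := ltz_mod (g 0 0) c0; have := modz_ge0 (g 0 0) c0; lia.
have -> : g = V q *m (S2 *m (S2 *m (S2 *m g'))).
  have S4' (x : 'M[int]_2) : S2 *m (S2 *m (S2 *m (S2 *m x))) = x.
    by rewrite !mulmxA -(mulmxA (S2 *m S2) S2 S2) S4 mul1mx.
  by rewrite /g' S4' mulmxA VD subrr V0 mul1mx.
by do ![exact: dg'|exact: Pg'|apply: (PV)|apply: (PS)|apply: (dS)].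
Qed.

End Generators.

(** * The metaplectic group and slash invariance *)

Section Metaplectic.
#[local] Opaque e cexp.
Variable R : realType.
Local Notation C := R[i].
Local Notation nc := (@ComplexField.Normc.normc R).
Local Notation S2 := (mx22 0 (-1) 1 0).
Local Notation T2 := (mx22 1 1 0 1).
Local Notation "'I2'" := (1%:M : 'M[int]_2).
Implicit Type g : 'M[int]_2.

Lemma jfactor1 (t : C) : jfactor 1%:M t = 1.
Proof. by rewrite /jfactor !mxE /= mul0r add0r. Qed.

Lemma moebius1 (t : C) : moebius 1%:M t = t.
Proof. by rewrite /moebius jfactor1 !mxE /= mul1r addr0 divr1. Qed.

Lemma jfactor_S (t : C) : jfactor S2 t = t.
Proof. by rewrite /jfactor !mxE /= mul1r addr0. Qed.

Lemma moebius_S (t : C) : moebius S2 t = - t^-1.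
Proof. by rewrite /moebius jfactor_S !mxE /= mul0r add0r mulN1r. Qed.

Lemma jfactor_T (t : C) : jfactor T2 t = 1.
Proof. by rewrite /jfactor !mxE /= mul0r add0r. Qed.

Lemma moebius_T (t : C) : moebius T2 t = t + 1.
Proof. by rewrite /moebius jfactor_T !mxE /= mul1r divr1. Qed.

Lemma jfactor_mul g h (t : C) : jfactor h t != 0 ->
  jfactor (g *m h) t = jfactor g (moebius h t) * jfactor h t.
Proof.
move=> j0; rewrite /moebius; move: j0; rewrite /jfactor !mul_mx2 !intrD !intrM.
move: ((h 1 0)%:~R : C) ((h 1 1)%:~R : C) ((h 0 0)%:~R : C) ((h 0 1)%:~R : C) => c d a b j0.
by field.
Qed.

Lemma moebius_mul g h (t : C) : jfactor h t != 0 -> jfactor g (moebius h t) != 0 ->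
  moebius (g *m h) t = moebius g (moebius h t).
Proof.
move=> j0 j1; rewrite [LHS]/moebius [RHS]/moebius jfactor_mul// invfM mulrCA mulrC; congr (_ / _).
rewrite /moebius; move: j0; rewrite /jfactor !mul_mx2 !intrD !intrM.
move: ((h 1 0)%:~R : C) ((h 1 1)%:~R : C) ((h 0 0)%:~R : C) ((h 0 1)%:~R : C) => c d a b j0.
by field.
Qed.

Lemma moebius_upper g (t : C) : \det g = 1 -> t \in @upper R ->
  jfactor g t != 0 /\ moebius g t \in @upper R.
Proof.
move=> dg ut; move: g dg; apply: SL2_ind => [|g _ [j0 ug]|g _ [j0 ug]].
- by rewrite jfactor1 moebius1 oner_neq0.
- have jS : jfactor S2 (moebius g t) != 0 by rewrite jfactor_S upper_neq0.
  by rewrite jfactor_mul// moebius_mul// moebius_S; split; [rewrite mulf_neq0|exact: upper_S].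
- have jT : jfactor T2 (moebius g t) != 0 by rewrite jfactor_T oner_neq0.
  by rewrite jfactor_mul// moebius_mul// moebius_T; split; [rewrite mulf_neq0|exact: upper_T].
Qed.

Lemma SL2_law (w : nat) (f : C -> C) :
  {in @upper R, forall t, f (- t^-1) = t ^+ w * f t} -> {in @upper R, forall t, f (t + 1) = f t} ->
  forall g, \det g = 1 -> {in @upper R, forall t, jfactor g t ^ (- w%:Z) * f (moebius g t) = f t}.
Proof.
move=> fS fT g dg t ut; have [j0 _] := moebius_upper dg ut.
suff -> : f (moebius g t) = jfactor g t ^+ w * f t.
  by rewrite -exprnN mulrA mulVf ?mul1r// expf_neq0.
clear j0; move: g dg; apply: SL2_ind => [|g dg IH|g dg IH].
- by rewrite jfactor1 moebius1 expr1n mul1r.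
- have [j0 ug] := moebius_upper dg ut.
  have jS : jfactor S2 (moebius g t) != 0 by rewrite jfactor_S upper_neq0.
  rewrite jfactor_mul// moebius_mul// moebius_S fS// IH jfactor_S [in RHS]exprMn.
  by rewrite mulrA.
- have [j0 ug] := moebius_upper dg ut.
  have jT : jfactor T2 (moebius g t) != 0 by rewrite jfactor_T oner_neq0.
  by rewrite jfactor_mul// moebius_mul// moebius_T fT// IH jfactor_T mul1r.
Qed.

Lemma cderivV (f : C -> C) t l : f t != 0 -> cderiv f t l -> cderiv (fun x => (f x)^-1) t (- (f t) ^- 2 * l).
Proof. by move=> f0 df; exact: cderiv_comp df (cderiv_inv f0). Qed.

Lemma moebius_cderiv g t : \det g = 1 -> t \in @upper R -> exists l, cderiv (@moebius R g) t l.
Proof.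
move=> dg ut; have [j0 _] := moebius_upper dg ut.
have lin (a b : C) : cderiv (fun x => a * x + b) t (a * 1 + 0).
  exact: cderivD (cderivZ a (cderiv_id t)) (cderiv_cst b t).
by eexists; exact: cderivM (lin _ _) (cderivV j0 (lin _ _)).
Qed.

(* A holomorphic square root of 1 is a constant sign, because its real part is
   continuous along the segment between two points. *)
Lemma square_root_one (f : C -> C) : holomorphic f -> {in @upper R, forall t, f t ^+ 2 = 1} ->
  {in @upper R, f =1 fun=> 1} \/ {in @upper R, f =1 fun=> -1}.
Proof.
move=> hf f2; pose i : C := 'i%C; have ui : i \in @upper R by rewrite upperE /= ltr01.
have pm t : t \in @upper R -> f t = 1 \/ f t = -1.
  by move=> ut; have /eqP := f2 t ut; rewrite sqrf_eq1 => /orP[] /eqP; [left|right].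
suff key t : t \in @upper R -> f t = f i.
  by case: (pm i ui) => fi; [left|right] => t ut; rewrite key.
move=> ut; pose g (s : R) := complex.Re (f (i + s%:C%C * (t - i))).
have us (s : R) : 0 <= s <= 1 -> i + s%:C%C * (t - i) \in @upper R.
  move: ut; rewrite !upperE; case: (t) => x y /= y0 /andP[s0 s1].
  rewrite !mul0r !addr0; nra.
have cg (s : R) : s \in `[0, 1] -> {for s, continuous g}.
  rewrite in_itv /= => s01; apply/cvgrPdist_lt => eps e0.
  have [p hp cp] := holo_cderiv hf (us s s01).
  have [dl dl0 hd] := cp 1 ltr01.
  pose K := nc (twopii R * D f (i + s%:C%C * (t - i))) + 1.
  have K0 : 0 < K by rewrite ltr_wpDl ?nc_ge0.
  pose L := nc (t - i) + 1; have L0 : 0 < L by rewrite ltr_wpDl ?nc_ge0.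
  have r0 : 0 < Num.min (dl / L) (eps / (K * L)).
    by rewrite lt_min !divr_gt0// mulr_gt0.
  near=> u; have hu : `|s - u| < Num.min (dl / L) (eps / (K * L)).
    by near: u; apply: cvgr_dist_lt.
  rewrite distrC; pose h := (u - s)%:C%C * (t - i).
  have nh : nc h <= `|u - s| * L by rewrite ncM nc_real ler_wpM2l// lerDl.
  move: hu; rewrite (distrC s u) lt_min => /andP[h1 h2].
  have hdl : nc h < dl by apply: le_lt_trans nh _; rewrite -(ltr_pdivlMr _ _ L0).
  have E : g u - g s = complex.Re (p h * h).
    rewrite /g -raddfB /=; congr complex.Re.
    have -> : i + u%:C%C * (t - i) = i + s%:C%C * (t - i) + h by rewrite /h rcB; ring.
    by rewrite hp addrC addKr.
  rewrite E; apply: le_lt_trans (nc_Re _) _; rewrite ncM.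
  have pK : nc (p h) <= K.
    rewrite -[p h](subrK (twopii R * D f (i + s%:C%C * (t - i)))) addrC.
    by apply: le_trans (ncD _ _) _; rewrite lerD2l ltW// hd.
  apply: (@le_lt_trans _ _ (K * (`|u - s| * L))); first by rewrite ler_pM ?nc_ge0.
  by rewrite mulrCA -(ltr_pdivlMr _ _ (mulr_gt0 K0 L0)).
have g2 s : s \in `[0, 1] -> g s = 1 \/ g s = -1.
  by rewrite in_itv /= => s01; rewrite /g; case: (pm _ (us s s01)) => ->; [left|right].
have g0 : g 0 = complex.Re (f i) by rewrite /g mul0r addr0.
have g1 : g 1 = complex.Re (f t) by rewrite /g mul1r addrC subrK.
have wc : {within `[0, 1], continuous g}%classic by apply: continuous_in_subspaceT => s /set_mem; exact: cg.
have E01 : g 0 = g 1.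
  have m0 : (0 : R) \in `[0, 1] by rewrite in_itv /= lexx ler01.
  have m1 : (1 : R) \in `[0, 1] by rewrite in_itv /= lexx ler01.
  have ivt := @IVT R g 0 1 0 ler01 wc.
  case: (g2 0 m0) (g2 1 m1) => h0 [] h1; rewrite ?h0 ?h1 // in ivt *; exfalso.
    have [|s /g2 gs s0] := ivt; first by rewrite ge_min le_max; lra.
    by case: gs; rewrite s0; lra.
  have [|s /g2 gs s0] := ivt; first by rewrite ge_min le_max; lra.
  by case: gs; rewrite s0; lra.
case: (pm t ut) => ft; case: (pm i ui) => fi; rewrite ?ft ?fi//; exfalso;
  by move: E01; rewrite g0 g1 ft fi /=; lra.
Unshelve. all: by end_near.
Qed.

Section Slash.
Variables (d : nat) (rho : mp R -> 'M[C]_d) (w : int) (F : C -> 'cV[C]_d).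
Hypotheses (rho_eq : forall g h : mp R, in_Mp2 g -> in_Mp2 h -> mp_eq g h -> rho g = rho h)
  (rho_mul : forall g h : mp R, in_Mp2 g -> in_Mp2 h -> rho (mp_mul g h) = rho g *m rho h)
  (rho_unit : forall g : mp R, in_Mp2 g -> rho g \in unitmx).

Lemma in_Mp2_neq0 (g : mp R) t : in_Mp2 g -> t \in @upper R -> g.2 t != 0.
Proof.
move=> [dg _ hg] ut; have [j0 _] := moebius_upper dg ut.
by apply: contraNneq j0 => g0; rewrite -hg// g0 expr0n.
Qed.

Lemma in_Mp2_mul (g h : mp R) : in_Mp2 g -> in_Mp2 h -> in_Mp2 (mp_mul g h).
Proof.
move=> [dg ag hg] [dh ah hh]; split; first by rewrite /= det_mulmx dg dh mulr1.
  apply: cderiv_holo => t ut; have [j0 up] := moebius_upper dh ut.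
  have [l dl] := moebius_cderiv dh ut; eexists.
  exact: cderivM (cderiv_comp dl (holo_cderiv ag up)) (holo_cderiv ah ut).
move=> t ut /=; have [j0 up] := moebius_upper dh ut.
by rewrite exprMn hg// hh// jfactor_mul.
Qed.

Lemma in_Mp2_S : in_Mp2 (mpS R).
Proof.
split; first by rewrite det_mx2 !mxE.
  by apply: cderiv_holo => t ut; eexists; exact: sqrtc_cderiv.
by move=> t ut; rewrite sqr_sqrtc jfactor_S.
Qed.

Lemma in_Mp2_T : in_Mp2 (mpT R).
Proof.
split; first by rewrite det_mx2 !mxE.
  by apply: cderiv_holo => t ut; eexists; exact: cderiv_cst.
by move=> t ut; rewrite expr1n jfactor_T.
Qed.

Definition slash_law (g : mp R) := {in @upper R, forall t, F (moebius g.1 t) = g.2 t ^ w *: (rho g *m F t)}.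

Lemma slashP (g : mp R) : in_Mp2 g -> slash_law g <-> {in @upper R, slash w rho F g =1 F}.
Proof.
move=> hg; split=> h t ut; have g0 := in_Mp2_neq0 hg ut; have ru := rho_unit hg.
  by rewrite /slash h// -scalemxAr scalerA -expfzDr// addNr expr0z scale1r mulKmx.
by rewrite -[in RHS](h t ut) /slash -scalemxAr scalerA -expfzDr// addrN expr0z scale1r mulKVmx.
Qed.

Lemma slash_law_mul (g h : mp R) : in_Mp2 g -> in_Mp2 h ->
  slash_law g -> slash_law h -> slash_law (mp_mul g h).
Proof.
move=> hg hh lg lh t ut; have [dh _ _] := hh; have [dg _ _] := hg.
have [j0 up] := moebius_upper dh ut; have [j1 _] := moebius_upper dg up.
rewrite [(mp_mul g h).1]/= (moebius_mul j0 j1) (lg _ up) (lh _ ut) (rho_mul hg hh).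
by rewrite -mulmxA -scalemxAr scalerA [(mp_mul g h).2 t]/= expfzMl.
Qed.

Hypotheses (FS : slash_law (mpS R)) (FT : slash_law (mpT R)).

(** An invertible idempotent matrix is the identity; this yields the value of [rho] at the neutral
    element from multiplicativity alone. *)
Let rho_sqr (g : mp R) : in_Mp2 g -> mp_eq (mp_mul g g) g -> rho g = 1%:M.
Proof.
move=> hg gg; have := rho_eq (in_Mp2_mul hg hg) hg gg; rewrite rho_mul// => h1.
by rewrite -[LHS](mulKmx (rho_unit hg)) h1 mulVmx// rho_unit.
Qed.

(** By [square_root_one] the identity has two lifts. The lift -1 is the fourth power of [mpS]: the
    second component of its square is sqrt(- 1 / t) sqrt(t) = i, and i^2 = -1. *)
Let slash_law_one f : in_Mp2 (1%:M, f) -> slash_law (1%:M, f).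
Proof.
move=> hf; have [_ af f2] := hf.
have f21 : {in @upper R, forall t, f t ^+ 2 = 1} by move=> t ut; rewrite f2// jfactor1.
case: (square_root_one af f21); rewrite [(_, f).2]/= => fE.
  have r1 : rho (1%:M, f) = 1%:M.
    apply: (rho_sqr hf); split; first by rewrite /= mulmx1.
    by move=> t ut; rewrite /= moebius1 fE// mulr1.
  by move=> t ut; rewrite /= moebius1 fE// r1 mul1mx exp1rz scale1r.
have hS := in_Mp2_S; have hSS := in_Mp2_mul hS hS; have hSSSS := in_Mp2_mul hSS hSS.
have lSS := slash_law_mul hS hS FS FS; have lS4 := slash_law_mul hSS hSS lSS lSS.
have SS : S2 *m S2 = mx22 (-1) 0 0 (-1) by apply: mx2_eq; rewrite !mul_mx2 !mxE.
have S4 : S2 *m S2 *m (S2 *m S2) = 1%:M by rewrite SS; apply: mx2_eq; rewrite !mul_mx2 !mxE.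
have mSS t : t \in @upper R -> moebius (S2 *m S2) t = t.
  move=> ut; rewrite moebius_mul ?jfactor_S ?moebius_S ?upper_neq0 ?upper_S//.
  by rewrite invrN invrK opprK.
have f4 t : t \in @upper R -> (mp_mul (mp_mul (mpS R) (mpS R)) (mp_mul (mpS R) (mpS R))).2 t = - 1.
  move=> ut; rewrite /= mSS// moebius_S sqrtc_S// divfK ?sqrtc_neq0//.
  by rewrite -expr2 sqr_i.
have E : mp_eq (mp_mul (mp_mul (mpS R) (mpS R)) (mp_mul (mpS R) (mpS R))) (1%:M, f).
  by split=> // t ut; rewrite f4// [RHS]/= fE.
move=> t ut; have := lS4 t ut; rewrite (rho_eq hSSSS hf E) f4//.
by rewrite /= S4 fE.
Qed.

(** The induction covers all lifts [f] of a matrix at once. A lift of S g is divided by the square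
    root of g t to give a lift of g, whose law is known. *)
Lemma slash_generators (g : mp R) : in_Mp2 g -> slash_law g.
Proof.
case: g => g f hg; have dg : \det g = 1 by case: hg.
move: g dg f hg; apply: SL2_ind.
- exact: slash_law_one.
- move=> g dg IH f hf; have [_ af f2] := hf.
  pose f' (t : C) := f t * (sqrtc (moebius g t))^-1.
  have hf' : in_Mp2 (g, f').
    split; first exact: dg.
      apply: cderiv_holo => t ut; have [j0 up] := moebius_upper dg ut; have [l dl] := moebius_cderiv dg ut.
      have ds := cderiv_comp dl (sqrtc_cderiv up); eexists.
      exact: cderivM (holo_cderiv af ut) (cderivV (f := fun x => sqrtc (moebius g x)) (sqrtc_neq0 up) ds).
    move=> t ut; have [j0 up] := moebius_upper dg ut.
    rewrite /= exprMn exprVn sqr_sqrtc f2//= jfactor_mul// jfactor_S mulrAC mulfV ?mul1r//.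
    exact: upper_neq0.
  have E : mp_eq (mp_mul (mpS R) (g, f')) (S2 *m g, f).
    split; first by [].
    move=> t ut /=; have [j0 up] := moebius_upper dg ut.
    by rewrite /f' mulrCA mulfV ?mulr1// sqrtc_neq0.
  move=> t ut; have := slash_law_mul in_Mp2_S hf' FS (IH _ hf') ut.
  by rewrite (rho_eq (in_Mp2_mul in_Mp2_S hf') hf E) E.2.
- move=> g dg IH f hf; have [_ af f2] := hf.
  have hf' : in_Mp2 (g, f).
    split; [exact: dg|exact: af|move=> t ut]; have [j0 up] := moebius_upper dg ut.
    by rewrite /= f2//= jfactor_mul// jfactor_T mul1r.
  have E : mp_eq (mp_mul (mpT R) (g, f)) (T2 *m g, f) by split; [|move=> t ut /=; rewrite mul1r].
  move=> t ut; have := slash_law_mul in_Mp2_T hf' FT (IH _ hf') ut.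
  by rewrite (rho_eq (in_Mp2_mul in_Mp2_T hf') hf E) E.2.
Qed.

End Slash.
End Metaplectic.

(** * Iterated Serre derivatives, pairings and scalar modular forms *)

Section SerreCalculus.
#[local] Opaque e cexp.
Variable R : realType.
Local Notation C := R[i].
Local Notation nc := (@ComplexField.Normc.normc R).
Implicit Types f g : C -> C.

Lemma D_ext f g t : {in @upper R, f =1 g} -> holomorphic f -> t \in @upper R -> D g t = D f t.
Proof.
move=> fg hf ut; rewrite (cderiv_D (cderiv_ext ut fg (holo_cderiv hf ut))).
by rewrite mulKf// twopii_neq0.
Qed.

Lemma D_lin a f g t : holomorphic f -> holomorphic g -> t \in @upper R ->
  D (fun x => a * f x + g x) t = a * D f t + D g t.
Proof.
move=> hf hg ut; rewrite (cderiv_D (cderivD (cderivZ a (holo_cderiv hf ut)) (holo_cderiv hg ut))).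
by move: (D f t) (D g t) (twopii R) (twopii_neq0 R) => x y p p0; field.
Qed.

Lemma serre_ext x f g t : {in @upper R, f =1 g} -> holomorphic f -> t \in @upper R ->
  serre x g t = serre x f t.
Proof. by move=> fg hf ut; rewrite /serre (D_ext fg hf ut) fg. Qed.

Lemma serre_iterSS x n f t : serre_iter x n.+2 f t =
  serre (x + 2 * n.+1%:R) (serre_iter x n.+1 f) t
  - n.+1%:R * (n.+1%:R + x - 1) / 144 * E4 t * serre_iter x n f t.
Proof. by []. Qed.

Lemma qexp_serre_iter h x n f : (0 < h)%N -> qexp h f -> qexp h (serre_iter x n f).
Proof.
move=> h0 hf; suff: qexp h (serre_iter x n f) /\ qexp h (serre_iter x n.+1 f) by case.
elim: n => [|n [IH1 IH2]]; first by split=> //; exact: qexp_serre.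
split=> //; have := qexpD h0 (qexp_serre (x + 2 * n.+1%:R) h0 IH2)
  (qexpM h0 (qexpZ (- (n.+1%:R * (n.+1%:R + x - 1) / 144)) h0 (qexp_E4 R h0)) IH1).
by apply: qexp_ext => t _; rewrite serre_iterSS !mulNr.
Qed.

(** Two consecutive orders are carried along because of the three-term recursion. The induction
    hypothesis holds on the upper half-plane only, so it passes under a derivative through
    [serre_ext]. *)
Lemma serre_iter_lin h h' x n a f g t : (0 < h)%N -> (0 < h')%N -> qexp h f -> qexp h' g ->
  t \in @upper R ->
  serre_iter x n (fun z => a * f z + g z) t = a * serre_iter x n f t + serre_iter x n g t.
Proof.
move=> h0 h0' hf hg; have Hf m := qexp_holo h0 (qexp_serre_iter x m h0 hf).
have Hg m := qexp_holo h0' (qexp_serre_iter x m h0' hg).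
have sl y u v z : holomorphic u -> holomorphic v -> z \in @upper R ->
    serre y (fun w => a * u w + v w) z = a * serre y u z + serre y v z.
  move=> hu hv uz; rewrite /serre (D_lin a hu hv uz).
  by move: (D u z) (D v z) (u z) (v z) (E2 z) => p q r s w; ring.
pose ok m := {in @upper R, forall z, serre_iter x m (fun z => a * f z + g z) z =
  a * serre_iter x m f z + serre_iter x m g z}.
suff: ok n /\ ok n.+1 by case=> + _ => /[apply].
elim: n {t} => [|n [IH1 IH2]].
  by split=> [z uz|z uz] //; rewrite /= sl//; [exact: (Hf 0%N)|exact: (Hg 0%N)].
split=> // z uz; rewrite !serre_iterSS IH1//.
have hol : holomorphic (fun w => a * serre_iter x n.+1 f w + serre_iter x n.+1 g w).
  apply: cderiv_holo => w uw; eexists.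
  exact: cderivD (cderivZ a (holo_cderiv (Hf n.+1) uw)) (holo_cderiv (Hg n.+1) uw).
have eqv : {in @upper R, (fun w => a * serre_iter x n.+1 f w + serre_iter x n.+1 g w) =1
    serre_iter x n.+1 (fun z => a * f z + g z)} by move=> w uw; rewrite IH2.
rewrite (serre_ext _ eqv hol uz) (sl _ _ _ _ (Hf n.+1) (Hg n.+1) uz).
by move: (serre _ _ z) (serre _ _ z) (serre_iter x n f z) (serre_iter x n g z) (_ * E4 z) => p q r u w; ring.
Qed.

Section Pairing.
Variable d : nat.
Implicit Types F G : C -> 'cV[C]_d.

Lemma serre_pairing a b F G t : vholo F -> vholo G -> t \in @upper R ->
  serre (a + b) (pairing F G) t = pairing (componentwise (serre a) F) G t +
    pairing F (componentwise (serre b) G) t.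
Proof.
move=> hF hG ut.
have pE : {in @upper R, (fun t => \sum_i F t i 0 * G t i 0) =1 pairing F G}.
  by move=> x _; rewrite /pairing mxE; apply: eq_bigr => i _; rewrite mxE.
have := cderiv_ext ut pE (cderiv_sum (index_enum _) (fun i => cderivM (holo_cderiv (hF i) ut) (holo_cderiv (hG i) ut))).
move/cderiv_D; rewrite /serre => ->; rewrite -pE// /pairing !mxE !mulr_sumr -sumrB -big_split.
apply: eq_bigr => i _; rewrite !mxE.
move: (D _ t) (D _ t) (F t i 0) (G t i 0) (E2 t) (twopii R) (twopii_neq0 R) => x y u v w p p0.
by rewrite /=; field.
Qed.

Lemma qexp_det h n (W : C -> 'M[C]_n) : (0 < h)%N ->
  (forall i j, qexp h (fun t => W t i j)) -> qexp h (fun t => \det (W t)).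
Proof.
move=> h0 hW; exact: qexp_sum h0 (fun p => qexpZ _ h0 (qexp_prod _ h0 (fun i => hW i _))).
Qed.

Definition Viter (m : nat) G := componentwise (serre_iter (3 / 2) m) G.

Lemma Viter0 G : Viter 0 G = G.
Proof. by apply/funext => t; apply/matrixP => i o; rewrite mxE ord1. Qed.

(** The coefficient n (n + kappa - 1) / 144 for kappa = 3/2. It vanishes at 0, so recursions may
    mention [m.-1] at m = 0 harmlessly. *)
Definition ser_coef (m : nat) : C := m%:R * (m%:R + 3 / 2 - 1) / 144.

Lemma ViterSS m G : Viter m.+2 G = fun t => componentwise (serre (3 / 2 + 2 * m.+1%:R)) (Viter m.+1 G) t +
  (- (ser_coef m.+1 * E4 t)) *: Viter m G t.
Proof.
apply/funext => t; apply/matrixP => i o; rewrite !mxE serre_iterSS /ser_coef mulNr; congr (_ - _).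
by congr (serre _ _ t); apply/funext => z; rewrite mxE.
Qed.

Lemma Viter_vqexp h m G : (0 < h)%N -> vqexp h G -> vqexp h (Viter m G).
Proof.
move=> h0 hG i; apply: qexp_ext (qexp_serre_iter (3 / 2) m h0 (hG i)) => t _.
by rewrite mxE.
Qed.

Lemma Viter_law h phi j M m G : (0 < h)%N -> equivariant phi j -> vqexp h G ->
  vlaw phi j 3 M G -> vlaw phi j (3 + 4 * m) M (Viter m G).
Proof.
move=> h0 ej qG lG; have [j' _ hj] := ej.
suff: vlaw phi j (3 + 4 * m) M (Viter m G) /\ vlaw phi j (3 + 4 * m.+1) M (Viter m.+1 G) by case.
elim: m => [|m [IH1 IH2]].
  split; first by rewrite Viter0 muln0.
  exact: vlaw_serre ej (vqexp_holo h0 qG) lG.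
split=> //; rewrite ViterSS; have qV := vqexp_holo h0 (Viter_vqexp m.+1 h0 qG).
have -> : (3 + 4 * m.+2 = 3 + 4 * m.+1 + 4)%N by lia.
apply: vlawD; first by have := vlaw_serre ej qV IH2; rewrite (_ : (3 + 4 * m.+1)%:R / 2 = 3 / 2 + 2 * m.+1%:R :> C)// natrD natrM; field.
have -> : (3 + 4 * m.+1 + 4 = 3 + 4 * m + 8)%N by lia.
apply: vlawZ IH1 _ => t ut; have [_ _ _ ->] := hj t ut; ring.
Qed.

End Pairing.

(** Only the two generators are tested, and [v] is the weight itself; [modularP] passes to the whole
    group. *)
Definition modular (v : nat) f := [/\ {in @upper R, forall t, f (- t^-1) = t ^+ v * f t},
  {in @upper R, forall t, f (t + 1) = f t} & qexp 1 f].

Lemma modularP (v : nat) (w : int) f : w = v%:Z -> modular v f <-> weakly_holomorphic_SL2 w f.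
Proof.
move=> ->; split=> [[fS fT qf]|[hf fg qf]].
  split; [exact: qexp_holo (isT : (0 < 1)%N) qf|exact: SL2_law|exact/(qexp_has _ (isT : (0 < 1)%N))].
split; last exact/(qexp_has _ (isT : (0 < 1)%N)).
  move=> t ut; have dS : \det (mx22 0 (-1) 1 0) = 1 by rewrite det_mx2 !mxE.
  have := fg _ dS t ut; rewrite jfactor_S moebius_S => <-.
  by rewrite -exprnN mulrA mulfV ?mul1r// expf_neq0// upper_neq0.
move=> t ut; have dT : \det (mx22 1 1 0 1) = 1 by rewrite det_mx2 !mxE.
by have := fg _ dT t ut; rewrite jfactor_T moebius_T exp1rz mul1r.
Qed.

Lemma modular0 v : modular v (fun=> 0).
Proof. by split=> [t _|t _|]; [rewrite mulr0| |exact: qexp_cst]. Qed.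

Lemma modularZ v a f : modular v f -> modular v (fun t => a * f t).
Proof.
move=> [fS fT qf]; split=> [t ut|t ut|]; rewrite ?fS ?fT//; first by rewrite mulrCA.
exact: qexpZ.
Qed.

Lemma modularD v f g : modular v f -> modular v g -> modular v (fun t => f t + g t).
Proof.
move=> [fS fT qf] [gS gT qg]; split=> [t ut|t ut|]; rewrite ?fS ?fT ?gS ?gT//; first by rewrite mulrDr.
exact: qexpD.
Qed.

Lemma modularE4 v f : modular v f -> modular (v + 4) (fun t => E4 t * f t).
Proof.
move=> [fS fT qf]; split=> [t ut|t ut|]; rewrite ?fS ?fT ?E4_S ?E4_T//; first by rewrite exprD; ring.
by apply: qexpM => //; exact: qexp_E4.
Qed.

(** A scalar form is a vector of length 1 and trivial type, so [vlaw_serre] applies with the doubled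
    weight. *)
Lemma modular_serre v f : modular v f -> modular (v + 2) (serre v%:R f).
Proof.
move=> [fS fT qf]; pose F (t : C) : 'cV[C]_1 := \col_i f t.
have hF : vholo F.
  move=> i; apply: qexp_holo (isT : (0 < 1)%N) _; apply: qexp_ext qf => t _; by rewrite mxE.
have lS : vlaw (fun t => - t^-1) (@sqrtc R) (2 * v) 1%:M F.
  move=> t ut; apply/matrixP => i o; rewrite mul1mx !mxE fS// exprM sqr_sqrtc//.
have lT : vlaw (fun t => t + 1) (fun=> 1) (2 * v) 1%:M F.
  by move=> t ut; apply/matrixP => i o; rewrite mul1mx !mxE fT// expr1n mul1r.
have ww : (2 * v)%:R / 2 = v%:R :> C by rewrite natrM; field.
have sE : componentwise (serre ((2 * v)%:R / 2)) F = fun t => \col_i serre v%:R f t.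
  apply/funext => t; apply/matrixP => i o; rewrite !mxE ww.
  by congr (serre _ _ t); apply/funext => z; rewrite mxE.
have := vlaw_serre (equivariant_S R) hF lS; have := vlaw_serre (equivariant_T R) hF lT.
rewrite sE => sT sS; split=> [t ut|t ut|]; last exact: qexp_serre.
  have := sS t ut => /matrixP/(_ 0 0); rewrite mul1mx !mxE => ->.
  have -> : t ^+ (v + 2) = sqrtc t ^+ (2 * (v + 2)) by rewrite exprM sqr_sqrtc.
  by rewrite mulnDr.
by have := sT t ut => /matrixP/(_ 0 0); rewrite mul1mx !mxE expr1n mul1r.
Qed.

(* The Serre derivative of the pairing of the [r]-th derivative of [H] with the
   [m]-th iterated derivative of [U] ties these pairings together for
   neighbouring [(r, m)]; [tableau f] is the solution of this recursion with
   row [f] at [r = 0]. *)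
Fixpoint tableau (f : nat -> C -> C) (r : nat) : nat -> C -> C :=
  if r is q.+1 then fun m t =>
    serre (2 * (q + m) + 2)%:R (tableau f q m) t +
    (-1 * tableau f q m.+1 t + - ser_coef m * (E4 t * tableau f q m.-1 t))
  else f.

Lemma tableau_modular (f : nat -> C -> C) r m : (forall m, modular (2 * m + 2) (f m)) ->
  modular (2 * (r + m) + 2) (tableau f r m).
Proof.
move=> hf; elim: r m => [|r IH] m; first by rewrite add0n.
have -> : (2 * (r.+1 + m) + 2 = 2 * (r + m) + 2 + 2)%N by lia.
apply: modularD; first exact: modular_serre.
apply: modularD; first by apply: modularZ; have := IH m.+1; rewrite (_ : 2 * (r + m.+1) + 2 = 2 * (r + m) + 2 + 2)%N//; lia.
case: m => [|m]; last first.
  apply: modularZ; have := modularE4 (IH m); rewrite (_ : 2 * (r + m) + 2 + 4 = 2 * (r + m.+1) + 2 + 2)%N//; lia.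
have -> : (fun t => - ser_coef 0 * (E4 t * tableau f r 0.-1 t)) = fun=> 0.
  by apply/funext => t; rewrite /ser_coef !mul0r oppr0 mul0r.
exact: modular0.
Qed.

End SerreCalculus.

(** * The dual basis, the expansion and the isomorphism *)

Section Expansion.
#[local] Opaque e cexp.
Variable R : realType.
Local Notation C := R[i].
Local Notation nc := (@ComplexField.Normc.normc R).
Local Notation "'S" := (fun t : C => - t^-1).
Local Notation "'T" := (fun t : C => t + 1).
Local Notation sqrtc := (@sqrtc R).
Variables (k : nat) (sigma : mp R -> 'M[C]_k.-1).
Hypotheses (k2 : (2 <= k)%N) (hsigma : is_sigma sigma).
Local Notation H := (@Hder R k).
Local Notation W := (@Wronskian R k).
Local Notation rho := (contragredient sigma).
Local Notation psi := (@Psi R k).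
Local Notation wh := (weakly_holomorphic 3 rho).
Local Notation d := k.-1.

Let sigma_unit g : in_Mp2 g -> sigma g \in unitmx.
Proof. by move=> hg; case: hsigma => -[_ _ h] _ _; apply: unitarymx_unit; exact: h. Qed.

Let rho_unit g : in_Mp2 g -> rho g \in unitmx.
Proof. by move=> hg; rewrite unitmx_tr unitmx_inv sigma_unit. Qed.

Let rho_eq g h : in_Mp2 g -> in_Mp2 h -> mp_eq g h -> rho g = rho h.
Proof. by case: hsigma => -[h1 _ _] _ _ hg hh gh; rewrite /contragredient (h1 _ _ hg hh gh). Qed.

Let rho_mul g h : in_Mp2 g -> in_Mp2 h -> rho (mp_mul g h) = rho g *m rho h.
Proof.
case: hsigma => -[_ h2 _] _ _ hg hh; rewrite /contragredient h2// -trmx_mul; congr _^T.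
have [ug uh] := (sigma_unit hg, sigma_unit hh).
have uX : sigma g *m sigma h \in unitmx by rewrite unitmx_mul ug uh.
apply: (can_inj (mulKmx uX)); rewrite mulmxV// -mulmxA (mulmxA (sigma h)) mulmxV//.
by rewrite mul1mx mulmxV.
Qed.

Let sigma_S : sigma (mpS R) = SmatC R k. Proof. by case: hsigma. Qed.
Let sigma_T : sigma (mpT R) = TmatC R k. Proof. by case: hsigma. Qed.

(** Read off from the unitarity of [sigma]; the determinant of the sine matrix is never computed. *)
Let nc_det_S : nc (\det (SmatC R k)) = 1.
Proof.
case: hsigma => -[_ _ /(_ _ (in_Mp2_S R))/unitarymxP] + _ _; rewrite sigma_S.
move=> /(congr1 determinant); rewrite det_mulmx det_map_mx det_tr det1 -normCK ncE -rcX => /complexI.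
by move/eqP; rewrite sqrp_eq1 ?nc_ge0// => /eqP.
Qed.

Let H_S r : vlaw 'S sqrtc (1 + 4 * r) (sigma (mpS R)) (H r).
Proof. by rewrite sigma_S; exact: (@Hder_law R k k2 _ _ _ r (equivariant_S R) (@Hvec_S R k k2)). Qed.

Let H_T r : vlaw 'T (fun=> 1) (1 + 4 * r) (sigma (mpT R)) (H r).
Proof. by rewrite sigma_T; exact: (@Hder_law R k k2 _ _ _ r (equivariant_T R) (@Hvec_T R k k2)). Qed.

Let dual g : in_Mp2 g -> (sigma g)^T *m rho g = 1%:M.
Proof. by move=> hg; rewrite /contragredient -trmx_mul mulVmx ?trmx1// sigma_unit. Qed.

Let dualS := dual (in_Mp2_S R).
Let dualT := dual (in_Mp2_T R).

Let W_unit t : t \in @upper R -> W t \in unitmx.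
Proof.
move=> ut; have [a a0 h] := det_Wronskian_eta k2 nc_det_S; rewrite unitmxE unitfE.
by apply: contraNneq a0 => W0; rewrite -(h t ut) W0 mul0r.
Qed.

Let colW r t : col r (W t) = H r t.
Proof. by apply/matrixP => i o; rewrite !mxE ord1. Qed.

(** The pairings with the vectors [H r] are the entries of the product with the transposed
    Wronskian, which is invertible. *)
Let W_inj t (X Y : 'cV[C]_d) : t \in @upper R ->
  (forall r : 'I_d, ((H r t)^T *m X) 0 0 = ((H r t)^T *m Y) 0 0) -> X = Y.
Proof.
move=> ut h; have WT : (W t)^T \in unitmx by rewrite unitmx_tr W_unit.
rewrite -(mulKmx WT X) -(mulKmx WT Y); congr (_ *m _); apply/matrixP => r o; rewrite !ord1.
by have := h r; rewrite -colW tr_col -!row_mul !mxE.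
Qed.

Lemma pairing_Psi (r j : 'I_d) t : t \in @upper R -> pairing (H r) (psi j) t = (r == j)%:R.
Proof.
move=> ut; rewrite /pairing /Psi -colW mulmxA -trmx_mul.
rewrite colE mulKmx ?W_unit// trmx_delta mul_delta_mx_cond mulmxnE mxE !eqxx.
by rewrite eq_sym.
Qed.

Let pairing_inj t (X Y : C -> 'cV[C]_d) : t \in @upper R ->
  (forall r : 'I_d, pairing (H r) X t = pairing (H r) Y t) -> X t = Y t.
Proof. exact: W_inj. Qed.

Let pairing_sum (f : 'I_d -> C -> C) (r : 'I_d) t : t \in @upper R ->
  pairing (H r) (fun t => \sum_j f j t *: psi j t) t = f r t.
Proof.
move=> ut; rewrite /pairing mulmx_sumr summxE (bigD1 r)//= -scalemxAr mxE -/(pairing (H r) (psi r) t).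
rewrite pairing_Psi// eqxx mulr1 big1 ?addr0// => j jr.
by rewrite -scalemxAr mxE -/(pairing (H r) (psi j) t) pairing_Psi// eq_sym (negPf jr) mulr0.
Qed.

Lemma expansion (U : C -> 'cV[C]_d) t : t \in @upper R ->
  U t = \sum_(j < d) pairing (H j) U t *: psi j t.
Proof.
move=> ut; apply: (pairing_inj (Y := fun t => \sum_(j < d) pairing (H j) U t *: psi j t)) => // r.
by rewrite (pairing_sum (fun j : 'I_d => pairing (H j) U)).
Qed.

Lemma expansion_uniq (U : C -> 'cV[C]_d) (f : 'I_d -> C -> C) :
  {in @upper R, forall t, U t = \sum_(j < d) f j t *: psi j t} ->
  forall j : 'I_d, {in @upper R, f j =1 pairing (H j) U}.
Proof. by move=> hU j t ut; rewrite [RHS]/pairing hU// -(pairing_sum f). Qed.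

Let hH := (8 * ell k)%N.
Let hH0 : (0 < hH)%N. Proof. by rewrite /hH /ell; lia. Qed.

Let H_vqexp m r : (0 < m)%N -> vqexp (hH * m) (H r).
Proof. by move=> m0 i; apply: qexp_dil => //; apply: (Hder_vqexp R k2 r). Qed.

Let wh_facts (U : C -> 'cV[C]_d) : wh U ->
  [/\ vlaw 'S sqrtc 3 (rho (mpS R)) U, vlaw 'T (fun=> 1) 3 (rho (mpT R)) U &
  exists2 h, (0 < h)%N & vqexp h U].
Proof.
move=> [hU sU [h h0 qU]]; split.
- move=> t ut; have := (slashP 3 U rho_unit (in_Mp2_S R)).2 (sU _ (in_Mp2_S R)) t ut.
  by rewrite [(mpS R).1]/= moebius_S.
- move=> t ut; have := (slashP 3 U rho_unit (in_Mp2_T R)).2 (sU _ (in_Mp2_T R)) t ut.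
  by rewrite [(mpT R).1]/= moebius_T [(mpT R).2 t]/= exp1rz expr1n.
by exists h => // i; apply/(qexp_has _ h0).
Qed.

Let pairing_modular (F G : C -> 'cV[C]_d) (w w' v h : nat) : (0 < h)%N ->
  vlaw 'S sqrtc w (sigma (mpS R)) F -> vlaw 'T (fun=> 1) w (sigma (mpT R)) F ->
  vlaw 'S sqrtc w' (rho (mpS R)) G -> vlaw 'T (fun=> 1) w' (rho (mpT R)) G ->
  vqexp h F -> vqexp h G -> (w + w' = 2 * v)%N -> modular v (pairing F G).
Proof.
move=> h0 FS FT GS GT qF qG wv; split=> [t ut|t ut|].
- by rewrite (pairing_law FS GS dualS ut) wv exprM sqr_sqrtc.
- by rewrite (pairing_law FT GT dualT ut) expr1n mul1r.
apply: (qexp_periodic h0); first exact: pairing_qexp.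
by move=> t ut; rewrite (pairing_law FT GT dualT ut) expr1n mul1r.
Qed.

Let P U r m := pairing (H r) (@Viter R d m U).

Let P_modular U r m : wh U -> modular (2 * (r + m) + 2) (P U r m).
Proof.
move=> /wh_facts[US UT [h h0 qU]]; have hh0 : (0 < hH * h)%N by rewrite muln_gt0 hH0.
have qU' : vqexp (hH * h) U by move=> i; rewrite mulnC; apply: qexp_dil.
apply: (pairing_modular hh0 (H_S r) (H_T r)
  (Viter_law m hh0 (equivariant_S R) qU' US) (Viter_law m hh0 (equivariant_T R) qU' UT)).
- exact: H_vqexp.
- exact: Viter_vqexp.
lia.
Qed.

(** The Leibniz rule solved for the entry (r, m + 1); the weights 1/2 + 2 r and 3/2 + 2 m add up to
    2 (r + m) + 2. At m = 0 the correction disappears with [ser_coef]. *)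
Let P_rec U r m t : wh U -> t \in @upper R ->
  P U r m.+1 t = serre (2 * (r + m) + 2)%:R (P U r m) t +
    (-1 * P U r.+1 m t + - ser_coef R m * (E4 t * P U r m.-1 t)).
Proof.
move=> /wh_facts[US UT [h h0 qU]] ut.
have hV := vqexp_holo h0 (Viter_vqexp m h0 qU).
have hHr := vqexp_holo hH0 (Hder_vqexp R k2 r).
have -> : (2 * (r + m) + 2)%:R = (2^-1 + 2 * r%:R) + (3 / 2 + 2 * m%:R) :> C.
  by rewrite natrD natrM natrD; field.
have := serre_pairing (2^-1 + 2 * r%:R) (3 / 2 + 2 * m%:R) hHr hV ut.
rewrite -/(P U r m) -[componentwise _ (H r)]/(H r.+1) -/(P U r.+1 m t) => ->.
rewrite mulN1r addrA [P U r.+1 m t + _]addrC addrK.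
case: m hV => [|m] hV.
  by rewrite /ser_coef !mul0r oppr0 mul0r addr0 /P mulr0 addr0 Viter0.
rewrite {1}/P ViterSS /pairing mulmxDr mxE; congr (_ + _).
by rewrite -scalemxAr mxE !mulNr mulrA.
Qed.

(** Rows are read downwards: (r + 1, m) depends on (r, m), (r, m + 1) and (r, m - 1), so the first
    row up to d determines the triangle r + m < d. This is the source of injectivity. *)
Let P_tableau U f r m : wh U -> (forall n, (n < d)%N -> {in @upper R, f n =1 P U 0 n}) ->
  (forall n, modular (2 * n + 2) (f n)) ->
  (r + m < d)%N -> {in @upper R, tableau f r m =1 P U r m}.
Proof.
move=> hU hf mf; elim: r m => [|r IH] m rm; first exact: hf.
move=> t ut; have := P_rec r m hU ut.
have hol : holomorphic (tableau f r m) by have [_ _ /(qexp_holo (isT : (0 < 1)%N))] := tableau_modular r m mf.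
rewrite (serre_ext _ (IH m _) hol ut); last by lia.
have rm1 : (r + m.+1 < d)%N by lia.
have rm2 : (r + m.-1 < d)%N by lia.
rewrite -(IH _ rm1)// -(IH _ rm2)// [tableau f r.+1 m t]/= => ->; ring.
Qed.

(* On the column [m = 0] the tableau of [U] lists the coefficients of its
   expansion, on the row [r = 0] the pairings that define [calJ]. *)
Let tableau_P U f r : wh U -> (forall m, modular (2 * m + 2) (f m)) ->
  (forall r, (r < d)%N -> {in @upper R, P U r 0 =1 tableau f r 0}) ->
  forall m, (r + m < d)%N -> {in @upper R, P U r m =1 tableau f r m}.
Proof.
move=> hU mf h0 m; elim/ltn_ind: m r => -[|m] IH r rm t ut; first by rewrite addn0 in rm; exact: h0.
have hol n : (n < m.+1)%N -> (r + n < d)%N -> {in @upper R, tableau f r n =1 P U r n} by move=> nm rn x ux; rewrite IH.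
have hm : holomorphic (tableau f r m) by have [_ _ /(qexp_holo (isT : (0 < 1)%N))] := tableau_modular r m mf.
(* Here columns are filled from left to right: (r, m + 1) depends on (r, m), (r + 1, m) and (r, m -
   1), all inside the triangle. *)
rewrite P_rec// (serre_ext _ (hol m _ _) hm ut)//; last by lia.
rewrite (IH m (leqnn _) r.+1) ?addSnnS// (IH m.-1) //; [|by lia|by lia].
rewrite [tableau f r.+1 m t]/=; ring.
Qed.

Let calJ_coef (n : nat) : C := (- ((ell k)%:R / 2)) ^+ n / (n`!%:R * pochhammer (3 / 2) n).

Let calJ_coef_neq0 n : calJ_coef n != 0.
Proof.
rewrite mulf_neq0 ?expf_neq0 ?oppr_eq0 ?mulf_neq0 ?invr_eq0 ?pnatr_eq0//.
  by rewrite /ell; lia.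
rewrite mulf_neq0 ?pnatr_eq0 -?lt0n ?fact_gt0//; apply/prodf_neq0 => i _.
have -> : 3 / 2 + i%:R = (3 + 2 * i)%:R / 2 :> C by rewrite natrD natrM; field.
by rewrite mulf_neq0 ?invr_eq0 ?pnatr_eq0.
Qed.

Let calJE n U t : calJ n U t = calJ_coef n * P U 0 n t. Proof. by []. Qed.

(** Both sides have the same pairings with all [H r] at the image point, and by [W_inj] these
    determine a vector. In the only nonzero pairing, r = j, the powers of the automorphy factor
    cancel. *)
Let psi_law (j : 'I_d) : slash_law rho (- 1 - 4 * (j : nat)%:Z) (psi j) (mpS R) /\
  slash_law rho (- 1 - 4 * (j : nat)%:Z) (psi j) (mpT R).
Proof.
have key g phi (f : C -> C) t (ut : t \in @upper R) : in_Mp2 g -> phi t \in @upper R -> f t != 0 ->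
    (forall r, vlaw phi f (1 + 4 * r) (sigma g) (H r)) ->
    psi j (phi t) = f t ^ (- 1 - 4 * (j : nat)%:Z) *: (rho g *m psi j t).
  move=> hg up f0 hH'; apply: (W_inj up) => r; rewrite -/(pairing (H r) (psi j) (phi t)) pairing_Psi//.
  have -> : (H r (phi t))^T = f t ^+ (1 + 4 * r) *: ((H r t)^T *m (sigma g)^T).
    by rewrite hH'// -trmx_mul; apply/matrixP => a b; rewrite !mxE.
  rewrite -scalemxAl -scalemxAr scalerA -mulmxA (mulmxA _^T (rho g)) dual// mul1mx mxE.
  rewrite -/(pairing (H r) (psi j) t) pairing_Psi//; case: eqP => [->|_]; last by rewrite mulr0.
  by rewrite mulr1 exprnP -expfzDr// (_ : _ + _ = 0) ?expr0z//; lia.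
split=> t ut.
  rewrite [(mpS R).1]/= moebius_S.
  exact: (key _ (fun t => - t^-1) sqrtc t ut (in_Mp2_S R) (upper_S ut) (sqrtc_neq0 ut) H_S).
rewrite [(mpT R).1]/= moebius_T.
exact: (key _ (fun t => t + 1) (fun=> 1) t ut (in_Mp2_T R) (upper_T ut) (oner_neq0 C) H_T).
Qed.

(** Cramer's rule: the adjugate is polynomial in entries with q-expansions, and the inverse
    determinant is a^-1 [etaV t ^+ m]. The denominator 24 comes from [etaV], the factor 8 l from
    [H]. *)
Let psi_vqexp (j : 'I_d) : vqexp (24 * hH) (psi j).
Proof.
have [a a0 ha] := det_Wronskian_eta k2 nc_det_S; have h0 : (0 < 24 * hH)%N by rewrite muln_gt0 hH0.
set m := (_ * _)%N in ha.
have qV : qexp (24 * hH) (@etaV R).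
  apply: qexp_dil => //; exists 1%N; eexists; rewrite mul1r.
  exact: (qser_dil (isT : (0 < 1)%N) (isT : (0 < 24)%N) (etaV_qser R)).
have qW (i r : 'I_d) : qexp (24 * hH) (fun t => W t i r).
  by have := H_vqexp r (isT : (0 < 24)%N) i; rewrite mulnC; apply: qexp_ext => t _; rewrite mxE.
have qA (i r : 'I_d) : qexp (24 * hH) (fun t => (\adj (W t)) i r).
  have qM : qexp (24 * hH) (fun t => \det (row' r (col' i (W t)))).
    by apply: qexp_det => // x y; apply: qexp_ext (qW (lift r x) (lift i y)) => t _; rewrite !mxE.
  by apply: qexp_ext (qexpZ ((-1) ^+ (r + i)) h0 qM) => t _; rewrite mxE.
move=> i; have := qexpM h0 (qexpZ a^-1 h0 (qexp_prod (index_enum 'I_m) h0 (fun=> qV))) (qA j i).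
apply: qexp_ext => t ut; rewrite prodr_const card_ord.
have dE : a^-1 * etaV t ^+ m = (\det (W t))^-1.
  rewrite -(ha t ut) invfM mulfVK// expf_neq0//.
  apply: contraTneq (oner_neq0 C) => V0; by rewrite -(eta_mulV ut) V0 mulr0 eqxx.
by rewrite dE /Psi -colE [RHS]mxE [RHS]mxE /invmx W_unit// [RHS]mxE.
Qed.

Let psi_wh (j : 'I_d) : weakly_holomorphic (- 1 - 4 * (j : nat)%:Z) rho (psi j).
Proof.
have h0 : (0 < 24 * hH)%N by rewrite muln_gt0 hH0.
have [lS lT] := psi_law j; split.
- exact: vqexp_holo h0 (psi_vqexp j).
- move=> g hg; apply/(slashP _ _ rho_unit hg).
  exact: (slash_generators rho_eq rho_mul rho_unit lS lT hg).
- by exists (24 * hH)%N => // i; apply/(qexp_has _ h0); exact: psi_vqexp.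
Qed.

(** The doubled weights match: 4 j + 4 for [g j] and - 1 - 4 j for [psi j] add up to 3. *)
Let lift_wh (g : nat -> C -> C) : (forall j, modular (2 * j + 2) (g j)) ->
  wh (fun t => \sum_(j < d) g j t *: psi j t).
Proof.
move=> mg; have h0 : (0 < 24 * hH)%N by rewrite muln_gt0 hH0.
have q : vqexp (24 * hH) (fun t => \sum_(j < d) g j t *: psi j t).
  move=> i; have qg (j : 'I_d) : qexp (24 * hH) (g j).
    by have [_ _ q] := mg j; rewrite -[(24 * hH)%N]mul1n; apply: qexp_dil.
  have := qexp_sum (index_enum 'I_d) h0 (fun j => qexpM h0 (qg j) (psi_vqexp j i)).
  by apply: qexp_ext => t _; rewrite summxE; apply: eq_bigr => j _; rewrite [RHS]mxE.
split; first exact: vqexp_holo h0 q.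
  move=> x hx; apply/(slashP _ _ rho_unit hx).
  apply: (slash_generators rho_eq rho_mul rho_unit _ _ hx) => t ut.
    rewrite [(mpS R).1]/= moebius_S mulmx_sumr scaler_sumr; apply: eq_bigr => j _.
    have [gS _ _] := mg j; have := (psi_law j).1 t ut; rewrite [(mpS R).1]/= moebius_S => ->.
    rewrite gS// -scalemxAr !scalerA; congr (_ *: _); rewrite mulrAC; congr (_ * _).
    rewrite -(sqr_sqrtc t) -exprM [_ ^+ _]exprnP [(mpS R).2]/= sqr_sqrtc -expfzDr ?sqrtc_neq0//.
    by congr (_ ^ _); lia.
  rewrite [(mpT R).1]/= moebius_T mulmx_sumr scaler_sumr; apply: eq_bigr => j _.
  have [_ gT _] := mg j; have := (psi_law j).2 t ut; rewrite [(mpT R).1]/= moebius_T => ->.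
  by rewrite gT// -scalemxAr !scalerA [(mpT R).2 t]/= !exp1rz mulr1 mul1r.
by exists (24 * hH)%N => // i; apply/(qexp_has _ h0).
Qed.

Let P_linear a U V r m t : wh U -> wh V -> t \in @upper R ->
  P (fun t => a *: U t + V t) r m t = a * P U r m t + P V r m t.
Proof.
move=> /wh_facts[_ _ [h h0 qU]] /wh_facts[_ _ [h' h0' qV]] ut.
have E i : Viter m (fun t => a *: U t + V t) t i 0 = a * Viter m U t i 0 + Viter m V t i 0.
  rewrite ![Viter _ _ _ _ _]mxE -(serre_iter_lin _ _ _ h0 h0' (qU i) (qV i) ut).
  by congr (serre_iter _ _ _ t); apply/funext => z; rewrite !mxE.
rewrite /P /pairing ![(_ *m _) 0 0]mxE mulr_sumr -big_split; apply: eq_bigr => i _.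
by rewrite E mulrDr mulrCA.
Qed.

(** [tableau] works with rows indexed by all natural numbers; entries from d on are filled with the
    modular form 0. *)
Let pad (f : 'I_d -> C -> C) (n : nat) : C -> C := if insub n is Some i then f i else fun=> 0.

Let padE f (i : 'I_d) : pad f i = f i. Proof. by rewrite /pad valK. Qed.

Let pad_modular f : (forall n : 'I_d, modular (2 * n + 2) (f n)) -> forall n, modular (2 * n + 2) (pad f n).
Proof.
by move=> hf n; rewrite /pad; case: insubP => [i _ <-|_]; [exact: hf|exact: modular0].
Qed.

Lemma calJ_linear a U V : wh U -> wh V -> forall n : 'I_d, {in @upper R, forall t,
  calJ n (fun t => a *: U t + V t) t = a * calJ n U t + calJ n V t}.
Proof. by move=> hU hV n t ut; rewrite !calJE P_linear// mulrDr mulrCA. Qed.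

Lemma main_isomorphism : [/\ forall j : 'I_d, weakly_holomorphic (- 1 - 4 * (j : nat)%:Z) rho (psi j),
  forall U, wh U -> forall j : 'I_d, weakly_holomorphic_SL2 (2 * (j : nat)%:Z + 2) (pairing (H j) U),
  forall U, wh U -> forall n : 'I_d, weakly_holomorphic_SL2 (2 * (n : nat)%:Z + 2) (calJ n U),
  forall U V, wh U -> wh V -> (forall n : 'I_d, {in @upper R, calJ n U =1 calJ n V}) -> {in @upper R, U =1 V} &
  forall f : 'I_d -> C -> C, (forall n : 'I_d, weakly_holomorphic_SL2 (2 * (n : nat)%:Z + 2) (f n)) ->
    exists2 U, wh U & forall n : 'I_d, {in @upper R, calJ n U =1 f n}].
Proof.
have wE (n : nat) : 2 * n%:Z + 2 = (2 * n + 2)%N :> int by lia.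
split; first exact: psi_wh.
- move=> U hU j; apply/(modularP _ (wE j)); have := P_modular j 0 hU.
  by rewrite addn0 /P Viter0.
- move=> U hU n; apply/(modularP _ (wE n)); exact: modularZ (P_modular 0 n hU).
- move=> U V hU hV UV t ut.
  (* Equal values of [calJ] mean that U and V share this row below d; it determines the column m =
     0, that is, all coordinates of U and of V. *)
  pose f n := P U 0 n.
  have mf n : modular (2 * n + 2) (f n) by have := P_modular 0 n hU.
  have fV n : (n < d)%N -> {in @upper R, f n =1 P V 0 n}.
    by move=> nd x ux; have := UV (Ordinal nd) x ux; rewrite !calJE => /(mulfI (calJ_coef_neq0 n)).
  apply: pairing_inj => // r.
  have rd : (r + 0 < d)%N by rewrite addn0.
  have := P_tableau hU (fun n _ x _ => erefl (f n x)) mf rd ut.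
  by rewrite (P_tableau hV fV mf rd ut) /P !Viter0.
move=> f hf; have mf (n : 'I_d) : modular (2 * n + 2) (f n) by apply/(modularP _ (wE n)).
(* The prescribed first row, freed of the nonzero constants in [calJ]; the column m = 0 of its
   tableau supplies the coefficients of the preimage. *)
pose g n t := (calJ_coef n)^-1 * pad f n t.
have mg n : modular (2 * n + 2) (g n) by apply: modularZ; exact: pad_modular.
pose U t := \sum_(j < d) tableau g j 0 t *: psi j t.
have hU : wh U.
  apply: (@lift_wh (fun j => tableau g j 0)) => j.
  by have := tableau_modular j 0 mg; rewrite addn0.
exists U => // n t ut; rewrite calJE.
have h0 r : (r < d)%N -> {in @upper R, P U r 0 =1 tableau g r 0}.
  move=> rd x ux; rewrite /P Viter0.
  exact: (pairing_sum (fun j : 'I_d => tableau g j 0) (Ordinal rd) ux).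
have nd : (0 + n < d)%N by rewrite add0n.
by rewrite (tableau_P hU mg h0 nd ut) /= /g padE mulVKf// calJ_coef_neq0.
Qed.

End Expansion.

Theorem theorem6p3 (R : realType) (k : nat) (hk : (2 <= k)%N)
    (sigma : mp R -> 'M[R[i]]_k.-1) (hsigma : is_sigma sigma) :
  [/\ (* weight -1/2 - 2j and type sigma^\vee *)
      forall j : 'I_k.-1,
        weakly_holomorphic (- 1 - 4 * (j : nat)%:Z) (contragredient sigma) (Psi j),
      forall r j : 'I_k.-1,
        {in @upper R, forall tau,
          pairing (@Hder R k r) (Psi j) tau = (r == j)%:R},
      (* the unique expansion *)
      forall U : R[i] -> 'cV[R[i]]_k.-1,
        weakly_holomorphic 3 (contragredient sigma) U ->
        [/\ forall j : 'I_k.-1,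
              weakly_holomorphic_SL2 (2 * (j : nat)%:Z + 2)
                (pairing (@Hder R k j) U),
            {in @upper R, forall tau,
              U tau = \sum_(j < k.-1) pairing (@Hder R k j) U tau *: Psi j tau}
          & forall f : 'I_k.-1 -> R[i] -> R[i],
              {in @upper R, forall tau,
                U tau = \sum_(j < k.-1) f j tau *: Psi j tau} ->
              forall j, {in @upper R, f j =1 pairing (@Hder R k j) U}]
    & (* the map U |-> (calJ n U)_n is well defined, linear, injective and
         surjective *)
      [/\ forall U : R[i] -> 'cV[R[i]]_k.-1,
            weakly_holomorphic 3 (contragredient sigma) U ->
            forall n : 'I_k.-1,
              weakly_holomorphic_SL2 (2 * (n : nat)%:Z + 2) (calJ n U),
          forall (a : R[i]) (U V : R[i] -> 'cV[R[i]]_k.-1),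
            weakly_holomorphic 3 (contragredient sigma) U ->
            weakly_holomorphic 3 (contragredient sigma) V ->
            forall n : 'I_k.-1,
              {in @upper R, forall tau,
                calJ n (fun t => a *: U t + V t) tau
                = a * calJ n U tau + calJ n V tau},
          forall U V : R[i] -> 'cV[R[i]]_k.-1,
            weakly_holomorphic 3 (contragredient sigma) U ->
            weakly_holomorphic 3 (contragredient sigma) V ->
            (forall n : 'I_k.-1, {in @upper R, calJ n U =1 calJ n V}) ->
            {in @upper R, U =1 V}
        & forall f : 'I_k.-1 -> R[i] -> R[i],
            (forall n : 'I_k.-1,
              weakly_holomorphic_SL2 (2 * (n : nat)%:Z + 2) (f n)) ->
            exists2 U : R[i] -> 'cV[R[i]]_k.-1,
              weakly_holomorphic 3 (contragredient sigma) U
              & forall n : 'I_k.-1, {in @upper R, calJ n U =1 f n}]].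
Proof.
have [psiW HU JU Jinj Jsurj] := main_isomorphism hk hsigma.
split.
- exact: psiW.
- by move=> r j t ut; exact: (pairing_Psi hk hsigma).
- move=> U hU; split; first exact: HU.
    by move=> t ut; exact: (expansion hk hsigma).
  by move=> f hf; exact: (expansion_uniq hk hsigma).
split.
- exact: JU.
- exact: (calJ_linear hsigma).
- exact: Jinj.
- exact: Jsurj.
Qed.
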